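(* Let $N\geq 3$, $a_1>0$ and $\psi\in C^2(\mathbb{R})$. Assume that there exist $0<k\leq 2$ such that $$1<p<\frac{(k+1)N+2}{N-2},$$ and $a(s)=a_1|s|^k+\psi(s)$ for $s\in\mathbb{R}$, where $$\inf_{s\geq 0}\psi(s)>0,\qquad \inf_{s\geq 0}\big(k\psi(s)-s\psi'(s)\big)\geq 0.$$ Furthermore, assume that $$0<\lim_{s\to+\infty}\psi(s)<+\infty,\qquad \lim_{s\to+\infty}s\psi'(s)=\lim_{s\to+\infty}s^2\psi''(s)=0.$$ Then there exists $m_0>0$ such that, for all $m\geq m_0$, the problem $$\begin{cases}-\mathrm{div}(a(u)Du)+\frac12 a'(u)|Du|^2+mu=u^p & \text{in } \mathbb{R}^N,\\ u>0 & \text{in } \mathbb{R}^N,\\ u \text{ is radially symmetric},\end{cases}$$ admits a unique solution $u\in X\cap C^2(\mathbb{R}^N)$, up to translations.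
   Context: $Du$ denotes the gradient of $u$, and $$X:=\big\{u\in H^1(\mathbb{R}^N):\ a(u)|Du|^2\in L^1(\mathbb{R}^N)\big\},$$ where functions are real valued. *)

(* Defs.v *)
From HB Require Import structures.
From mathcomp Require Import all_boot all_order all_algebra.
From mathcomp Require Import all_classical all_reals all_analysis.
Set Implicit Arguments.
Unset Strict Implicit.
Unset Printing Implicit Defensive.
Import Order.TTheory GRing.Theory Num.Theory.
Import numFieldNormedType.Exports.
Local Open Scope classical_set_scope.
Local Open Scope ring_scope.

(* The N-dimensional Lebesgue measure is carried by N.-tuple R, which has the
   product (Borel) sigma-algebra; it is the N-fold product of lebesgue_measure. *)
Section lebesgue_tuple.
Context {R : realType}.
Local Notation Rb := (measurableTypeR R).

Definition tcons n (z : Rb * n.-tuple Rb) : n.+1.-tuple Rb :=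
  [the n.+1.-tuple Rb of z.1 :: z.2].

Lemma measurable_tcons n : measurable_fun [set: Rb * n.-tuple Rb] (@tcons n).
Proof.
exact: (measurable_cons (@measurable_fst _ _ _ _) (@measurable_snd _ _ _ _)).
Qed.

HB.instance Definition _ n :=
  isMeasurableFun.Build _ _ _ _ (@tcons n) (@measurable_tcons n).

Definition uncons n (t : n.+1.-tuple Rb) : Rb * n.-tuple Rb :=
  (thead t, [tuple of behead t]).

Lemma measurable_uncons n : measurable_fun [set: n.+1.-tuple Rb] (@uncons n).
Proof.
apply: measurable_fun_pair; last exact: measurable_behead.
exact: measurable_tnth.
Qed.

Lemma unconsK n : cancel (@uncons n) (@tcons n).
Proof. by move=> t; apply/val_inj; rewrite /= [in RHS](tuple_eta t). Qed.

Lemma tconsK n : cancel (@tcons n) (@uncons n).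
Proof. by move=> [x t]; congr (_, _); apply/val_inj. Qed.

Section step.
Variables (n : nat) (m : {sigma_finite_measure set (n.-tuple Rb) -> \bar R}).

Definition lebesgue_step : set (n.+1.-tuple Rb) -> \bar R :=
  pushforward (lebesgue_measure \x m)%E (@tcons n).

Let lebesgue_step0 : lebesgue_step set0 = 0%E.
Proof. exact: measure0. Qed.

Let lebesgue_step_ge0 A : (0 <= lebesgue_step A)%E.
Proof. exact: measure_ge0. Qed.

Let lebesgue_step_sigma_additive : semi_sigma_additive lebesgue_step.
Proof. exact: measure_semi_sigma_additive. Qed.

HB.instance Definition _ := isMeasure.Build _ _ _ lebesgue_step
  lebesgue_step0 lebesgue_step_ge0 lebesgue_step_sigma_additive.

Let lebesgue_step_sigma_finite : sigma_finite [set: n.+1.-tuple Rb] lebesgue_step.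
Proof.
have /sigma_finiteP[F [TF ndF Foo]] := sigma_finiteT (@lebesgue_measure R).
have /sigma_finiteP[G [TG ndG Goo]] := sigma_finiteT m.
exists (fun k => @uncons n @^-1` (F k `*` G k)).
  rewrite -preimage_bigcup (_ : \bigcup_i _ = setT) ?preimage_setT//.
  rewrite -subTset => -[x y] _.
  have [i _ Fix] : (\bigcup_i F i) x by rewrite -TF.
  have [j _ Gjy] : (\bigcup_j G j) y by rewrite -TG.
  exists (maxn i j) => //; split.
    by move: x Fix; exact/subsetPset/ndF/leq_maxl.
  by move: y Gjy; exact/subsetPset/ndG/leq_maxr.
move=> k; have [mFk Fkoo] := Foo k; have [mGk Gkoo] := Goo k; split.
  rewrite -[X in measurable X]setTI.
  by apply: measurable_uncons => //; exact: measurableX.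
rewrite /lebesgue_step /pushforward (_ : _ @^-1` _ = F k `*` G k).
  by rewrite product_measure1E// lte_mul_pinfty// ge0_fin_numE.
apply: funext => z; exact: (congr1 (F k `*` G k) (tconsK z)).
Qed.

HB.instance Definition _ :=
  Measure_isSigmaFinite.Build _ _ _ lebesgue_step lebesgue_step_sigma_finite.

End step.

Fixpoint lebesgue_tuple (n : nat) :
    {sigma_finite_measure set (n.-tuple Rb) -> \bar R} :=
  match n with
  | 0 => \d_([tuple] : 0.-tuple Rb)
  | n'.+1 => lebesgue_step (lebesgue_tuple n')
  end.

End lebesgue_tuple.

Section calculus.
Context {R : realType} {N : nat}.
Local Notation RN := 'rV[R]_N.

Definition partial (i : 'I_N) (f : RN -> R) : RN -> R := 'D_(delta_mx 0 i) f.

Definition grad (f : RN -> R) (x : RN) : RN := \row_i partial i f x.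

Definition divergence (F : RN -> RN) (x : RN) : R :=
  \sum_(i < N) partial i (fun y => F y 0 i) x.

(* The library norm on row vectors is the sup norm. *)
Definition enorm (x : RN) : R := Num.sqrt (\sum_(i < N) x 0 i ^+ 2).

Fixpoint Ck (k : nat) (f : RN -> R) : Prop :=
  continuous f /\
  if k is k'.+1 then
    forall i : 'I_N, (forall x, derivable f x (delta_mx 0 i)) /\
      Ck k' (partial i f)
  else True.

Definition test_function (phi : RN -> R) : Prop :=
  (forall k, Ck k phi) /\
  (exists r : R, forall x, r < enorm x -> phi x = 0).

Definition radially_symmetric (u : RN -> R) : Prop :=
  exists c : RN, forall x y, enorm (x - c) = enorm (y - c) -> u x = u y.

Definition vec_of_tuple (t : N.-tuple (measurableTypeR R)) : RN :=
  \row_i (tnth t i : R).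

Definition Lp (p : \bar R) (f : RN -> R) : Prop :=
  f \o vec_of_tuple \in Lfun (lebesgue_tuple N) p.

Definition integral_RN (f : RN -> R) : R :=
  \int[lebesgue_tuple N]_(t in [set: N.-tuple (measurableTypeR R)])
    f (vec_of_tuple t).

(* u is in H^1(R^N) and G is (a representative of) its weak gradient Du. *)
Definition H1_with_gradient (u : RN -> R) (G : RN -> RN) : Prop :=
  [/\ Lp 2%:E u,
      forall i, Lp 2%:E (fun x => G x 0 i) &
      forall phi, test_function phi -> forall i,
        integral_RN (fun x => u x * partial i phi x) =
        - integral_RN (fun x => G x 0 i * phi x)].

(* The weak gradient is unique almost everywhere, so that the choice of G
   does not matter. *)
Definition spaceX (a : R -> R) : set (RN -> R) :=
  [set u | exists2 G, H1_with_gradient u G &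
                      Lp 1%:E (fun x => a (u x) * enorm (G x) ^+ 2)].

Definition solves (a : R -> R) (m p : R) (u : RN -> R) : Prop :=
  [/\ forall x, - divergence (fun y => a (u y) *: grad u y) x
                + 2^-1 * (a^`())%classic (u x) * enorm (grad u x) ^+ 2 + m * u x
                = u x `^ p,
      forall x, 0 < u x &
      radially_symmetric u].

End calculus.

Definition C2 {R : realType} (f : R -> R) : Prop :=
  [/\ forall s, derivable f s 1, forall s, derivable (f^`())%classic s 1 &
      continuous (f^`(2))%classic].

(* Main.v *)
Require Import Defs.
From HB Require Import structures.
From mathcomp Require Import all_boot all_order all_algebra.
From mathcomp Require Import all_classical all_reals all_analysis.
From mathcomp Require Import measurable_realfun.
From mathcomp Require Import ring lra.

(* Let V be the odd function with V' = sqrt a on the positive half line.  For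
   v = V(u) the equation becomes Lap v + h(v) = 0 with h(v) = (u^p - m u) / sqrt(a(u)),
   so that radial solutions u are the solutions of the ODE
     v'' + (N - 1)/r v' + h(v) = 0,  v'(0) = 0.
   Let H' = h.  The energy v'^2/2 + H(v) is nonincreasing in r.  If it becomes
   negative, then v stays away from 0 and u is not square integrable; if it stays
   nonnegative and v is positive, then v and v' decay faster than any power of r.
   Hence the solutions in X are exactly the positive v with nonnegative energy.

   Existence is by shooting.  The set of initial values for which the energy becomes
   negative is open and contains the zero b of h; the set of those for which v becomes
   negative is open, and is nonempty by the Pohozaev identity and the upper bound on p.
   The two sets are disjoint, so that some initial value is in neither.

   For uniqueness, m is taken so large that l h'(l)/h(l) is nonincreasing for l > b.
   Two solutions are regarded as functions of their level l, through the radius r(l)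
   and the slope q(l) = -v'(r(l)).  Suppose the second one starts higher.  Comparison
   of theta = r q / l, at points where the two solutions have the same theta, shows
   that theta is smaller for the first solution at all levels above b.  Below b, where
   h < 0, two solutions cannot have the same radius at the same level, and the order
   of their radii determines the order of their slopes and of r q.  At level b the two
   comparisons contradict each other. *)

Set Implicit Arguments.
Unset Strict Implicit.
Unset Printing Implicit Defensive.
Import Order.TTheory GRing.Theory Num.Theory.
Import numFieldNormedType.Exports.
Local Open Scope classical_set_scope.
Local Open Scope ring_scope.

(** * Calculus on the real line *)

(** The upper bound on [p] is subcriticality after the change of variable: V(u) grows like u^(1 +
    k/2), so h grows with exponent (p - k/2)/(1 + k/2), and the bound says exactly that this is
    below (N + 2)/(N - 2). The exponent may be smaller than 1, so h need not be superlinear. The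
    elasticity l h'(l)/h(l) is a product of two factors, V/(u V') and the elasticity of (u^p - m
    u)/sqrt(a(u)). The asymptotic conditions on psi make both nonincreasing only for large u; a
    large m moves the zero b of h into that range. In the variables theta and r^2 h/l, taken as
    functions of the level, h enters only through its elasticity, which is why theta is the quantity
    to compare. The obstacle is that solutions can be matched at equal theta only if theta is
    strictly monotone in the level above b. This is itself proved by matching, applied to two arcs
    of a single trajectory. Extending h by 0 to the negative half line makes nonpositive constants
    solutions, so that no shooting trajectory has a critical point at a value at most 0. *)

Section Calculus.
Context {R : realType}.
Implicit Types (f g : R -> R) (x y a b c d : R).

(** The value of the derivative is an argument, so that it can be left as an existential variable
    and computed from the shape of the function by the tactic [drv]. *)
Definition drv f x d := is_derive x (1 : R) f d.

Lemma drv_eq f x d d' : drv f x d -> d = d' -> drv f x d'.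
Proof. by move=> ? <-. Qed.

Lemma drv_near {f g x d} : (\forall y \near x, f y = g y) -> drv f x d -> drv g x d.
Proof.
move=> fg [df <-]; have o : (1 : R) != 0 by rewrite oner_eq0.
split; first by apply: near_eq_derivable fg df.
by rewrite (near_eq_derive _ fg).
Qed.

Lemma drv_ext {f g x d} : (forall y, f y = g y) -> drv f x d -> drv g x d.
Proof. by move=> /funext->. Qed.

Lemma drv_val f x d d' : drv f x d -> drv f x d' -> d = d'.
Proof. by move=> [_ <-] [_ <-]. Qed.

Lemma drvC x (c : R) : drv (fun=> c) x 0.
Proof. exact: is_derive_cst. Qed.

Lemma drvI x : drv (fun y => y) x 1.
Proof. exact: is_derive_id. Qed.

Lemma drvD f g x a b : drv f x a -> drv g x b -> drv (fun y => f y + g y) x (a + b).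
Proof. by move=> ? ?; exact: is_deriveD. Qed.

Lemma drvN f x a : drv f x a -> drv (fun y => - f y) x (- a).
Proof. by move=> ?; exact: is_deriveN. Qed.

Lemma drvM f g x a b : drv f x a -> drv g x b ->
  drv (fun y => f y * g y) x (a * g x + f x * b).
Proof.
move=> ha hb; have := is_deriveM ha hb; move=> /drv_eq; apply.
by rewrite /GRing.scale /=; ring.
Qed.

Lemma drvX f x a n : drv f x a -> drv (fun y => f y ^+ n) x (n%:R * f x ^+ n.-1 * a).
Proof. by move=> ha; have := @is_deriveX _ _ f n _ _ _ ha; rewrite exprfctE. Qed.

Lemma drvV f x a : drv f x a -> f x != 0 -> drv (fun y => (f y)^-1) x (- a / f x ^+ 2).
Proof.
move=> ha hx; have := is_deriveV hx ha; move=> /drv_eq; apply.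
by rewrite /GRing.scale /=; ring.
Qed.

Lemma drv_comp f g x a b : drv f x a -> drv g (f x) b -> drv (fun y => g (f y)) x (b * a).
Proof.
move=> ha hb; have [dg eg] := hb; have [df ef] := ha.
have df1 (k : R -> R) (y : R) : derivable k y (1 : R) -> differentiable k y by move/derivable1_diffP.
split; first by apply/derivable1_diffP; exact: (differentiable_comp (df1 _ _ df) (df1 _ _ dg)).
have := derive1_comp df dg; rewrite !derive1E => ->.
by rewrite eg ef.
Qed.

Lemma drv_expR f x a : drv f x a -> drv (fun y => expR (f y)) x (a * expR (f x)).
Proof.
move=> ha; have := drv_comp ha (is_derive_expR (f x)); rewrite mulrC; exact.
Qed.

Lemma drv_ln f x a : drv f x a -> 0 < f x -> drv (fun y => ln (f y)) x (a / f x).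
Proof.
move=> ha hx; have := drv_comp ha (is_derive1_ln hx); rewrite mulrC; exact.
Qed.

Lemma drv_sqrt f x a : drv f x a -> 0 < f x ->
  drv (fun y => Num.sqrt (f y)) x (a / (2 * Num.sqrt (f x))).
Proof.
move=> ha hx; have := drv_comp ha (is_derive1_sqrt hx); rewrite mulrC; exact.
Qed.

Lemma drv_powR f x a p : drv f x a -> 0 < f x ->
  drv (fun y => f y `^ p) x (p * f x `^ (p - 1) * a).
Proof.
move=> ha hx; apply: (drv_near (f := fun y => expR (p * ln (f y)))).
  have [df _] := ha; have cf : {for x, continuous f}.
    exact/differentiable_continuous/derivable1_diffP.
  have : \forall y \near x, 0 < f y by exact: (cvgr_gt _ cf _ hx).
  by apply: filterS => y fy; rewrite /powR gt_eqF.
apply: (drv_eq (drv_expR (drvM (drvC _ p) (drv_ln ha hx)))).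
have e1 : expR (ln (f x)) = f x by rewrite lnK.
rewrite mul0r add0r /powR gt_eqF// mulrBl mul1r expRB e1.
by field; rewrite gt_eqF.
Qed.

Lemma drv_cont f x d : drv f x d -> {for x, continuous f}.
Proof. by move=> [df _]; exact/differentiable_continuous/derivable1_diffP. Qed.

Lemma contC x c : {for x, continuous (fun=> c : R)}.
Proof. exact: cst_continuous. Qed.

Lemma contI x : {for x, continuous (fun y : R => y)}.
Proof. exact: cvg_id. Qed.

Lemma contD f g x : {for x, continuous f} -> {for x, continuous g} ->
  {for x, continuous (fun y => f y + g y)}.
Proof. by move=> cf cg; exact: (cvgD cf cg). Qed.

Lemma contN f x : {for x, continuous f} -> {for x, continuous (fun y => - f y)}.
Proof. by move=> cf; exact: (cvgN cf). Qed.

Lemma contM f g x : {for x, continuous f} -> {for x, continuous g} ->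
  {for x, continuous (fun y => f y * g y)}.
Proof. by move=> cf cg; exact: (cvgM cf cg). Qed.

Lemma contX f n x : {for x, continuous f} -> {for x, continuous (fun y => f y ^+ n)}.
Proof. by move=> cf; exact: (@continuous_comp _ _ _ f (fun z => z ^+ n) x cf (@exprn_continuous _ n (f x))). Qed.

Lemma contV f x : f x != 0 -> {for x, continuous f} -> {for x, continuous (fun y => (f y)^-1)}.
Proof. by move=> f0 cf; exact: (cvgV f0 cf). Qed.

Lemma cont_comp f g x : {for x, continuous f} -> {for f x, continuous g} ->
  {for x, continuous (fun y => g (f y))}.
Proof. by move=> cf cg; exact: (@continuous_comp _ _ _ f g x cf cg). Qed.

Lemma cont_norm f x : {for x, continuous f} -> {for x, continuous (fun y => `|f y|)}.
Proof. by move=> cf; exact: (@continuous_comp _ _ _ f (fun z => `|z|) x cf (@norm_continuous _ R (f x))). Qed.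

End Calculus.

(** Constant functions are tried first, which keeps closed products and powers from being
    differentiated factor by factor. Nonvanishing and positivity conditions are left as goals. *)
Ltac drv_core :=
  first [lazymatch goal with |- drv (fun _ => ?c) _ _ => eapply (drvC _ c) end |
  lazymatch goal with
  | |- drv (fun y => @?f y + @?g y) _ _ => eapply (drvD (f:=f) (g:=g)); [drv_core|drv_core]
  | |- drv (fun y => - @?f y) _ _ => eapply (drvN (f:=f)); drv_core
  | |- drv (fun y => @?f y * @?g y) _ _ => eapply (drvM (f:=f) (g:=g)); [drv_core|drv_core]
  | |- drv (fun y => (@?f y) ^+ ?n) _ _ => eapply (@drvX _ f _ _ n); drv_core
  | |- drv (fun y => (@?f y)^-1) _ _ => eapply (drvV (f:=f)); [drv_core|]
  | |- drv (fun y => expR (@?f y)) _ _ => eapply (drv_expR (f:=f)); drv_core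
  | |- drv (fun y => ln (@?f y)) _ _ => eapply (drv_ln (f:=f)); [drv_core|]
  | |- drv (fun y => Num.sqrt (@?f y)) _ _ => eapply (drv_sqrt (f:=f)); [drv_core|]
  | |- drv (fun y => (@?f y) `^ ?p) _ _ => eapply (@drv_powR _ f _ _ p); [drv_core|]
  | |- drv (fun y => y) _ _ => eapply drvI
  | |- _ => first [eassumption | match goal with H : _ |- _ => eapply H end]
  end].

Ltac drv := eapply drv_eq; [drv_core|].

(** * Mean value theorem, signs and zeros of functions of one variable *)

Section Monotone.
Context {R : realType}.
Implicit Types (f df g : R -> R) (x y a b c d : R).

Lemma mvt f df x y : x < y ->
  (forall t, x <= t <= y -> {for t, continuous f}) ->
  (forall t, x < t < y -> drv f t (df t)) ->
  exists2 c, x < c < y & f y - f x = df c * (y - x).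
Proof.
move=> xy cf hf.
have [t| |c cxy e] := @MVT R f df x y xy.
- by rewrite in_itv /= => /hf.
- by apply: continuous_in_subspaceT => t /set_mem /=; rewrite in_itv /= => /cf.
- by exists c => //; move: cxy; rewrite in_itv.
Qed.

Lemma drv_ge0_le f df x y : x <= y ->
  (forall t, x <= t <= y -> {for t, continuous f}) ->
  (forall t, x < t < y -> drv f t (df t)) ->
  (forall t, x < t < y -> 0 <= df t) -> f x <= f y.
Proof.
rewrite le_eqVlt => /predU1P[->//|xy] cf hf h.
have [c cxy e] := mvt xy cf hf.
by rewrite -subr_ge0 e mulr_ge0 ?h// subr_ge0 ltW.
Qed.

Lemma drv_gt0_lt f df x y : x < y ->
  (forall t, x <= t <= y -> {for t, continuous f}) ->
  (forall t, x < t < y -> drv f t (df t)) ->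
  (forall t, x < t < y -> 0 < df t) -> f x < f y.
Proof.
move=> xy cf hf h; have [c cxy e] := mvt xy cf hf.
by rewrite -subr_gt0 e mulr_gt0 ?h// subr_gt0.
Qed.

Lemma drv_le0_ge f df x y : x <= y ->
  (forall t, x <= t <= y -> {for t, continuous f}) ->
  (forall t, x < t < y -> drv f t (df t)) ->
  (forall t, x < t < y -> df t <= 0) -> f y <= f x.
Proof.
move=> xy cf hf h; rewrite -lerN2.
apply: (@drv_ge0_le (fun t => - f t) (fun t => - df t) x y xy) => [t /cf|t /hf|t /h].
- exact: continuousN.
- exact: drvN.
- by rewrite oppr_ge0.
Qed.

Lemma drv_lt0_gt f df x y : x < y ->
  (forall t, x <= t <= y -> {for t, continuous f}) ->
  (forall t, x < t < y -> drv f t (df t)) ->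
  (forall t, x < t < y -> df t < 0) -> f y < f x.
Proof.
move=> xy cf hf h; rewrite -ltrN2.
apply: (@drv_gt0_lt (fun t => - f t) (fun t => - df t) x y xy) => [t /cf|t /hf|t /h].
- exact: continuousN.
- exact: drvN.
- by rewrite oppr_gt0.
Qed.

Lemma continuousP f x : {for x, continuous f} <->
  forall e, 0 < e -> exists2 d, 0 < d & forall y, `|y - x| < d -> `|f y - f x| < e.
Proof.
split=> [cf e e0|h].
  have : \forall y \near x, `|f x - f y| < e by move: cf => /cvgrPdist_lt; apply.
  by move=> /nbhs_ballP[d d0 hd]; exists d => // y hy; rewrite distrC; apply: hd; rewrite /ball /= distrC.
apply/cvgrPdist_lt => e e0; have [d d0 hd] := h _ e0.
by apply/nbhs_ballP; exists d => // y; rewrite /ball /= distrC => /hd; rewrite distrC.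
Qed.

Lemma continuous_lt0 f x : {for x, continuous f} -> f x < 0 ->
  exists2 d, 0 < d & forall y, `|y - x| < d -> f y < 0.
Proof.
move=> /continuousP cf h; have [d d0 hd] := cf (- f x) ltac:(lra).
exists d => // y /hd; rewrite ltr_norml => /andP[_]; lra.
Qed.

Lemma continuous_gt0 f x : {for x, continuous f} -> 0 < f x ->
  exists2 d, 0 < d & forall y, `|y - x| < d -> 0 < f y.
Proof.
move=> /continuousP cf h; have [d d0 hd] := cf (f x) ltac:(lra).
exists d => // y /hd; rewrite ltr_norml => /andP[]; lra.
Qed.

(** The zero is the supremum of the points up to which [f] has remained negative; continuity
    excludes either strict sign there. *)
Lemma first_zero f a b : a <= b ->
  (forall t, a <= t <= b -> {for t, continuous f}) -> f a < 0 -> 0 <= f b ->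
  exists2 c, a < c <= b & f c = 0 /\ forall x, a <= x < c -> f x < 0.
Proof.
move=> ab cf fa fb.
pose S := [set c | a <= c <= b /\ forall x, a <= x <= c -> f x < 0].
have Sa : S a by split; [lra|move=> x hx; have -> : x = a by lra].
have hS : has_sup S by split; [exists a|exists b => x [] /andP[]].
pose c := sup S.
have ac : a <= c by apply: ub_le_sup Sa; case: hS.
have cb : c <= b by apply: ge_sup; [exists a|move=> x [] /andP[]].
have neg x : a <= x < c -> f x < 0.
  move=> /andP[ax xc]; have [y [_ Sy] xy] := sup_adherent (eps := c - x) ltac:(lra) hS.
  by apply: Sy; rewrite ax ltW//; move: xy; rewrite -/c; lra.
have fc := cf c ltac:(lra).
have fc0 : 0 <= f c.
  rewrite leNgt; apply/negP => h; have [d d0 hd] := continuous_lt0 fc h.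
  have cb' : c < b by rewrite lt_neqAle cb andbT; apply/eqP => e; move: h; rewrite e; lra.
  pose y := Num.min b (c + d / 2).
  have yb : y <= b by rewrite ge_min lexx.
  have yd : y <= c + d / 2 by rewrite ge_min lexx orbT.
  have cy : c < y by rewrite lt_min; lra.
  have : S y.
    split; first lra.
    move=> x /andP[ax xy]; have [xc|xc] := ltP x c; first by apply: neg; lra.
    by apply: hd; rewrite ltr_norml; lra.
  by move=> Sy; have := ub_le_sup (proj2 hS) Sy; rewrite -/c; lra.
have fc1 : f c <= 0.
  rewrite leNgt; apply/negP => h; have [d d0 hd] := continuous_gt0 fc h.
  have ac' : a < c by rewrite lt_neqAle ac andbT; apply/eqP => e; move: h; rewrite -e; lra.
  pose y := Num.max a (c - d / 2).
  have ay : a <= y by rewrite le_max lexx.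
  have yd : c - d / 2 <= y by rewrite le_max lexx orbT.
  have yc : y < c by rewrite gt_max; lra.
  have := neg y ltac:(lra); have := hd y; rewrite ltr_norml.
  move=> /(_ ltac:(lra)); lra.
have f0 : f c = 0 by apply/eqP; rewrite eq_le fc0 fc1.
exists c; last by [].
by rewrite cb andbT lt_neqAle ac andbT; apply/eqP => e; move: f0; rewrite -e; lra.
Qed.

Lemma last_zero f a b : a <= b ->
  (forall t, a <= t <= b -> {for t, continuous f}) -> 0 <= f a -> f b < 0 ->
  exists2 c, a <= c < b & f c = 0 /\ forall x, c < x <= b -> f x < 0.
Proof.
move=> ab cf fa fb.
have [|t ht|||c hc [f0 h]] := @first_zero (fun x => f (- x)) (- b) (- a).
- by rewrite lerN2.
- have cN : {for t, continuous (fun y : R => - y)} by apply: continuousN; exact: cvg_id.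
  by apply: (continuous_comp cN); apply: cf; lra.
- by rewrite opprK.
- by rewrite opprK.
exists (- c); first lra.
split=> // x hx; rewrite -(opprK x); apply: h; lra.
Qed.

(** In Caratheodory's form, f y - f x is y - x times a function that is continuous at [x] with value
    [d] there. *)
Lemma drv_sign_pos f x d : drv f x d -> 0 < d -> exists2 e, 0 < e &
  (forall y, x < y < x + e -> f x < f y) /\ (forall y, x - e < y < x -> f y < f x).
Proof.
move=> hd d0; have /is_derive1_caratheodory[g [fE gC gx]] := hd.
have [e e0 he] := continuous_gt0 gC ltac:(by rewrite gx).
exists e => //; split=> y hy.
  by rewrite -subr_gt0 fE mulr_gt0 ?subr_gt0//; [apply: he; rewrite ltr_norml; lra|lra].
by rewrite -subr_lt0 fE pmulr_rlt0 ?subr_lt0//; [lra|apply: he; rewrite ltr_norml; lra].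
Qed.

Lemma drv_sign_neg f x d : drv f x d -> d < 0 -> exists2 e, 0 < e &
  (forall y, x < y < x + e -> f y < f x) /\ (forall y, x - e < y < x -> f x < f y).
Proof.
move=> hd d0; have [|e e0 [h1 h2]] := drv_sign_pos (drvN hd); first lra.
by exists e => //; split=> y hy; [have := h1 y hy|have := h2 y hy]; lra.
Qed.

Lemma bounded_seg f a b : a <= b -> (forall t, a <= t <= b -> {for t, continuous f}) ->
  exists2 M, 0 < M & forall t, a <= t <= b -> `|f t| <= M.
Proof.
move=> ab cf.
have cf' : {within `[a, b], continuous f}.
  by apply: continuous_in_subspaceT => t /set_mem /=; rewrite in_itv /= => /cf.
have [c1 _ h1] := EVT_max ab cf'; have [c2 _ h2] := EVT_min ab cf'.
exists (`|f c1| + `|f c2| + 1); first by have := normr_ge0 (f c1); have := normr_ge0 (f c2); lra.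
move=> t ht; have := h1 t ltac:(by rewrite in_itv); have := h2 t ltac:(by rewrite in_itv).
have := ler_norm (f c1); have := ler_norm (- f c2); rewrite normrN.
by rewrite ler_norml; have := normr_ge0 (f c1); have := normr_ge0 (f c2); lra.
Qed.

Lemma ivt f a b l : a <= b -> (forall t, a <= t <= b -> {for t, continuous f}) ->
  f a <= l <= f b \/ f b <= l <= f a -> exists2 c, a <= c <= b & f c = l.
Proof.
move=> ab cf hl.
have cf' : {within `[a, b], continuous f}.
  by apply: continuous_in_subspaceT => t /set_mem /=; rewrite in_itv /= => /cf.
have [|c hc e] := IVT ab cf' (v := l).
  by case: hl => /andP[h1 h2]; rewrite ge_min le_max h1 h2 ?orbT.
by exists c => //; move: hc; rewrite in_itv.
Qed.

End Monotone.

Lemma near_left {R : realFieldType} (x a e : R) : x < a -> 0 < e -> exists t, x < t < a /\ a - e < t.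
Proof.
move=> xa e0; have [h|h] := leP (a - e / 2) x; last by exists (a - e / 2); lra.
by exists ((x + a) / 2); lra.
Qed.

Lemma near_right {R : realFieldType} (a y e : R) : a < y -> 0 < e -> exists t, a < t < y /\ t < a + e.
Proof.
move=> ay e0; have [h|h] := leP y (a + e / 2); last by exists (a + e / 2); lra.
by exists ((a + y) / 2); lra.
Qed.

(** The integrating factor [expR (M * t)] reduces this to monotonicity. It serves to show that a
    negative [e l] prevents [e] from vanishing at [c]. *)
Lemma drv_gronwall {R : realType} (e de : R -> R) (M l c : R) : l <= c ->
  (forall t, l <= t <= c -> drv e t (de t)) -> (forall t, l < t < c -> de t + M * e t <= 0) ->
  e c * expR (M * c) <= e l * expR (M * l).
Proof.
move=> lc he hde; pose E t := e t * expR (M * t).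
have hE t : l <= t <= c -> drv E t ((de t + M * e t) * expR (M * t)).
  move=> ht; apply: drv_eq.
    by apply: drvM; [exact: he|apply: drv_expR; apply: drvM; [exact: drvC|exact: drvI]].
  by rewrite /=; ring.
apply: (@drv_le0_ge _ E _ l c lc) => [t ht|t /andP[t1 t2]|t ht]; first exact: drv_cont (hE t ht).
  by apply: hE; rewrite !ltW.
by rewrite pmulr_lle0 ?expR_gt0// hde.
Qed.

Section Inverse.
Context {R : realType}.

(* [f] is only assumed to invert [g] between [a] and [b]. *)
Lemma drv_inverse (f g df : R -> R) a b :
  (forall t, a < t < b -> drv f t (df t)) ->
  (forall t, a < t < b -> df t != 0) ->
  (forall t, a < t < b -> g (f t) = t) ->
  forall t, a < t < b -> drv g (f t) (df t)^-1.
Proof.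
move=> hf hdf hg t ht; apply: is_derive_inverse => //; last 2 first.
- exact: hf.
- exact: hdf.
- near=> z; apply: hg; near: z.
  by have := near_in_itvoo (a := a) (b := b); rewrite /prop_in1 /= => /(_ t); rewrite in_itv /= ; apply.
near=> z; apply: (drv_cont (hf z _)); near: z.
by have := near_in_itvoo (a := a) (b := b); rewrite /prop_in1 /= => /(_ t); rewrite in_itv /= ; apply.
Unshelve. all: by end_near. Qed.

End Inverse.

(** * Radial solutions of the ODE *)

Section Primitive.
Context {R : realType}.
Notation mu := (@lebesgue_measure R).

Lemma drv_zero_eq (f : R -> R) a x y : a < x -> a < y -> (forall t, a < t -> drv f t 0) -> f x = f y.
Proof.
wlog xy : x y / x <= y => [hw ax ay h|ax ay h].
  by have [xy|yx] := leP x y; [exact: hw|symmetry; apply: hw => //; exact: ltW].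
apply/eqP; rewrite eq_le; apply/andP; split.
  by apply: (@drv_ge0_le _ _ (fun=> 0)) => // t ht; [apply: drv_cont (h t _)|apply: h]; lra.
by apply: (@drv_le0_ge _ _ (fun=> 0)) => // t ht; [apply: drv_cont (h t _)|apply: h]; lra.
Qed.

(** The lower end -(|x| + 1) lies to the left of both 0 and [x], so the difference is the signed
    integral from 0 to [x] whatever the sign of [x]. *)
Definition prim (g : R -> R) (x : R) : R :=
  (\int[mu]_(t in `[- (`|x| + 1), x]) g t - \int[mu]_(t in `[- (`|x| + 1), 0]) g t)%R.

Lemma prim0 g : prim g 0 = 0.
Proof. exact: subrr. Qed.

Lemma drv_prim (g : R -> R) x : continuous g -> drv (prim g) x (g x).
Proof.
move=> cg.
pose F (a x : R) : R := (\int[mu]_(t in `[a, x]) g t)%R.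
have dF a y : a < y -> drv (F a) y (g y).
  move=> ay; have ig : mu.-integrable `[a, y + 1] (EFin \o g).
    apply: continuous_compact_integrable; first exact: segment_compact.
    by apply: continuous_subspaceT => z; exact: cg.
  have [|d e] := @continuous_FTC1_closed R g a y (y + 1) _ ig ay (cg y); first lra.
  by split; [exact: d|rewrite -derive1E; exact: e].
(* The lower end in [prim] moves with the point. Two admissible lower ends give the same increment
   from 0, since the difference has zero derivative; a fixed one can therefore be used near [x]. *)
have FF a a' y : a < 0 -> a' < 0 -> a < y -> a' < y -> F a y - F a 0 = F a' y - F a' 0.
  move=> a0 a'0 ay a'y.
  have : F a y - F a' y = F a 0 - F a' 0.
    apply: (@drv_zero_eq (fun t => F a t - F a' t) (Num.max a a')); rewrite ?gt_max ?ay ?a0 ?a'0 ?a'y//.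
    move=> t; rewrite gt_max => /andP[at0 at1].
    by apply: drv_eq; [apply: drvD; [exact: dF|apply: drvN; exact: dF]|rewrite subrr].
  by move: (F a y) (F a' y) (F a 0) (F a' 0) => x1 x2 x3 x4 e; lra.
pose a := - (`|x| + 2).
have xa : a < x - 1 by rewrite /a; have := ler_norm (- x); rewrite normrN; lra.
apply: (drv_near (f := fun y => F a y - F a 0)); last first.
  by apply: drv_eq; [apply: drvD; [apply: dF; lra|exact: drvC]|rewrite addr0].
apply/nbhs_ballP; exists 1; first exact: ltr01.
move=> y; rewrite /ball /= => hy; apply: FF.
- by rewrite /a; have := normr_ge0 x; lra.
- by have := normr_ge0 y; lra.
- by move: hy; rewrite ltr_norml; lra.
- by have := ler_norm (- y); rewrite normrN; lra.
Qed.

End Primitive.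

(** * The radial equation: uniqueness and continuous dependence *)

Section Radial.
Context {R : realType}.
Implicit Types (h v dv g : R -> R) (n : nat).

(** The equation is imposed for r > 0 only, where 1/r makes sense; at the centre it is replaced by
    [dv 0 = 0] and the continuity of [dv]. Differentiability of [v] on the whole line avoids
    one-sided derivatives at 0. *)
Definition radsol n h v dv := [/\ forall r, drv v r (dv r), dv 0 = 0, continuous dv &
  forall r, 0 < r -> drv dv r (- (n%:R - 1) / r * dv r - h (v r))].

Definition dist2 v dv w dw (r : R) := (v r - w r) ^+ 2 + (dv r - dw r) ^+ 2.

Lemma radsol_cont n h v dv r : radsol n h v dv -> {for r, continuous v}.
Proof. by case=> hv _ _ _; exact: drv_cont (hv r). Qed.

Lemma dist2_cont n h v dv w dw r : radsol n h v dv -> radsol n h w dw ->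
  {for r, continuous (dist2 v dv w dw)}.
Proof.
move=> sv sw; have cv := radsol_cont (r := r) sv; have cw := radsol_cont (r := r) sw.
case: sv => _ _ /(_ r) cdv _; case: sw => _ _ /(_ r) cdw _.
by apply: continuousD; (apply: continuousM; apply: continuousB).
Qed.

Lemma drv_dist2 n h v dv w dw r : radsol n h v dv -> radsol n h w dw -> 0 < r ->
  drv (dist2 v dv w dw) r (2 * (v r - w r) * (dv r - dw r)
     - 2 * (n%:R - 1) / r * (dv r - dw r) ^+ 2 - 2 * (dv r - dw r) * (h (v r) - h (w r))).
Proof.
case=> hv _ _ hdv; case=> hw _ _ hdw r0; rewrite /dist2.
have := hdv _ r0; have := hdw _ r0 => h1 h2.
by drv; field; rewrite gt_eqF.
Qed.

(** The friction term contributes -2(n-1)/t (dv - dw)^2, which has the good sign when r increases.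
    The singularity at 0 is therefore harmless and the exponential rate 1 + L does not depend on
    [n]. *)
Lemma radsol_forward n h v dv w dw (L r0 T : R) : (0 < n)%N -> 0 <= L -> 0 <= r0 ->
  radsol n h v dv -> radsol n h w dw ->
  (forall r, r0 <= r <= T -> `|h (v r) - h (w r)| <= L * `|v r - w r|) ->
  forall r, r0 <= r <= T -> dist2 v dv w dw r <= dist2 v dv w dw r0 * expR ((1 + L) * (r - r0)).
Proof.
move=> n0 L0 hr0 sv sw hL r hr.
suff : dist2 v dv w dw r * expR (- (1 + L) * (r - r0)) <=
       dist2 v dv w dw r0 * expR (- (1 + L) * (r0 - r0)).
  rewrite subrr mulr0 expR0 mulr1 mulNr expRN ler_pdivrMr ?expR_gt0//.
pose E t := expR (- (1 + L) * (t - r0)).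
pose d t := 2 * (v t - w t) * (dv t - dw t)
     - 2 * (n%:R - 1) / t * (dv t - dw t) ^+ 2 - 2 * (dv t - dw t) * (h (v t) - h (w t)).
have dE t : drv E t (- (1 + L) * E t).
  by rewrite /E; drv; ring.
apply: (@drv_le0_ge _ (fun t => dist2 v dv w dw t * E t)
   (fun t => (d t - (1 + L) * dist2 v dv w dw t) * E t)).
- by case/andP: hr.
- by move=> t ht; apply: continuousM; [exact: (dist2_cont sv sw)|exact: drv_cont (dE t)].
- move=> t ht; have dd := drv_dist2 sv sw (r := t) ltac:(lra).
  by drv; rewrite /d; ring.
- move=> t ht; rewrite pmulr_lle0 ?expR_gt0// subr_le0 /d /dist2.
  have n1 : 0 <= 2 * (n%:R - 1) / t * (dv t - dw t) ^+ 2.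
    rewrite mulr_ge0 ?sqr_ge0// divr_ge0 ?mulr_ge0//; last lra.
    by rewrite subr_ge0 ler1n.
  have hLt := hL t ltac:(lra).
  have h2 : - (2 * (dv t - dw t) * (h (v t) - h (w t))) <= L * ((v t - w t) ^+ 2 + (dv t - dw t) ^+ 2).
    apply: le_trans (ler_norm _) _; rewrite normrN !normrM gtr0_norm//.
    apply: (@le_trans _ _ (2 * `|dv t - dw t| * (L * `|v t - w t|))).
      by rewrite ler_wpM2l.
    rewrite -(real_normK (num_real (v t - w t))) -(real_normK (num_real (dv t - dw t))).
    rewrite -subr_ge0; set x := `|v t - w t|; set y := `|dv t - dw t|.
    have -> : L * (x ^+ 2 + y ^+ 2) - 2 * y * (L * x) = L * (x - y) ^+ 2 by ring.
    by rewrite mulr_ge0// sqr_ge0.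
  move: n1 h2; set x := v t - w t; set y := dv t - dw t => n1 h2.
  have : 0 <= (x - y) ^+ 2 by exact: sqr_ge0.
  have -> : (x - y) ^+ 2 = x ^+ 2 + y ^+ 2 - 2 * x * y by ring.
  lra.
Qed.

Lemma radsol_unique n h v dv w dw (L T : R) : (0 < n)%N -> 0 <= L ->
  radsol n h v dv -> radsol n h w dw ->
  (forall r, 0 <= r <= T -> `|h (v r) - h (w r)| <= L * `|v r - w r|) ->
  v 0 = w 0 -> forall r, 0 <= r <= T -> v r = w r.
Proof.
move=> n0 L0 sv sw hL e r hr.
have := radsol_forward n0 L0 (lexx 0) sv sw hL hr.
have d0 : dist2 v dv w dw 0 = 0.
  by rewrite /dist2 e; case: sv => _ -> _ _; case: sw => _ -> _ _; rewrite !subrr expr0n addr0.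
rewrite d0 mul0r /dist2 => h1; have := sqr_ge0 (dv r - dw r).
have := sqr_ge0 (v r - w r) => h2 h3.
have /eqP : (v r - w r) ^+ 2 = 0 by lra.
by rewrite sqrf_eq0 subr_eq0 => /eqP.
Qed.

(** Towards the centre the friction term has the wrong sign. It is bounded on every interval away
    from 0, at the price of a rate [K] depending on [r]; this gives equality on (0, r0], and
    continuity gives it at 0. *)
Lemma radsol_backward n h v dv w dw (L r0 : R) : (0 < n)%N -> 0 <= L -> 0 < r0 ->
  radsol n h v dv -> radsol n h w dw ->
  (forall r, 0 <= r <= r0 -> `|h (v r) - h (w r)| <= L * `|v r - w r|) ->
  v r0 = w r0 -> dv r0 = dw r0 -> forall r, 0 <= r <= r0 -> v r = w r.
Proof.
move=> n0 L0 hr0 sv sw hL e1 e2.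
have pos r : 0 < r <= r0 -> v r = w r.
  move=> hr; pose K := 1 + L + 2 * (n%:R - 1) / r.
  pose E t := expR (K * t).
  have dE t : drv E t (K * E t) by rewrite /E; drv; ring.
  pose d t := 2 * (v t - w t) * (dv t - dw t)
     - 2 * (n%:R - 1) / t * (dv t - dw t) ^+ 2 - 2 * (dv t - dw t) * (h (v t) - h (w t)).
  have : dist2 v dv w dw r * E r <= dist2 v dv w dw r0 * E r0.
    apply: (@drv_ge0_le _ (fun t => dist2 v dv w dw t * E t)
      (fun t => (d t + K * dist2 v dv w dw t) * E t)).
    - by case/andP: hr.
    - by move=> t ht; apply: continuousM; [exact: (dist2_cont sv sw)|exact: drv_cont (dE t)].
    - move=> t ht; have dd := drv_dist2 sv sw (r := t) ltac:(lra).
      by drv; rewrite /d; ring.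
    move=> t ht; rewrite pmulr_lge0 ?expR_gt0// /d /dist2.
    set x := v t - w t; set y := dv t - dw t.
    have n1 : 2 * (n%:R - 1) / t * y ^+ 2 <= 2 * (n%:R - 1) / r * y ^+ 2.
      rewrite ler_wpM2r ?sqr_ge0// ler_wpM2l//.
        by rewrite mulr_ge0// subr_ge0 ler1n.
      by rewrite lef_pV2 ?posrE; lra.
    have n2 : 0 <= 2 * (n%:R - 1) / r * x ^+ 2.
      by rewrite mulr_ge0 ?sqr_ge0// divr_ge0 ?mulr_ge0 ?subr_ge0 ?ler1n//; lra.
    have hLt := hL t ltac:(lra).
    have h2 : 2 * y * (h (v t) - h (w t)) <= L * (x ^+ 2 + y ^+ 2).
      apply: le_trans (ler_norm _) _; rewrite !normrM gtr0_norm//.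
      apply: (@le_trans _ _ (2 * `|y| * (L * `|x|))).
        by rewrite ler_wpM2l.
      rewrite -(real_normK (num_real x)) -(real_normK (num_real y)).
      rewrite -subr_ge0.
      have -> : L * (`|x| ^+ 2 + `|y| ^+ 2) - 2 * `|y| * (L * `|x|) = L * (`|x| - `|y|) ^+ 2 by ring.
      by rewrite mulr_ge0// sqr_ge0.
    have : 0 <= (x + y) ^+ 2 by exact: sqr_ge0.
    have -> : (x + y) ^+ 2 = x ^+ 2 + y ^+ 2 + 2 * x * y by ring.
    by rewrite /K 2!mulrDl mul1r; lra.
  have -> : dist2 v dv w dw r0 = 0 by rewrite /dist2 e1 e2 !subrr expr0n addr0.
  rewrite mul0r pmulr_lle0 ?expR_gt0// /dist2 => h1; have := sqr_ge0 (dv r - dw r).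
  have := sqr_ge0 (v r - w r) => h2 h3.
  have /eqP : (v r - w r) ^+ 2 = 0 by lra.
  by rewrite sqrf_eq0 subr_eq0 => /eqP.
move=> r hr; have [r_0|] := ltP 0 r; first by apply: pos; lra.
move=> r1; have -> : r = 0 by lra.
apply/eqP/negPn/negP => ne.
have cvw : {for 0, continuous (fun t => `|v t - w t|)}.
  by apply: (continuous_comp (continuousB (radsol_cont (r := 0) sv) (radsol_cont (r := 0) sw))); exact: norm_continuous.
have [|d d0 hd] := continuous_gt0 cvw; first by rewrite normr_gt0 subr_eq0.
have := hd (Num.min (d / 2) r0).
have m0 : 0 < Num.min (d / 2) r0 by rewrite lt_min; lra.
rewrite subr0 gtr0_norm// gt_min; case: ltP => [_|]; last lra.
by rewrite pos ?subrr ?normr0 ?ltxx; [move/(_ isT)|rewrite m0 ge_min lexx orbT].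
Qed.

End Radial.

(** * Global existence by successive approximation *)

Section Picard.
Context {R : realType}.
Implicit Types (g h v : R -> R).
Variable n' : nat.
Hypothesis n'0 : (0 < n')%N.

(* [v = al - rpot (h \o v)] is the integral form of the radial equation in dimension [n' + 1]. *)
Definition rflux (g : R -> R) (r : R) := prim (fun t : R => t ^+ n' * g t) r / r ^+ n'.
Definition rpot g := prim (rflux g).

Lemma wcont g : continuous g -> continuous (fun t : R => t ^+ n' * g t).
Proof. by move=> cg t; exact: (contM (contX (n := n') (contI (x := t))) (cg t)). Qed.

Lemma prim_zero g (r : R) : (forall t, g t = 0) -> prim g r = 0.
Proof.
move=> /funext->.
have c0 : continuous (fun _ : R => 0 : R) by move=> ?; exact: cst_continuous.
have ha : - (`|r| + 1) < r by have := ler_norm (- r); rewrite normrN; lra.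
have ha0 : - (`|r| + 1) < 0 by have := normr_ge0 r; lra.
by rewrite (drv_zero_eq ha ha0 (fun t _ => drv_prim t c0)) prim0.
Qed.

Lemma rflux_zero (r : R) : rflux (fun=> 0) r = 0.
Proof. by rewrite /rflux prim_zero ?mul0r// => t; rewrite mulr0. Qed.

Lemma rpot_zero (r : R) : rpot (fun=> 0) r = 0.
Proof. by rewrite /rpot prim_zero// => t; exact: rflux_zero. Qed.

Lemma rflux0 g : rflux g 0 = 0.
Proof. by rewrite /rflux prim0 mul0r. Qed.

(** The mean value theorem bounds the numerator by |r| |r|^n' times the supremum of the integrand,
    and |r|^n' cancels the denominator. Negative radii are included because the iterates live on the
    whole line. *)
Lemma rflux_bound g1 g2 (M K r : R) : continuous g1 -> continuous g2 -> 0 <= M -> 0 <= K ->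
  (forall t, `|t| <= `|r| -> `|g1 t - g2 t| <= M * expR (K * t ^+ 2)) ->
  `|rflux g1 r - rflux g2 r| <= M * `|r| * expR (K * r ^+ 2).
Proof.
move=> c1 c2 M0 K0 hM.
pose P t := prim (fun t : R => t ^+ n' * g1 t) t - prim (fun t : R => t ^+ n' * g2 t) t.
have dP t : drv P t (t ^+ n' * (g1 t - g2 t)).
  have p1 := drv_prim t (wcont c1); have p2 := drv_prim t (wcont c2).
  by rewrite /P; drv; ring.
have bnd (c : R) : `|c| <= `|r| -> `|c ^+ n' * (g1 c - g2 c)| <= `|r| ^+ n' * (M * expR (K * r ^+ 2)).
  move=> hc; rewrite normrM normrX ler_pM ?exprn_ge0//; first by rewrite lerXn2r ?nnegrE.
  apply: le_trans (hM _ hc) _; rewrite ler_wpM2l// ler_expR ler_wpM2l//.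
  by rewrite -(real_normK (num_real c)) -(real_normK (num_real r)) lerXn2r ?nnegrE.
have P0 : P 0 = 0 by rewrite /P !prim0 subrr.
have hP : `|P r| <= `|r| * (`|r| ^+ n' * (M * expR (K * r ^+ 2))).
  have [r0|r0|r0] := ltgtP 0 r; last by rewrite -r0 P0 !normr0 mul0r.
    have [t _|t _|c hc e] := mvt r0 (f := P) (df := fun t => t ^+ n' * (g1 t - g2 t)); [exact: drv_cont (dP t)|exact: dP|].
    move: e; rewrite P0 !subr0 => ->; rewrite normrM mulrC ler_wpM2l// bnd//.
    by rewrite !gtr0_norm; lra.
  have [t _|t _|c hc e] := mvt r0 (f := P) (df := fun t => t ^+ n' * (g1 t - g2 t)); [exact: drv_cont (dP t)|exact: dP|].
  move: e; rewrite P0 sub0r => /eqP; rewrite eqr_oppLR => /eqP ->; rewrite normrN normrM mulrC sub0r normrN ler_wpM2l// bnd//.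
  by rewrite !ltr0_norm; lra.
have [->|r0] := eqVneq r 0; first by rewrite !rflux0 subrr normr0 mulr0 mul0r.
rewrite /rflux -mulrBl normrM normfV normrX ler_pdivrMr; last by rewrite exprn_gt0// normr_gt0.
by apply: le_trans hP _; rewrite le_eqVlt; apply/orP; left; apply/eqP; ring.
Qed.

Lemma rflux_bounded g (T : R) : continuous g -> exists2 M, 0 <= M & forall r, `|r| <= T ->
  `|rflux g r| <= M * `|r|.
Proof.
move=> cg; have [T0|T0] := ltP T 0.
  by exists 0 => // r hr; have := normr_ge0 r; lra.
have [|t _|M M0 hM] := @bounded_seg R g (- T) T; first lra.
  exact: cg.
exists M; first exact: ltW.
have c0 : continuous (fun _ : R => 0 : R) by move=> ?; exact: cst_continuous.
move=> r hr; have := @rflux_bound g (fun=> 0) M 0 r cg c0 (ltW M0) (lexx 0).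
rewrite rflux_zero subr0 mul0r expR0 mulr1; apply => t ht; rewrite subr0 mul0r expR0 mulr1; apply: hM.
by rewrite -ler_norml; lra.
Qed.

Lemma drv_rflux g r : continuous g -> r != 0 -> drv (rflux g) r (g r - n'%:R / r * rflux g r).
Proof.
move=> cg r0; rewrite /rflux.
have p1 := drv_prim r (wcont cg).
drv; first by rewrite expf_neq0.
have e : r ^+ n' = r * r ^+ n'.-1 by rewrite -exprS prednK.
have r1 : r ^+ n'.-1 != 0 by rewrite expf_neq0.
by rewrite e; field; rewrite r0 r1.
Qed.

Lemma rflux_cont g : continuous g -> continuous (rflux g).
Proof.
move=> cg r; have [->|r0] := eqVneq r 0; last exact: drv_cont (drv_rflux cg r0).
have [M M0 hM] := rflux_bounded 1 cg.
apply/continuousP => e e0; exists (Num.min 1 (e / (M + 1))); first by rewrite lt_min ltr01 divr_gt0//; lra.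
move=> y; rewrite rflux0 !subr0 lt_min => /andP[y1 y2].
apply: le_lt_trans (hM _ (ltW y1)) _.
move: y2; rewrite ltr_pdivlMr; last lra.
by rewrite mulrDr mulr1 mulrC; have := normr_ge0 y; lra.
Qed.

(** The Gaussian weight is chosen because the flux bound M |r| exp(K r^2) integrates exactly to
    M/(2K) exp(K r^2). A large exponent thus makes the integral operator a contraction on the whole
    line at once. *)
Lemma rpot_bound g1 g2 (M K r : R) : continuous g1 -> continuous g2 -> 0 <= M -> 0 < K ->
  (forall t, `|g1 t - g2 t| <= M * expR (K * t ^+ 2)) ->
  `|rpot g1 r - rpot g2 r| <= M / (2 * K) * expR (K * r ^+ 2).
Proof.
move=> c1 c2 M0 K0 hM.
pose D t := rpot g1 t - rpot g2 t; pose dD t := rflux g1 t - rflux g2 t.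
pose E t := M / (2 * K) * expR (K * t ^+ 2).
have hD t : drv D t (dD t).
  by apply: drvD; [|apply: drvN]; apply: drv_prim; exact: rflux_cont.
have hE t : drv E t (M * t * expR (K * t ^+ 2)).
  by rewrite /E; drv; rewrite /=; field; rewrite gt_eqF.
have D0 : D 0 = 0 by rewrite /D /rpot !prim0 subrr.
have E0 : 0 <= E 0 by rewrite /E mulr_ge0 ?expR_ge0// divr_ge0//; lra.
have hb t : `|dD t| <= M * `|t| * expR (K * t ^+ 2) by apply: rflux_bound => //; exact: ltW.
have hp t : 0 < t -> 0 <= M * t * expR (K * t ^+ 2) - dD t /\ 0 <= M * t * expR (K * t ^+ 2) + dD t.
  by move=> t0; have := hb t; rewrite (gtr0_norm t0) ler_norml; move: (_ * expR _) (dD t) => x y; clear; lra.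
have hn t : t < 0 -> M * t * expR (K * t ^+ 2) - dD t <= 0 /\ M * t * expR (K * t ^+ 2) + dD t <= 0.
  move=> t0; have := hb t; rewrite (ltr0_norm t0) ler_norml mulrN mulNr; move: (_ * expR _) (dD t) => x y.
  by clear; lra.
have hM' t : drv (fun t => E t - D t) t (M * t * expR (K * t ^+ 2) - dD t) by apply: drvD => //; exact: drvN.
have hP' t : drv (fun t => E t + D t) t (M * t * expR (K * t ^+ 2) + dD t) by exact: drvD.
suff [] : E 0 - D 0 <= E r - D r /\ E 0 + D 0 <= E r + D r.
  move=> A B; rewrite -/(D r) -/(E r) ler_norml; move: A B E0; rewrite D0; move: (E 0) (E r) (D r) => x y z; clear; lra.
have [r0|r0] := leP 0 r; split.
- apply: (@drv_ge0_le _ (fun t => E t - D t) _ _ _ r0) => t ht; [exact: drv_cont (hM' t)|exact: hM'|].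
  by have [|] := hp t; first by case/andP: ht.
- apply: (@drv_ge0_le _ (fun t => E t + D t) _ _ _ r0) => t ht; [exact: drv_cont (hP' t)|exact: hP'|].
  by have [|] := hp t; first by case/andP: ht.
- apply: (@drv_le0_ge _ (fun t => E t - D t) _ _ _ (ltW r0)) => t ht; [exact: drv_cont (hM' t)|exact: hM'|].
  by have [|] := hn t; first by case/andP: ht.
- apply: (@drv_le0_ge _ (fun t => E t + D t) _ _ _ (ltW r0)) => t ht; [exact: drv_cont (hP' t)|exact: hP'|].
  by have [|] := hn t; first by case/andP: ht.
Qed.

Lemma halving_absurd (X a b c : R) :
  X < a / 2 -> b <= X / 2 -> c <= X / 2 -> 0 < a -> a <= b + c -> False.
Proof. lra. Qed.

Variables (h : R -> R) (L al : R).
Hypothesis L0 : 0 < L.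
Hypothesis hL : forall x y, `|h x - h y| <= L * `|x - y|.

Lemma lip_cont : continuous h.
Proof.
move=> x; apply/continuousP => e e0; exists (e / L); first exact: divr_gt0.
move=> y hy; apply: le_lt_trans (hL _ _) _.
by rewrite mulrC -ltr_pdivlMr.
Qed.

Let T (v : R -> R) (r : R) : R := al - rpot (fun t => h (v t)) r.

Lemma picard_cont v : continuous v -> continuous (T v).
Proof.
move=> cv; have ch : continuous (fun t => h (v t)) by move=> t; exact: (cont_comp (cv t) (lip_cont (x := v t))).
by move=> t; apply: cvgB; [exact: cvg_cst|exact: (drv_cont (drv_prim t (rflux_cont ch)))].
Qed.

Lemma picard_bound v w (M : R) : continuous v -> continuous w -> 0 <= M ->
  (forall r, `|v r - w r| <= M * expR (L * r ^+ 2)) ->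
  forall r, `|T v r - T w r| <= M / 2 * expR (L * r ^+ 2).
Proof.
move=> cv cw M0 hM r.
have chv : continuous (fun t => h (v t)) by move=> t; exact: (cont_comp (cv t) (lip_cont (x := v t))).
have chw : continuous (fun t => h (w t)) by move=> t; exact: (cont_comp (cw t) (lip_cont (x := w t))).
have := @rpot_bound _ _ (L * M) L r chw chv (mulr_ge0 (ltW L0) M0) L0.
have -> : T v r - T w r = rpot (fun t => h (w t)) r - rpot (fun t => h (v t)) r 
  by rewrite /T; move: (rpot (fun t => h (w t)) r) (rpot (fun t => h (v t)) r) => A B; ring.
(* With the weight exponent equal to the Lipschitz constant, [L] cancels and a contraction factor
   1/2 remains. *)
have -> : L * M / (2 * L) = M / 2 by field; rewrite gt_eqF.
apply => t; apply: le_trans (hL _ _) _; rewrite -mulrA ler_wpM2l//; first exact: ltW.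
by rewrite distrC.
Qed.

Let v_ j := iter j T (fun=> al).
Let C := `|h al| / (2 * L).

Lemma picard_iter_cont j : continuous (v_ j).
Proof. by elim: j => [|j ih]; [move=> ?; exact: cst_continuous|exact: picard_cont]. Qed.

Lemma picard_step j r : `|v_ j.+1 r - v_ j r| <= C / 2 ^+ j * expR (L * r ^+ 2).
Proof.
elim: j r => [r|j ih r].
  rewrite expr0 divr1 /= /T.
  have -> : al - rpot (fun=> h al) r - al = rpot (fun=> 0) r - rpot (fun=> h al) r.
    by rewrite rpot_zero; ring.
  apply: rpot_bound => //; try by move=> ?; exact: cst_continuous.
  move=> t; rewrite sub0r normrN ler_peMr// -expR0 ler_expR mulr_ge0 ?sqr_ge0//; exact: ltW.
have := @picard_bound (v_ j.+1) (v_ j) (C / 2 ^+ j) (@picard_iter_cont _) (@picard_iter_cont _) _ ih r.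
have -> : C / 2 ^+ j.+1 = C / 2 ^+ j / 2 by rewrite exprS; field; rewrite expf_neq0.
apply; by rewrite divr_ge0 ?exprn_ge0// /C divr_ge0// mulr_ge0// ltW.
Qed.

(** The geometric sum is kept exact, with the subtracted term 1/2^i, so that the induction on [i]
    closes. *)
Lemma picard_cauchy j i r : (j <= i)%N -> `|v_ i r - v_ j r| <= 2 * C * (1 / 2 ^+ j - 1 / 2 ^+ i) * expR (L * r ^+ 2).
Proof.
elim: i => [|i ih]; first by rewrite leqn0 => /eqP->; rewrite !subrr normr0 mulr0 mul0r.
rewrite leq_eqVlt => /predU1P[->|]; first by rewrite !subrr normr0 mulr0 mul0r.
rewrite ltnS => /ih {}ih.
have -> : v_ i.+1 r - v_ j r = (v_ i.+1 r - v_ i r) + (v_ i r - v_ j r) by ring.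
apply: le_trans (ler_normD _ _) _; apply: le_trans (lerD (picard_step i r) ih) _.
rewrite -mulrDl ler_wpM2r ?expR_ge0// exprS le_eqVlt; apply/orP; left; apply/eqP.
by field; rewrite !expf_neq0.
Qed.

Lemma C_ge0 : 0 <= C.
Proof. by rewrite /C divr_ge0// mulr_ge0// ltW. Qed.

Lemma picard_cauchy' j i r : (j <= i)%N -> `|v_ i r - v_ j r| <= 2 * C / 2 ^+ j * expR (L * r ^+ 2).
Proof.
move=> ji; apply: le_trans (picard_cauchy r ji) _; rewrite ler_wpM2r ?expR_ge0// -mulrA -[leRHS]mulrA.
rewrite !ler_wpM2l ?C_ge0// div1r gerBl div1r invr_ge0 exprn_ge0//.
Qed.

Lemma picard_cvg r : cvgn (fun j => v_ j r).
Proof.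
have e : (fun j => v_ j r) = (fun j => al + series (fun i => v_ i.+1 r - v_ i r) j).
  apply/funext => j; rewrite /series /= telescope_sumr// addrC subrK//.
rewrite e; apply: is_cvgD; first exact: is_cvg_cst.
apply: normed_cvg.
apply: (@series_le_cvg _ _ (geometric (C * expR (L * r ^+ 2)) (2^-1))).
- by move=> n; exact: normr_ge0.
- move=> n; rewrite /geometric /= mulr_ge0 ?exprn_ge0// mulr_ge0 ?expR_ge0 ?C_ge0//.
- by move=> n; apply: le_trans (picard_step n r) _; rewrite /geometric /= exprVn mulrAC.
- by apply: is_cvg_geometric_series; rewrite ger0_norm// invf_lt1// ltr1n.
Qed.

Let v r := limn (fun j => v_ j r).

Lemma picard_lim j r : `|v r - v_ j r| <= 2 * C / 2 ^+ j * expR (L * r ^+ 2).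
Proof.
have cv : (fun i => `|v_ i r - v_ j r|) @ \oo --> `|v r - v_ j r|.
  by apply: cvg_norm; apply: cvgB; [exact: picard_cvg|exact: cvg_cst].
rewrite -(cvg_lim _ cv)//; apply: limr_le; first by apply/cvg_ex; eexists; exact: cv.
by exists j => // i /= ji; exact: picard_cauchy'.
Qed.

Lemma geo_small (e K : R) : 0 < e -> exists j, K / 2 ^+ j < e.
Proof.
move=> e0; have : K * 2^-1 ^+ j @[j --> \oo] --> 0.
  by rewrite -[X in _ --> X](mulr0 K); apply: cvgMr; apply: cvg_expr; rewrite ger0_norm// invf_lt1// ltr1n.
move/cvgrPdist_lt => /(_ _ e0)[j _ /(_ j (leqnn j))] /=.
rewrite sub0r normrN exprVn => h1; exists j; exact: le_lt_trans (ler_norm _) h1.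
Qed.

Lemma picard_lim_cont : continuous v.
Proof.
move=> x; apply/continuousP => e e0.
pose B := expR (L * (`|x| + 1) ^+ 2).
have [j hj] := geo_small (2 * C * B) (e := e / 3) ltac:(lra).
have /continuousP/(_ (e / 3) ltac:(lra))[d d0 hd] := picard_iter_cont (j := j) (x := x).
have bd (y : R) : `|y| <= `|x| + 1 -> `|v y - v_ j y| < e / 3.
  move=> hy; apply: le_lt_trans (picard_lim j y) _; apply: le_lt_trans hj.
  rewrite mulrAC ler_wpM2r ?invr_ge0 ?exprn_ge0//.
  apply: ler_wpM2l; first by apply: mulr_ge0 => //; exact: C_ge0.
  rewrite /B ler_expR; apply: ler_wpM2l; first exact: ltW.
  by rewrite -(real_normK (num_real y)); apply: lerXn2r; rewrite ?nnegrE ?addr_ge0.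
exists (Num.min d 1); first by rewrite lt_min d0 ltr01.
move=> y; rewrite lt_min => /andP[y1 y2].
have hy : `|y| <= `|x| + 1.
  by rewrite -[X in `|X|](subrK x) addrC; apply: le_trans (ler_normD _ _) _; rewrite lerD2l ltW.
have -> : v y - v x = (v y - v_ j y) + (v_ j y - v_ j x) - (v x - v_ j x) by ring.
apply: le_lt_trans (ler_normB _ _) _.
have := ler_normD (v y - v_ j y) (v_ j y - v_ j x).
have := bd y hy; have := bd x ltac:(lra); have := hd y y1; lra.
Qed.

Lemma picard_fix r : v r = T v r.
Proof.
apply/eqP; rewrite -subr_eq0 -normr_eq0 eq_le normr_ge0 andbT leNgt; apply/negP => h0.
have [j hj] := geo_small (2 * C * expR (L * r ^+ 2)) (e := `|v r - T v r| / 2) ltac:(lra).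
have h1 := picard_lim j.+1 r.
have h2 := @picard_bound v (v_ j) (2 * C / 2 ^+ j) picard_lim_cont (@picard_iter_cont j) _ (picard_lim j) r.
have hCj : 0 <= 2 * C / 2 ^+ j by apply: divr_ge0; [apply: mulr_ge0 => //; exact: C_ge0|exact: exprn_ge0].
move: (h2 hCj) => {}h2.
have := ler_normB (v r - v_ j.+1 r) (T v r - T (v_ j) r).
have -> : v r - v_ j.+1 r - (T v r - T (v_ j) r) = v r - T v r.
  have gen (a b c : R) : a - c - (b - c) = a - b by ring.
  exact: gen.
move=> h3.
have e1 : 2 * C / 2 ^+ j.+1 = 2 * C / 2 ^+ j / 2 by rewrite exprS; field; rewrite expf_neq0.
move: h1; rewrite e1 => h1.
have e2 : 2 * C * expR (L * r ^+ 2) / 2 ^+ j = 2 * C / 2 ^+ j * expR (L * r ^+ 2) by ring.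
by apply: (@halving_absurd (2 * C / 2 ^+ j * expR (L * r ^+ 2)) _ _ _ _ _ _ h0 h3); [rewrite -e2|rewrite [leRHS]mulrAC|rewrite [leRHS]mulrAC].
Qed.

Lemma radsol_ex : exists v dv, radsol n'.+1 h v dv /\ v 0 = al.
Proof.
have ch : continuous (fun t => h (v t)).
  by move=> t; exact: (cont_comp (@picard_lim_cont t) (lip_cont (x := v t))).
exists v, (fun r => - rflux (fun t => h (v t)) r); split; last by rewrite picard_fix /T /rpot prim0 subr0.
split.
- move=> r; apply: (@drv_ext _ (T v)); first by move=> y; rewrite -picard_fix.
  by apply: drv_eq; [apply: drvD; [exact: drvC|apply: drvN; apply: drv_prim; exact: rflux_cont]|rewrite add0r].
- by rewrite rflux0 oppr0.
- by move=> t; exact: (contN (@rflux_cont _ ch t)).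
- move=> r r0; by apply: drv_eq; [apply: drvN; exact: (drv_rflux ch (lt0r_neq0 r0))|rewrite -natr1; ring].
Qed.

End Picard.

(** * Two solutions compared level by level *)

Section Levels.
Context {R : realType}.
Variables (d : nat) (h : R -> R) (b : R).
Let n : R := d%:R + 3.
Hypothesis b0 : 0 < b.
Hypothesis hneg : forall l, 0 < l < b -> h l < 0.
Hypothesis hb : h b = 0.

(* [r l] and [q l] are the radius at which a decreasing solution, starting at [al], has
   the value [l], and its slope [- v'] there.  The dimension is [n = d + 3]. *)
Record profile (al : R) (r q : R -> R) : Prop := Profile {
  prof_al : b < al ;
  prof_r : forall l, 0 < l < al -> 0 < r l ;
  prof_q : forall l, 0 < l < al -> 0 < q l ;
  prof_dr : forall l, 0 < l < al -> drv r l (- (q l)^-1) ;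
  prof_dq : forall l, 0 < l < al -> drv q l ((n - 1) / r l - h l / q l) ;
  prof_top : forall e, 0 < e -> exists2 dl, 0 < dl & forall l, al - dl < l < al -> 0 < l ->
    r l < e /\ `|q l / r l - h al / n| < e ;
  prof_bot : forall e, 0 < e -> exists2 dl, 0 < dl & forall l, 0 < l < dl -> l < al ->
    r l ^+ d.+2 * q l < e /\ 1 <= r l }.

Lemma hle0 l : 0 < l <= b -> h l <= 0.
Proof.
move=> /andP[l0]; rewrite le_eqVlt => /predU1P[->|lb]; first by rewrite hb.
by apply/ltW/hneg/andP.
Qed.

Lemma n3 : 3 <= n.
Proof. by rewrite /n lerDr. Qed.

Section OneProfile.
Variables (al : R) (r q : R -> R).
Hypothesis P : profile al r q.

Lemma profb l : 0 < l <= b -> 0 < l < al.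
Proof. by have := prof_al P; lra. Qed.

Lemma drv_w l : 0 < l < al -> drv (fun l => r l ^+ d.+2 * q l) l (- (r l ^+ d.+2 * h l / q l)).
Proof.
move=> hl; have r0 := prof_r P hl; have q0 := prof_q P hl.
have h1 := prof_dr P hl; have h2 := prof_dq P hl.
drv; rewrite /n /= -(natr1 d.+1) -(natr1 d) !(exprS _ d.+1, exprS _ d).
by field; rewrite !gt_eqF.
Qed.

(** Squaring the flux removes the slope from the derivative: at a common level, two solutions are
    then compared through their radii alone. *)
Lemma drv_w2 l : 0 < l < al -> drv (fun l => (r l ^+ d.+2 * q l) ^+ 2) l (- (2 * (r l ^+ d.+2) ^+ 2 * h l)).
Proof.
move=> hl; have q0 := prof_q P hl.
by apply: drv_eq; [apply: drvX; exact: drv_w|rewrite /= expr1; field; rewrite gt_eqF].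
Qed.

Lemma drv_rq l : 0 < l < al -> drv (fun l => r l * q l) l (n - 2 - r l * h l / q l).
Proof.
move=> hl; have r0 := prof_r P hl; have q0 := prof_q P hl.
have h1 := prof_dr P hl; have h2 := prof_dq P hl.
by drv; field; rewrite !gt_eqF.
Qed.

Lemma prof_small e : 0 < e -> exists2 dl, 0 < dl & forall l, 0 < l < dl -> l < al ->
  [/\ r l ^+ d.+2 * q l < e, r l * q l < e, q l < e & 1 <= r l].
Proof.
move=> e0; have [dl dl0 hdl] := prof_bot P e0; exists dl => // l hl lal.
have [h1 h2] := hdl l hl lal; have q0 : 0 < q l by apply: (prof_q P); lra.
have h3 : r l <= r l ^+ d.+2 by rewrite -[leLHS]expr1 ler_weXn2l.
split => //.
  by apply: le_lt_trans h1; rewrite ler_wpM2r// ltW.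
apply: le_lt_trans h1; rewrite ler_peMl//; first exact: ltW.
exact: le_trans h2 h3.
Qed.

(* Phi = (n-2) l - r q vanishes at l = 0 and is nonincreasing where h <= 0. *)
Lemma rq_ge : (n - 2) * b <= r b * q b.
Proof.
rewrite leNgt; apply/negP => hlt.
pose f l := r l * q l - (n - 2) * l.
have df l : 0 < l < al -> drv f l (- (r l * h l / q l)).
  by move=> hl; apply: drv_eq; [apply: drvD; [exact: (drv_rq hl)|apply: drvN; apply: drvM; [exact: drvC|exact: drvI]]|rewrite /=; ring].
have fb l : 0 < l <= b -> f l <= f b.
  move=> hl; apply: (@drv_ge0_le _ _ (fun l => - (r l * h l / q l))).
  - by case/andP: hl.
  - by move=> t ht; apply: drv_cont (df t _); apply: profb; lra.
  - by move=> t ht; apply: df; apply: profb; lra.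
  - move=> t ht; have t0 : 0 < t < al by apply: profb; lra.
    rewrite oppr_ge0 pmulr_lle0 ?invr_gt0 ?(prof_q P)// pmulr_rle0 ?(prof_r P)//.
    by apply: hle0; lra.
have f0 : 0 < - f b by rewrite /f; lra.
have [dl dl0 hdl] := prof_small f0.
(* The last bound makes (n-2) l at most -f(b)/2, so positivity of r q alone puts f(l) above f(b)/2,
   hence above f(b), against monotonicity. *)
pose l := Num.min (Num.min (dl / 2) b) (- f b / (2 * (n - 2))).
have n2 : 0 < n - 2 by have := n3; lra.
have l0 : 0 < l by rewrite !lt_min b0 divr_gt0//= divr_gt0// mulr_gt0.
have l1 : l <= dl / 2 by rewrite !ge_min lexx.
have l2 : l <= b by rewrite !ge_min lexx orbT.
have l3 : l <= - f b / (2 * (n - 2)) by rewrite ge_min lexx orbT.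
have hl : 0 < l <= b by rewrite l0 l2.
have [_ _ _ _] := hdl l ltac:(lra) ltac:(have := prof_al P; lra).
have := fb l hl; rewrite {1}/f.
have : 0 < r l * q l by rewrite mulr_gt0 ?(prof_r P) ?(prof_q P)//; exact: profb.
move: l3; rewrite ler_pdivlMr; last by rewrite mulr_gt0.
nra.
Qed.

End OneProfile.

Section TwoProfiles.
Variables (al be : R) (r q s p : R -> R).
Hypotheses (P : profile al r q) (Q : profile be s p).

(** Going down from the crossing, the smaller slope [q] gives the larger radius [r]. While s < r and
    h <= 0, the difference [G] of squared fluxes is nondecreasing in the level, so it stays below
    G(l0) < 0 and the order of radii and slopes persists. At level 0 the fluxes vanish, which
    contradicts G <= G(l0). *)
Lemma no_crossing_lt l0 : 0 < l0 <= b -> r l0 = s l0 -> q l0 < p l0 -> False.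
Proof.
move=> hl0 e0 qp; have hA := profb P hl0; have hB := profb Q hl0.
have pA l : 0 < l <= l0 -> 0 < l < al by move=> hl; apply: (profb P); lra.
have pB l : 0 < l <= l0 -> 0 < l < be by move=> hl; apply: (profb Q); lra.
pose f l := s l - r l.
have df l : 0 < l <= l0 -> drv f l ((q l)^-1 - (p l)^-1).
  move=> hl; have h1 := prof_dr P (pA l hl); have h2 := prof_dr Q (pB l hl).
  by rewrite /f; drv; ring.
have qpos l : 0 < l <= l0 -> 0 < q l by move=> hl; apply: (prof_q P); exact: pA.
have ppos l : 0 < l <= l0 -> 0 < p l by move=> hl; apply: (prof_q Q); exact: pB.
have rpos l : 0 < l <= l0 -> 0 < r l by move=> hl; apply: (prof_r P); exact: pA.
have spos l : 0 < l <= l0 -> 0 < s l by move=> hl; apply: (prof_r Q); exact: pB.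
pose G l := (r l ^+ d.+2 * q l) ^+ 2 - (s l ^+ d.+2 * p l) ^+ 2.
have dG l : 0 < l <= l0 -> drv G l (- (2 * h l * ((r l ^+ d.+2) ^+ 2 - (s l ^+ d.+2) ^+ 2))).
  move=> hl; have h1 := drv_w2 P (pA l hl); have h2 := drv_w2 Q (pB l hl).
  by apply: drv_eq; [apply: drvD; [exact: h1|apply: drvN; exact: h2]|ring].
have hl00 : 0 < l0 <= l0 by lra.
have G0 : G l0 < 0.
  have k0 : 0 < s l0 ^+ d.+2 by apply: exprn_gt0; exact: spos.
  have q0 := qpos l0 hl00; have p0 := ppos l0 hl00.
  rewrite /G e0 subr_lt0 ltr_pXn2r// ?nnegrE ?ltr_pM2l//; apply: mulr_ge0; exact: ltW.
have Gmono c l : 0 < c -> (forall t, c < t < l0 -> s t < r t) -> c <= l <= l0 -> G l <= G l0.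
  move=> c0 hc hl; apply: (@drv_ge0_le _ G (fun l => (- (2 * h l * ((r l ^+ d.+2) ^+ 2 - (s l ^+ d.+2) ^+ 2))))).
  - by case/andP: hl.
  - by move=> t ht; apply: drv_cont (dG t _); lra.
  - by move=> t ht; apply: dG; lra.
  - move=> t ht; have sr := hc t ltac:(lra).
    rewrite oppr_ge0 pmulr_lle0; first by rewrite pmulr_rle0//; apply: hle0; lra.
    have s0 : 0 < s t by apply: spos; lra.
    have r0 : 0 < r t by apply: rpos; lra.
    by rewrite subr_gt0 -!exprM ltr_pXn2r// ?nnegrE ltW.
have Gqp t : 0 < t <= l0 -> s t < r t -> G t < 0 -> q t < p t.
  move=> ht sr; have r0 := rpos t ht; have s0 := spos t ht; have q0 := qpos t ht; have p0 := ppos t ht.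
  have a0 : 0 <= r t ^+ d.+2 * q t by apply: mulr_ge0; [apply: exprn_ge0|]; exact: ltW.
  have c0 : 0 <= s t ^+ d.+2 * p t by apply: mulr_ge0; [apply: exprn_ge0|]; exact: ltW.
  rewrite subr_lt0 ltr_pXn2r// => h1.
  rewrite ltNge; apply/negP => h2; move: h1; apply/negP; rewrite -leNgt.
  apply: ler_pM => //; [by apply: exprn_ge0; exact: ltW|exact: ltW|].
  by apply: lerXn2r; rewrite ?nnegrE; exact: ltW.
(* At the last level below [l0] with s >= r the difference s - r would vanish, and from there to
   [l0] it would increase strictly, although it vanishes at [l0] too. *)
have sr l1 : 0 < l1 < l0 -> s l1 < r l1.
  move=> hl1; rewrite ltNge; apply/negP => rs.
  have d0 : (q l0)^-1 - (p l0)^-1 > 0 by rewrite subr_gt0 ltf_pV2 ?posrE ?qpos ?ppos.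
  have [e ep [_ he]] := drv_sign_pos (df l0 hl00) d0.
  have f0 : f l0 = 0 by rewrite /f e0 subrr.
  pose l2 := Num.max ((l1 + l0) / 2) (l0 - e / 2).
  have l21 : (l1 + l0) / 2 <= l2 by rewrite le_max lexx.
  have l22 : l0 - e / 2 <= l2 by rewrite le_max lexx orbT.
  have l23 : l2 < l0 by rewrite gt_max; lra.
  have [||||c hc [fc hcl]] := @last_zero _ f l1 l2; first lra.
  - by move=> t ht; apply: drv_cont (df t _); lra.
  - by rewrite /f subr_ge0.
  - by rewrite -f0; apply: he; lra.
  have hc0 t : c < t < l0 -> s t < r t.
    move=> ht; rewrite -subr_lt0 -/(f t); have [tl|tl] := leP t l2; first by apply: hcl; lra.
    by rewrite -f0; apply: he; lra.
  have : f c < f l0.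
    apply: (@drv_gt0_lt _ f (fun l => (q l)^-1 - (p l)^-1)); first lra.
    - by move=> t ht; apply: drv_cont (df t _); lra.
    - by move=> t ht; apply: df; lra.
    - move=> t ht; have t0 : 0 < t <= l0 by lra.
      rewrite subr_gt0 ltf_pV2 ?posrE ?qpos ?ppos//; apply: Gqp => //; first exact: hc0.
      by apply: le_lt_trans G0; apply: (Gmono c); [lra|exact: hc0|lra].
  by rewrite fc f0 ltxx.
have GG l : 0 < l <= l0 -> G l <= G l0.
  by move=> hl; apply: (Gmono l) => [||]; [lra|move=> t ht; apply: sr; lra|lra].
(* A flux below 1 dominates its own square, so that the square is below -G(l0) as well. *)
have [dl dl0 hdl] := prof_small Q (e := Num.min 1 (- G l0)) ltac:(by rewrite lt_min ltr01 oppr_gt0).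
pose l := Num.min (dl / 2) l0.
have l1 : l <= dl / 2 by rewrite ge_min lexx.
have l2 : l <= l0 by rewrite ge_min lexx orbT.
have l3 : 0 < l by rewrite lt_min; lra.
have [h1 _ _ _] := hdl l ltac:(lra) ltac:(have := prof_al Q; lra).
have := GG l ltac:(lra); rewrite {1}/G; move: h1; rewrite lt_min => /andP[h1 h2].
have h3 : 0 <= s l ^+ d.+2 * p l by apply: mulr_ge0; [apply: exprn_ge0; apply/ltW/spos|apply/ltW/ppos]; lra.
have : 0 <= (r l ^+ d.+2 * q l) ^+ 2 by exact: sqr_ge0.
have : (s l ^+ d.+2 * p l) ^+ 2 <= s l ^+ d.+2 * p l.
  by rewrite expr2 ler_piMr// ltW.
lra.
Qed.

End TwoProfiles.

Lemma no_crossing al be r q s p l : profile al r q -> profile be s p ->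
  0 < l <= b -> r l = s l -> q l = p l.
Proof.
move=> P Q hl e; have [qp|qp|//] := ltgtP (q l) (p l).
  by case: (no_crossing_lt P Q hl e qp).
by case: (no_crossing_lt Q P hl (esym e) qp).
Qed.

End Levels.

(** [f] may touch 0 again to the right of [S], so [last_zero] does not apply. [S] is the supremum of
    the points where [f] is positive, which is why positive values accumulate at [S] from the
    left. *)
Lemma last_positive {R : realType} (f : R -> R) (a b : R) : a <= b ->
  (forall t : R, a <= t <= b -> {for t, continuous f}) -> 0 < f a -> f b <= 0 ->
  exists2 S : R, a < S <= b & [/\ f S = 0, forall x : R, S <= x <= b -> f x <= 0 &
    forall e : R, 0 < e -> exists2 x : R, S - e < x < S & a <= x /\ 0 < f x].
Proof.
move=> ab cf fa fb.
pose A := [set x : R | a <= x <= b /\ 0 < f x].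
have Aa : A a by split; [lra|].
have hA : has_sup A by split; [exists a|exists b => x [] /andP[]].
pose S := sup A.
have aS : a <= S by apply: ub_le_sup Aa; case: hA.
have Sb : S <= b by apply: ge_sup; [exists a|move=> x [] /andP[]].
have up x : S < x <= b -> f x <= 0.
  move=> hx; rewrite leNgt; apply/negP => fx.
  have Ax : A x by split => //; lra.
  by have := ub_le_sup (proj2 hA) Ax; rewrite -/S; lra.
have cS := cf S ltac:(lra).
have fS0 : 0 <= f S.
  rewrite leNgt; apply/negP => h; have [d d0 hd] := continuous_lt0 cS h.
  have [y [yab fy] xy] := sup_adherent d0 hA; move: xy; rewrite -/S => xy.
  have yS : y <= S by apply: ub_le_sup; [case: hA|split].
  have := hd y; rewrite ltr_norml => /(_ ltac:(lra)); lra.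
have fS1 : f S <= 0.
  rewrite leNgt; apply/negP => h; have [d d0 hd] := continuous_gt0 cS h.
  have Sb' : S < b by rewrite lt_neqAle Sb andbT; apply/eqP => e; move: h; rewrite e; lra.
  pose y := Num.min b (S + d / 2).
  have yb : y <= b by rewrite ge_min lexx.
  have yd : y <= S + d / 2 by rewrite ge_min lexx orbT.
  have Sy : S < y by rewrite lt_min; lra.
  have := up y ltac:(lra); have := hd y; rewrite ltr_norml => /(_ ltac:(lra)); lra.
have fS : f S = 0 by apply/eqP; rewrite eq_le fS0 fS1.
have aS' : a < S by rewrite lt_neqAle aS andbT; apply/eqP => e; move: fa; rewrite e fS ltxx.
exists S; first lra.
split=> // [x hx|e e0].
  by have [xS|xS|<-] := ltgtP S x; [apply: up; lra|lra|].
have [y [yab fy] xy] := sup_adherent e0 hA; move: xy; rewrite -/S => xy.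
have yS : y < S.
  rewrite ltNge; apply/negP; rewrite le_eqVlt => /predU1P[E|h]; first by move: fy; rewrite -E fS ltxx.
  by have := up y ltac:(lra); lra.
by exists y; [lra|split => //; lra].
Qed.

(** * Levels up to b: consequences of an order of the radii *)

Section LevelsUp.
Context {R : realType}.
Variables (d : nat) (h : R -> R) (b : R).
Let n : R := d%:R + 3.
Hypothesis b0 : 0 < b.
Hypothesis hneg : forall l, 0 < l < b -> h l < 0.
Hypothesis hb : h b = 0.
Let profile := profile d h b.

Section Separation.
Variables (al be : R) (r q s p : R -> R).
Hypotheses (P : profile al r q) (Q : profile be s p).

(** At a given level the term in [h] is the same for both solutions and cancels in the difference of
    the squared slopes. *)
Lemma drv_qp l : 0 < l < al -> 0 < l < be ->
  drv (fun l => q l ^+ 2 - p l ^+ 2) l (2 * (n - 1) * (q l / r l - p l / s l)).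
Proof.
move=> hA hB; have r0 := prof_r P hA; have q0 := prof_q P hA.
have s0 := prof_r Q hB; have p0 := prof_q Q hB.
have h1 := prof_dq P hA; have h2 := prof_dq Q hB.
by drv; rewrite /= !expr1 -/n; field; rewrite !gt_eqF.
Qed.

Hypothesis sr : forall l, 0 < l <= b -> s l < r l.

(** Once q < p, the inequality s < r gives q/r < p/s, so q^2 - p^2 decreases and q < p persists at
    higher levels. If q >= p at [l0], then q >= p at all lower levels; there Z = s^(n-1) (q^2 - p^2)
    is strictly decreasing, hence bounded below by a positive constant near level 0, whereas it is
    at most r^(n-1) q^2, which tends to 0. *)
Lemma separation l : 0 < l <= b -> q l < p l.
Proof.
move: l => l0 hl0; rewrite ltNge; apply/negP => pq0.
have pA l : 0 < l <= b -> 0 < l < al by move=> hl; exact: (profb P).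
have pB l : 0 < l <= b -> 0 < l < be by move=> hl; exact: (profb Q).
have qpos l : 0 < l <= b -> 0 < q l by move=> hl; apply: (prof_q P); exact: pA.
have ppos l : 0 < l <= b -> 0 < p l by move=> hl; apply: (prof_q Q); exact: pB.
have rpos l : 0 < l <= b -> 0 < r l by move=> hl; apply: (prof_r P); exact: pA.
have spos l : 0 < l <= b -> 0 < s l by move=> hl; apply: (prof_r Q); exact: pB.
pose y l := q l ^+ 2 - p l ^+ 2.
have dy l : 0 < l <= b -> drv y l (2 * (n - 1) * (q l / r l - p l / s l)).
  by move=> hl; apply: drv_qp; [exact: pA|exact: pB].
have n1 : 0 < n - 1 by have := n3 d (R := R); rewrite -/n; lra.
have ysgn l : 0 < l <= b -> (0 <= y l) = (p l <= q l).
  by move=> hl; rewrite subr_ge0 ler_pXn2r// nnegrE ltW// ?ppos ?qpos.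
have qp l : 0 < l <= l0 -> p l <= q l.
  move=> hl; rewrite leNgt; apply/negP => qp.
  have [||||c hc [yc hcl]] := @first_zero _ y l l0; first lra.
  - by move=> t ht; apply: drv_cont (dy t _); lra.
  - by rewrite ltNge ysgn -?ltNge//; lra.
  - by rewrite ysgn.
  have : y c < y l.
    apply: (@drv_lt0_gt _ y (fun l => 2 * (n - 1) * (q l / r l - p l / s l))); first lra.
    - by move=> t ht; apply: drv_cont (dy t _); lra.
    - by move=> t ht; apply: dy; lra.
    - move=> t ht; have ht0 : 0 < t <= b by lra.
      have := hcl t ltac:(lra); rewrite ltNge ysgn// -ltNge => qpt.
      rewrite pmulr_rlt0 ?mulr_gt0// subr_lt0.
      apply: (@lt_trans _ _ (p t / r t)); first by rewrite ltr_pM2r ?invr_gt0 ?rpos.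
      by rewrite ltr_pM2l ?ppos// ltf_pV2 ?posrE ?rpos ?spos// sr.
  have := hcl l ltac:(lra); rewrite yc; lra.
pose Z l := s l ^+ d.+2 * y l.
pose W l := (n - 1) * s l ^+ d.+1 * (- (y l / p l) + 2 * (s l * q l / r l - p l)).
have dZ l : 0 < l <= b -> drv Z l (W l).
  move=> hl; have h1 := prof_dr Q (pB l hl); have h2 := dy l hl.
  have [r0 s0 q0 p0] := And4 (rpos l hl) (spos l hl) (qpos l hl) (ppos l hl).
  rewrite /Z /W; apply: drv_eq; [apply: drvM; [apply: drvX; exact: h1|exact: h2]|].
  rewrite /n /= -(natr1 d.+1) -(natr1 d) !(exprS _ d.+1, exprS _ d).
  by field; rewrite !gt_eqF.
have W0 l : 0 < l <= l0 -> W l < 0.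
  move=> hl; have hl' : 0 < l <= b by lra.
  have [r0 s0 q0 p0] := And4 (rpos l hl') (spos l hl') (qpos l hl') (ppos l hl').
  rewrite /W pmulr_rlt0; last by apply: mulr_gt0 => //; apply: exprn_gt0.
  have h1 : 2 * (q l - p l) <= y l / p l.
    rewrite ler_pdivlMr// /y; have := qp l hl; have : (q l - p l) ^+ 2 >= 0 by exact: sqr_ge0.
    nra.
  have h2 : s l * q l / r l < q l by rewrite ltr_pdivrMr// mulrC ltr_pM2l// sr.
  lra.
have Zdec x z : 0 < x -> x < z -> z <= l0 -> Z z < Z x.
  move=> x0 xz zl; apply: (@drv_lt0_gt _ Z W) => // t ht.
  - by apply: drv_cont (dZ t _); lra.
  - by apply: dZ; lra.
  - by apply: W0; lra.
have Z0 : 0 <= Z l0.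
  by apply: mulr_ge0; [apply: exprn_ge0; apply/ltW/spos|rewrite ysgn//; apply: qp; lra].
have c0 : 0 < Z (l0 / 2) by apply: le_lt_trans Z0 _; apply: Zdec; lra.
have [dl dl0 hdl] := prof_small P (e := Num.min 1 (Z (l0 / 2))) ltac:(by rewrite lt_min ltr01).
pose l := Num.min (dl / 2) (l0 / 4).
have l1 : l <= dl / 2 by rewrite ge_min lexx.
have l2 : l <= l0 / 4 by rewrite ge_min lexx orbT.
have l3 : 0 < l by rewrite lt_min; lra.
have hl : 0 < l <= b by lra.
have [h1 _ h2 _] := hdl l ltac:(lra) ltac:(have := pA l hl; lra).
have := Zdec l (l0 / 2) l3 ltac:(lra) ltac:(lra).
have [r0 s0 q0 p0] := And4 (rpos l hl) (spos l hl) (qpos l hl) (ppos l hl).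
move: h1 h2; rewrite !lt_min => /andP[_ h1] /andP[h2 _].
have h3 : Z l <= r l ^+ d.+2 * q l.
  apply: (@le_trans _ _ (r l ^+ d.+2 * q l ^+ 2)).
    apply: ler_pM; [by apply: exprn_ge0; exact: ltW|by rewrite ysgn//; apply: qp; lra| |].
      by apply: lerXn2r; rewrite ?nnegrE ltW// sr.
    by rewrite /y gerBl sqr_ge0.
  apply: ler_wpM2l; first by apply: exprn_ge0; exact: ltW.
  by rewrite expr2 ler_piMl// ltW.
lra.
Qed.

(** The difference r q - s p has derivative -h (r/q - s/p), nonnegative because h <= 0, s < r and q
    < p; near level 0 both products are arbitrarily small. *)
Lemma sp_le_rq : s b * p b <= r b * q b.
Proof.
rewrite leNgt; apply/negP => hlt.
have pA l : 0 < l <= b -> 0 < l < al by move=> hl; exact: (profb P).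
have pB l : 0 < l <= b -> 0 < l < be by move=> hl; exact: (profb Q).
pose f l := r l * q l - s l * p l.
have df l : 0 < l <= b -> drv f l (- h l * (r l / q l - s l / p l)).
  move=> hl; apply: drv_eq; [apply: drvD; [exact: (drv_rq P (pA l hl))|apply: drvN; exact: (drv_rq Q (pB l hl))]|].
  by rewrite /=; ring.
have fb l : 0 < l <= b -> f l <= f b.
  move=> hl; apply: (@drv_ge0_le _ f (fun l => - h l * (r l / q l - s l / p l))).
  - by case/andP: hl.
  - by move=> t ht; apply: drv_cont (df t _); lra.
  - by move=> t ht; apply: df; lra.
  - move=> t ht; have ht' : 0 < t <= b by lra.
    have [r0 s0] := conj (prof_r P (pA t ht')) (prof_r Q (pB t ht')).
    have [q0 p0] := conj (prof_q P (pA t ht')) (prof_q Q (pB t ht')).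
    apply: mulr_ge0; first by rewrite oppr_ge0; apply: (hle0 hneg hb).
    rewrite subr_ge0; apply: ler_pM; [exact: ltW|by rewrite invr_ge0 ltW| |].
      by apply/ltW/sr.
    by rewrite lef_pV2 ?posrE//; apply/ltW/separation.
have f0 : 0 < - f b by rewrite /f; lra.
have [dl dl0 hdl] := prof_small Q f0.
pose l := Num.min (dl / 2) b.
have l1 : l <= dl / 2 by rewrite ge_min lexx.
have l2 : l <= b by rewrite ge_min lexx orbT.
have l3 : 0 < l by rewrite lt_min b0 andbT divr_gt0.
have hl : 0 < l <= b by lra.
have [_ h1 _ _] := hdl l ltac:(lra) ltac:(have := pB l hl; lra).
have := fb l hl; rewrite {1}/f.
have : 0 < r l * q l by rewrite mulr_gt0 ?(prof_r P) ?(prof_q P)//; exact: pA.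
lra.
Qed.

End Separation.

End LevelsUp.

(** * Levels above b: the logarithmic slope *)

Section Theta.
Context {R : realType}.
Variables (d : nat) (h dh : R -> R) (b : R).
Let n : R := d%:R + 3.
Hypothesis b0 : 0 < b.
Hypothesis hneg : forall l, 0 < l < b -> h l < 0.
Hypothesis hb : h b = 0.
Hypothesis hpos : forall l, b < l -> 0 < h l.
Hypothesis hdh : forall l, b < l -> drv h l (dh l).
Hypothesis hcont : {for b, continuous h}.
Let g l : R := l * dh l / h l.
Hypothesis gmono : forall x y, b < x -> x <= y -> g y <= g x.
Let profile := profile d h b.

(** The logarithmic slope -d ln v / d ln r, in the level variable. *)
Definition th (r q : R -> R) (l : R) : R := r l * q l / l.
Definition zz (r : R -> R) (l : R) : R := r l ^+ 2 * h l / l.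
(** The derivative of [th] with respect to ln r, expressed through [th] and [zz]. Where it is
    positive, [th] decreases as the level increases. *)
Definition DD (r q : R -> R) (l : R) : R := th r q l ^+ 2 - (n - 2) * th r q l + zz r l.

Let n2 : 0 < n - 2.
Proof. by have := @n3 R d; rewrite -/n; lra. Qed.

Section One.
Variables (al : R) (r q : R -> R).
Hypothesis P : profile al r q.

Lemma above_dom l : b <= l < al -> 0 < l < al.
Proof. by have := b0; lra. Qed.

Lemma th_gt0 l : b <= l < al -> 0 < th r q l.
Proof.
move=> /above_dom hl; rewrite /th divr_gt0 ?mulr_gt0//.
- exact: (prof_r P hl).
- exact: (prof_q P hl).
- by case/andP: hl.
Qed.

Lemma zz_gt0 l : b < l < al -> 0 < zz r l.
Proof.
move=> hl; have hl' : 0 < l < al by apply: above_dom; lra.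
have r0 := prof_r P hl'; have h0 : 0 < h l by apply: hpos; lra.
by rewrite /zz divr_gt0 ?mulr_gt0 ?exprn_gt0//; case/andP: hl'.
Qed.

Lemma drv_th l : b <= l < al -> drv (th r q) l (- DD r q l / (th r q l * l)).
Proof.
move=> hl; have hl' := above_dom hl; have l0 : 0 < l by case/andP: hl'.
have r0 := prof_r P hl'; have q0 := prof_q P hl'.
apply: drv_eq; first by apply: drvM; [exact: (drv_rq P hl')|apply: drvV; [exact: drvI|exact: lt0r_neq0]].
rewrite /DD /zz /th -/n /=; field; rewrite !gt_eqF//.
Qed.

(** The pair [th], [zz] satisfies a system that is closed apart from [g]: the nonlinearity acts
    through its elasticity only. *)
Lemma drv_zz l : b < l < al -> drv (zz r) l (zz r l * (g l - 1 - 2 / th r q l) / l).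
Proof.
move=> hl; have hl' : 0 < l < al by apply: above_dom; lra.
have l0 : 0 < l by case/andP: hl'.
have h0 : 0 < h l by apply: hpos; lra.
have r0 := prof_r P hl'; have q0 := prof_q P hl'.
have h1 := prof_dr P hl'; have h2 : drv h l (dh l) by apply: hdh; lra.
rewrite /zz; drv; first exact: lt0r_neq0.
by rewrite /th /g /= expr1; field; rewrite !gt_eqF.
Qed.

Lemma th_cont l : b <= l < al -> {for l, continuous (th r q)}.
Proof. by move=> hl; exact: drv_cont (drv_th hl). Qed.

Lemma zz_cont l : b <= l < al -> {for l, continuous (zz r)}.
Proof.
move=> hl; have hl' := above_dom hl; have l0 : 0 < l by case/andP: hl'.
have cr := drv_cont (prof_dr P hl').
have ch : {for l, continuous h}.
  have [bl|lb|<-//] := ltgtP b l; first exact: drv_cont (hdh bl).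
  by move: hl; lra.
rewrite /zz; apply: contM; last by apply: contV; [exact: lt0r_neq0|exact: contI].
by apply: contM => //; exact: contX.
Qed.

Lemma DD_cont l : b <= l < al -> {for l, continuous (DD r q)}.
Proof.
move=> hl; have ct := th_cont hl; have cz := zz_cont hl.
rewrite /DD; apply: contD => //; apply: contD; first exact: contX.
by apply: contN; apply: contM => //; exact: contC.
Qed.

Lemma drv_DD l : b < l < al -> drv (DD r q) l
  ((2 * th r q l - (n - 2)) * (- DD r q l / (th r q l * l)) + zz r l * (g l - 1 - 2 / th r q l) / l).
Proof.
move=> hl; have h1 := drv_th (l := l) ltac:(lra); have h2 := drv_zz hl.
apply: drv_eq; first by apply: drvD; [apply: drvD; [apply: drvX; exact: h1|apply: drvN; apply: drvM; [exact: drvC|exact: h1]]|exact: h2].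
by rewrite /= expr1; ring.
Qed.

(** As q/r tends to h(al)/n, to leading order [DD] is r^2/l times h(al) - (n-2) h(al)/n = 2 h(al)/n,
    which is positive. Errors of size h(al)/n^2 in q/r and in h are small enough to keep this
    sign. *)
Lemma th_top (e : R) : 0 < e -> exists2 dl, 0 < dl & forall l, al - dl < l < al -> b < l ->
  [/\ th r q l < e, zz r l < e & 0 < DD r q l].
Proof.
move=> e0; have hal : 0 < h al by apply: hpos; exact: prof_al P.
have bal := prof_al P; have n0 : 0 < n by have := n2; lra.
pose M := Num.max (h al / n + 1) (2 * h al).
have M1 : h al / n + 1 <= M by rewrite le_max lexx.
have M2 : 2 * h al <= M by rewrite le_max lexx orbT.
have M0 : 0 < M by have : 0 < h al / n by [rewrite divr_gt0]; lra.
(* the radius r below which both r^2 M / b < e and the quotient q / r is close to its limit *)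
pose e1 := Num.min (Num.min 1 (e * b / M)) (h al / n ^+ 2).
have e1p : 0 < e1 by rewrite !lt_min ltr01 !divr_gt0 ?mulr_gt0 ?exprn_gt0.
have e11 : e1 <= 1 by rewrite !ge_min lexx.
have e12 : e1 <= e * b / M by rewrite !ge_min lexx orbT.
have e13 : e1 <= h al / n ^+ 2 by rewrite ge_min lexx orbT.
have [d1 d10 hd1] := prof_top P e1p.
have h2n : 0 < h al / n ^+ 2 by rewrite divr_gt0 ?exprn_gt0.
have /continuousP/(_ _ h2n)[d2 d20 hd2] := drv_cont (hdh bal).
exists (Num.min d1 d2); first by rewrite lt_min d10.
move=> l hl bl.
have m1 : Num.min d1 d2 <= d1 by rewrite ge_min lexx.
have m2 : Num.min d1 d2 <= d2 by rewrite ge_min lexx orbT.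
have l0 : 0 < l by have := b0; lra.
have hl' : 0 < l < al by lra.
have r0 := prof_r P hl'; have q0 := prof_q P hl'.
have [re] := hd1 l ltac:(lra) l0; rewrite ltr_norml => /andP[hq1 hq2].
have := hd2 l; rewrite !ltr_norml => /(_ ltac:(lra))/andP[hh1 hh2].
have n1 : h al / n ^+ 2 <= h al / 2.
  rewrite ler_pM2l// lef_pV2 ?posrE ?exprn_gt0//; have := n2; nra.
have hM : h l <= M by lra.
have qM : q l / r l <= M by lra.
have rr : r l ^+ 2 * M < e * l.
  apply: (@lt_le_trans _ _ (e * b)); last by rewrite ler_pM2l// ltW.
  rewrite -ltr_pdivlMr//; apply: (lt_le_trans _ e12); apply: (le_lt_trans _ re).
  by rewrite expr2; apply: ler_piMr; [exact: ltW|lra].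
split.
- rewrite /th ltr_pdivrMr//; apply: le_lt_trans rr.
  have -> : r l * q l = r l ^+ 2 * (q l / r l) by field; rewrite gt_eqF.
  by rewrite ler_pM2l ?exprn_gt0.
- by rewrite /zz ltr_pdivrMr//; apply: le_lt_trans rr; rewrite ler_pM2l ?exprn_gt0.
- have -> : DD r q l = th r q l ^+ 2 + r l ^+ 2 / l * (h l - (n - 2) * (q l / r l)).
    by rewrite /DD /zz /th; field; rewrite !gt_eqF.
  apply: ltr_wpDl; first exact: sqr_ge0.
  rewrite mulr_gt0 ?divr_gt0 ?exprn_gt0// subr_gt0.
  have k1 : (n - 2) * (q l / r l) < (n - 2) * (h al / n + h al / n ^+ 2).
    by rewrite ltr_pM2l//; lra.
  have k2 : (n - 2) * (h al / n + h al / n ^+ 2) + h al / n ^+ 2 <= h al.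
    have -> : (n - 2) * (h al / n + h al / n ^+ 2) + h al / n ^+ 2 = h al - h al * (n + 1) / n ^+ 2.
      by field; rewrite gt_eqF.
    rewrite gerBl; apply: divr_ge0; last exact: exprn_ge0 (ltW n0).
    by apply: mulr_ge0; [exact: ltW|exact: addr_ge0 (ltW n0) ler01].
  lra.
Qed.

Lemma th_decr (la x y : R) : b <= la -> (forall l, la < l < al -> 0 < DD r q l) ->
  la <= x -> x < y -> y < al -> th r q y < th r q x.
Proof.
move=> bla hD lx xy yal.
apply: (@drv_lt0_gt _ _ (fun l => - DD r q l / (th r q l * l))) => // t ht.
- by apply: th_cont; lra.
- by apply: drv_th; lra.
- have t0 : 0 < th r q t by apply: th_gt0; lra.
  have t1 : 0 < t by have := b0; lra.
  have D0 : 0 < DD r q t by apply: hD; lra.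
  by rewrite mulNr oppr_lt0; apply: divr_gt0 => //; exact: mulr_gt0.
Qed.

(** [th] is strictly decreasing above [la] and tends to 0 at the top, so its values fill the
    interval between 0 and [th r q la]. *)
Lemma th_inv (la : R) : b <= la < al -> (forall l, la < l < al -> 0 < DD r q l) ->
  exists inv : R -> R, (forall t, la < t < al -> inv (th r q t) = t) /\
    forall y, 0 < y < th r q la -> la < inv y < al /\ th r q (inv y) = y.
Proof.
move=> bla hD.
have ex y : exists t, 0 < y < th r q la -> la < t < al /\ th r q t = y.
  have [hy|] := boolP (0 < y < th r q la); last by exists 0.
  have [dl dl0 hdl] := @th_top y ltac:(by case/andP: hy).
  pose l := Num.max ((la + al) / 2) (al - dl / 2).
  have l1 : (la + al) / 2 <= l by rewrite le_max lexx.
  have l2 : al - dl / 2 <= l by rewrite le_max lexx orbT.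
  have l3 : l < al by rewrite gt_max; lra.
  have [thl _ _] := hdl l ltac:(lra) ltac:(lra).
  have [|||t ht e] := @ivt _ (th r q) la l y; first lra.
  - by move=> t ht; apply: th_cont; lra.
  - by right; lra.
  exists t => _; split => //.
  have : t != la by apply/eqP => e'; move: hy; rewrite -e -e'; lra.
  by rewrite neq_lt => /orP[|]; lra.
have [inv hinv] := choice ex.
exists inv; split => // t ht.
have tla : 0 < th r q t < th r q la.
  by rewrite th_gt0 ?(th_decr (la := la))//; lra.
have [h1 h2] := hinv _ tla.
have [lt|lt|//] := ltgtP (inv (th r q t)) t.
- by have := th_decr (la := la) (x := inv (th r q t)) (y := t) ltac:(lra) hD ltac:(lra) lt ltac:(lra); rewrite h2 ltxx.
- by have := th_decr (la := la) (x := t) (y := inv (th r q t)) ltac:(lra) hD ltac:(lra) lt ltac:(lra); rewrite h2 ltxx.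
Qed.

End One.

(* Two solutions are compared at equal values of [th]: [lam l] is the level at
   which the solution [(s, p)] has the value of [th] that [(r, q)] has at level [l]. *)
Section Matching.
Variables (al be : R) (r q s p : R -> R).
Hypotheses (P : profile al r q) (Q : profile be s p).
Variables (la l1 l0 : R) (inv : R -> R).
Hypothesis bla : b <= la < be.
Hypothesis hD : forall l, la < l < be -> 0 < DD s p l.
Hypothesis hinv : forall t, la < t < be -> inv (th s p t) = t.
Let lam l := inv (th r q l).
Hypothesis bl1 : b <= l1.
Hypothesis l0al : l0 <= al.
Hypothesis hlam : forall l, l1 < l < l0 -> [/\ la < lam l < be, th s p (lam l) = th r q l & l <= lam l].

Lemma drv_lam l : l1 < l < l0 -> drv lam l (DD r q l / DD s p (lam l) * (lam l / l)).
Proof.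
have B0 := b0; have B1 := bl1; have B2 := l0al; have B3 := bla.
move=> hl; have [h1 h2 h3] := hlam hl.
have d1 := drv_th P (l := l) ltac:(lra).
have d2 : drv inv (th s p (lam l)) (- DD s p (lam l) / (th s p (lam l) * lam l))^-1.
  apply: (@drv_inverse _ (th s p) inv (fun l => - DD s p l / (th s p l * l)) la be) => // t ht.
  - by apply: (drv_th Q); lra.
  - have t0 : 0 < th s p t by apply: (th_gt0 Q); lra.
    have t1 : 0 < t by lra.
    have D0 := hD ht; rewrite mulNr oppr_eq0; apply: lt0r_neq0.
    by apply: divr_gt0 => //; exact: mulr_gt0.
rewrite h2 in d2; apply: drv_eq; first exact: (drv_comp d1 d2).
have t0 : 0 < th r q l by apply: (th_gt0 P); lra.
have D0 := hD h1; have lp : 0 < l by lra.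
by field; rewrite !gt_eqF//; lra.
Qed.

(** At matched levels [th] agrees, so this gap is also the difference of the two values of [DD]. *)
Let e l := zz s (lam l) - zz r l.
Let K l := (g (lam l) - 1 - 2 / th r q l) * (th r q l ^+ 2 - (n - 2) * th r q l) / DD s p (lam l).

(** The gap satisfies a linear equation with source -zz (g(l) - g(lam l)). As l <= lam l, a
    nonincreasing elasticity makes the source nonpositive, so a negative gap stays negative as the
    level increases. *)
Lemma drv_gap l : l1 < l < l0 ->
  drv e l ((K l * e l - zz r l * (g l - g (lam l))) / l).
Proof.
have B0 := b0; have B1 := bl1; have B2 := l0al; have B3 := bla.
move=> hl; have [h1 h2 h3] := hlam hl.
have d1 := drv_lam hl; have d2 := drv_zz Q (l := lam l) ltac:(lra).
have d3 := drv_zz P (l := l) ltac:(lra).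
apply: drv_eq; first by apply: drvD; [exact: (drv_comp d1 d2)|apply: drvN; exact: d3].
have t0 : 0 < th r q l by apply: (th_gt0 P); lra.
have D0 := hD h1; have lp : 0 < l by lra.
have eA : DD s p (lam l) = th r q l ^+ 2 - (n - 2) * th r q l + zz s (lam l) by rewrite /DD h2.
have eB : DD r q l = th r q l ^+ 2 - (n - 2) * th r q l + zz r l by [].
rewrite h2 /K /e eB; have -> : zz s (lam l) = DD s p (lam l) - (th r q l ^+ 2 - (n - 2) * th r q l).
  by rewrite eA; ring.
by field; rewrite !gt_eqF//; lra.
Qed.

(** [K] need not be continuous, since continuity of [dh] is not assumed. Monotonicity bounds g(lam
    t) between g(be) and g(l), and [F] is a continuous majorant. *)
Lemma gap_coef_bounded l c : l1 < l -> l <= c -> c < l0 -> exists M, forall t, l <= t <= c -> `|K t / t| <= M.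
Proof.
move=> l1l lc cl0; have B0 := b0; have B1 := bl1; have B2 := l0al; have B3 := bla.
pose G := `|g l| + `|g be|.
pose F t := (G + 1 + 2 / th r q t) * `|th r q t ^+ 2 - (n - 2) * th r q t| / DD s p (lam t) / t.
have tp t : l <= t <= c -> 0 < th r q t by move=> ht; apply: (th_gt0 P); lra.
have Dp t : l <= t <= c -> 0 < DD s p (lam t) by move=> ht; have [] := @hlam t ltac:(lra) => h1 _ _; exact: hD.
have cF t : l <= t <= c -> {for t, continuous F}.
  move=> ht; have ct : {for t, continuous (th r q)} by apply: (th_cont P); lra.
  have cl : {for t, continuous lam} by apply: drv_cont (drv_lam _); lra.
  have cD : {for t, continuous (fun t => DD s p (lam t))}.
    by apply: (cont_comp cl); have [] := @hlam t ltac:(lra) => h1 _ _; apply: (DD_cont Q); lra.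
  have tt : t != 0 by apply: lt0r_neq0; lra.
  rewrite /F; apply: contM; last by apply: contV => //; exact: contI.
  apply: contM; last by apply: contV => //; apply: lt0r_neq0; exact: Dp.
  apply: contM.
    apply: contD; first exact: contC.
    by apply: contM; [exact: contC|apply: contV => //; apply: lt0r_neq0; exact: tp].
  apply: cont_norm; apply: contD; first exact: contX.
  by apply: contN; apply: contM => //; exact: contC.
have [M M0 hM] := @bounded_seg _ F l c lc cF.
exists M; move=> t ht; apply: le_trans (hM t ht); have t0 : 0 < t by lra.
have [T0 D0] := conj (tp t ht) (Dp t ht).
have [h1 _ h3] := @hlam t ltac:(lra).
rewrite /K /F !normrM !normfV (gtr0_norm D0) (gtr0_norm t0).
rewrite normr_id; apply: ler_wpM2r; first by rewrite invr_ge0 ltW.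
apply: ler_wpM2r; first by rewrite invr_ge0 ltW.
apply: ler_wpM2r; first exact: normr_ge0.
apply: (@le_trans _ _ (G + 1 + 2 / th r q t)); last exact: ler_norm.
have k2 : 0 < 2 / th r q t by rewrite divr_gt0.
have g1 : g (lam t) <= g l by apply: gmono; lra.
have g2 : g be <= g (lam t) by apply: gmono; lra.
have a1 := ler_norm (g l); have a2 := ler_norm (- g be); rewrite normrN in a2.
have a3 := normr_ge0 (g l); have a4 := normr_ge0 (g be).
by rewrite /G ler_norml; lra.
Qed.

(** A gap negative at [l] would have a first zero before [ls]; with a nonpositive source, Gronwall's
    inequality keeps it negative up to there. *)
Lemma gap_ge0 ls l : l1 < l -> l <= ls -> ls < l0 -> 0 <= e ls -> 0 <= e l.
Proof.
have B0 := b0; have B1 := bl1; have B2 := l0al; have B3 := bla.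
move=> l1l lls lsl0 els; rewrite leNgt; apply/negP => el.
have ce t : l <= t <= ls -> {for t, continuous e} by move=> ht; apply: drv_cont (drv_gap _); lra.
have [c hc [ec hec]] := first_zero lls ce el els.
have bl : b < l by lra.
have [M KM] := gap_coef_bounded l1l (ltW (proj1 (andP hc))) ltac:(lra).
have : e c * expR (M * c) <= e l * expR (M * l).
  apply: (@drv_gronwall _ e (fun t => (K t * e t - zz r t * (g t - g (lam t))) / t) M) => [|t ht|t ht].
  - by case/andP: hc => /ltW.
  - by apply: (@drv_gap t); lra.
  have ht' : l <= t <= c by lra.
  have et : e t < 0 by apply: hec; lra.
  have [h1 _ h3] := @hlam t ltac:(lra).
  have z0 : 0 <= zz r t * (g t - g (lam t)) / t.
    have z1 : 0 < zz r t by apply: (zz_gt0 P); lra.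
    apply: divr_ge0; last lra.
    by apply: mulr_ge0; [exact: ltW|rewrite subr_ge0; apply: gmono; lra].
  have := KM t ht'; rewrite ler_norml => /andP[k1 _].
  have -> : (K t * e t - zz r t * (g t - g (lam t))) / t + M * e t =
    (K t / t + M) * e t - zz r t * (g t - g (lam t)) / t by ring.
  have k2 : (K t / t + M) * e t <= 0 by rewrite mulr_ge0_le0 ?(ltW et)//; lra.
  by rewrite subr_le0 (le_trans k2).
rewrite ec mul0r pmulr_lge0 ?expR_gt0//; lra.
Qed.

(** The logarithmic derivative of [lam] in ln l is the quotient of the two values of [DD], and a
    nonnegative gap makes this quotient at most 1. *)
Lemma ratio_mono (x y : R) : l1 < x -> x <= y -> y < l0 -> (forall l, x < l < y -> 0 <= e l) ->
  lam y / y <= lam x / x.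
Proof.
have B0 := b0; have B1 := bl1; have B2 := l0al; have B3 := bla.
move=> l1x xy yl0 he.
have dr t : x <= t <= y -> drv (fun t => lam t / t) t ((DD r q t / DD s p (lam t) - 1) * lam t / t ^+ 2).
  move=> ht; have t0 : t != 0 by apply: lt0r_neq0; lra.
  apply: drv_eq; first by apply: drvM; [apply: (@drv_lam t); lra|apply: drvV; [exact: drvI|]].
  have [h1 _ _] := @hlam t ltac:(lra); have D0 := hD h1.
  by rewrite /=; field; rewrite t0 gt_eqF.
apply: (@drv_le0_ge _ (fun t => lam t / t) (fun t => (DD r q t / DD s p (lam t) - 1) * lam t / t ^+ 2) x y xy) => [t ht|t ht|t ht].
- exact: drv_cont (dr t ht).
- by apply: dr; lra.
- have [h1 h2 h3] := @hlam t ltac:(lra); have D0 := hD h1.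
  have t0 : 0 < t by lra.
  have := he t ht; rewrite /e /= => het.
  rewrite pmulr_lle0 ?invr_gt0 ?exprn_gt0// pmulr_lle0; last lra.
  rewrite subr_le0 ler_pdivrMr// mul1r /DD h2 lerD2l; lra.
Qed.

End Matching.

(* While [DD > 0], [th] increases as the level decreases.  At a first zero of [DD],
   [th] would be below [n - 2] and would stay below it by comparison with the
   earlier part of the same trajectory, contradicting [rq_ge] at level [b]. *)
Section Trap.
Variables (al : R) (r q : R -> R).
Hypothesis P : profile al r q.

(** r^(n-2) l^2 is an integrating factor: [DD] disappears from the derivative, and only the sign of
    2 - th (g - 1) matters. *)
Lemma drv_N l : b < l < al -> drv (fun l => r l ^+ d.+1 * l ^+ 2 * DD r q l) l
  (- (r l ^+ d.+2 * l * h l * (2 - th r q l * (g l - 1)) / q l)).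
Proof.
move=> hl; have hl' : 0 < l < al by apply: (above_dom); lra.
have l0 : 0 < l by case/andP: hl'.
have h0 : 0 < h l by apply: hpos; lra.
have r0 := prof_r P hl'; have q0 := prof_q P hl'.
have h1 := prof_dr P hl'; have h2 := drv_DD P hl.
apply: drv_eq; first by apply: drvM; [apply: drvM; [apply: drvX; exact: h1|apply: drvX; exact: drvI]|exact: h2].
rewrite /DD /zz /th /g /n /= -(natr1 d) !(exprS _ d.+1, exprS _ d).
by field; rewrite !gt_eqF.
Qed.

Section Turn.
Variable m : R.
Hypothesis hm : b < m < al.
Hypothesis Dm : DD r q m = 0.
Hypothesis hD : forall l, m < l < al -> 0 < DD r q l.

(** Above [m] both [th] and [g] are no larger than at [m]. If th (g - 1) <= 2 held at [m], it would
    hold above, so r^(n-2) l^2 DD would be nonincreasing from its value 0 at [m], against DD > 0. *)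
Lemma turn_gt2 : 2 < th r q m * (g m - 1).
Proof.
have B0 := b0; have B1 := hm.
rewrite ltNge; apply/negP => le2.
pose N l := r l ^+ d.+1 * l ^+ 2 * DD r q l.
pose t := (m + al) / 2.
have ht : m < t < al by rewrite /t; lra.
have : N t <= N m.
  apply: (@drv_le0_ge _ N (fun l => - (r l ^+ d.+2 * l * h l * (2 - th r q l * (g l - 1)) / q l))); first lra.
  - by move=> l hl; apply: drv_cont (drv_N _); lra.
  - by move=> l hl; apply: drv_N; lra.
  - move=> l hl; have hl' : 0 < l < al by lra.
    have h0 : 0 < h l by apply: hpos; lra.
    have r0 := prof_r P hl'; have q0 := prof_q P hl'.
    have t0 : 0 < th r q l by apply: (th_gt0 P); lra.
    have t1 : th r q l < th r q m by apply: (th_decr P (la := m)) => //; lra.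
    have g1 : g l <= g m by apply: gmono; lra.
    rewrite oppr_le0; apply: divr_ge0; last exact: ltW.
    apply: mulr_ge0; first by apply: mulr_ge0; [apply: mulr_ge0; [apply: exprn_ge0|]|]; apply: ltW => //; lra.
    rewrite subr_ge0; have [g2|g2] := leP (g l - 1) 0.
      by apply: (@le_trans _ _ 0) => //; rewrite pmulr_rle0.
    by apply: le_trans le2; apply: ler_pM; lra.
rewrite /N Dm mulr0 leNgt => /negP; apply.
have tl : 0 < t < al by lra.
by rewrite mulr_gt0 ?hD// mulr_gt0 ?exprn_gt0 ?(prof_r P)//; lra.
Qed.

(** Where [DD] vanishes its derivative is zz (g - 1 - 2/th)/l. This is positive, since [th] has the
    value it has at [m] and [g] is at least g(m), by [turn_gt2]. *)
Lemma turn_dD l : b < l <= m -> th r q l = th r q m -> DD r q l = 0 ->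
  exists2 e, 0 < e & forall y, l - e < y < l -> DD r q y < 0.
Proof.
have B0 := b0; have B1 := hm.
move=> hl et eD; have hl' : b < l < al by lra.
have := drv_DD P hl'; rewrite eD oppr0 mul0r mulr0 add0r => hd.
have z0 := zz_gt0 P hl'.
have t0 : 0 < th r q m by apply: (th_gt0 P); lra.
have g1 : g m <= g l by apply: gmono; lra.
have t2 := turn_gt2.
have [|e e0 [_ he]] := drv_sign_pos hd.
  apply: divr_gt0; last lra.
  apply: mulr_gt0 => //; rewrite et.
  have : 2 / th r q m < g m - 1 by rewrite ltr_pdivrMr// mulrC.
  rewrite -/(g l); lra.
by exists e => // y /he; rewrite eD.
Qed.

Lemma turn_th_below l (e : R) : b < l <= m -> th r q l = th r q m ->
  (forall y, l - e < y < l -> DD r q y < 0) ->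
  forall y, l - e < y < l -> b < y -> th r q y < th r q m.
Proof.
have B0 := b0; have B1 := hm.
move=> hl et he y hy byy; rewrite -et.
apply: (@drv_gt0_lt _ (th r q) (fun l => - DD r q l / (th r q l * l))); first lra.
- by move=> x hx; apply: (th_cont P); lra.
- by move=> x hx; apply: (drv_th P); lra.
- move=> x hx; have t0 : 0 < th r q x by apply: (th_gt0 P); lra.
  have D0 := he x ltac:(lra).
  by apply: divr_gt0; [rewrite oppr_gt0|apply: mulr_gt0 => //; lra].
Qed.

(* As [l] decreases to [S], the matched level [inv (th l)] tends to [m], where [DD] vanishes. *)
Lemma turn_limit (S ls : R) (inv : R -> R) : b < S -> S < m -> S < ls <= m ->
  th r q S = th r q m -> 0 < DD r q S ->
  (forall l, S < l <= ls -> [/\ m < inv (th r q l) < al, th r q (inv (th r q l)) = th r q l &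
     DD r q l <= DD r q (inv (th r q l))]) -> False.
Proof.
have B0 := b0; have B1 := hm.
move=> bS Sm Sls tS DS hlam.
have cm : {for m, continuous (fun l => DD r q l - DD r q S)}.
  by apply: contD; [apply: (DD_cont P); lra|exact: contC].
have [|e1 e10 he1] := continuous_lt0 cm; first by rewrite Dm; lra.
have [mu [mu2 mu1]] := near_right (proj2 (andP hm)) e10.
have thmu : th r q mu < th r q m by apply: (th_decr P (la := m)) => //; lra.
(* [D1] separates DD(S) > 0 from the values of [DD] just above [m], where [DD] is close to 0. For
   [l] near [S] the matched level falls into (m, mu], where DD <= D1, although DD(l) > D1. *)
have [D1 D1p hD1] : exists2 D1, DD r q S > D1 & forall y, m < y <= mu -> DD r q y <= D1.
  have cD t : m <= t <= mu -> {for t, continuous (DD r q)} by move=> ht; apply: (DD_cont P); lra.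
  have cD' : {within `[m, mu], continuous (DD r q)}.
    by apply: continuous_in_subspaceT => t /set_mem /=; rewrite in_itv /= => /cD.
  have [|c + hc] := EVT_max _ cD'; [lra|rewrite in_itv /= => cm'].
  exists (DD r q c); last by move=> y hy; apply: hc; rewrite in_itv /=; lra.
  by have := he1 c; rewrite ltr_norml subr_lt0; apply; lra.
clear cm e1 e10 he1 mu1.
have cS1 : {for S, continuous (fun l => th r q l - th r q mu)}.
  by apply: contD; [apply: (th_cont P); lra|exact: contC].
have [|e2 e20 he2] := continuous_gt0 cS1; first by rewrite tS subr_gt0.
have cS2 : {for S, continuous (fun l => DD r q l - D1)}.
  by apply: contD; [apply: (DD_cont P); lra|exact: contC].
have [|e3 e30 he3] := continuous_gt0 cS2; first by rewrite subr_gt0.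
clear cS1 cS2.
have [l [x1 [x2 x3]]] : exists l, S < l <= ls /\ l < S + e2 /\ l < S + e3.
  exists (Num.min ls (S + Num.min (e2 / 2) (e3 / 2))).
  rewrite lt_min !gt_min ge_min lexx !ltrD2l !gt_min ltrDl lt_min.
  have -> : e2 / 2 < e2 by lra.
  have -> : e3 / 2 < e3 by lra.
  by rewrite !orbT !divr_gt0//; case/andP: Sls => ->.
have [k1 k2 k3] := hlam l x1.
have a1 : th r q mu < th r q l by rewrite -subr_gt0; apply: he2; rewrite ltr_norml; lra.
have a2 : D1 < DD r q l by rewrite -subr_gt0; apply: he3; rewrite ltr_norml; lra.
clear he2 he3 e2 e20 x2 e3 e30 x3 hlam.
have : inv (th r q l) <= mu.
  rewrite leNgt; apply/negP => h2.
  have := th_decr P (la := m) (x := mu) (y := inv (th r q l)) ltac:(lra) hD ltac:(lra) h2 ltac:(lra).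
  by rewrite k2 ltNge ltW.
case/andP: k1 => k1 _ a4; have := hD1 (inv (th r q l)); rewrite k1 a4 => /(_ isT).
by rewrite leNgt (lt_le_trans a2 k3).
Qed.

(** The arc between the two levels [S] and [l0] is matched with the arc above [m] of the same
    trajectory. Just below [l0], [DD] is negative, so the gap is nonnegative there; by [gap_ge0] it
    is nonnegative down to [S], which is what [turn_limit] excludes. *)
Lemma turn_return (S l0 : R) : b < S -> S < l0 <= m -> th r q S = th r q m ->
  th r q l0 = th r q m -> (forall t, S < t < l0 -> th r q t < th r q m) -> 0 < DD r q S -> False.
Proof.
have B0 := b0; have B1 := hm.
move=> bS hl0 tS tl0 flt DS.
have tl00 : 0 < th r q l0 by apply: (th_gt0 P); lra.
have Dl0 : DD r q l0 <= 0.
  rewrite leNgt; apply/negP => D0.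
  have dl := drv_th P (l := l0) ltac:(lra).
  have dl0 : - DD r q l0 / (th r q l0 * l0) < 0.
    by rewrite mulNr oppr_lt0; apply: divr_gt0 => //; apply: mulr_gt0 => //; lra.
  have [e' e'0 [_ he']] := drv_sign_neg dl dl0; clear dl dl0.
  pose y := Num.max (l0 - e' / 2) ((S + l0) / 2).
  have y1 : l0 - e' / 2 <= y by rewrite le_max lexx.
  have y2 : (S + l0) / 2 <= y by rewrite le_max lexx orbT.
  have y3 : y < l0 by rewrite gt_max; lra.
  have := he' y ltac:(lra); have := flt y ltac:(lra); rewrite tl0.
  by move=> h1 h2; have := lt_trans h1 h2; rewrite ltxx.
have [e' e'0 he'] : exists2 e, 0 < e & forall y, l0 - e < y < l0 -> DD r q y < 0.
  have [k|k|k] := ltgtP (DD r q l0) 0; last by apply: turn_dD => //; lra.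
    have [e' e'0 he'] := continuous_lt0 (DD_cont P (l := l0) ltac:(lra)) k.
    by exists e' => // y hy; apply: he'; rewrite ltr_norml; lra.
  by have := le_lt_trans Dl0 k; rewrite ltxx.
have [|ls [/andP[s2 s4] s1']] := @near_left _ S l0 e' _ e'0; first lra.
have s1 : l0 - e' < ls < l0 by rewrite s1'.
clear s1'.
have Dls : DD r q ls < 0 by exact: he'.
have s3 : ls < l0 by case/andP: s1.
clear Dl0 tl00 he' s1 e'0 e'.
have [inv [inv1 inv2]] := th_inv P (la := m) ltac:(lra) hD.
have hlam l : S < l < l0 -> [/\ m < inv (th r q l) < al, th r q (inv (th r q l)) = th r q l & l <= inv (th r q l)].
  move=> hl; have [|h2 h3] := inv2 (th r q l).
    by apply/andP; split; [apply: (th_gt0 P); lra|exact: flt].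
  by split => //; lra.
clear inv2.
have gap l : S < l -> l <= ls -> 0 <= zz r (inv (th r q l)) - zz r l.
  move=> h2 h3; apply: (gap_ge0 P P (la := m) (l1 := S) (l0 := l0) (inv := inv) _ hD inv1 _ _ hlam h2 h3 s3); [lra|lra|lra|].
  have [h4 h5 _] := hlam ls ltac:(lra).
  have h6 := hD h4.
  have : 0 <= DD r q (inv (th r q ls)) - DD r q ls by rewrite subr_ge0; apply/ltW/(lt_trans Dls).
  by rewrite /DD h5; lra.
apply: (turn_limit (S := S) (ls := ls) (inv := inv)) => //; [lra|lra|].
move=> l hl; have [h4 h5 _] := hlam l ltac:(lra); split => //.
by rewrite /DD h5 lerD2l -subr_ge0; apply: gap; case/andP: hl.
Qed.

(** Let [S] be the supremum of the levels below [m] where [th] exceeds its value at [m]. If DD(S) >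
    0, then [th] is below that value just above [S] and returns to it at some level up to [m],
    against [turn_return]. *)
Lemma turn_trap l : b <= l <= m -> th r q l <= th r q m.
Proof.
have B0 := b0; have B1 := hm.
move: l => l1 hl1; rewrite leNgt; apply/negP => h1.
have l1m : l1 < m by rewrite lt_neqAle; apply/andP; split; [apply/eqP => e; move: h1; rewrite e ltxx|lra].
pose f l := th r q l - th r q m.
have cf t : b <= t <= m -> {for t, continuous f}.
  by move=> ht; apply: contD; [apply: (th_cont P); lra|exact: contC].
have [||||S hS [fS hS1 hS2]] := @last_positive _ f l1 m; first lra.
- by move=> t ht; apply: cf; lra.
- by rewrite /f subr_gt0.
- by rewrite /f subrr.
have tS : th r q S = th r q m by move: fS; rewrite /f => /subr0_eq.
have hS' : b < S < al by lra.
have tS0 : 0 < th r q S by apply: (th_gt0 P); lra.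
clear h1 l1m fS hS1.
(* Levels with larger [th] accumulate at [S] from below, whereas DD < 0 to the left of [S] would
   make [th] smaller there. This excludes DD(S) <= 0. *)
have nbelow (e : R) : 0 < e -> (forall y, S - e < y < S -> DD r q y < 0) -> False.
  move=> e0 he; have [x hx [lx fx]] := hS2 (Num.min e (S - b)) ltac:(by rewrite lt_min; lra).
  have e1 : Num.min e (S - b) <= e by rewrite ge_min lexx.
  have e2 : Num.min e (S - b) <= S - b by rewrite ge_min lexx orbT.
  have := turn_th_below (l := S) ltac:(lra) tS he (y := x) ltac:(lra) ltac:(lra).
  by move: fx; rewrite /f; lra.
have DS : 0 < DD r q S.
  have [k|k|k] := ltgtP 0 (DD r q S); first by [].
    have [e e0 he] := continuous_lt0 (DD_cont P (l := S) ltac:(lra)) k.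
    by case: (nbelow e e0) => y hy; apply: he; rewrite ltr_norml; lra.
  have [e e0 he] := turn_dD (l := S) ltac:(lra) tS (esym k).
  by case: (nbelow e e0).
clear nbelow hS2.
have Sm : S < m by rewrite lt_neqAle; apply/andP; split; [apply/eqP => e; move: DS; rewrite e Dm ltxx|lra].
have dS := drv_th P (l := S) ltac:(lra).
have dS0 : - DD r q S / (th r q S * S) < 0.
  by rewrite mulNr oppr_lt0; apply: divr_gt0 => //; apply: mulr_gt0 => //; lra.
have [e e0 [he _]] := drv_sign_neg dS dS0; clear dS dS0.
have [|l2 [/andP[l21 l24] l22']] := @near_right _ S m e _ e0; first lra.
have l22 : S < l2 < S + e by rewrite l21.
clear l22'.
have fl2 : f l2 < 0 by rewrite /f -tS subr_lt0; apply: he.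
have [||||l0 hl0 [fl0 hl0']] := @first_zero _ f l2 m; first exact: ltW.
- by move=> t ht; apply: cf; lra.
- by [].
- by rewrite /f subrr.
apply: (turn_return (S := S) (l0 := l0)) => //; [lra|lra|by move: fl0; rewrite /f => /subr0_eq|].
move=> t ht; rewrite -subr_lt0 -/(f t).
have [t2|t2] := ltP t l2; last by apply: hl0'; lra.
by rewrite /f -tS subr_lt0; apply: he; lra.
Qed.

End Turn.

Lemma DD_gt0 l : b < l < al -> 0 < DD r q l.
Proof.
have B0 := b0.
move: l => l1 hl1; rewrite ltNge; apply/negP => D1.
have [dl dl0 hdl] := th_top P ltr01.
pose lt := Num.max ((l1 + al) / 2) (al - dl / 2).
have t1 : (l1 + al) / 2 <= lt by rewrite le_max lexx.
have t2 : al - dl / 2 <= lt by rewrite le_max lexx orbT.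
have t3 : lt < al by rewrite gt_max; lra.
have [||||m hm [fm hm']] := @last_zero _ (fun l => - DD r q l) l1 lt; first lra.
- by move=> t ht; apply: contN; apply: (DD_cont P); lra.
- by rewrite oppr_ge0.
- by rewrite oppr_lt0; have [] := hdl lt ltac:(lra) ltac:(lra).
have Dm : DD r q m = 0 by move: fm => /eqP; rewrite oppr_eq0 => /eqP.
have hD l : m < l < al -> 0 < DD r q l.
  move=> hl; have [ll|ll] := leP l lt; first by rewrite -oppr_lt0; apply: hm'; lra.
  by have [] := hdl l ltac:(lra) ltac:(lra).
have hm2 : b < m < al by lra.
have tb : th r q b <= th r q m by apply: (turn_trap hm2 Dm hD); lra.
have z0 := zz_gt0 P hm2.
have t0 : 0 < th r q m by apply: (th_gt0 P); lra.
have : n - 2 <= th r q b.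
  by rewrite /th ler_pdivlMr//; exact: (rq_ge b0 hneg hb P).
have : th r q m * (th r q m - (n - 2)) < 0.
  have E : DD r q m = th r q m ^+ 2 - (n - 2) * th r q m + zz r m by [].
  by move: Dm; rewrite E expr2; lra.
rewrite pmulr_rlt0//; lra.
Qed.

End Trap.

(** * Two solutions with ordered starting values *)

Section Order.
Variables (al be : R) (r q s p : R -> R).
Hypotheses (P : profile al r q) (Q : profile be s p) (albe : al < be).

Section Gap.
Variables (c : R) (inv : R -> R).
Hypothesis bc : b <= c < al.
Hypothesis inv1 : forall t, b < t < be -> inv (th s p t) = t.
Hypothesis hlam : forall l, c < l < al ->
  [/\ b < inv (th r q l) < be, th s p (inv (th r q l)) = th r q l & l <= inv (th r q l)].
Let e l := zz s (inv (th r q l)) - zz r l.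
Let K l := (g (inv (th r q l)) - 1 - 2 / th r q l) * (th r q l ^+ 2 - (n - 2) * th r q l) / DD s p (inv (th r q l)).

(** Near the top [th] is so small that both g - 1 - 2/th and th^2 - (n-2) th are negative, hence K >
    0. The threshold 2/(|g(l)| + 2) serves the first factor, the threshold 1 the second, as n - 2 >=
    1. *)
Lemma gap_drv_lt0 l t : c < l -> l < t < al -> th r q t < 1 -> th r q t < 2 / (`|g l| + 2) ->
  e t < 0 -> (K t * e t - zz r t * (g t - g (inv (th r q t)))) / t < 0.
Proof.
have B0 := b0; have B1 := bc.
move=> cl lt T1 T2 et; have [i1 i2 i3] := hlam (l := t) ltac:(lra).
have tp : 0 < th r q t by apply: (th_gt0 P); lra.
have D0 := DD_gt0 Q i1.
have gle : g (inv (th r q t)) <= g l by apply: gmono; lra.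
have z0 : 0 < zz r t by apply: (zz_gt0 P); lra.
have gg : 0 <= g t - g (inv (th r q t)) by rewrite subr_ge0; apply: gmono; lra.
have t0 : 0 < t by lra.
clear i1 i2 i3 lt cl.
have G0 : 0 < `|g l| + 2 by have := normr_ge0 (g l); lra.
have g2 : g (inv (th r q t)) - 1 - 2 / th r q t < 0.
  have : `|g l| + 2 < 2 / th r q t by rewrite ltr_pdivlMr// mulrC -ltr_pdivlMr.
  by have := ler_norm (g l); lra.
have P0 : th r q t ^+ 2 - (n - 2) * th r q t < 0.
  have -> : th r q t ^+ 2 - (n - 2) * th r q t = th r q t * (th r q t - (n - 2)) by ring.
  by rewrite pmulr_rlt0//; have := @n3 R d; rewrite -/n; lra.
have K0 : 0 < K t by rewrite /K; apply: divr_gt0 => //; rewrite nmulr_rgt0.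
rewrite pmulr_llt0 ?invr_gt0// subr_lt0; apply: (@lt_le_trans _ _ 0); first by rewrite pmulr_rlt0.
by apply: mulr_ge0 => //; exact: ltW.
Qed.

(* If the gap were negative up to the top of [(r, q)] it would be decreasing there,
   although it tends to a nonnegative limit. *)
Lemma gap_ge0_top l : c < l < al -> 0 <= e l.
Proof.
have B0 := b0; have B1 := bc; have B2 := albe.
move=> hl; rewrite leNgt; apply/negP => el.
have hD t : b < t < be -> 0 < DD s p t by exact: (DD_gt0 Q).
have egt t : l < t < al -> e t < 0.
  move=> ht; rewrite ltNge; apply/negP => et; move: el; apply/negP; rewrite -leNgt.
  apply: (gap_ge0 P Q (la := b) (l1 := c) (l0 := al) (inv := inv) _ hD inv1 _ _ hlam (ls := t)) => //; lra.
have G0 : 0 < `|g l| + 2 by have := normr_ge0 (g l); lra.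
have t00 : 0 < Num.min 1 (2 / (`|g l| + 2)) by rewrite lt_min ltr01 divr_gt0.
have [d1 d10 hd1] := th_top P t00.
clear el t00 G0.
have [|x [x1 x2]] := @near_left _ l al d1 _ d10; first lra.
have ex : 0 < - e x by rewrite oppr_gt0; apply: egt; lra.
have [d2 d20 hd2] := th_top P ex.
have [y [y1 y2]] := near_left (proj2 (andP x1)) d20.
have [_ zy _] := hd2 y ltac:(lra) ltac:(lra).
clear hd2 d20 d2 y2 d10.
have [iy _ _] := hlam (l := y) ltac:(lra).
have zsy := zz_gt0 Q iy.
have ey : e x < e y by rewrite {2}/e -[e x]opprK; apply: (lt_trans (y := - zz r y)); [rewrite ltrN2|rewrite ltrDr].
clear zsy zy iy ex.
have dE t : x <= t <= y -> drv e t ((K t * e t - zz r t * (g t - g (inv (th r q t)))) / t).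
  by move=> ht; apply: (drv_gap P Q (la := b) (l1 := c) (l0 := al) (inv := inv) _ hD inv1 _ _ hlam) => //; lra.
have : e y <= e x.
  apply: (@drv_le0_ge _ e (fun t => (K t * e t - zz r t * (g t - g (inv (th r q t)))) / t)); first lra.
  - by move=> t ht; exact: drv_cont (dE t ht).
  - by move=> t ht; apply: dE; lra.
  - move=> t ht; have [T1 _ _] := hd1 t ltac:(lra) ltac:(lra).
    move: T1; rewrite lt_min => /andP[T1 T2].
    by apply/ltW/(gap_drv_lt0 (l := l)) => //; [lra|lra|apply: egt; lra].
by rewrite leNgt ey.
Qed.

End Gap.

(** At [c] the two values of [th] agree, and since [th s p] is strictly decreasing its value at k c
    is strictly smaller. Continuity contradicts the assumed inequality just above [c]. *)
Lemma scaled_cross_absurd c lt k : b <= c < al -> c < lt < al -> th r q c = th s p c -> 1 < k -> k * lt < be ->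
  (forall l, c < l <= lt -> th r q l <= th s p (k * l)) -> False.
Proof.
move=> bc /andP[clt ltal] fc k1 klt thk.
have B0 := b0; have B1 := albe; have kpos : 0 < k by apply: lt_trans k1.
have hD l : b < l < be -> 0 < DD s p l by exact: (DD_gt0 Q).
have kc : c < k * c.
  by rewrite -[ltLHS]mul1r ltr_pM2r//; lra.
have kcl : k * c < k * lt by rewrite ltr_pM2l.
have kcbe : k * c < be by exact: lt_trans klt.
have cc : {for c, continuous (fun l => th s p (k * l) - th r q l)}.
  apply: contD; last by apply: contN; apply: (th_cont P); lra.
  have ck : {for c, continuous (fun l : R => k * l)} by apply: contM; [exact: contC|exact: contI].
  by apply: (cont_comp ck); apply: (th_cont Q); lra.
have [|e0 e00 he0] := continuous_lt0 cc.
  have := th_decr Q (la := b) (x := c) (y := k * c) ltac:(lra) hD ltac:(lra) kc kcbe.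
  by rewrite fc subr_lt0.
have [l [z1 z2]] := near_right clt e00; have z1' : c < l <= lt by case/andP: z1 => -> /ltW.
have := thk l z1'; apply/negP; rewrite -ltNge -subr_lt0.
by apply: he0; rewrite ltr_norml; lra.
Qed.

(** Above the last level [c] where the order fails, the matched level lies above [l] and the gap is
    nonnegative up to the top. Then lam(l)/l is nonincreasing, so lam(l) >= k l with a fixed k > 1
    down to [c], where the two solutions would however be matched at the same level. *)
Lemma th_lt l : b <= l < al -> th r q l < th s p l.
Proof.
have B0 := b0; have B1 := albe; have B2 := prof_al P.
move: l => l1 hl1; rewrite ltNge; apply/negP => th1.
have hD l : b < l < be -> 0 < DD s p l by exact: (DD_gt0 Q).
have thal : 0 < th s p al by apply: (th_gt0 Q); lra.
have [dl dl0 hdl] := th_top P thal.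
pose phi l := th r q l - th s p l.
have cphi t : b <= t < al -> {for t, continuous phi}.
  by move=> ht; apply: contD; [|apply: contN]; [apply: (th_cont P)|apply: (th_cont Q)]; lra.
have ntop l : al - dl < l < al -> b < l -> phi l < 0.
  move=> hl bl; have [h1 _ _] := hdl l hl bl.
  have h2 := th_decr Q (la := b) (x := l) (y := al) ltac:(lra) hD ltac:(lra) ltac:(lra) ltac:(lra).
  by rewrite /phi subr_lt0; exact: lt_trans h1 h2.
clear thal hdl.
have [lt [t1 t2]] := near_left (proj2 (andP hl1)) dl0.
have [||||c hc [fc hc']] := @last_zero _ phi l1 lt; first lra.
- by move=> t ht; apply: cphi; lra.
- by rewrite /phi subr_ge0.
- by apply: ntop; lra.
have bc : b <= c < al by lra.
have clt : c < lt by lra.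
have neg l : c < l < al -> th r q l < th s p l.
  by move=> hl; rewrite -subr_lt0; have [ll|ll] := leP l lt; [apply: hc'|apply: ntop]; lra.
move: fc; rewrite /phi => /subr0_eq fc.
clear cphi ntop hc' th1 hc t2 dl0 dl phi.
have [inv [inv1 inv2]] := th_inv Q (la := b) ltac:(lra) hD.
have hlam l : c < l < al -> [/\ b < inv (th r q l) < be, th s p (inv (th r q l)) = th r q l & l <= inv (th r q l)].
  move=> hl; have nl := neg l hl.
  have tb : th s p l < th s p b by apply: (th_decr Q (la := b)) => //; lra.
  have tp : 0 < th r q l by apply: (th_gt0 P); lra.
  have [|h2 h3] := inv2 (th r q l); first by rewrite tp (lt_trans nl).
  split => //; rewrite leNgt; apply/negP => h4.
  have := th_decr Q (la := b) (x := inv (th r q l)) (y := l) ltac:(lra) hD ltac:(lra) h4 ltac:(lra).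
  by rewrite h3 => h5; have := lt_trans nl h5; rewrite ltxx.
clear inv2.
have [it i2 i3] := hlam lt ltac:(lra).
have lt0 : 0 < lt by lra.
(* The ratio of matched levels at [lt]; by monotonicity it bounds the ratio from below on the way
   down to [c]. *)
pose k := inv (th r q lt) / lt.
have k1 : 1 < k.
  rewrite /k ltr_pdivlMr// mul1r lt_neqAle i3 andbT; apply/eqP => E; have := neg lt ltac:(lra).
  by rewrite -i2 -E ltxx.
have klt : k * lt < be by rewrite /k mulfVK ?gt_eqF//; case/andP: it.
clear i2 i3 neg.
have hk l : c < l <= lt -> k * l <= inv (th r q l).
  move=> hl; rewrite -ler_pdivlMr; last lra.
  apply: (ratio_mono P Q (la := b) (l1 := c) (l0 := al) (inv := inv) _ hD inv1 _ _ hlam) => //; try lra.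
  by move=> t ht; apply: (gap_ge0_top bc inv1 hlam); lra.
have kpos : 0 < k by apply: lt_trans k1.
clearbody k; clear it.
apply: (scaled_cross_absurd (c := c) (lt := lt) (k := k)) => //; first by rewrite clt; case/andP: t1.
move=> l hl; have [i1 i2 i3] := hlam l ltac:(lra); rewrite -i2.
have := hk l hl; rewrite le_eqVlt => /predU1P[->//|kl'].
have kl : c < k * l by apply: lt_trans (_ : l < _); [case/andP: hl|rewrite ltr_pMl//; lra].
by apply/ltW/(th_decr Q (la := b)) => //; lra.
Qed.

Lemma rq_lt l : b <= l < al -> r l * q l < s l * p l.
Proof.
move=> hl; have := th_lt hl; rewrite /th ltr_pM2r// invr_gt0.
by have := b0; lra.
Qed.

(* If [r < s] at level [b], the gap between the squared slopes would persist up to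
   the top of [(r, q)], where [q] vanishes. *)
Lemma slope_gap_absurd : (forall l, b <= l < al -> r l < s l) -> p b < q b -> False.
Proof.
have B0 := b0; have B1 := albe; have B2 := prof_al P.
move=> rsup pq.
have pos l : b <= l < al -> [/\ 0 < r l, 0 < s l, 0 < q l & 0 < p l].
  move=> hl; split; [apply: (prof_r P)|apply: (prof_r Q)|apply: (prof_q P)|apply: (prof_q Q)]; lra.
pose y l := p l ^+ 2 - q l ^+ 2.
have yE l : b <= l < al -> (y l < 0) = (p l < q l).
  by move=> /pos[_ _ Q1 P1]; rewrite /y subr_lt0 ltr_pXn2r// nnegrE; exact: ltW.
pose dy l := 2 * (n - 1) * (p l / s l - q l / r l).
have hy l : b <= l < al -> drv y l (dy l).
  by move=> hl; apply: (drv_qp Q P); lra.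
have n1 : 0 < n - 1 by have := n2; lra.
have dy0 l : b <= l < al -> y l < 0 -> dy l <= 0.
  move=> hl; rewrite yE// => qp; have [R1 S1 Q1 P1] := pos l hl.
  rewrite /dy pmulr_rle0; last by apply: mulr_gt0.
  rewrite subr_le0; apply: ler_pM; [exact: ltW|by rewrite invr_ge0 ltW|exact: ltW|].
  by rewrite lef_pV2 ?posrE//; apply/ltW/rsup.
have yb : y b < 0 by rewrite yE//; lra.
have yneg l : b <= l < al -> y l < 0.
  move=> hl; rewrite ltNge; apply/negP => y0.
  have [||||c hc [yc hyc]] := @first_zero _ y b l; first lra.
  - by move=> t ht; apply: drv_cont (hy t _); lra.
  - by [].
  - by [].
  have : y c <= y b.
    apply: (@drv_le0_ge _ y dy); first lra.
    - by move=> t ht; apply: drv_cont (hy t _); lra.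
    - by move=> t ht; apply: hy; lra.
    - by move=> t ht; apply: dy0; [lra|apply: hyc; lra].
  by rewrite yc leNgt yb.
have ymono l : b <= l < al -> y l <= y b.
  move=> hl; apply: (@drv_le0_ge _ y dy); first lra.
  - by move=> t ht; apply: drv_cont (hy t _); lra.
  - by move=> t ht; apply: hy; lra.
  - by move=> t ht; apply: dy0; [|apply: yneg]; lra.
clear yneg dy0 hy n1 dy yE rsup pq.
have hal : 0 < h al by apply: hpos.
have n0 : 0 < n by have := n2; lra.
pose C := h al / n + 1.
have C1 : 1 <= C by rewrite /C lerDr divr_ge0 ?ltW.
have y0 : 0 < - y b by rewrite oppr_gt0.
have e0 : 0 < Num.min 1 (- y b / C ^+ 2).
  by rewrite lt_min ltr01 divr_gt0 ?exprn_gt0//; lra.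
have [dl dl0 hdl] := prof_top P e0.
have [l [l1 l2]] := near_left B2 dl0.
have [] := hdl l ltac:(lra) ltac:(lra); rewrite lt_min => /andP[r1 r2].
rewrite ltr_norml -/n lt_min => /andP[_ /andP[qr _]].
have [R1 S1 Q1 P1] := pos l ltac:(lra).
clear hdl dl0 l2.
have qC : q l <= C * r l.
  by rewrite -ler_pdivrMr// /C -lerBlDl; exact: ltW.
have qy : q l ^+ 2 < - y b.
  apply: (@le_lt_trans _ _ (C ^+ 2 * r l ^+ 2)).
    rewrite -exprMn; apply: lerXn2r => //; rewrite nnegrE; first exact: ltW.
    by apply: mulr_ge0; [apply: le_trans C1|exact: ltW].
  rewrite mulrC -ltr_pdivlMr; last by apply: exprn_gt0; apply: lt_le_trans C1.
  apply: (le_lt_trans _ r2); rewrite expr2; apply: ler_piMr; exact: ltW.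
have := ymono l ltac:(lra); rewrite {1}/y leNgt => /negP; apply.
by rewrite -ltrN2 opprB ltrBlDr; apply: (lt_le_trans qy); rewrite lerDl sqr_ge0.
Qed.

(** The radii keep their order on (0, b]. If s < r there, [sp_le_rq] contradicts [rq_lt] at [b]. If
    r < s, [separation] with exchanged roles gives p < q at [b]; above [b], [rq_lt] makes r/s
    nonincreasing in the level, so r < s persists and [slope_gap_absurd] applies. *)
Lemma profile_unique : (forall l, 0 < l <= b -> r l = s l -> q l = p l -> False) -> False.
Proof.
have B0 := b0; have B1 := albe; have B2 := prof_al P; have B3 := prof_al Q.
move=> ne.
have pA l : 0 < l <= b -> 0 < l < al by move=> hl; lra.
have pB l : 0 < l <= b -> 0 < l < be by move=> hl; lra.
have nc l : 0 < l <= b -> r l != s l.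
  move=> hl; apply/eqP => E; apply: (ne l hl E).
  exact: (no_crossing hneg hb P Q hl E).
have cr l : 0 < l <= b -> {for l, continuous (fun l => r l - s l)}.
  by move=> hl; apply: contD; [exact: drv_cont (prof_dr P (pA l hl))|apply: contN; exact: drv_cont (prof_dr Q (pB l hl))].
have rqb := rq_lt (l := b) ltac:(lra).
have [rs|sr|E] := ltgtP (r b) (s b); last by have := nc b ltac:(lra); rewrite E eqxx.
  have rs' l : 0 < l <= b -> r l < s l.
    move=> hl; rewrite ltNge; apply/negP => h1.
    have [|||t ht e] := @ivt _ (fun l => r l - s l) l b 0; first lra.
    - by move=> t ht; apply: cr; lra.
    - by right; rewrite subr_le0 subr_ge0 h1 ltW.
    by have := nc t ltac:(lra); rewrite -subr_eq0 e eqxx.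
  have pq := separation Q P rs' (l := b) ltac:(lra).
  apply: slope_gap_absurd pq => l hl.
  have pos t : b <= t < al -> [/\ 0 < r t, 0 < s t, 0 < q t & 0 < p t].
    move=> ht; split; [apply: (prof_r P)|apply: (prof_r Q)|apply: (prof_q P)|apply: (prof_q Q)]; lra.
  have [R0 S0 Q0 P0] := pos l hl.
  suff : r l / s l <= r b / s b.
    have [_ S1 _ _] := pos b ltac:(lra).
    move=> h1; rewrite -[ltRHS]mul1r -ltr_pdivrMr//; apply: le_lt_trans h1 _.
    by rewrite ltr_pdivrMr// mul1r.
  clear R0 S0 Q0 P0 rs' ne nc cr.
  pose dR l := (r l * q l - s l * p l) / (q l * p l * s l ^+ 2).
  have hR t : b <= t <= l -> drv (fun l => r l / s l) t (dR t).
    move=> ht; have [R1 S1 Q1 P1] := pos t ltac:(lra).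
    have h1 := prof_dr P (l := t) ltac:(lra); have h2 := prof_dr Q (l := t) ltac:(lra).
    by drv; [exact: lt0r_neq0|rewrite /dR; field; rewrite !gt_eqF].
  apply: (@drv_le0_ge _ (fun l => r l / s l) dR); first lra.
  - by move=> t ht; exact: drv_cont (hR t ht).
  - by move=> t ht; apply: hR; lra.
  - move=> t ht; have [R1 S1 Q1 P1] := pos t ltac:(lra).
    rewrite /dR pmulr_lle0; last by rewrite invr_gt0 !mulr_gt0 ?exprn_gt0.
    by rewrite subr_le0 ltW// rq_lt//; lra.
have sr' l : 0 < l <= b -> s l < r l.
  move=> hl; rewrite ltNge; apply/negP => h1.
  have [|||t ht e] := @ivt _ (fun l => r l - s l) l b 0; first lra.
  - by move=> t ht; apply: cr; lra.
  - by left; rewrite subr_le0 subr_ge0 h1 ltW.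
  by have := nc t ltac:(lra); rewrite -subr_eq0 e eqxx.
by have := sp_le_rq b0 hneg hb P Q sr'; rewrite leNgt rqb.
Qed.

End Order.

End Theta.

(** * Ground states *)

Section GroundState.
Context {R : realType}.
Variables (d : nat) (h : R -> R) (b mu eps : R).
Let n : R := d.+3%:R.
Hypothesis b0 : 0 < b.
Hypothesis h0 : forall v : R, v <= 0 -> h v = 0.
Hypothesis hlip : forall A : R, exists2 L : R, 0 < L & forall x y : R, x <= A -> y <= A ->
  `|h x - h y| <= L * `|x - y|.
Hypothesis hneg : forall l : R, 0 < l < b -> h l < 0.
Hypothesis hpos : forall l : R, b < l -> 0 < h l.
Hypothesis mu0 : 0 < mu.
Hypothesis eps0 : 0 < eps.
Hypothesis hmu : forall l : R, 0 <= l <= eps -> h l <= - mu * l.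

Lemma h_cont : continuous h.
Proof.
move=> x; have [L L0 hL] := hlip (x + 1).
apply/continuousP => e e0; exists (Num.min 1 (e / L)); first by rewrite lt_min ltr01 divr_gt0.
move=> y; rewrite lt_min => /andP[y1 y2].
apply: (le_lt_trans (hL _ _ _ _)); last by rewrite mulrC -ltr_pdivlMr.
  by move: y1; rewrite ltr_norml; lra.
by rewrite lerDl.
Qed.

Lemma h_b : h b = 0.
Proof.
have B0 := b0; have [k|k|//] := ltgtP (h b) 0.
  have [e e0 he] := continuous_lt0 (h_cont (x := b)) k.
  have := he (b + e / 2); have := @hpos (b + e / 2); rewrite ltr_norml.
  by move=> /(_ ltac:(lra)) h1 /(_ ltac:(lra)); lra.
have [e e0 he] := continuous_gt0 (h_cont (x := b)) k.
pose x := Num.max (b - e / 2) (b / 2).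
have x1 : b - e / 2 <= x by rewrite le_max lexx.
have x2 : b / 2 <= x by rewrite le_max lexx orbT.
have x3 : x < b by rewrite gt_max; lra.
have := he x; have := @hneg x; rewrite ltr_norml.
by move=> /(_ ltac:(lra)) h1 /(_ ltac:(lra)); lra.
Qed.

Definition potential := prim h.
Local Notation H := potential.

Lemma drv_H x : drv H x (h x).
Proof. by apply: drv_prim; exact: h_cont. Qed.

Lemma H_le0 x : x <= 0 -> H x = 0.
Proof.
rewrite le_eqVlt => /predU1P[->|x0]; first exact: prim0.
have [t _|t _|c hc e] := mvt x0 (f := H) (df := h); [exact: drv_cont (drv_H t)|exact: drv_H|].
by move: e; rewrite h0 ?mul0r; [rewrite /H prim0; lra|lra].
Qed.

Lemma H_lt0 x : 0 < x <= b -> H x < 0.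
Proof.
move=> hx; have <- : H 0 = 0 by exact: prim0.
apply: (@drv_lt0_gt _ H h); first by case/andP: hx.
- by move=> t _; exact: drv_cont (drv_H t).
- by move=> t _; exact: drv_H.
- by move=> t ht; apply: hneg; lra.
Qed.

Lemma H_incr x y : b <= x -> x < y -> H x < H y.
Proof.
move=> bx xy; apply: (@drv_gt0_lt _ H h) => // t ht.
- exact: drv_cont (drv_H t).
- exact: drv_H.
- by apply: hpos; lra.
Qed.

Lemma H_mu x : 0 <= x <= eps -> H x <= - mu * x ^+ 2 / 2.
Proof.
move=> hx; have dF t : drv (fun x => H x + mu * x ^+ 2 / 2) t (h t + mu * t).
  have h1 := drv_H t; apply: drv_eq; first by apply: drvD; [exact: h1|apply: drvM; [apply: drvM; [exact: drvC|apply: drvX; exact: drvI]|exact: drvC]].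
  by rewrite /= expr1; field.
have := @drv_le0_ge _ (fun x => H x + mu * x ^+ 2 / 2) (fun t => h t + mu * t) 0 x.
rewrite /H prim0 expr0n mulr0 mul0r addr0 => h1.
have {}h1 : prim h x + mu * x ^+ 2 / 2 <= 0.
  apply: h1; first by case/andP: hx.
  - by move=> t _; exact: drv_cont (dF t).
  - by move=> t _; exact: dF.
  - by move=> t ht; have := @hmu t ltac:(lra); lra.
by move: h1; rewrite /potential; lra.
Qed.

Section Solution.
Variables (v dv : R -> R).
Hypothesis sol : radsol d.+3 h v dv.

Definition energy (r : R) := dv r ^+ 2 / 2 + H (v r).
Local Notation E := energy.

Let hv r : drv v r (dv r). Proof. by case: sol. Qed.
Let dv0 : dv 0 = 0. Proof. by case: sol. Qed.
Let cdv r : {for r, continuous dv}. Proof. by case: sol => _ _ c _; exact: c. Qed.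
Let hdv r : 0 < r -> drv dv r (- (n - 1) / r * dv r - h (v r)).
Proof. by case: sol => _ _ _ k /k. Qed.
Let cv r : {for r, continuous v}. Proof. exact: drv_cont (hv r). Qed.

Let n1 : 0 < n - 1.
Proof. by rewrite /n -natr1 addrK. Qed.

Lemma energy_cont r : {for r, continuous E}.
Proof.
apply: contD; first by apply: contM; [exact: contX|exact: contC].
exact: (cont_comp (cv (r := r)) (drv_cont (drv_H (v r)))).
Qed.

Lemma drv_energy r : 0 < r -> drv E r (- (n - 1) / r * dv r ^+ 2).
Proof.
move=> r0; have h1 := hdv r0; have h2 := drv_comp (hv r) (drv_H (v r)).
apply: drv_eq; first by apply: drvD; [apply: drvM; [apply: drvX; exact: h1|exact: drvC]|exact: h2].
by rewrite /= expr1; field; rewrite gt_eqF.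
Qed.

Lemma energy_noninc x y : 0 <= x -> x <= y -> E y <= E x.
Proof.
move=> x0 xy; apply: (@drv_le0_ge _ E (fun r => - (n - 1) / r * dv r ^+ 2)) => // t ht.
- exact: energy_cont.
- by apply: drv_energy; lra.
- have t0 : 0 < t by lra.
  rewrite mulNr mulNr oppr_le0; apply: mulr_ge0; last exact: sqr_ge0.
  by apply: divr_ge0; exact: ltW.
Qed.

Lemma drv_flux r : 0 < r -> drv (fun r : R => r ^+ d.+2 * dv r) r (- (r ^+ d.+2 * h (v r))).
Proof.
move=> r0; have h1 := hdv r0.
apply: drv_eq; first by apply: drvM; [apply: drvX; exact: drvI|exact: h1].
have -> : n - 1 = d.+2%:R by rewrite /n -natr1 addrK.
rewrite /= (exprS r d.+1); field; rewrite gt_eqF//.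
Qed.

Lemma flux_cont r : {for r, continuous (fun r : R => r ^+ d.+2 * dv r)}.
Proof. by apply: contM => //; apply: contX; exact: contI. Qed.

Lemma slope_absurd (T c : R) : 0 < c -> 0 <= T -> (forall r, T <= r -> 0 < v r) ->
  (forall r, T <= r -> dv r <= - c) -> False.
Proof.
move=> c0 T0 vp hc; have vT := vp T (lexx _).
pose r := T + v T / c.
have Tr : T < r by rewrite /r ltrDl divr_gt0.
have [t _|t _|x hx e] := mvt Tr (f := v) (df := dv); [exact: cv|exact: hv|].
have := hc x ltac:(lra); have := vp r ltac:(lra).
have : v r = v T + dv x * (v T / c) by move: e; rewrite /r; lra.
move=> -> h1 h2; have : dv x * (v T / c) <= - c * (v T / c).
  by apply: ler_wpM2r => //; apply: divr_ge0; exact: ltW.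
have -> : - c * (v T / c) = - v T by field; rewrite gt_eqF.
lra.
Qed.

(* [dv r / r] tends to [- h (v 0) / n] *)
Lemma slope_at_0 e : 0 < e -> exists2 dl, 0 < dl & forall r, 0 < r < dl ->
  `|dv r / r + h (v 0) / n| < e.
Proof.
move=> e0; have n0 : 0 < n by have := n1; lra.
have ch : {for 0, continuous (fun r => h (v r))} := cont_comp (cv (r := 0)) (h_cont (x := v 0)).
have /continuousP/(_ e e0)[dl dl0 hdl] := ch.
exists dl => // r hr; have r0 : 0 < r by case/andP: hr.
(* For s = 1 and s = -1 these compare the flux with its value for a constant source perturbed by
   [e]; their derivatives have opposite signs near 0. *)
pose F (s : R) (t : R) := t ^+ d.+2 * dv t + (h (v 0) + s * e) * t ^+ d.+3 / n.
have dF s t : 0 < t -> drv (F s) t (t ^+ d.+2 * (h (v 0) + s * e - h (v t))).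
  move=> t0; apply: drv_eq; first by apply: drvD; [exact: drv_flux|apply: drvM; [apply: drvM; [exact: drvC|apply: drvX; exact: drvI]|exact: drvC]].
  by rewrite -/n /=; field; rewrite gt_eqF.
have cF s t : {for t, continuous (F s)}.
  apply: contD; first exact: flux_cont.
  by apply: contM; [apply: contM; [exact: contC|apply: contX; exact: contI]|exact: contC].
have F0 s : F s 0 = 0 by rewrite /F !exprS !mul0r mulr0 mul0r addr0.
have hb t : 0 < t < r -> - e < h (v t) - h (v 0) < e.
  by move=> ht; rewrite -ltr_norml; apply: hdl; rewrite subr0 gtr0_norm; lra.
have Fp : 0 < F 1 r.
  rewrite -(F0 1); apply: (@drv_gt0_lt _ _ (fun t => t ^+ d.+2 * (h (v 0) + 1 * e - h (v t)))) => // t ht.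
  - by apply: dF; lra.
  - by apply: mulr_gt0; [apply: exprn_gt0|have := hb t ht]; lra.
have Fn : F (-1) r < 0.
  rewrite -(F0 (-1)); apply: (@drv_lt0_gt _ _ (fun t => t ^+ d.+2 * (h (v 0) + -1 * e - h (v t)))) => // t ht.
  - by apply: dF; lra.
  - by rewrite pmulr_rlt0; [have := hb t ht|apply: exprn_gt0]; lra.
have rd : 0 < r ^+ d.+3 by apply: exprn_gt0.
have FE s : F s r = r ^+ d.+3 * (dv r / r + h (v 0) / n + s * (e / n)).
  by rewrite /F (exprS r d.+2); field; rewrite !gt_eqF.
move: Fp Fn; rewrite !FE pmulr_rgt0// pmulr_rlt0// => Fp Fn.
have en : e / n <= e by rewrite ler_pdivrMr// ler_peMr//; [exact: ltW|rewrite /n ler1n].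
by move: (e / n) (dv r / r + h (v 0) / n) Fp Fn en => Y X; rewrite ltr_norml; lra.
Qed.

Section Positive.
Hypothesis vpos : forall r, 0 <= r -> 0 < v r.
Hypothesis Epos : forall r, 0 <= r -> 0 <= E r.

(** At a critical point the energy is H(v), and H is negative on (0, b]. *)
Lemma crit_gt_b r : 0 <= r -> dv r = 0 -> b < v r.
Proof.
move=> r0 e; have := Epos r0; rewrite /E e expr0n mul0r add0r => k.
rewrite ltNge; apply/negP => vb; have := @H_lt0 (v r); rewrite vpos// vb => /(_ isT).
by rewrite ltNge k.
Qed.

Lemma ground_top : b < v 0.
Proof. exact: (crit_gt_b (lexx 0)). Qed.

(** Near the centre the flux is negative because h(v(0)) > 0. At a first zero of [dv] the value is
    above [b], so the equation gives dv' = -h < 0, while [dv] arrives at 0 from below. *)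
Lemma ground_slope r : 0 < r -> dv r < 0.
Proof.
move=> r0; rewrite ltNge; apply/negP => dr.
have h00 := hpos ground_top.
have ch : {for 0, continuous (fun r => h (v r))} := cont_comp (cv (r := 0)) (h_cont (x := v 0)).
have [dl dl0 hdl] := continuous_gt0 ch h00.
have near t : 0 < t < dl -> dv t < 0.
  move=> ht; have t0 : 0 < t by case/andP: ht.
  suff : t ^+ d.+2 * dv t < 0 by rewrite pmulr_rlt0// exprn_gt0.
  have := @drv_lt0_gt _ (fun r : R => r ^+ d.+2 * dv r) (fun r => - (r ^+ d.+2 * h (v r))) 0 t t0.
  have -> : (0 : R) ^+ d.+2 * dv 0 = 0 by rewrite expr0n mul0r.
  apply=> [x hx|x hx|x hx].
  - exact: flux_cont.
  - by apply: drv_flux; lra.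
  - rewrite oppr_lt0; apply: mulr_gt0; first by apply: exprn_gt0; lra.
    by apply: hdl; rewrite subr0 gtr0_norm; lra.
have [t [t1 t2]] := near_right dl0 r0; rewrite add0r in t2.
have [|x _|||c hc [fc hc']] := @first_zero _ dv t r; [exact: ltW|exact: cdv|exact: near|by []|].
have c0 : 0 < c by lra.
have hvc := crit_gt_b (ltW c0) fc.
have := hdv c0; rewrite fc mulr0 sub0r => dc.
have [|e e0 [_ he]] := drv_sign_neg dc; first by rewrite oppr_lt0; exact: hpos.
have [x [x1 x2]] := near_left (proj1 (andP hc)) e0.
have := he x ltac:(lra); rewrite fc; have := hc' x ltac:(lra); lra.
Qed.

Lemma ground_decr x y : 0 <= x -> x < y -> v y < v x.
Proof.
move=> x0 xy; apply: (@drv_lt0_gt _ v dv) => // t ht; apply: ground_slope; lra.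
Qed.

(** A positive limit L of the decreasing [v] is impossible. If L is at most [b], nonnegative energy
    and H(L) < 0 keep the slope away from 0; if L is above [b], the source of size at least h(L)/2
    drives the slope down without bound. Both contradict positivity. *)
Lemma ground_vanish e : 0 < e -> exists2 T, 0 < T & forall r, T <= r -> v r < e.
Proof.
move=> e0; suff : exists2 T, 0 < T & v T < e.
  move=> [T T0 vT]; exists T => // r; rewrite le_eqVlt => /predU1P[<-//|Tr].
  by apply: lt_trans vT; apply: ground_decr => //; exact: ltW.
apply: contrapT => nex.
have ve r : 0 < r -> e <= v r.
  by move=> r0; rewrite leNgt; apply/negP => k; apply: nex; exists r.
pose A := [set v r | r in [set r : R | 0 < r]].
have hA : has_inf A.
  by split; [exists (v 1), 1 => //=; exact: ltr01|exists e => _ [r /= r0 <-]; exact: ve].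
pose L := inf A.
have Le : e <= L by apply: lb_le_inf; [case: hA|move=> _ [r /= r0 <-]; exact: ve].
have Lv r : 0 < r -> L <= v r by move=> r0; apply: ge_inf; [case: hA|exists r].
have L0 : 0 < L by exact: lt_le_trans Le.
have toL x : 0 < x -> exists2 T, 0 < T & forall r, T <= r -> L <= v r < L + x.
  move=> x0; have [_ [T /= T0 <-] vT] := inf_adherent x0 hA.
  exists T => // r Tr; rewrite Lv ?(lt_le_trans T0)//=.
  move: Tr; rewrite le_eqVlt => /predU1P[<-//|Tr].
  by apply: lt_trans vT; apply: ground_decr => //; exact: ltW.
have [Lb|bL] := leP L b.
- have HL := @H_lt0 L ltac:(by rewrite L0 Lb).
  have cH : {for L, continuous (fun x => H x - H L / 2)} by apply: contD; [exact: drv_cont (drv_H L)|exact: contC].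
  have [|x x0 hx] := continuous_lt0 cH; first lra.
  have [T T0 hT] := toL x x0.
  apply: (@slope_absurd T (Num.sqrt (- H L))).
  + by rewrite sqrtr_gt0 oppr_gt0.
  + exact: ltW.
  + by move=> r Tr; apply: vpos; lra.
  + move=> r Tr; have r0 : 0 < r by lra.
    have k1 := hx (v r) ltac:(have := hT r Tr; rewrite ltr_norml; lra).
    have k2 := Epos (ltW r0); have k3 := ground_slope r0.
    have : - H L <= dv r ^+ 2 by move: k2; rewrite /E; lra.
    rewrite -(@ler_sqrt _ _ (dv r ^+ 2)) ?sqr_ge0// sqrtr_sqr ltr0_norm//; lra.
- have hL := hpos bL.
  have ch : {for L, continuous (fun x => h x - h L / 2)} by apply: contD; [exact: h_cont|exact: contC].
  have [|x x0 hx] := continuous_gt0 ch; first lra.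
  have [T T0 hT] := toL x x0.
  pose c := h L / 2; have c0 : 0 < c by rewrite /c; lra.
  (* Adding (n-1) v/r absorbs the friction term: what remains of it in the derivative, -(n-1) v/r^2,
     has a favourable sign. *)
  pose G r := dv r + (n - 1) / r * v r.
  have dG r : 0 < r -> drv G r (- h (v r) - (n - 1) * v r / r ^+ 2).
    move=> r0; have k1 := hdv r0; have k2 := hv r.
    apply: drv_eq; first by apply: drvD; [exact: k1|apply: drvM; [apply: drvM; [exact: drvC|apply: drvV; [exact: drvI|exact: lt0r_neq0]]|exact: k2]].
    by rewrite /=; field; rewrite gt_eqF.
  have Gle r : T <= r -> G r + c * r <= G T + c * T.
    move=> Tr; apply: (@drv_le0_ge _ (fun r => G r + c * r) (fun r => - h (v r) - (n - 1) * v r / r ^+ 2 + c)) => // t ht.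
    + by apply: contD; [apply: drv_cont (dG t _); lra|apply: contM; [exact: contC|exact: contI]].
    + apply: drv_eq; first by apply: drvD; [apply: dG; lra|apply: drvM; [exact: drvC|exact: drvI]].
      by rewrite /=; ring.
    + have t0 : 0 < t by lra.
      have k1 := hx (v t) ltac:(have := hT t ltac:(lra); rewrite ltr_norml; lra).
      have k2 : 0 <= (n - 1) * v t / t ^+ 2.
        apply: divr_ge0; last exact: sqr_ge0.
        by apply: mulr_ge0; apply: ltW => //; apply: vpos; exact: ltW.
      by rewrite /c; lra.
  pose T1 := T + (`|G T + c * T| + 1) / c.
  have T1T : T <= T1 by rewrite /T1 lerDl divr_ge0 ?addr_ge0//; exact: ltW.
  apply: (@slope_absurd T1 1) => //; first by lra.
    by move=> r Tr; apply: vpos; lra.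
  move=> r Tr; have r0 : 0 < r by lra.
  have k1 := Gle r ltac:(lra).
  have k2 : `|G T + c * T| + 1 <= c * r.
    rewrite [leRHS]mulrC -ler_pdivrMr//; apply: (le_trans _ Tr); rewrite /T1 lerDr; exact: ltW.
  have k3 : 0 <= (n - 1) / r * v r.
    by apply: mulr_ge0; [apply: divr_ge0; exact: ltW|apply: ltW; apply: vpos; exact: ltW].
  have := ler_norm (G T + c * T); move: k1; rewrite {1}/G; lra.
Qed.

(** Near 0, H <= -mu v^2/2 and nonnegative energy give -v' >= sqrt(mu) v, hence the decay of [v].
    Where v < b the function is convex, so -v'(r) is at most v(r-1) - v(r); the shift by 1 costs the
    factor [expR k] in [C]. *)
Lemma exp_decay : exists C T k : R, [/\ 0 < C, 0 < T, 0 < k & forall r, T <= r ->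
  v r <= C * expR (- (k * r)) /\ - dv r <= C * expR (- (k * r))].
Proof.
have B0 := b0; have E0 := eps0.
have [T T0 hT] := @ground_vanish (Num.min eps b) ltac:(by rewrite lt_min E0 B0).
have smu : 0 < Num.sqrt mu by rewrite sqrtr_gt0.
set k := Num.sqrt mu in smu.
have k2 : k ^+ 2 = mu by rewrite sqr_sqrtr// ltW.
have dle r : T <= r -> dv r <= - (k * v r).
  move=> Tr; have r0 : 0 < r by lra.
  have := hT r Tr; rewrite lt_min => /andP[ve vb].
  have vr := vpos (ltW r0); have := H_mu (x := v r); rewrite (ltW vr) (ltW ve) => /(_ isT) Hv.
  have Er := Epos (ltW r0); have dr := ground_slope r0.
  have : (k * v r) ^+ 2 <= (- dv r) ^+ 2.
    by rewrite sqrrN exprMn k2; move: Er; rewrite /E; lra.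
  by rewrite ler_pXn2r// ?nnegrE; [lra|apply: mulr_ge0; exact: ltW|lra].
pose C := v T * expR (k * T) * expR k.
have vT : 0 < v T by apply: vpos; exact: ltW.
have vdec r : T <= r -> v r <= v T * expR (k * T) * expR (- (k * r)).
  move=> Tr; rewrite expRN ler_pdivlMr ?expR_gt0//.
  apply: (@drv_le0_ge _ (fun r => v r * expR (k * r)) (fun r => (dv r + k * v r) * expR (k * r))) => // t ht.
  - by apply: contM => //; apply: drv_cont (_ : drv _ _ (k * expR (k * t))); drv; ring.
  - by have h1 := hv t; drv; ring.
  - by rewrite pmulr_lle0 ?expR_gt0//; have := dle t ltac:(lra); lra.
have ek : 1 <= expR k by rewrite -expR0 ler_expR ltW.
have vTe : 0 < v T * expR (k * T) by rewrite mulr_gt0 ?expR_gt0.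
exists C, (T + 1), k; split => //.
- by rewrite /C mulr_gt0 ?expR_gt0.
- lra.
move=> r Tr; split.
  apply: le_trans (vdec r ltac:(lra)) _; apply: ler_wpM2r; first exact: expR_ge0.
  by rewrite /C ler_peMr// ltW.
have r1 : r - 1 < r by lra.
have [t _|t _|x hx e] := mvt r1 (f := v) (df := dv); [exact: cv|exact: hv|].
have dx : dv x <= dv r.
  apply: (@drv_ge0_le _ dv (fun r => - (n - 1) / r * dv r - h (v r))); first lra.
  - by move=> t _; exact: cdv.
  - by move=> t ht; apply: hdv; lra.
  - move=> t ht; have t0 : 0 < t by lra.
    have := hT t ltac:(lra); rewrite lt_min => /andP[ve vb].
    have hn := @hneg (v t); rewrite vpos ?ltW//= vb in hn.
    have := hn isT; have dt := ground_slope t0.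
    have : 0 <= - (n - 1) / t * dv t.
      by rewrite mulNr mulNr -mulrN; apply: mulr_ge0; [apply: divr_ge0; exact: ltW|lra].
    lra.
apply: (@le_trans _ _ (v (r - 1))).
  have := vpos (r := r) ltac:(lra); have : v r - v (r - 1) = dv x by rewrite e; ring.
  lra.
apply: le_trans (vdec (r - 1) ltac:(lra)) _.
have -> : expR (- (k * (r - 1))) = expR k * expR (- (k * r)) by rewrite -expRD; congr expR; ring.
by rewrite /C !mulrA.
Qed.

Lemma pow_exp (k : R) (j : nat) : 0 < k -> exists2 M, 0 < M & forall r, 0 <= r -> r ^+ j <= M * expR (k * r).
Proof.
move=> k0; case: j => [|j].
  by exists 1 => // r r0; rewrite expr0 mul1r -expR0 ler_expR mulr_ge0// ltW.
have j0 : 0 < j.+1%:R :> R by rewrite ltr0n.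
(* From 1 + x <= exp(x) with x = k r/(j + 1), raised to the power j + 1. *)
exists ((j.+1%:R / k) ^+ j.+1); first by rewrite exprn_gt0// divr_gt0.
move=> r r0; have -> : k * r = j.+1%:R * (k * r / j.+1%:R) by field; rewrite gt_eqF.
rewrite expRM_natl -exprMn; apply: lerXn2r; rewrite ?nnegrE//.
  by apply: mulr_ge0; [apply: divr_ge0; exact: ltW|exact: expR_ge0].
rewrite -ler_pdivrMl ?divr_gt0// invf_div.
apply: le_trans (expR_ge1Dx _); rewrite [k / _ * r]mulrAC lerDr//.
Qed.

Lemma rapid_decay (j : nat) : exists2 C, 0 < C & forall r, 0 <= r ->
  r ^+ j * v r <= C /\ r ^+ j * - dv r <= C.
Proof.
have [C [T [k [C0 T0 k0 hC]]]] := exp_decay.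
have [M M0 hM] := pow_exp j k0.
have cj (t : R) : {for t, continuous (fun r : R => r ^+ j)} by apply: contX; exact: contI.
have [t _|K1 K10 hK1] := @bounded_seg _ (fun r => r ^+ j * v r) 0 T (ltW T0).
  by apply: contM.
have [t _|K2 K20 hK2] := @bounded_seg _ (fun r => r ^+ j * - dv r) 0 T (ltW T0).
  by apply: contM => //; exact: contN.
have MC : 0 < M * C by exact: mulr_gt0.
exists (K1 + K2 + M * C); first by rewrite !addr_gt0.
move=> r r0; have [rT|Tr] := leP r T.
  have := hK1 r ltac:(lra); have := hK2 r ltac:(lra); rewrite !ler_norml; lra.
have key x : x <= C * expR (- (k * r)) -> r ^+ j * x <= M * C.
  move=> hx; apply: (@le_trans _ _ (r ^+ j * (C * expR (- (k * r))))).
    by apply: ler_wpM2l => //; apply: exprn_ge0.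
  rewrite expRN mulrA ler_pdivrMr ?expR_gt0// [leRHS]mulrAC; apply: ler_wpM2r; first exact: ltW.
  exact: hM.
have [v1 v2] := hC r (ltW Tr).
by have := key _ v1; have := key _ v2; lra.
Qed.

End Positive.
End Solution.
End GroundState.

(** * Uniqueness of the ground state *)

Section GroundUnique.
Context {R : realType}.
Variables (d : nat) (h dh : R -> R) (b mu eps : R).
Hypothesis b0 : 0 < b.
Hypothesis hlip : forall A : R, exists2 L : R, 0 < L & forall x y : R, x <= A -> y <= A ->
  `|h x - h y| <= L * `|x - y|.
Hypothesis hneg : forall l : R, 0 < l < b -> h l < 0.
Hypothesis hpos : forall l : R, b < l -> 0 < h l.
Hypothesis mu0 : 0 < mu.
Hypothesis eps0 : 0 < eps.
Hypothesis hmu : forall l : R, 0 <= l <= eps -> h l <= - mu * l.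
Hypothesis hdh : forall l : R, b < l -> drv h l (dh l).
Hypothesis gmono : forall x y : R, b < x -> x <= y -> y * dh y / h y <= x * dh x / h x.

Definition ground (v dv : R -> R) := [/\ radsol d.+3 h v dv,
  forall r, 0 <= r -> 0 < v r & forall r, 0 <= r -> 0 <= energy h v dv r].

Lemma ground_strict v dv x y : ground v dv -> 0 <= x -> x < y -> v y < v x.
Proof. by case=> sol vpos Epos; exact: (ground_decr hlip hneg hpos sol vpos Epos). Qed.

Lemma ground_profile v dv : ground v dv ->
  exists2 r, (forall l, 0 < l < v 0 -> 0 < r l /\ v (r l) = l) &
    profile d h b (v 0) r (fun l => - dv (r l)).
Proof.
move=> gv; have dec := ground_strict gv; case: (gv) => sol vpos Epos.
have slope := ground_slope hlip hneg hpos sol vpos Epos.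
have ex (l : R) : exists r : R, 0 < l < v 0 -> 0 < r /\ v r = l.
  have [hl|hl] := pselect (0 < l < v 0); last by exists 0 => k; case: hl.
  have l0 : 0 < l by case/andP: hl.
  have [T T0 hT] := ground_vanish hlip hneg hpos sol vpos Epos l0.
  have [|||t ht e] := @ivt _ v 0 T l; first exact: ltW.
  - by move=> t _; exact: radsol_cont sol.
  - by right; have := hT T (lexx _); lra.
  exists t => _; split => //; rewrite lt_neqAle; apply/andP; split; last lra.
  by apply/eqP => t0; move: hl; rewrite -e -t0 ltxx andbF.
have [rho hrho] := choice ex.
have rhoK t : 0 < t -> rho (v t) = t.
  move=> t0; have [|r0 e] := hrho (v t).
    by rewrite (vpos _ (ltW t0)) dec.
  have [k|k|//] := ltgtP (rho (v t)) t.
    by have := dec _ _ (ltW r0) k; rewrite e ltxx.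
  by have := dec _ _ (ltW t0) k; rewrite e ltxx.
have lt_rho l t : 0 < t -> 0 < l < v 0 -> (rho l < t) = (v t < l).
  move=> t0 hl; have [r0 e] := hrho l hl; apply/idP/idP => k.
    by rewrite -e; apply: dec => //; exact: ltW.
  rewrite ltNge; apply/negP; rewrite le_eqVlt => /predU1P[k'|k'].
    by move: k; rewrite k' e ltxx.
  by have := dec _ _ (ltW t0) k'; rewrite e; lra.
have rho_lt l t : 0 < t -> 0 < l < v 0 -> (t < rho l) = (l < v t).
  move=> t0 hl; have [r0 e] := hrho l hl; apply/idP/idP => k.
    by rewrite -e; apply: dec => //; exact: ltW.
  rewrite ltNge; apply/negP; rewrite le_eqVlt => /predU1P[k'|k'].
    by move: k; rewrite -k' e ltxx.
  by have := dec _ _ (ltW r0) k'; rewrite e; lra.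
have nE : d.+3%:R = d%:R + 3 :> R by rewrite -addn3 natrD.
case: (sol) => dv1 dv0 cdv ddv.
have drho l : 0 < l < v 0 -> drv rho l (- (- dv (rho l))^-1).
  move=> hl; have [r0 e] := hrho l hl.
  rewrite invrN opprK -{1}e; apply: (@drv_inverse _ v rho dv 0 (rho l + 1)) => [t _|t ht|t ht|].
  - exact: dv1.
  - by rewrite lt_eqF// slope//; case/andP: ht.
  - by apply: rhoK; case/andP: ht.
  - by rewrite r0 ltrDl ltr01.
exists rho => //; split.
- exact: (ground_top hlip hneg sol vpos Epos).
- by move=> l /hrho[].
- by move=> l /hrho[r0 _]; rewrite oppr_gt0 slope.
- exact: drho.
- move=> l hl; have [r0 e] := hrho l hl; have k1 := drv_comp (drho l hl) (ddv _ r0).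
  apply: drv_eq; first by apply: drvN; exact: k1.
  rewrite nE e /=; have := slope _ r0 => sl; field.
  by rewrite lt_eqF// gt_eqF.
- move=> e e0; have [dl dl0 hdl] := slope_at_0 hlip sol e0.
  have [t [t0 td te]] : exists t, [/\ 0 < t, t < dl & t < e].
    by exists (Num.min dl e / 2); have : 0 < Num.min dl e by [rewrite lt_min dl0]; have := ge_min dl dl e; have := ge_min e dl e; rewrite !lexx orbT /=; split; lra.
  have vt : v t < v 0 by exact: dec.
  exists (v 0 - v t); first by rewrite subr_gt0.
  move=> l hl l0; have hl' : 0 < l < v 0 by lra.
  have [r0 E] := hrho l hl'; have : rho l < t by rewrite lt_rho//; lra.
  move=> rt; split; first lra.
  have := hdl (rho l) ltac:(lra); rewrite nE -normrN opprD -mulNr //.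
(* The power n is one more than in the flux r^(n-1) q, so the flux is at most C/r. The summand 1 in
   [t] gives the bound 1 <= r. *)
- move=> e e0; have [C C0 hC] := rapid_decay b0 hlip hneg hpos mu0 eps0 hmu sol vpos Epos d.+3.
  pose t := C / e + 1; have Ce : 0 < C / e by exact: divr_gt0.
  have t0 : 0 < t by rewrite /t; lra.
  exists (v t); first by apply: vpos; exact: ltW.
  move=> l hl lv; have hl' : 0 < l < v 0 by lra.
  have [r0 E] := hrho l hl'; have tr : t < rho l by rewrite rho_lt//; lra.
  split; last by move: tr; rewrite /t; lra.
  have [_ k] := hC (rho l) (ltW r0).
  rewrite -(ltr_pM2l r0) mulrA -exprS; apply: (le_lt_trans k).
  by rewrite -ltr_pdivrMr//; move: tr; rewrite /t; lra.
Qed.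

(** Equal starting values are settled by uniqueness of the initial value problem. For different ones
    [profile_unique] applies: a level with equal radii and slopes would, by backward uniqueness,
    give equal starting values. *)
Lemma ground_unique v dv w dw : ground v dv -> ground w dw -> forall r, 0 <= r -> v r = w r.
Proof.
move=> gv gw.
have le0 u du : ground u du -> forall r, 0 <= r -> u r <= u 0.
  move=> gu r; rewrite le_eqVlt => /predU1P[<-//|r0].
  by apply: ltW; exact: (ground_strict gu).
have sv : radsol d.+3 h v dv by case: gv.
have sw : radsol d.+3 h w dw by case: gw.
have [L L0 hL] := hlip (`|v 0| + `|w 0|).
have hL' r : 0 <= r -> `|h (v r) - h (w r)| <= L * `|v r - w r|.
  move=> r0; have := le0 _ _ gv r r0; have := le0 _ _ gw r r0.
  have := ler_norm (v 0); have := ler_norm (w 0).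
  have := normr_ge0 (v 0); have := normr_ge0 (w 0) => *.
  by apply: hL; lra.
suff e0 : v 0 = w 0.
  move=> r r0; apply: (radsol_unique _ (ltW L0) sv sw _ e0 (T := r)) => //.
    by move=> t ht; apply: hL'; case/andP: ht.
  by rewrite r0 lexx.
have main u du z dz : ground u du -> ground z dz ->
    (forall r, 0 <= r -> `|h (u r) - h (z r)| <= L * `|u r - z r|) -> u 0 < z 0 -> False.
  move=> gu gz hh k.
  have [rho hrho P] := ground_profile gu; have [sig hsig Q] := ground_profile gz.
  have hb := h_b b0 hlip hneg hpos.
  have hc : {for b, continuous h} := h_cont hlip (x := b).
  apply: (profile_unique b0 hneg hb hpos hdh hc gmono P Q k) => l hl E Eq.
  have bu : b < u 0 := prof_al P.
  have [r0 e1] := hrho l ltac:(lra); have [s0 e2] := hsig l ltac:(lra).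
  move: s0 e2 Eq; rewrite -E => s0 e2 /oppr_inj Eq.
  have su : radsol d.+3 h u du by case: gu.
  have sz : radsol d.+3 h z dz by case: gz.
  have := radsol_backward (isT : 0 < d.+3)%N (ltW L0) r0 su sz _ _ Eq (r := 0).
  rewrite e1 e2 lexx ltW// => H.
  have : u 0 = z 0 by apply: H => // t ht; apply: hh; case/andP: ht.
  lra.
have [k|k|//] := ltgtP (v 0) (w 0).
  by case: (main _ _ _ _ gv gw hL' k).
by case: (main _ _ _ _ gw gv _ k) => r r0; rewrite distrC [in leRHS]distrC; exact: hL'.
Qed.

End GroundUnique.

(** * Shooting *)

(** Connectedness of a half line: the end of the largest initial interval on which [P] holds belongs
    to neither set. *)
Lemma open_disjoint_gap {R : realType} (b c : R) (P Q : R -> Prop) : b <= c -> P b -> Q c ->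
  (forall x, b <= x -> P x -> exists2 e, 0 < e & forall y, b <= y -> `|y - x| < e -> P y) ->
  (forall x, b <= x -> Q x -> exists2 e, 0 < e & forall y, b <= y -> `|y - x| < e -> Q y) ->
  (forall x, b <= x -> P x -> Q x -> False) -> exists x, [/\ b <= x, ~ P x & ~ Q x].
Proof.
move=> bc Pb Qc Popen Qopen disj.
pose A := [set z : R | b <= z /\ forall x, b <= x <= z -> P x].
have Ab : A b by split => // x hx; have -> : x = b by [lra].
have hA : has_sup A.
  split; [by exists b|exists c => z [bz hz]; rewrite leNgt; apply/negP => lt].
  by apply: (disj c) => //; apply: hz; rewrite bc ltW.
have Az x : A x -> x <= sup A by move=> Ax; apply: ub_le_sup => //; case: hA.
have below x : b <= x < sup A -> P x.
  move=> hx; have [|y Ay yx] := @sup_adherent _ A (sup A - x) _ hA; first lra.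
  by case: Ay => _; apply; move: yx; lra.
move: (sup A) Az below => z Az below; have bz : b <= z by exact: Az.
have nP : ~ P z.
  move=> Pz; have [e e0 he] := Popen z bz Pz.
  suff /Az : A (z + e / 2) by lra.
  split=> [|x hx]; first lra.
  have [xz|zx] := ltP x z; first by apply: below; lra.
  by apply: he; rewrite ?ger0_norm; lra.
exists z; split => // Qz; have [e e0 he] := Qopen z bz Qz.
have bz' : b < z by rewrite lt_neqAle bz andbT; apply/eqP => k; apply: nP; rewrite -k.
have [x [x1 x2]] : exists x, b <= x < z /\ z - e < x.
  have [ze|ze] := leP (z - e / 2) b; first by exists b; lra.
  by exists (z - e / 2); lra.
apply: (disj x); [lra|exact: below|apply: he; first lra].
by rewrite ltr0_norm; lra.
Qed.

Lemma drv_min0 {R : realType} (f : R -> R) (x d a b : R) : drv f x d -> a < x < b ->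
  (forall y, a < y < b -> f x <= f y) -> d = 0.
Proof.
move=> dx axb fmin; have [k|k|//] := ltgtP d 0.
- have [e e0 [he _]] := drv_sign_neg dx k.
  have [t [t1 t2]] : exists t, x < t < x + e /\ t < b.
    have [xe|xe] := leP b (x + e / 2); first by exists ((x + b) / 2); lra.
    by exists (x + e / 2); lra.
  by have := he t t1; have := fmin t ltac:(lra); lra.
- have [e e0 [_ he]] := drv_sign_pos dx k.
  have [t [t1 t2]] : exists t, x - e < t < x /\ a < t.
    have [xe|xe] := leP (x - e / 2) a; first by exists ((x + a) / 2); lra.
    by exists (x - e / 2); lra.
  by have := he t t1; have := fmin t ltac:(lra); lra.
Qed.

Section Shooting.
Context {R : realType}.
Variables (d : nat) (h : R -> R) (b : R).
Hypothesis b0 : 0 < b.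
Hypothesis h0 : forall v : R, v <= 0 -> h v = 0.
Hypothesis hlip : forall A : R, exists2 L : R, 0 < L & forall x y : R, x <= A -> y <= A ->
  `|h x - h y| <= L * `|x - y|.
Hypothesis hneg : forall l : R, 0 < l < b -> h l < 0.
Hypothesis hpos : forall l : R, b < l -> 0 < h l.
Local Notation radsol := (radsol d.+3).
Local Notation H := (potential h).

(** Above [b] the potential increases, so a value above the starting one would raise the energy. The
    nonlinearity [k] is arbitrary because the lemma also serves for a truncated [h]. *)
Lemma radsol_le_top (k v dv : R -> R) :
  (forall A : R, exists2 L : R, 0 < L & forall x y : R, x <= A -> y <= A ->
    `|k x - k y| <= L * `|x - y|) -> (forall l : R, b < l -> 0 < k l) ->
  radsol k v dv -> b <= v 0 -> forall r, 0 <= r -> v r <= v 0.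
Proof.
move=> klip kpos sol bv r r0; rewrite leNgt; apply/negP => lt.
have k1 := energy_noninc klip sol (lexx 0) r0.
have k2 := H_incr klip kpos bv lt.
have dv0 : dv 0 = 0 by case: sol.
move: k1; rewrite /energy dv0 expr0n mul0r add0r.
by have := sqr_ge0 (dv r); lra.
Qed.

(** [h] is Lipschitz only on sets bounded above, so it is truncated at al + 1; the solution never
    exceeds [al] and does not see the truncation. *)
Lemma shoot_ex (al : R) : b <= al -> exists v dv, radsol h v dv /\ v 0 = al.
Proof.
move=> bal; pose k (x : R) := h (Num.min x (al + 1)).
have minA (x : R) : Num.min x (al + 1) <= al + 1 by rewrite ge_min lexx orbT.
have [L L0 hL] := hlip (al + 1).
have kL x y : `|k x - k y| <= L * `|x - y|.
  apply: le_trans (hL _ _ (minA x) (minA y)) _; apply: ler_wpM2l; first exact: ltW.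
  have k1 (z t : R) : z <= t -> Num.min t (al + 1) - Num.min z (al + 1) <= t - z /\
      Num.min z (al + 1) <= Num.min t (al + 1).
    by move=> zt; rewrite /Num.min; case: ltP => h1; case: ltP => h2; split; lra.
  have [xy|yx] := leP x y.
    have [e1 e2] := k1 _ _ xy.
    by rewrite distrC ger0_norm ?subr_ge0// distrC ger0_norm ?subr_ge0.
  have [e1 e2] := k1 _ _ (ltW yx).
  by rewrite ger0_norm ?subr_ge0// ger0_norm ?subr_ge0// ltW.
have [v [dv [sol e]]] := @radsol_ex _ d.+2 isT k L al L0 kL.
exists v, dv; split => //; have B0 := b0.
have ltop : forall r, 0 <= r -> v r <= v 0.
  apply: (radsol_le_top (k := k)) sol _ => [A|l bl|]; last by rewrite e.
    by exists L.
  by apply: hpos; rewrite lt_min bl; lra.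
case: sol => d1 d2 d3 d4; split => // r r0.
have := d4 r r0; rewrite /k (_ : Num.min (v r) _ = v r)//.
by apply/min_idPl; have := ltop r (ltW r0); lra.
Qed.

Section Solution.
Variables v dv : R -> R.
Hypothesis sol : radsol h v dv.
Hypothesis top : b <= v 0.

(** A nonpositive constant solves the equation, and backward uniqueness would identify [v] with it,
    against v(0) >= b > 0. *)
Lemma no_bottom (r : R) : 0 < r -> v r <= 0 -> dv r = 0 -> False.
Proof.
move=> r0 vr dr; have [L L0 hL] := hlip (v 0).
have B0 := b0; have B1 := top.
have sc : radsol h (fun=> v r) (fun=> 0).
  split=> [t||t|t t0] //; first exact: drvC; first exact: contC.
  by apply: drv_eq; [exact: drvC|rewrite h0//; ring].
have hh t : 0 <= t <= r -> `|h (v t) - h (v r)| <= L * `|v t - v r|.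
  by move=> ht; apply: hL; apply: (radsol_le_top hlip hpos sol) => //; lra.
have := radsol_backward (isT : (0 < d.+3)%N) (ltW L0) r0 sol sc hh erefl dr (r := 0).
by rewrite lexx ltW// => /(_ isT); lra.
Qed.

Lemma energy_nonpos_ge0 r : v r <= 0 -> 0 <= energy h v dv r.
Proof.
move=> vr; rewrite /energy (H_le0 h0 hlip vr) addr0.
by apply: divr_ge0 => //; exact: sqr_ge0.
Qed.

(** Nonpositive values have nonnegative energy, so [v] is positive from [r1] on. A negative value
    before [r1] would produce an interior minimum at a negative value, which [no_bottom]
    excludes. *)
Lemma trapped_or_crosses r1 r2 : 0 <= r1 -> 0 <= r2 -> energy h v dv r1 < 0 -> v r2 < 0 -> False.
Proof.
move=> r10 r20 E1 v2; have B0 := b0; have B1 := top.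
have cv t : {for t, continuous v} := radsol_cont (r := t) sol.
have pos r : r1 <= r -> 0 < v r.
  move=> hr; rewrite ltNge; apply/negP => /energy_nonpos_ge0.
  by have := energy_noninc hlip sol r10 hr; lra.
have r21 : r2 < r1 by rewrite ltNge; apply/negP => /pos; lra.
have [c hc cmin] : exists2 c, c \in `[0, r1]%R & forall t, t \in `[0, r1]%R -> v c <= v t.
  by apply: EVT_min => //; apply: continuous_subspaceT => t; exact: cv.
move: hc; rewrite in_itv /= => hc.
have vc : v c < 0.
  by have := cmin r2; rewrite in_itv /= r20 ltW// => /(_ isT); lra.
have c0 : 0 < c.
  rewrite lt_neqAle; apply/andP; split; last by case/andP: hc.
  by apply/eqP => e; move: vc; rewrite -e; lra.
have cr1 : c < r1.
  rewrite lt_neqAle; apply/andP; split; last by case/andP: hc.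
  by apply/eqP => e; move: vc; rewrite e; have := pos r1 (lexx _); lra.
have dc : drv v c (dv c) by case: sol.
apply: (no_bottom c0 (ltW vc)); apply: (drv_min0 dc (a := 0) (b := r1)); first by rewrite c0.
by move=> t /andP[t0 t1]; apply: cmin; rewrite in_itv /= !ltW.
Qed.

(** Solutions starting within 1 of v(0) stay below v(0) + 1, where one Lipschitz constant serves for
    all of them. *)
Lemma shoot_dependence r e : 0 <= r -> 0 < e -> exists2 dl, 0 < dl & forall w dw, radsol h w dw ->
  b <= w 0 -> `|w 0 - v 0| < dl -> `|w r - v r| < e /\ `|dw r - dv r| < e.
Proof.
move=> r0 e0; have [L L0 hL] := hlip (v 0 + 1).
pose X := expR ((1 + L) * (r - 0)); have X0 : 0 < X by exact: expR_gt0.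
exists (Num.min 1 (e / Num.sqrt X)); first by rewrite lt_min ltr01 divr_gt0// sqrtr_gt0.
move=> w dw sw bw; rewrite lt_min => /andP[w1 w2].
have hh t : 0 <= t <= r -> `|h (w t) - h (v t)| <= L * `|w t - v t|.
  move=> ht; have t0 : 0 <= t by case/andP: ht.
  apply: hL; first by have := radsol_le_top hlip hpos sw bw t0; move: w1; rewrite ltr_norml; lra.
  by have := radsol_le_top hlip hpos sol top t0; lra.
have := radsol_forward (isT : (0 < d.+3)%N) (ltW L0) (lexx 0) sw sol hh (r := r).
rewrite r0 lexx => /(_ isT); rewrite -/X.
have dw0 : dw 0 = 0 by case: sw.
have dv0 : dv 0 = 0 by case: sol.
have -> : dist2 w dw v dv 0 = (w 0 - v 0) ^+ 2.
  by rewrite /dist2 dw0 dv0 subrr expr0n addr0.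
have lt : (w 0 - v 0) ^+ 2 * X < e ^+ 2.
  have -> : (w 0 - v 0) ^+ 2 * X = (`|w 0 - v 0| * Num.sqrt X) ^+ 2.
    by rewrite exprMn sqr_sqrtr ?ltW// real_normK ?num_real.
  rewrite ltr_pXn2r ?nnegrE ?mulr_ge0 ?sqrtr_ge0//; last exact: ltW.
  by rewrite -ltr_pdivlMr// sqrtr_gt0.
rewrite /dist2 => k; have k1 := sqr_ge0 (w r - v r); have k2 := sqr_ge0 (dw r - dv r).
have aux (x : R) : x ^+ 2 < e ^+ 2 -> `|x| < e.
  by rewrite -(real_normK (num_real x)) ltr_pXn2r// ?nnegrE// ltW.
by split; apply: aux; lra.
Qed.

Lemma negative_energy_stable r : 0 <= r -> energy h v dv r < 0 -> exists2 dl, 0 < dl &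
  forall w dw, radsol h w dw -> b <= w 0 -> `|w 0 - v 0| < dl -> energy h w dw r < 0.
Proof.
move=> r0 E0; pose eta := - energy h v dv r / 2; have eta0 : 0 < eta by rewrite /eta; lra.
have c1 : {for v r, continuous H} := drv_cont (drv_H hlip (v r)).
have c2 : {for dv r, continuous (fun y : R => y ^+ 2 / 2)}.
  by apply: contM; [apply: contX; exact: contI|exact: contC].
have /continuousP/(_ _ eta0)[e1 e10 h1] := c1.
have /continuousP/(_ _ eta0)[e2 e20 h2] := c2.
have e12 : 0 < Num.min e1 e2 by rewrite lt_min e10.
have [dl dl0 hdl] := shoot_dependence r0 e12.
exists dl => // w dw sw bw wv; have := hdl w dw sw bw wv.
rewrite !lt_min => -[/andP[k1 _] /andP[_ k2]].
have := h1 _ k1; have := h2 _ k2; rewrite /eta /energy !ltr_norml.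
by move: (H (w r)) (H (v r)) (dw r ^+ 2) (dv r ^+ 2) => x y z t; lra.
Qed.

Lemma negative_value_stable r : 0 <= r -> v r < 0 -> exists2 dl, 0 < dl &
  forall w dw, radsol h w dw -> b <= w 0 -> `|w 0 - v 0| < dl -> w r < 0.
Proof.
move=> r0 vr; have [|dl dl0 hdl] := shoot_dependence r0 (e := - v r); first lra.
exists dl => // w dw sw bw wv; have [k _] := hdl w dw sw bw wv.
by move: k; rewrite ltr_norml; lra.
Qed.

End Solution.

Lemma ground_ex : (exists v dv, [/\ radsol h v dv, b <= v 0 & exists2 r, 0 <= r & v r < 0]) ->
  exists v dv, ground d h v dv.
Proof.
have B0 := b0; move=> [vN [dvN [solN topN [rN rN0 hN]]]].
have ex (al : R) : exists s : (R -> R) * (R -> R), b <= al -> radsol h s.1 s.2 /\ s.1 0 = al.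
  have [/shoot_ex[v [dv s]]|k] := leP b al; first by exists (v, dv).
  by exists (fun=> 0, fun=> 0); lra.
have [S hS] := choice ex.
pose Pp (al : R) := exists2 r, 0 <= r & energy h (S al).1 (S al).2 r < 0.
pose Np (al : R) := exists2 r, 0 <= r & (S al).1 r < 0.
have disj (al : R) : b <= al -> Pp al -> Np al -> False.
  move=> bal [r1 r10 E1] [r2 r20 v2]; have [s e] := hS al bal.
  by apply: (trapped_or_crosses s _ r10 r20 E1 v2); rewrite e.
have Popen al : b <= al -> Pp al -> exists2 dl, 0 < dl & forall be, b <= be -> `|be - al| < dl -> Pp be.
  move=> bal [r r0 Er]; have [s e] := hS al bal.
  have [|dl dl0 hdl] := negative_energy_stable s _ r0 Er; first by rewrite e.
  exists dl => // be bbe hbe; have [s' e'] := hS be bbe.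
  by exists r => //; apply: hdl => //; rewrite e' ?e.
have Nopen al : b <= al -> Np al -> exists2 dl, 0 < dl & forall be, b <= be -> `|be - al| < dl -> Np be.
  move=> bal [r r0 Er]; have [s e] := hS al bal.
  have [|dl dl0 hdl] := negative_value_stable s _ r0 Er; first by rewrite e.
  exists dl => // be bbe hbe; have [s' e'] := hS be bbe.
  by exists r => //; apply: (hdl _ (S be).2) => //; rewrite e' ?e.
have Pb : Pp b.
  have [s e] := hS b (lexx b); exists 0 => //.
  have dv0 : (S b).2 0 = 0 by case: s.
  by rewrite /energy dv0 expr0n mul0r add0r e (H_lt0 hlip hneg)// b0 lexx.
have NN : Np (vN 0).
  have [s e] := hS _ topN; exists rN => //.
  have [L L0 hL] := hlip (vN 0).
  have hh t : 0 <= t <= rN -> `|h ((S (vN 0)).1 t) - h (vN t)| <= L * `|(S (vN 0)).1 t - vN t|.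
    move=> ht; have t0 : 0 <= t by case/andP: ht.
    apply: hL; last exact: (radsol_le_top hlip hpos solN topN t0).
    by have := radsol_le_top hlip hpos s _ t0; rewrite e => /(_ topN).
  by rewrite (radsol_unique (isT : (0 < d.+3)%N) (ltW L0) s solN hh e (r := rN))// rN0 lexx.
have [al [bal nP nN]] : exists al : R, [/\ b <= al, ~ Pp al & ~ Np al].
  exact: (open_disjoint_gap topN Pb NN Popen Nopen disj).
have [s e] := hS al bal.
exists (S al).1, (S al).2; have top : b <= (S al).1 0 by rewrite e.
have nonneg r : 0 <= r -> 0 <= (S al).1 r.
  by move=> r0; rewrite leNgt; apply/negP => k; apply: nN; exists r.
split => // r r0; last by rewrite leNgt; apply/negP => k; apply: nP; exists r.
(* A zero of the nonnegative solution would be a minimum, hence a critical point with value 0. *)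
rewrite lt_neqAle nonneg// andbT; apply/eqP => v0.
have {}r0 : 0 < r.
  by rewrite lt_neqAle r0 andbT; apply/eqP => k; move: top; rewrite k -v0; lra.
have dc : drv (S al).1 r ((S al).2 r) by case: s.
apply: (no_bottom s top r0); first by rewrite -v0.
apply: (drv_min0 dc (a := 0) (b := r + 1)); first by rewrite r0 ltrDl ltr01.
by move=> t /andP[/ltW/nonneg + _]; rewrite -v0.
Qed.

End Shooting.

(** * The Pohozaev identity *)

(** [x] will be the radius at half the height, with x^2 at least N al/h(al), and [r] the radius at a
    fixed level, with r^2 at most C al^(1-q). Their ratio squared is then of order at least
    al^q/h(al). *)
Lemma radius_ratio {R : realType} (N al ha yq y C x r : R) : 0 < N -> 0 < ha -> 0 <= yq -> 1 <= y ->
  al = y * yq -> 0 < C -> 0 <= r -> N * al / ha <= x ^+ 2 -> r ^+ 2 <= C * y ->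
  N / (2 * (C + 1)) * (yq / ha) <= (x / (r + 1)) ^+ 2.
Proof.
move=> N0 ha0 yq0 y1 -> C0 r0 hx hr.
have R2 : (r + 1) ^+ 2 <= 2 * (C + 1) * y.
  have : (r + 1) ^+ 2 <= 2 * (r ^+ 2 + 1).
    by have := sqr_ge0 (r - 1); rewrite !expr2 => k; lra.
  lra.
rewrite expr_div_n ler_pdivlMr; last by apply: exprn_gt0; lra.
apply: le_trans hx.
apply: (@le_trans _ _ (N / (2 * (C + 1)) * (yq / ha) * (2 * (C + 1) * y))).
  apply: ler_wpM2l => //; apply: mulr_ge0; first by apply: divr_ge0; lra.
  by apply: divr_ge0 => //; exact: ltW.
rewrite le_eqVlt; apply/orP; left; apply/eqP.
by field; rewrite !gt_eqF//; lra.
Qed.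

Lemma powR_split {R : realType} (x : R) (q : R) : 0 <= x -> x = x `^ (1 - q) * x `^ q.
Proof.
by move=> x0; rewrite -powRD ?subrK ?powRr1//; apply/implyP; rewrite oner_eq0.
Qed.

Section Pohozaev.
Context {R : realType}.
Variables (d : nat) (h dh : R -> R) (b q Q M0 : R).
Let n : R := d.+3%:R.
Hypothesis b0 : 0 < b.
Hypothesis h0 : forall v : R, v <= 0 -> h v = 0.
Hypothesis hlip : forall A : R, exists2 L : R, 0 < L & forall x y : R, x <= A -> y <= A ->
  `|h x - h y| <= L * `|x - y|.
Hypothesis hneg : forall l : R, 0 < l < b -> h l < 0.
Hypothesis hpos : forall l : R, b < l -> 0 < h l.
Hypothesis hdh : forall l : R, b < l -> drv h l (dh l).
Hypothesis bM0 : b < M0.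
Hypothesis q01 : 0 < q < 1.
Hypothesis hg : forall l : R, M0 <= l -> q <= l * dh l / h l <= Q.
Hypothesis subcritical : Q * (n - 2) - 2 < q * n.
Local Notation H := (potential h).

Let n3 : 3 <= n.
Proof. by rewrite /n ler_nat. Qed.

Let Q0 : 0 < Q.
Proof. by have := hg (lexx M0); have := q01; lra. Qed.

(** The elasticity is the derivative of ln h with respect to ln l, so its bounds integrate to bounds
    on increments. *)
Lemma growth_log (x y : R) : M0 <= x -> x <= y ->
  q * (ln y - ln x) <= ln (h y) - ln (h x) <= Q * (ln y - ln x).
Proof.
move=> Mx xy; have B0 := b0; have B1 := bM0.
have dl (c t : R) : M0 <= t -> drv (fun t : R => ln (h t) - c * ln t) t ((t * dh t / h t - c) / t).
  move=> Mt; have ht : 0 < h t by apply: hpos; lra.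
  have k := hdh (l := t) ltac:(lra).
  apply: drv_eq; first by apply: drvD; [apply: drv_ln; [exact: k|exact: ht]|apply: drvN; apply: drvM; [exact: drvC|apply: drv_ln; [exact: drvI|lra]]].
  rewrite /=; field; rewrite !gt_eqF//; lra.
apply/andP; split.
- have : ln (h x) - q * ln x <= ln (h y) - q * ln y.
    apply: (@drv_ge0_le _ (fun t => ln (h t) - q * ln t) (fun t => (t * dh t / h t - q) / t)) => // t ht.
    - by apply: drv_cont (dl q t _); lra.
    - by apply: dl; lra.
    apply: divr_ge0; last lra.
    by have := hg (l := t) ltac:(lra); lra.
  by rewrite mulrBr; lra.
- have : ln (h y) - Q * ln y <= ln (h x) - Q * ln x.
    apply: (@drv_le0_ge _ (fun t => ln (h t) - Q * ln t) (fun t => (t * dh t / h t - Q) / t)) => // t ht.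
    - by apply: drv_cont (dl Q t _); lra.
    - by apply: dl; lra.
    rewrite -oppr_ge0 -mulNr; apply: divr_ge0; last lra.
    by have := hg (l := t) ltac:(lra); lra.
  by rewrite mulrBr; lra.
Qed.

Let hgt (x : R) : M0 <= x -> 0 < h x.
Proof. by have B1 := bM0 => k; apply: hpos; lra. Qed.

Lemma h_mono (x y : R) : M0 <= x -> x <= y -> h x <= h y.
Proof.
move=> Mx xy; have B0 := b0; have B1 := bM0; have B2 := q01.
have := growth_log Mx xy => /andP[k _].
have : ln x <= ln y by rewrite ler_ln ?posrE; lra.
rewrite -subr_ge0 => k1.
have : 0 <= q * (ln y - ln x) by apply: mulr_ge0 => //; lra.
by rewrite -ler_ln ?posrE ?hgt//; lra.
Qed.

Lemma h_half (x : R) : M0 <= x / 2 -> h x <= 2 `^ Q * h (x / 2).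
Proof.
move=> Mx; have B0 := b0; have B1 := bM0; have k1 : 0 < h (x / 2) by exact: hgt.
have k2 : 0 < h x by apply: hgt; lra.
rewrite -ler_ln ?posrE ?mulr_gt0 ?powR_gt0// lnM ?posrE ?powR_gt0// ln_powR.
have [|_] := andP (growth_log Mx (y := x) _); first lra.
have -> : ln (x / 2) = ln x - ln 2 by rewrite ln_div ?posrE; lra.
have -> : Q * (ln x - (ln x - ln 2)) = Q * ln 2 by ring.
lra.
Qed.

Lemma h_power : exists2 c, 0 < c & forall l : R, M0 <= l -> c * l `^ q <= h l.
Proof.
have B0 := b0; have B1 := bM0.
have M1 : 0 < h M0 by exact: hgt.
exists (h M0 / M0 `^ q); first by rewrite divr_gt0 ?powR_gt0//; lra.
move=> l Ml; have l0 : 0 < l by lra.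
rewrite -ler_ln ?posrE ?hgt// ?mulr_gt0 ?invr_gt0 ?powR_gt0//; try lra.
rewrite lnM ?ln_div ?posrE ?divr_gt0 ?powR_gt0//; try lra.
by rewrite !ln_powR; have := growth_log (lexx M0) Ml; rewrite mulrBr; lra.
Qed.

(** The integrand of the Pohozaev identity; its sign at large values expresses subcriticality. *)
Definition poho (v : R) := n * H v - (n - 2) / 2 * (v * h v).

(** [de] is determined by n = ((n-2)/2 + de)(1 + Q). It makes the derivative of poho - de v h a
    positive multiple of Q minus the elasticity, and it is positive exactly when Q is below
    (n+2)/(n-2). *)
Let ka := (n + 2 - (n - 2) * Q) / 2.
Let de := ka / (1 + Q).

Let de0 : 0 < de.
Proof.
have q1 := q01; have N3 := n3; have S := subcritical; have Q1 := Q0.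
rewrite /de divr_gt0 ?addr_gt0// /ka; have : q * n <= n by rewrite ler_piMl//; lra.
by move: S; rewrite [Q * _]mulrC; move: (q * n) ((n - 2) * Q) => x y; lra.
Qed.

(** poho - de v h is nondecreasing beyond [M0], hence bounded below there. The bound is absorbed by
    half of de v h, which grows at least linearly. *)
Lemma poho_above : exists2 M, M0 <= M & forall v, M <= v -> de / 2 * (v * h v) <= poho v.
Proof.
have B0 := b0; have B1 := bM0; have D0 := de0; have Q1 := Q0; have N3 := n3.
pose F (v : R) := poho v - de * (v * h v).
have dF v : M0 <= v -> drv F v (h v * ((n - 2) / 2 + de) * (Q - v * dh v / h v)).
  move=> Mv; have k1 := hdh (l := v) ltac:(lra); have k2 := drv_H hlip v.
  have hv : h v != 0 by rewrite gt_eqF// hgt.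
  rewrite /F /poho; apply: drv_eq; first by apply: drvD; [apply: drvD; [apply: drvM; [exact: drvC|exact: k2]|apply: drvN; apply: drvM; [exact: drvC|apply: drvM; [exact: drvI|exact: k1]]]|apply: drvN; apply: drvM; [exact: drvC|apply: drvM; [exact: drvI|exact: k1]]].
  rewrite /= /de /ka; move: (n) => N; field; rewrite hv gt_eqF//; lra.
have Fmono v : M0 <= v -> F M0 <= F v.
  move=> Mv; apply: (@drv_ge0_le _ F (fun v => h v * ((n - 2) / 2 + de) * (Q - v * dh v / h v)) M0 v Mv) => t ht.
  - by apply: drv_cont (dF t _); lra.
  - by apply: dF; lra.
  apply: mulr_ge0; last by have := hg (l := t) ltac:(lra); lra.
  apply: mulr_ge0; first by apply: ltW; apply: hgt; lra.
  by lra.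
have hM : 0 < h M0 by exact: hgt.
have den : 0 < de / 2 * h M0 by apply: mulr_gt0 => //; lra.
exists (M0 + `|F M0| / (de / 2 * h M0)); first by rewrite lerDl divr_ge0// ltW.
move=> v Mv; have Fn : 0 <= `|F M0| / (de / 2 * h M0) by rewrite divr_ge0// ltW.
have {}Mv' : M0 <= v by lra.
have k1 := Fmono v Mv'; have k2 := h_mono (lexx M0) Mv'.
have k3 : `|F M0| <= de / 2 * (v * h v).
  apply: (@le_trans _ _ (v * (de / 2 * h M0))).
    by rewrite -ler_pdivrMr//; lra.
  rewrite [leRHS]mulrCA; apply: ler_wpM2l; first lra.
  by apply: ler_wpM2l => //; lra.
move: k1 k3; have := ler_norm (- F M0); rewrite normrN.
by rewrite {4}/F; move: (v * h v) (poho v) (F M0) => x y z; lra.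
Qed.

Lemma poho_below (M : R) : 0 <= M -> (forall v, M <= v -> 0 <= poho v) ->
  exists2 C, 0 <= C & forall v, - C <= poho v.
Proof.
move=> M1 hM; have cp (t : R) : {for t, continuous poho}.
  have c1 : {for t, continuous H} := drv_cont (drv_H hlip t).
  have c2 : {for t, continuous h} := h_cont hlip (x := t).
  apply: contD; first by apply: contM => //; exact: contC.
  by apply: contN; apply: contM; [exact: contC|apply: contM => //; exact: contI].
have [t _|C C0 hC] := @bounded_seg _ poho 0 M M1; first exact: cp.
exists C; [exact: ltW|move=> v]; have [v0|v0] := leP v 0.
  by rewrite /poho (h0 v0) (H_le0 h0 hlip v0) !mulr0 subrr oppr_le0 ltW.
have [Mv|vM] := leP M v; first by apply: le_trans (hM v Mv); rewrite oppr_le0 ltW.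
by have := hC v ltac:(lra); rewrite ler_norml => /andP[].
Qed.

Section Solution.
Variables (v dv : R -> R) (al : R).
Hypothesis sol : radsol d.+3 h v dv.
Hypothesis v0 : v 0 = al.

Let hv r : drv v r (dv r). Proof. by case: sol. Qed.
Let dv0 : dv 0 = 0. Proof. by case: sol. Qed.
Let cdv r : {for r, continuous dv}. Proof. by case: sol => _ _ c _; exact: c. Qed.
Let cv r : {for r, continuous v}. Proof. exact: drv_cont (hv r). Qed.

Lemma descent_slope_lt0 r : 0 < r -> (forall t, 0 < t < r -> b < v t) -> dv r < 0.
Proof.
move=> r0 hr.
suff : r ^+ d.+2 * dv r < 0 by rewrite pmulr_rlt0// exprn_gt0.
have <- : (0 : R) ^+ d.+2 * dv 0 = 0 by rewrite expr0n mul0r.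
apply: (@drv_lt0_gt _ (fun r : R => r ^+ d.+2 * dv r) (fun r => - (r ^+ d.+2 * h (v r)))) => // t ht.
- exact: (flux_cont sol).
- by apply: (drv_flux sol); lra.
- rewrite oppr_lt0; apply: mulr_gt0; first by apply: exprn_gt0; lra.
  by apply: hpos; apply: hr.
Qed.

Lemma descent_mono r t : (forall t, 0 < t < r -> b < v t) -> 0 <= t -> t <= r -> v r <= v t.
Proof.
move=> hr t0 tr; apply: (@drv_le0_ge _ v dv) => // s hs.
apply: ltW; apply: descent_slope_lt0; first lra.
by move=> x hx; apply: hr; lra.
Qed.

(** As [v] decreases, h(v(t)) is at least h(v(r)) on the way, so the flux falls at least to -h(v(r))
    r^n/n. *)
Lemma descent_le r : 0 < r -> (forall t, 0 <= t <= r -> M0 <= v t) -> dv r <= - (r * h (v r) / n).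
Proof.
move=> r0 hr; have B1 := bM0; have hb t : 0 < t < r -> b < v t by move=> ht; have := hr t ltac:(lra); lra.
pose F (t : R) := t ^+ d.+2 * dv t + h (v r) * t ^+ d.+3 / n.
have N3 := n3.
suff : F r <= F 0.
  rewrite /F dv0 [0 ^+ d.+3]expr0n !mulr0 mul0r add0r (exprS r d.+2) => k.
  rewrite -(ler_pM2l (exprn_gt0 d.+2 r0)); move: k.
  have -> : h (v r) * (r * r ^+ d.+2) / n = r ^+ d.+2 * (r * h (v r) / n) by field; rewrite gt_eqF; lra.
  by move=> k; rewrite mulrN -subr_le0 opprK.
apply: (@drv_le0_ge _ F (fun t => t ^+ d.+2 * (h (v r) - h (v t)))); first exact: ltW.
- move=> t _; apply: contD; first exact: (flux_cont sol).
  by apply: contM; [apply: contM; [exact: contC|apply: contX; exact: contI]|exact: contC].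
- move=> t ht; have t0 : 0 < t by lra.
  apply: drv_eq; first by apply: drvD; [apply: (drv_flux sol t0)|apply: drvM; [apply: drvM; [exact: drvC|apply: drvX; exact: drvI]|exact: drvC]].
  by rewrite -/n /=; field; rewrite gt_eqF; lra.
- move=> t ht; apply: mulr_ge0_le0; first by apply: exprn_ge0; lra.
  rewrite subr_le0; apply: h_mono; first by apply: hr; lra.
  by apply: descent_mono => //; lra.
Qed.

Lemma descent_ge r : M0 <= al -> 0 < r -> (forall t, 0 <= t <= r -> M0 <= v t) -> - (r * h al / n) <= dv r.
Proof.
move=> Mal r0 hr; have B1 := bM0.
pose F (t : R) := t ^+ d.+2 * dv t + h al * t ^+ d.+3 / n.
have N3 := n3.
suff : F 0 <= F r.
  rewrite /F dv0 [0 ^+ d.+3]expr0n !mulr0 mul0r add0r (exprS r d.+2) => k.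
  rewrite -(ler_pM2l (exprn_gt0 d.+2 r0)); move: k.
  have -> : h al * (r * r ^+ d.+2) / n = r ^+ d.+2 * (r * h al / n) by field; rewrite gt_eqF; lra.
  by move=> k; rewrite mulrN -subr_ge0 opprK.
apply: (@drv_ge0_le _ F (fun t => t ^+ d.+2 * (h al - h (v t)))); first exact: ltW.
- move=> t _; apply: contD; first exact: (flux_cont sol).
  by apply: contM; [apply: contM; [exact: contC|apply: contX; exact: contI]|exact: contC].
- move=> t ht; have t0 : 0 < t by lra.
  apply: drv_eq; first by apply: drvD; [apply: (drv_flux sol t0)|apply: drvM; [apply: drvM; [exact: drvC|apply: drvX; exact: drvI]|exact: drvC]].
  by rewrite -/n /=; field; rewrite gt_eqF; lra.
- move=> t ht; apply: mulr_ge0; first by apply: exprn_ge0; lra.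
  rewrite subr_ge0; apply: h_mono; first by apply: hr; lra.
  rewrite -v0; apply: descent_mono => //; last lra.
  by move=> x hx; have := hr x ltac:(lra); lra.
Qed.

(** As long as [v] is above [l], its slope is at most -h(l)/n from radius 1 on, so the level is
    reached. *)
Lemma descent_level (l : R) : M0 <= l -> l < al -> exists2 r, 0 < r & v r = l /\ forall t, 0 <= t <= r -> l <= v t.
Proof.
move=> Ml lal; have B0 := b0; have B1 := bM0; have N3 := n3; have M1 := hgt Ml.
have [T T0 vT] : exists2 T, 0 <= T & v T <= l.
  apply: contrapT => nex; have gt r : 0 <= r -> l < v r.
    by move=> r0; rewrite ltNge; apply/negP => k; apply: nex; exists r.
  apply: (@slope_absurd _ d h v dv sol 1 (h l / n)) => //; first by apply: divr_gt0 => //; lra.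
    by move=> r r1; have := gt r ltac:(lra); lra.
  move=> r r1; have gM t : 0 <= t <= r -> M0 <= v t by move=> ht; have := gt t ltac:(lra); lra.
  apply: le_trans (descent_le _ gM) _; first lra.
  have k : h l <= h (v r) by apply: h_mono => //; apply: ltW; apply: gt; lra.
  rewrite lerN2; apply: ler_wpM2r; first by rewrite invr_ge0; lra.
  by apply: (le_trans k); rewrite ler_peMl//; apply: le_trans k; exact: ltW.
have [|t _|||c hc [fc hc']] := @first_zero _ (fun t => l - v t) 0 T; first lra.
- by apply: contD; [exact: contC|apply: contN; exact: cv].
- by rewrite v0; lra.
- lra.
exists c; first by rewrite lt_neqAle; apply/andP; split; [apply/eqP => e; move: fc; rewrite -e|]; lra.
split; first lra.
move=> t ht; have [tc|tc] := ltP t c; last by have -> : t = c by [lra]; lra.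
by have := hc' t ltac:(lra); lra.
Qed.

(** The slope bound of [descent_ge] integrates to v(r) >= al - h(al) r^2/(2n): the descent to half
    the height cannot be fast. *)
Lemma half_radius r : M0 <= al -> 0 < r -> (forall t, 0 <= t <= r -> M0 <= v t) -> v r = al / 2 ->
  n * al / h al <= r ^+ 2.
Proof.
move=> Mal r0 hr vr; have N3 := n3; have n0 : 0 < n by lra.
have hal0 := hgt Mal.
have k : v 0 + h al * 0 ^+ 2 / (2 * n) <= v r + h al * r ^+ 2 / (2 * n).
  apply: (@drv_ge0_le _ (fun t => v t + h al * t ^+ 2 / (2 * n)) (fun t => dv t + t * h al / n)) => [|t _|t ht|t ht].
  - exact: ltW.
  - apply: contD => //; apply: contM; [|exact: contC].
    by apply: contM; [exact: contC|apply: contX; exact: contI].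
  - have k := hv t.
    apply: drv_eq; first by apply: drvD; [exact: k|apply: drvM; [apply: drvM; [exact: drvC|apply: drvX; exact: drvI]|exact: drvC]].
    by rewrite /= expr1; field; rewrite gt_eqF.
  - rewrite -lerBlDr sub0r; apply: descent_ge => //; first by case/andP: ht.
    by move=> s hs; apply: hr; lra.
move: k; rewrite v0 vr expr0n mulr0 mul0r addr0 => k.
rewrite ler_pdivrMr// [leRHS]mulrC.
have : al / 2 <= h al * r ^+ 2 / (2 * n) by move: k; move: (_ / (2 * n)) => X; lra.
by rewrite ler_pdivlMr; [have -> : al / 2 * (2 * n) = n * al by field|lra].
Qed.

(** The slope bound with h(v) >= c v^q makes v^(1-q) + c (1-q) r^2/(2n) nonincreasing. For q < 1 the
    first summand is nonnegative and starts at al^(1-q), which limits the radius. *)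
Lemma level_radius c r : 0 < c -> (forall l : R, M0 <= l -> c * l `^ q <= h l) -> 0 < r ->
  (forall t, 0 <= t <= r -> M0 <= v t) -> r ^+ 2 <= 2 * n / (c * (1 - q)) * al `^ (1 - q).
Proof.
move=> c0 hc r0 hr; have N3 := n3; have n0 : 0 < n by lra.
have B0 := b0; have B1 := bM0; have B2 := q01.
have cq : 0 < c * (1 - q) by apply: mulr_gt0 => //; lra.
pose F (t : R) := v t `^ (1 - q) + c * (1 - q) * t ^+ 2 / (2 * n).
have vpos t : 0 <= t <= r -> 0 < v t by move=> ht; have := hr t ht; lra.
have dF t : 0 <= t <= r -> drv F t ((1 - q) * (dv t / v t `^ q + c * t / n)).
  move=> ht; have k := hv t; have vt := vpos t ht.
  have vq : 0 < v t `^ q by exact: powR_gt0.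
  apply: drv_eq; first by apply: drvD; [apply: drv_powR; [exact: k|exact: vt]|apply: drvM; [apply: drvM; [exact: drvC|apply: drvX; exact: drvI]|exact: drvC]].
  have -> : 1 - q - 1 = - q by ring.
  rewrite powRN /= expr1; move: (v t `^ q) vq => y y0.
  by field; rewrite !gt_eqF.
have : F r <= F 0.
  apply: (@drv_le0_ge _ F (fun t => (1 - q) * (dv t / v t `^ q + c * t / n))) => [|t ht|t ht|t ht]; first exact: ltW.
  - by apply: drv_cont (dF t ht).
  - by apply: dF; lra.
  - apply: mulr_ge0_le0; first lra.
    have vt := vpos t ltac:(lra); have vq : 0 < v t `^ q by exact: powR_gt0.
    have k1 : dv t <= - (t * h (v t) / n).
      by apply: descent_le; [lra|move=> s hs; apply: hr; lra].
    have k2 := hc (v t) (hr t ltac:(lra)).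
    have k3 : dv t / v t `^ q <= - (c * t / n).
      rewrite ler_pdivrMr//; apply: (le_trans k1); rewrite mulNr lerN2.
      have -> : c * t / n * v t `^ q = t * (c * v t `^ q) / n by field; rewrite gt_eqF.
      by apply: ler_wpM2r; [rewrite invr_ge0 ltW|apply: ler_wpM2l => //; lra].
    by move: k3; move: (_ / v t `^ q) (c * t / n) => X Y; lra.
have p1 : 0 <= v r `^ (1 - q) by exact: powR_ge0.
rewrite /F v0 expr0n mulr0 mul0r addr0 => k.
have : c * (1 - q) * r ^+ 2 / (2 * n) <= al `^ (1 - q) by apply: le_trans k; rewrite lerDr.
rewrite ler_pdivrMr; last lra.
rewrite -ler_pdivlMl// => /le_trans; apply; rewrite le_eqVlt; apply/orP; left; apply/eqP.
by field; rewrite !gt_eqF//; lra.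
Qed.

(* The Pohozaev function: its derivative is [r^(n-1) poho (v r)]. *)
Definition pfun (r : R) := r ^+ d.+3 * energy h v dv r + (n - 2) / 2 * (r ^+ d.+2 * (v r * dv r)).

Lemma drv_pfun r : 0 < r -> drv pfun r (r ^+ d.+2 * poho (v r)).
Proof.
move=> r0; have k1 := drv_energy hlip sol r0; have k2 := hv r.
have k3 : drv dv r (- (n - 1) / r * dv r - h (v r)) by case: sol => _ _ _; apply.
rewrite /pfun; apply: drv_eq.
  apply: drvD; first by apply: drvM; [apply: drvX; exact: drvI|exact: k1].
  by apply: drvM; [exact: drvC|apply: drvM; [apply: drvX; exact: drvI|apply: drvM; [exact: k2|exact: k3]]].
have -> : d.+2%:R = n - 1 by rewrite /n -[in RHS]natr1 addrK.
rewrite /energy /poho /= -/n !exprS; move: (n) (potential h (v r)) (h (v r)) (dv r) (v r) (r ^+ d) => N x1 x2 x3 x4 x5.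
by field; rewrite gt_eqF.
Qed.

Lemma pfun_cont r : {for r, continuous pfun}.
Proof.
apply: contD; first by apply: contM; [apply: contX; exact: contI|exact: (energy_cont hlip sol)].
apply: contM; first exact: contC.
by apply: contM; [apply: contX; exact: contI|apply: contM].
Qed.

Lemma pfun0 : pfun 0 = 0.
Proof. by rewrite /pfun !exprS !mul0r mulr0 addr0. Qed.

Lemma pfun_lower x y c : 0 <= x -> x <= y -> (forall t, x < t < y -> c <= poho (v t)) ->
  pfun x - c * x ^+ d.+3 / n <= pfun y - c * y ^+ d.+3 / n.
Proof.
move=> x0 xy hc; have N3 := n3.
apply: (@drv_ge0_le _ (fun t => pfun t - c * t ^+ d.+3 / n) (fun t => t ^+ d.+2 * (poho (v t) - c))) => //.
- move=> t _; apply: contD; first exact: pfun_cont.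
  by apply: contN; apply: contM; [apply: contM; [exact: contC|apply: contX; exact: contI]|exact: contC].
- move=> t ht; apply: drv_eq.
    apply: drvD; first by apply: drv_pfun; lra.
    by apply: drvN; apply: drvM; [apply: drvM; [exact: drvC|apply: drvX; exact: drvI]|exact: drvC].
  by rewrite -/n /=; field; rewrite gt_eqF; lra.
- by move=> t ht; apply: mulr_ge0; [apply: exprn_ge0; lra|have := hc t ht; lra].
Qed.

(** Up to half the height [poho] is at least a fixed multiple of al h(al), thanks to [h_half];
    integrating r^(n-1) produces the factor r^n/n. *)
Lemma pfun_half M r : M0 <= M -> (forall v, M <= v -> de / 2 * (v * h v) <= poho v) -> M <= al / 2 ->
  0 < r -> (forall t, 0 <= t <= r -> al / 2 <= v t) ->
  de / 4 / 2 `^ Q / n * (al * h al) * r ^+ d.+3 <= pfun r.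
Proof.
move=> MM hM Mal r0 hr; have n0 : 0 < n by have := n3; lra.
have M0p : 0 < M0 by have := b0; have := bM0; lra.
have p2 : 0 < 2 `^ Q :> R by exact: powR_gt0.
have D0 := de0; move: (D0) hM; move: (de) => D D1 hM.
have k := @pfun_lower 0 r (n * (D / 4 / 2 `^ Q / n * (al * h al))) (lexx 0) (ltW r0).
rewrite pfun0 [0 ^+ d.+3]expr0n mulr0 mul0r subr0 in k.
have -> : D / 4 / 2 `^ Q / n * (al * h al) * r ^+ d.+3 = n * (D / 4 / 2 `^ Q / n * (al * h al)) * r ^+ d.+3 / n.
  by field; rewrite !gt_eqF.
rewrite -subr_ge0; apply: k => t /andP[t1 t2]; have k1 : al / 2 <= v t by apply: hr; rewrite (ltW t1) (ltW t2).
have Mv : M <= v t by exact: le_trans Mal k1.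
have Ma2 : M0 <= al / 2 by exact: le_trans MM Mal.
apply: le_trans (hM (v t) Mv).
have k2 : h (al / 2) <= h (v t) by exact: h_mono.
have k3 : h al / 2 `^ Q <= h (al / 2) by rewrite ler_pdivrMr// mulrC; exact: h_half.
have -> : n * (D / 4 / 2 `^ Q / n * (al * h al)) = D / 2 * (al / 2 * (h al / 2 `^ Q)).
  by field; rewrite !gt_eqF.
apply: ler_wpM2l; first by apply: divr_ge0 => //; exact: ltW.
apply: ler_pM => //.
- by apply: le_trans Ma2; exact: ltW.
- by apply: divr_ge0; [apply: ltW; apply: hgt; lra|exact: ltW].
- exact: le_trans k3 k2.
Qed.

Lemma H_le_norm M x : b < M -> 0 <= x <= M -> H x <= `|H M|.
Proof.
move=> bM /andP[]; rewrite le_eqVlt => /predU1P[<- _|x0 xM].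
  by rewrite (H_le0 h0 hlip (lexx 0)).
have [xb|bx] := leP x b.
  by apply: (@le_trans _ _ 0) => //; apply: ltW; apply: (H_lt0 hlip hneg); rewrite x0.
apply: le_trans (ler_norm _); move: xM; rewrite le_eqVlt => /predU1P[->//|xM].
by apply: ltW; apply: (H_incr hlip hpos (ltW bx)).
Qed.

(** While [v] is nonnegative and nonincreasing the term in v v' of [pfun] is nonpositive, so [pfun]
    is at most r^n times the energy. *)
Lemma pfun_energy C0 K r : 0 <= C0 -> 0 < r -> K <= pfun r + C0 * r ^+ d.+3 / n -> 0 <= v r -> dv r <= 0 ->
  K / r ^+ d.+3 <= energy h v dv r + C0 / n.
Proof.
move=> C00 r0 k3 vr dr; have N3 := n3.
have k4 : (n - 2) / 2 * (r ^+ d.+2 * (v r * dv r)) <= 0.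
  apply: mulr_ge0_le0; first lra.
  apply: mulr_ge0_le0; first by apply: exprn_ge0; exact: ltW.
  exact: mulr_ge0_le0.
rewrite ler_pdivrMr ?exprn_gt0// mulrC mulrDr.
have -> : r ^+ d.+3 * (C0 / n) = C0 * r ^+ d.+3 / n by rewrite mulrCA mulrA.
by apply: (le_trans k3); rewrite lerD2r /pfun gerDl.
Qed.

Lemma energy_late C0 K rM r : 0 <= C0 -> (forall x, - C0 <= poho x) -> 0 < rM -> 0 <= K -> K <= pfun rM ->
  rM <= r <= rM + 1 -> 0 <= v r -> dv r <= 0 -> K / (rM + 1) ^+ d.+3 <= energy h v dv r + C0 / n.
Proof.
move=> C00 hC rM0 K0 KP /andP[r1 r2] vr dr; have r0 : 0 < r by exact: lt_le_trans r1.
apply: (@le_trans _ _ (K / r ^+ d.+3)).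
  apply: ler_wpM2l => //; rewrite lef_pV2 ?posrE ?exprn_gt0// ?(lt_le_trans r0)//.
  by apply: lerXn2r; rewrite ?nnegrE ?(ltW r0)// ltW// (lt_le_trans r0).
apply: pfun_energy => //.
have := @pfun_lower rM r (- C0) (ltW rM0) r1 (fun t _ => hC (v t)).
have k1 : 0 <= C0 * rM ^+ d.+3 / n by rewrite divr_ge0// mulr_ge0// exprn_ge0// ltW.
by rewrite !mulNr !opprK; move: KP k1; move: (_ / n) (_ / n) (pfun r) (pfun rM) => y1 y2 z t; lra.
Qed.

(** If [v] stayed nonnegative, the energy left after radius [rM] would exceed |H(M)| by at least
    (M+1)^2/2, forcing slopes at most -(M+1) on an interval of length 1. Starting from the value
    [M], the solution would become negative. *)
Lemma crossing (M C0 K rM : R) : M0 <= M -> 0 <= C0 -> (forall x, - C0 <= poho x) ->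
  0 < rM -> v rM = M -> (forall t, 0 < t < rM -> b < v t) -> 0 <= K -> K <= pfun rM ->
  C0 / n + `|H M| + (M + 1) ^+ 2 / 2 <= K / (rM + 1) ^+ d.+3 ->
  exists2 r, 0 <= r & v r < 0.
Proof.
move=> MM C00 hC rM0 vM hb K0 KP hK; apply: contrapT => nex.
have bM : b < M by exact: lt_le_trans MM.
have M0p : 0 < M by exact: lt_trans bM.
have nn r : 0 <= r -> 0 <= v r by move=> r0; rewrite leNgt; apply/negP => k; apply: nex; exists r.
have Elow r : rM <= r <= rM + 1 -> dv r <= 0 -> v r <= M -> (M + 1) ^+ 2 <= dv r ^+ 2.
  move=> hr dr vr; have r0 : 0 <= r by case/andP: hr => k _; exact: le_trans (ltW rM0) k.
  have vM' : 0 <= v r <= M by rewrite nn.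
  have := le_trans hK (energy_late C00 hC rM0 K0 KP hr (nn r r0) dr); have := H_le_norm bM vM'.
  rewrite /energy; move: (H (v r)) `|H M| (C0 / n) (dv r ^+ 2) ((M + 1) ^+ 2) => x1 x2 x3 x4 x5; lra.
have dM : dv rM < 0 by exact: descent_slope_lt0.
have M1 : 0 < (M + 1) ^+ 2 by rewrite exprn_gt0// ltr_pwDr// ltW.
have decr c : rM <= c -> (forall t, rM < t < c -> dv t <= 0) -> v c <= M.
  move=> rc hc; rewrite -vM; apply: (@drv_le0_ge _ v dv) => // t _; exact: cv.
have dlt r : rM <= r <= rM + 1 -> dv r < 0.
  move=> /andP[r1 r2]; rewrite ltNge; apply/negP => dr.
  have [t _|c /andP[c1 c2] [fc hc']] := @first_zero _ dv rM r r1 _ dM dr; first exact: cdv.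
  have vc : v c <= M by apply: decr => [|t /andP[t1 t2]]; [exact: ltW|apply/ltW/hc'; rewrite (ltW t1)].
  have := Elow c; rewrite (ltW c1) (le_trans c2 r2) fc => /(_ isT (lexx 0) vc).
  by rewrite expr0n /= leNgt M1.
have dle r : rM < r < rM + 1 -> dv r <= - (M + 1).
  move=> /andP[r1 r2]; have hr : rM <= r <= rM + 1 by rewrite !ltW.
  have dr := dlt r hr.
  have vr : v r <= M.
    by apply: decr => [|t /andP[t1 t2]]; [exact: ltW|apply/ltW/dlt; rewrite (ltW t1) ltW// (lt_trans t2)].
  have := Elow r hr (ltW dr) vr; rewrite -[dv r ^+ 2]sqrrN ler_pXn2r ?nnegrE ?oppr_ge0 ?(ltW dr) ?addr_ge0 ?(ltW M0p)//.
  by rewrite lerNr.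
have [|t _|t _|c hc e] := @mvt _ v dv rM (rM + 1); [by rewrite ltrDl|exact: cv|exact: hv|].
have := nn (rM + 1) (addr_ge0 (ltW rM0) ler01); have := dle c hc; move: e; rewrite vM addrAC subrr add0r mulr1.
by move: (dv c) (v _) => x y; lra.
Qed.

End Solution.

(** As h(al) is at most of order al^Q, the right side grows at least like al to the power 2 + q n -
    Q (n-2), which is positive by subcriticality. Writing [al] as an exponential makes all powers
    linear. *)
Lemma amplitude (B c3 c4 A : R) : 0 < c3 -> 0 < c4 -> exists2 al, A <= al &
  1 <= al /\ B <= (c3 * (al * h al)) ^+ 2 * (c4 * (al `^ q / h al)) ^+ d.+3.
Proof.
move=> c30 c40; have B0 := b0; have B1 := bM0; have N3 := n3; have S := subcritical.
pose g := 2 + q * n - Q * (n - 2); have g0 : 0 < g by rewrite /g; lra.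
pose c5 := ln (h M0) - Q * ln M0.
pose c6 := 2 * ln c3 + n * ln c4 - (n - 2) * c5.
have [x [x1 k2]] : exists x, `|A| + M0 + 1 <= x /\ `|B| + `|c6| <= g * x.
  exists ((`|B| + `|c6|) / g + (`|A| + M0 + 1)).
  have t1 : 0 <= (`|B| + `|c6|) / g by apply: divr_ge0; [exact: addr_ge0|exact: ltW].
  have A0 := normr_ge0 A; split; first lra.
  rewrite mulrDr mulrCA divff ?gt_eqF// mulr1 lerDl; apply: mulr_ge0; first exact: ltW.
  lra.
have A0 := normr_ge0 A; have xe : x <= expR x by apply: le_trans (expR_ge1Dx x); lra.
exists (expR x); first by have := ler_norm A; lra.
split; first lra.
have Mx : M0 <= expR x by lra.
have hx := hgt Mx; set y := ln (h (expR x)).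
have hE : h (expR x) = expR y by rewrite lnK// posrE.
have k1 : y <= Q * x + c5.
  by have /andP[_] := growth_log (lexx M0) Mx; rewrite expRK -/y /c5 mulrBr; lra.
have -> : (c3 * (expR x * h (expR x))) ^+ 2 * (c4 * (expR x `^ q / h (expR x))) ^+ d.+3 =
    expR (2 * (ln c3 + (x + y)) + n * (ln c4 + (q * x - y))).
  rewrite expRD /n !expRM_natl; congr (_ ^+ _ * _ ^+ _).
    by rewrite expRD lnK ?posrE// expRD hE.
  rewrite expRD lnK ?posrE// expRD expRN hE; congr (_ * (_ * _)).
  by rewrite /powR gt_eqF ?expR_gt0// expRK.
apply: (@le_trans _ _ (expR (c6 + g * x))).
  have := expR_ge1Dx (c6 + g * x); have := ler_norm B; have := ler_norm (- c6).
  by rewrite normrN; move: (g * x) k2 => z; lra.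
rewrite ler_expR.
have k3 : (n - 2) * y <= (n - 2) * (Q * x + c5) by apply: ler_wpM2l => //; lra.
have -> : 2 * (ln c3 + (x + y)) + n * (ln c4 + (q * x - y)) =
  2 * ln c3 + n * ln c4 + 2 * x + n * q * x - (n - 2) * y by ring.
have -> : c6 + g * x = 2 * ln c3 + n * ln c4 + 2 * x + n * q * x - (n - 2) * (Q * x + c5).
  by rewrite /c6 /g; ring.
lra.
Qed.

Lemma crossing_ex : exists v dv, [/\ radsol d.+3 h v dv, b <= v 0 & exists2 r, 0 <= r & v r < 0].
Proof.
have B0 := b0; have B1 := bM0.
have n0 : 0 < n by have := n3; lra.
have [M MM hM] := poho_above; have M1 : 0 < M by lra.
have hgt' t : M <= t -> 0 < t * h t by move=> k; apply: mulr_gt0; [|apply: hgt]; lra.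
have pM v : M <= v -> 0 <= poho v.
  move=> Mv; apply: le_trans (hM v Mv); apply: mulr_ge0; last exact: ltW (hgt' v Mv).
  by apply: divr_ge0 => //; exact: ltW de0.
have [C0 C00 hC0] := poho_below (ltW M1) pM.
have [c c0 hc] := h_power.
pose B := C0 / n + `|H M| + (M + 1) ^+ 2 / 2.
have Bge : 0 <= B.
  by apply: addr_ge0; [apply: addr_ge0 => //; apply: divr_ge0 => //; exact: ltW|apply: divr_ge0 => //; exact: sqr_ge0].
have q1 : 0 < 1 - q by have := q01; lra.
have [c3 hc3 c30] : exists2 c3, c3 = de / 4 / 2 `^ Q / n & 0 < c3.
  exists (de / 4 / 2 `^ Q / n) => //; apply: divr_gt0 => //; apply: divr_gt0; last exact: powR_gt0.
  by apply: divr_gt0 => //; exact: de0.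
have [C hC C1] : exists2 C, C = 2 * n / (c * (1 - q)) & 0 < C.
  by exists (2 * n / (c * (1 - q))) => //; apply: divr_gt0; apply: mulr_gt0.
have [c4 hc4 c40] : exists2 c4, c4 = n / (2 * (C + 1)) & 0 < c4.
  by exists (n / (2 * (C + 1))) => //; apply: divr_gt0 => //; lra.
have [al Aal [al1 hal]] := amplitude (B ^+ 2) (2 * M + 1) c30 c40.
have [al0 Mal] : 0 < al /\ M <= al / 2 by split; lra.
have Ma : M0 <= al by lra.
have hal0 := hgt Ma.
have [v [dv [sol e]]] := shoot_ex d b0 hlip hpos (al := al) ltac:(lra).
exists v, dv; split => //; first by rewrite e; lra.
have [r1 r10 [v1 hr1]] := descent_level sol e (l := al / 2) ltac:(lra) ltac:(lra).
have [rM rM0 [vM hrM]] := descent_level sol e (l := M) ltac:(lra) ltac:(lra).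
have r1M : r1 <= rM.
  rewrite leNgt; apply/negP => k; have := hr1 rM; rewrite (ltW rM0) (ltW k) vM => /(_ isT).
  by lra.
have hr1' t : 0 <= t <= r1 -> M0 <= v t by move=> /hr1; lra.
have hrM' t : 0 <= t <= rM -> M0 <= v t by move=> /hrM; lra.
have lo1 := half_radius sol e Ma r10 hr1' v1.
have hiM := level_radius sol e c0 hc rM0 hrM'; rewrite -hC in hiM.
have P1 := pfun_half sol MM hM Mal r10 hr1; rewrite -hc3 in P1.
have aq0 : 0 <= al `^ q by exact: powR_ge0.
have aq1 : 1 <= al `^ (1 - q) by have := ler_powR al1 (ltW q1); rewrite powRr0.
have rr := radius_ratio n0 hal0 aq0 aq1 (powR_split q (ltW al0)) C1 (ltW rM0) lo1 hiM.
rewrite -hc4 in rr.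
have cah : 0 <= c3 * (al * h al) by apply: mulr_ge0; [exact: ltW|apply: mulr_ge0; exact: ltW].
apply: (@crossing v dv sol M C0 (c3 * (al * h al) * r1 ^+ d.+3) rM) => //; last 2 first.
- apply: (le_trans P1); have := @pfun_lower v dv sol r1 rM 0 (ltW r10) r1M.
  rewrite !mul0r !subr0; apply => t /andP[t1 t2]; apply: pM; apply: hrM.
  by rewrite (ltW t2) (le_trans (ltW r10) (ltW t1)).
- rewrite -/B -mulrA -expr_div_n.
  have x0 : 0 <= (r1 / (rM + 1)) ^+ d.+3 by apply/exprn_ge0/divr_ge0; [exact: ltW|rewrite addr_ge0// ltW].
  (* Squares are compared because the radii are controlled through their squares. *)
  rewrite -(@ler_pXn2r _ 2)// ?nnegrE//; last exact: mulr_ge0.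
  apply: (le_trans hal); rewrite [leRHS]exprMn; apply: ler_wpM2l; first exact: sqr_ge0.
  rewrite exprAC; apply: lerXn2r; rewrite ?nnegrE ?sqr_ge0//.
  by apply: mulr_ge0; [exact: ltW|apply: divr_ge0 => //; exact: ltW].
- move=> t /andP[t1 t2]; apply: (lt_le_trans bM0); apply: hrM'.
  by rewrite (ltW t1) (ltW t2).
- by apply: mulr_ge0 => //; apply: exprn_ge0; exact: ltW.
Qed.

End Pohozaev.

(** * The change of variable *)

Section ChangeOfVariable.
Context {R : realType}.
Variables (a : R -> R) (c0 : R).
Hypothesis ca : continuous a.
Hypothesis c00 : 0 < c0.
Hypothesis a_ge : forall s : R, 0 <= s -> c0 <= a s.

(** [a] is bounded below on the nonnegative half line only; with the absolute value the integrand is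
    positive everywhere, and its primitive is a bijection of the line. *)
Definition sqa (t : R) : R := Num.sqrt (a `|t|).

Lemma sqa_pos t : 0 <= t -> sqa t = Num.sqrt (a t).
Proof. by move=> t0; rewrite /sqa ger0_norm. Qed.

Lemma sqa_cont : continuous sqa.
Proof.
move=> t; apply: (cont_comp (f := fun t => a `|t|) (g := Num.sqrt)); last exact: sqrt_continuous.
by apply: (cont_comp (f := fun t : R => `|t|)); [exact: norm_continuous|exact: ca].
Qed.

Lemma sqa_ge t : Num.sqrt c0 <= sqa t.
Proof. by apply: ler_wsqrtr; exact: a_ge. Qed.

Let sc0 : 0 < Num.sqrt c0.
Proof. by rewrite sqrtr_gt0. Qed.

Lemma sqa_gt0 t : 0 < sqa t.
Proof. exact: lt_le_trans (sqa_ge t). Qed.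

Definition chV := prim sqa.
Local Notation V := chV.

Lemma drv_V t : drv V t (sqa t).
Proof. by apply: drv_prim; exact: sqa_cont. Qed.

Lemma V0 : V 0 = 0.
Proof. exact: prim0. Qed.

Lemma V_lt x y : x < y -> V x < V y.
Proof.
move=> xy; apply: (@drv_gt0_lt _ V sqa) => // t _; [exact: drv_cont (drv_V t)|exact: drv_V|exact: sqa_gt0].
Qed.

Lemma V_growth x y : x <= y -> Num.sqrt c0 * (y - x) <= V y - V x.
Proof.
move=> xy; have : V x - Num.sqrt c0 * x <= V y - Num.sqrt c0 * y.
  apply: (@drv_ge0_le _ (fun t => V t - Num.sqrt c0 * t) (fun t => sqa t - Num.sqrt c0)) => // t _.
  - apply: contD; first exact: drv_cont (drv_V t).
    by apply: contN; apply: contM; [exact: contC|exact: contI].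
  - apply: drv_eq; first by apply: drvD; [exact: drv_V|apply: drvN; apply: drvM; [exact: drvC|exact: drvI]].
    by rewrite /=; ring.
  - by rewrite subr_ge0 sqa_ge.
by rewrite mulrBr; lra.
Qed.

Lemma V_surj v : exists u, V u = v.
Proof.
pose T := `|v| / Num.sqrt c0.
have T0 : 0 <= T by rewrite /T divr_ge0// ltW.
have cT : Num.sqrt c0 * T = `|v| by rewrite /T mulrC divfK// gt_eqF.
have [|||t ht e] := @ivt _ V (- T) T v; first lra.
- by move=> t _; exact: drv_cont (drv_V t).
- left; have := V_growth T0; rewrite V0 !subr0 cT.
  have := @V_growth (- T) 0; rewrite V0 opprK sub0r add0r cT oppr_le0 => /(_ T0).
  by have := ler_norm v; have := ler_norm (- v); rewrite normrN; lra.
by exists t.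
Qed.

Definition chU (v : R) : R := xget 0 [set u | V u = v].
Local Notation U := chU.

Lemma chUK v : V (U v) = v.
Proof. by have [u e] := V_surj v; exact: (@xgetPex _ 0 [set u | V u = v] (ex_intro _ u e)). Qed.

Lemma chVK u : U (V u) = u.
Proof.
by have := chUK (V u); have [k|k|//] := ltgtP (U (V u)) u; have := V_lt k => k1 k2; move: k1; rewrite k2 ltxx.
Qed.

Lemma U_lt x y : x < y -> U x < U y.
Proof.
move=> xy; rewrite ltNge; apply/negP; rewrite le_eqVlt => /predU1P[e|/V_lt].
  by move: xy; rewrite -(chUK x) -(chUK y) e ltxx.
by rewrite !chUK => /ltW; rewrite leNgt xy.
Qed.

Lemma U0 : U 0 = 0.
Proof. by rewrite -{1}V0 chVK. Qed.

Lemma U_gt0 v : 0 < v -> 0 < U v.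
Proof. by move=> v0; rewrite -U0; exact: U_lt. Qed.

Lemma drv_U v : drv U v (sqa (U v))^-1.
Proof.
rewrite -{1}(chUK v); apply: (@drv_inverse _ V U sqa (U v - 1) (U v + 1)) => [t _|t _|t _|].
- exact: drv_V.
- by rewrite gt_eqF// sqa_gt0.
- exact: chVK.
- by lra.
Qed.

Lemma V_le1 : exists2 C, 0 < C & forall u, 0 <= u <= 1 -> sqa u <= C /\ V u <= C * u.
Proof.
have [t _|C C0 hC] := @bounded_seg _ sqa 0 1 ler01; first exact: sqa_cont.
have bs t : 0 <= t <= 1 -> sqa t <= C by move=> /hC; exact: le_trans (ler_norm _).
exists C => // u hu; split; first exact: bs.
have : V u - C * u <= V 0 - C * 0.
  apply: (@drv_le0_ge _ (fun t => V t - C * t) (fun t => sqa t - C)) => [|t _|t _|t ht].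
  - by case/andP: hu.
  - apply: contD; first exact: drv_cont (drv_V t).
    by apply: contN; apply: contM; [exact: contC|exact: contI].
  - apply: drv_eq; first by apply: drvD; [exact: drv_V|apply: drvN; apply: drvM; [exact: drvC|exact: drvI]].
    by rewrite /=; ring.
  - by rewrite subr_le0; apply: bs; lra.
by rewrite V0; lra.
Qed.

End ChangeOfVariable.

Lemma lt_powR {R : realType} (x y r : R) : 0 <= x -> 0 <= y -> 0 < r -> (x `^ r < y `^ r) = (x < y).
Proof.
move=> x0 y0 r0; apply/idP/idP => [|xy]; last by apply: gt0_ltr_powR; rewrite ?nnegrE.
apply: contraTT; rewrite -!leNgt => yx.
by apply: ge0_ler_powR; rewrite ?nnegrE// ltW.
Qed.

(** (1 + k/2)^-1 (p - k/2) is the elasticity of the transformed nonlinearity at infinity, and the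
    bound on [p] puts it below (n+2)/(n-2). The room left is spent on [e], so that the lower
    exponent can be taken below 1 even if the elasticity at infinity is not. *)
Lemma growth_exponents {R : realFieldType} (k p n : R) : 0 < k <= 2 -> 1 < p -> 3 <= n ->
  p < ((k + 1) * n + 2) / (n - 2) ->
  exists e q, [/\ 0 < e, 0 < q < 1, q <= (1 + k / 2)^-1 * (p - k / 2) &
    ((1 + k / 2)^-1 * (p - k / 2) + e) * (n - 2) - 2 < q * n].
Proof.
move=> k02 p1 n3 hp; have kk : 0 < 1 + k / 2 by lra.
set q0 := _^-1 * _.
have q00 : 0 < q0 by rewrite mulr_gt0 ?invr_gt0//; lra.
have q0n : q0 * (n - 2) < n + 2.
  rewrite /q0 -mulrA mulrC ltr_pdivrMr//.
  by move: hp; rewrite ltr_pdivlMr ?mulrBl ?mulrBr; [|lra]; lra.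
move: q0 q00 q0n => q0 q00 q0n.
have [e [e0 e1 e2 e3]] : exists e, [/\ 0 < e, e < 1, (q0 + e) * (n - 2) - 2 < q0 * n &
    (q0 + e) * (n - 2) - 2 < (1 - e) * n].
  pose g := n + 2 - q0 * (n - 2); have g0 : 0 < g by rewrite /g; lra.
  exists (Num.min (1 / n) (g / (4 * n))).
  have n0 : 0 < n by lra.
  have z1 : Num.min (1 / n) (g / (4 * n)) <= 1 / n by rewrite ge_min lexx.
  have z2 : Num.min (1 / n) (g / (4 * n)) <= g / (4 * n) by rewrite ge_min lexx orbT.
  have z0 : 0 < Num.min (1 / n) (g / (4 * n)) by rewrite lt_min !divr_gt0// mulr_gt0.
  move: (Num.min _ _) z0 z1 z2 => z z0; rewrite !ler_pdivlMr ?mulr_gt0// => z1 z2.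
  have zn : 3 * z <= z * n by rewrite mulrC ler_wpM2l// ltW.
  split => //; first lra.
    rewrite mulrDl mulrBr [z * (n - 2)]mulrBr; have : 0 < q0 * 2 by lra.
    lra.
  by move: z2; rewrite /g; rewrite !mulrDl !mulrBr; lra.
have [k1|k1] := leP q0 (1 - e); first by exists e, q0; split => //; lra.
by exists e, (1 - e); split => //; lra.
Qed.

(** [w], [s] and [P] stand for V/(u V') and the elasticities of sqrt(a) and u^p - m u, with limits
    (1 + k/2)^-1, k/2 and p. The lower bound carries no error, because w (1 + s) >= 1 and s <= k/2
    force w >= (1 + k/2)^-1. *)
Lemma growth_window {R : realFieldType} (k p e : R) : 0 < k <= 2 -> 1 < p -> 0 < e ->
  exists e' d : R, [/\ 0 < e', 0 < d & forall w s P : R, 0 < w -> 1 <= w * (1 + s) ->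
    w <= (1 + k / 2)^-1 + e' -> k / 2 - d <= s -> s <= k / 2 -> p < P -> P <= p + d ->
    (1 + k / 2)^-1 * (p - k / 2) <= w * (P - s) <= (1 + k / 2)^-1 * (p - k / 2) + e].
Proof.
move=> k02 p1 e0; have kk : 0 < 1 + k / 2 by lra.
have W1 : (1 + k / 2)^-1 <= 1 by rewrite invf_le1//; lra.
have W0 : 0 < (1 + k / 2)^-1 by rewrite invr_gt0.
have [d [d0 d1 de]] : exists d, [/\ 0 < d, 4 * d <= e & d <= 1 / 2].
  exists (Num.min (1 / 2) (e / 4)); have x1 : Num.min (1 / 2) (e / 4) <= 1 / 2 by rewrite ge_min lexx.
  have x2 : Num.min (1 / 2) (e / 4) <= e / 4 by rewrite ge_min lexx orbT.
  by split => //; [rewrite lt_min; lra|lra].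
have pp1 : 0 < p + 1 by lra.
exists (e / (2 * (p + 1))), d; have e'0 : 0 < e / (2 * (p + 1)) by rewrite divr_gt0// mulr_gt0.
have e'e : e / (2 * (p + 1)) * (2 * (p + 1)) = e by rewrite divfK// gt_eqF// mulr_gt0.
split => // w s P w0 ws.
have : (1 + k / 2)^-1 * (1 + k / 2) = 1 by rewrite mulVf// gt_eqF.
move: (_^-1) (e / _) W0 W1 e'0 e'e ws => W e' W0 W1 e'0 e'e ws Wk b1 b2 b3 b4 b5.
have b7 : W <= w.
  rewrite -(ler_pM2r kk) Wk; apply: (le_trans ws); apply: ler_wpM2l; [exact: ltW|lra].
apply/andP; split; first by apply: ler_pM; lra.
apply: (@le_trans _ _ ((W + e') * (p - k / 2 + 2 * d))); first by apply: ler_pM; lra.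
have k2 : W * (2 * d) <= 2 * d by rewrite ler_piMl//; lra.
have k3 : e' * (p - k / 2 + 2 * d) <= e' * (p + 1) by apply: ler_wpM2l; lra.
by rewrite mulrDl mulrDr; lra.
Qed.

(** * The transformed nonlinearity and its elasticity *)

Section Nonlinearity.
Context {R : realType}.
Variables (a da dda : R -> R) (c0 k p : R).
Hypothesis ca : continuous a.
Hypothesis c00 : 0 < c0.
Hypothesis a_ge : forall s : R, 0 <= s -> c0 <= a s.
Hypothesis hda : forall s : R, 0 < s -> drv a s (da s).
Hypothesis hdda : forall s : R, 0 < s -> drv da s (dda s).
Hypothesis da_bound : forall A : R, exists2 C, 0 <= C & forall s : R, 0 < s <= A -> `|s * da s| <= C.
Hypothesis da_le : forall s : R, 0 < s -> s * da s <= k * a s.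
Hypothesis k02 : 0 < k <= 2.
Hypothesis p1 : 1 < p.

(* [p - elas u] is, for large [u], close to the elasticity [u F'(u) / F(u)] of
   [F(u) = (u^p - m u) / sqrt (a u)], and [delas] is the derivative of [elas]. *)
Definition elas (u : R) : R := u * da u / (2 * a u).
Definition delas (u : R) : R := ((da u + u * dda u) * a u - u * da u ^+ 2) / (2 * a u ^+ 2).

Hypothesis asym : exists2 c, 0 < c & exists2 U1, 1 <= U1 & forall u : R, U1 <= u ->
  0 <= da u /\ c / u <= u * Num.sqrt (a u) * delas u.
Hypothesis elas_lim : forall e : R, 0 < e -> exists2 U1, 1 <= U1 & forall u : R, U1 <= u ->
  k / 2 - e <= elas u.

Local Notation V := (chV a).
Local Notation U := (chU a).

Lemma a_gt0 s : 0 <= s -> 0 < a s.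
Proof. by move=> s0; apply: lt_le_trans (a_ge s0). Qed.

Lemma elas_le s : 0 < s -> elas s <= k / 2.
Proof.
move=> s0; have as0 := a_gt0 (ltW s0); rewrite /elas ler_pdivrMr; last lra.
by have := da_le s0; move: (s * da s) (a s) as0 => x y y0; lra.
Qed.

Lemma drv_elas u : 0 < u -> drv elas u (delas u).
Proof.
move=> u0; have au := a_gt0 (ltW u0); have h1 := hda u0; have h2 := hdda u0.
rewrite /elas; apply: drv_eq.
  apply: drvM; first by apply: drvM; [exact: drvI|exact: h2].
  by apply: drvV; [apply: drvM; [exact: drvC|exact: h1]|rewrite gt_eqF// mulr_gt0].
by rewrite /delas /=; field; rewrite gt_eqF.
Qed.

Lemma drv_sqrta u : 0 < u -> drv (fun u => Num.sqrt (a u)) u (Num.sqrt (a u) * elas u / u).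
Proof.
move=> u0; have au := a_gt0 (ltW u0).
apply: drv_eq; first by apply: drv_sqrt; [exact: hda|exact: au].
have sa : 0 < Num.sqrt (a u) by rewrite sqrtr_gt0.
rewrite /elas -{3}(sqr_sqrtr (ltW au)); field.
by rewrite !gt_eqF.
Qed.

Lemma V_gt0 u : 0 < u -> 0 < V u.
Proof. by move=> u0; rewrite -[ltLHS](V0 a); exact: (V_lt ca c00 a_ge). Qed.

Lemma drv_Vp u : 0 < u -> drv V u (Num.sqrt (a u)).
Proof. by move=> u0; rewrite -(sqa_pos a (ltW u0)); exact: drv_V. Qed.

(** The reciprocal of the elasticity of V, that is, the elasticity of its inverse. *)
Definition ww (u : R) : R := V u / (u * Num.sqrt (a u)).

Lemma ww_gt0 u : 0 < u -> 0 < ww u.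
Proof.
by move=> u0; apply: divr_gt0; [exact: V_gt0|apply: mulr_gt0; rewrite ?sqrtr_gt0 ?a_gt0// ltW].
Qed.

Lemma drv_ww u : 0 < u -> drv ww u ((1 - ww u * (1 + elas u)) / u).
Proof.
move=> u0; have au := a_gt0 (ltW u0); have h1 := drv_Vp u0; have h2 := drv_sqrta u0.
have sa : 0 < Num.sqrt (a u) by rewrite sqrtr_gt0.
rewrite /ww; apply: drv_eq.
  apply: drvM; first exact: h1.
  by apply: drvV; [apply: drvM; [exact: drvI|exact: h2]|rewrite gt_eqF// mulr_gt0].
by rewrite /=; field; rewrite !gt_eqF.
Qed.

(** The second inequality is F >= 0, and it makes [ww] nonincreasing. The derivative of [F] is at
    least c/(4u), as 1 + elas <= 2 by k <= 2, so [F] grows logarithmically and becomes nonnegative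
    whatever its value at [U1]. *)
Lemma ww_ge : exists2 U2, 1 <= U2 & forall u, U2 <= u -> 0 <= delas u /\ 1 <= ww u * (1 + elas u).
Proof.
have [c cpos [U1 U11 hU]] := asym.
pose F (u : R) := V u - u * Num.sqrt (a u) / (1 + elas u).
have el u : U1 <= u -> [/\ 0 < u, 0 < a u, 0 <= elas u & elas u <= 1].
  move=> Uu; have u0 : 0 < u by lra.
  have au := a_gt0 (ltW u0); split => //.
    by apply: divr_ge0; [apply: mulr_ge0; [exact: ltW|exact: (hU u Uu).1]|rewrite mulr_ge0// ltW].
  by apply: le_trans (elas_le u0) _; have := k02; lra.
have dl u : U1 <= u -> 0 < delas u.
  move=> Uu; have [u0 au _ _] := el u Uu; have [_ h] := hU u Uu.
  have h2 : 0 < u * Num.sqrt (a u) * delas u by apply: lt_le_trans h; exact: divr_gt0.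
  by move: h2; rewrite pmulr_rgt0// mulr_gt0// sqrtr_gt0.
have dF u : U1 <= u -> drv F u (u * Num.sqrt (a u) * delas u / (1 + elas u) ^+ 2).
  move=> Uu; have [u0 au e0 _] := el u Uu; have h1 := drv_Vp u0; have h2 := drv_sqrta u0; have h3 := drv_elas u0.
  have e1 : 0 < 1 + elas u by lra.
  rewrite /F; apply: drv_eq.
    apply: drvD; first exact: h1.
    apply: drvN; apply: drvM; first by apply: drvM; [exact: drvI|exact: h2].
    by apply: drvV; [apply: drvD; [exact: drvC|exact: h3]|rewrite gt_eqF].
  by rewrite /=; field; rewrite !gt_eqF.
have Fm u : U1 <= u -> F U1 - c / 4 * ln U1 <= F u - c / 4 * ln u.
  move=> Uu; apply: (@drv_ge0_le _ (fun u => F u - c / 4 * ln u)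
      (fun u => u * Num.sqrt (a u) * delas u / (1 + elas u) ^+ 2 - c / 4 / u)) => // t ht.
  - have t0 : 0 < t by lra.
    apply: contD; first by apply: drv_cont (dF t _); lra.
    by apply: contN; apply: contM; [exact: contC|apply: drv_cont (drv_ln (drvI t) t0)].
  - have t0 : 0 < t by lra.
    apply: drv_eq; first by apply: drvD; [apply: dF; lra|apply: drvN; apply: drvM; [exact: drvC|apply: drv_ln; [exact: drvI|exact: t0]]].
    by rewrite /=; field; rewrite !gt_eqF//; have [_ _ e0 _] := el t ltac:(lra); lra.
  - have Ut : U1 <= t by lra.
    have [t0 at0 e0 e1] := el t Ut; have [_ h] := hU t Ut.
    have e2 : 0 < (1 + elas t) ^+ 2 by apply: exprn_gt0; lra.
    rewrite subr_ge0 ler_pdivlMr//.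
    have e3 : (1 + elas t) ^+ 2 <= 4.
      have -> : 4 = (1 + 1) ^+ 2 :> R by ring.
      by apply: lerXn2r; rewrite ?nnegrE; lra.
    apply: le_trans h; have -> : c / t = c / 4 / t * 4 by field; rewrite gt_eqF.
    by apply: ler_wpM2l e3; apply: divr_ge0; [lra|exact: ltW].
pose X := U1 + expR (`|F U1 - c / 4 * ln U1| / (c / 4)).
exists X; first by have := expR_ge0 (`|F U1 - c / 4 * ln U1| / (c / 4)); rewrite /X; lra.
move=> u Xu; have e0' := expR_ge0 (`|F U1 - c / 4 * ln U1| / (c / 4)).
have U1u : U1 <= u by move: Xu; rewrite /X; lra.
have [u0 au e0 e1] := el u U1u; split; first exact: ltW (dl u U1u).
have sa : 0 < Num.sqrt (a u) by rewrite sqrtr_gt0.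
have h1 := Fm u U1u.
have h2 : `|F U1 - c / 4 * ln U1| <= c / 4 * ln u.
  rewrite [leRHS]mulrC -ler_pdivrMr; last lra.
  by rewrite -ler_expR lnK ?posrE//; move: Xu; rewrite /X; lra.
have h3 : 0 <= F u.
  have := ler_norm (- (F U1 - c / 4 * ln U1)); rewrite normrN.
  by move: (c / 4 * ln u) (F U1 - c / 4 * ln U1) h1 h2 => x y; lra.
have us : 0 < u * Num.sqrt (a u) by exact: mulr_gt0.
move: h3; rewrite /F subr_ge0 ler_pdivrMr; last lra.
by rewrite /ww mulrAC ler_pdivlMr// mul1r.
Qed.

(** With [z] slightly above the limit, V - z u sqrt(a) is eventually nonincreasing. The constant so
    obtained is absorbed by e/2 times u sqrt(a), which is unbounded since a >= c0. *)
Lemma ww_le e : 0 < e -> exists2 U2, 1 <= U2 & forall u, U2 <= u -> ww u <= (1 + k / 2)^-1 + e.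
Proof.
move=> e0; have kk : 0 < 1 + k / 2 by have := k02; lra.
pose z := (1 + k / 2)^-1 + e / 2.
have z0 : 0 < z by rewrite /z addr_gt0 ?invr_gt0//; lra.
have zi : z^-1 < 1 + k / 2.
  by rewrite invf_plt ?posrE// /z ltrDl; lra.
have [|U1 U11 hU] := elas_lim (e := 1 + k / 2 - z^-1); first lra.
have mono u : U1 <= u -> V u - z * (u * Num.sqrt (a u)) <= V U1 - z * (U1 * Num.sqrt (a U1)).
  move=> Uu; apply: (@drv_le0_ge _ (fun u => V u - z * (u * Num.sqrt (a u)))
     (fun u => Num.sqrt (a u) * (1 - z * (1 + elas u)))) => // t ht.
  - have t0 : 0 < t by lra.
    apply: contD; first exact: drv_cont (drv_Vp t0).
    apply: contN; apply: contM; first exact: contC.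
    by apply: contM; [exact: contI|exact: drv_cont (drv_sqrta t0)].
  - have t0 : 0 < t by lra.
    have h1 := drv_Vp t0; have h2 := drv_sqrta t0.
    apply: drv_eq; first by apply: drvD; [exact: h1|apply: drvN; apply: drvM; [exact: drvC|apply: drvM; [exact: drvI|exact: h2]]].
    by rewrite /=; field; rewrite gt_eqF.
  - rewrite mulr_ge0_le0 ?sqrtr_ge0// subr_le0 mulrC -ler_pdivrMr// mul1r.
    by have := hU t ltac:(lra); lra.
pose C := `|V U1 - z * (U1 * Num.sqrt (a U1))|.
have sc0 : 0 < Num.sqrt c0 by rewrite sqrtr_gt0.
pose X := U1 + C / (e / 2 * Num.sqrt c0).
have es : 0 < e / 2 * Num.sqrt c0 by apply: mulr_gt0 => //; lra.
have CX : 0 <= C / (e / 2 * Num.sqrt c0) by apply: divr_ge0; [exact: normr_ge0|exact: ltW].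
exists X; first by rewrite /X; lra.
move=> u Xu; have U1u : U1 <= u by move: Xu; rewrite /X; lra.
have u0 : 0 < u by lra.
have au := a_gt0 (ltW u0); have sa : 0 < Num.sqrt (a u) by rewrite sqrtr_gt0.
have us : 0 < u * Num.sqrt (a u) by exact: mulr_gt0.
rewrite /ww ler_pdivrMr//.
have h1 : V u - z * (u * Num.sqrt (a u)) <= C by apply: le_trans (mono u U1u) (ler_norm _).
have h2 : C <= e / 2 * (u * Num.sqrt (a u)).
  apply: (@le_trans _ _ (u * (e / 2 * Num.sqrt c0))).
    by rewrite -ler_pdivrMr//; move: Xu; rewrite /X; lra.
  rewrite mulrCA; apply: ler_wpM2l; first lra.
  by apply: ler_wpM2l; [exact: ltW|apply: ler_wsqrtr; exact: a_ge (ltW u0)].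
have -> : (1 + k / 2)^-1 + e = z + e / 2 by rewrite /z -addrA; congr (_ + _); field.
by rewrite mulrDl; lra.
Qed.

Variable m : R.
Hypothesis m0 : 0 < m.

(** The positive zero of u^p - m u. *)
Definition um : R := m `^ (p - 1)^-1.

Let pp : 0 < p - 1. Proof. by have := p1; lra. Qed.

Lemma um_gt0 : 0 < um.
Proof. exact: powR_gt0. Qed.

Lemma um_pow : um `^ (p - 1) = m.
Proof. by rewrite /um -powRrM mulVf ?gt_eqF// powRr1// ltW. Qed.

Lemma um_lt u : 0 < u -> (u `^ (p - 1) < m) = (u < um).
Proof.
by move=> u0; rewrite -{1}um_pow lt_powR// ltW// um_gt0.
Qed.

Lemma um_gt u : 0 < u -> (m < u `^ (p - 1)) = (um < u).
Proof.
by move=> u0; rewrite -{1}um_pow lt_powR// ltW// um_gt0.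
Qed.

Definition ff (u : R) : R := u * (u `^ (p - 1) - m) / Num.sqrt (a u).
Definition dff (u : R) : R := (p * u `^ (p - 1) - m - elas u * (u `^ (p - 1) - m)) / Num.sqrt (a u).

Lemma drv_ff u : 0 < u -> drv ff u (dff u).
Proof.
move=> u0; have au := a_gt0 (ltW u0); have h2 := drv_sqrta u0.
have sa : 0 < Num.sqrt (a u) by rewrite sqrtr_gt0.
have h1 : drv (fun u => u `^ (p - 1)) u ((p - 1) * (u `^ (p - 1) / u)).
  apply: drv_eq; first by apply: drv_powR; [exact: drvI|exact: u0].
  rewrite [u `^ (p - 1 - 1)]powRB; last by apply/implyP => _; rewrite gt_eqF.
  by rewrite powRr1 ?ltW//; ring.
rewrite /ff; apply: drv_eq.
  apply: drvM; first by apply: drvM; [exact: drvI|apply: drvD; [exact: h1|exact: drvC]].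
  by apply: drvV; [exact: h2|rewrite gt_eqF].
by rewrite /dff /=; field; rewrite !gt_eqF.
Qed.

(** The extension by 0 makes every nonpositive constant a solution of the radial equation and the
    potential vanish on the nonpositive half line. *)
Definition hh (v : R) : R := if v <= 0 then 0 else ff (U v).
Definition dhh (v : R) : R := dff (U v) / Num.sqrt (a (U v)).
Definition hb : R := V um.

Let Up v : 0 < v -> 0 < U v. Proof. exact: (U_gt0 ca c00 a_ge). Qed.

Lemma hh0 v : v <= 0 -> hh v = 0.
Proof. by rewrite /hh => ->. Qed.

Lemma hhE v : 0 < v -> hh v = ff (U v).
Proof. by rewrite /hh leNgt => ->. Qed.

Lemma hb_gt0 : 0 < hb.
Proof. exact: V_gt0 um_gt0. Qed.

Lemma U_lt_um v : 0 < v -> (U v < um) = (v < hb).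
Proof.
move=> v0; have VK := chUK ca c00 a_ge v; apply/idP/idP => [/(V_lt ca c00 a_ge)|]; first by rewrite VK.
by move=> /(U_lt ca c00 a_ge); rewrite /hb (chVK ca c00 a_ge).
Qed.

Lemma um_lt_U v : (um < U v) = (hb < v).
Proof.
have VK := chUK ca c00 a_ge v; apply/idP/idP => [/(V_lt ca c00 a_ge)|]; first by rewrite VK.
by move=> /(U_lt ca c00 a_ge); rewrite /hb (chVK ca c00 a_ge).
Qed.

Lemma hh_neg v : 0 < v < hb -> hh v < 0.
Proof.
move=> /andP[v0 vb]; have u0 := Up v0; rewrite hhE// /ff.
have sa : 0 < Num.sqrt (a (U v)) by rewrite sqrtr_gt0 a_gt0// ltW.
rewrite pmulr_llt0 ?invr_gt0// pmulr_rlt0// subr_lt0 um_lt// U_lt_um//.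
Qed.

Lemma hh_pos v : hb < v -> 0 < hh v.
Proof.
move=> bv; have v0 : 0 < v by apply: lt_trans bv; exact: hb_gt0.
have u0 := Up v0; rewrite hhE// /ff.
have sa : 0 < Num.sqrt (a (U v)) by rewrite sqrtr_gt0 a_gt0// ltW.
by rewrite divr_gt0// mulr_gt0// subr_gt0 um_gt// um_lt_U.
Qed.

Lemma drv_hh v : 0 < v -> drv hh v (dhh v).
Proof.
move=> v0; apply: (drv_near (f := fun v => ff (U v))).
  near=> y; rewrite hhE//; near: y; exact: lt_nbhsr.
have h1 := drv_U ca c00 a_ge v; have h2 := drv_ff (Up v0).
apply: drv_eq; first exact: drv_comp h1 h2.
by rewrite sqa_pos// ltW// Up.
Unshelve. all: by end_near. Qed.

Lemma hh_near0 : exists mu eps, [/\ 0 < mu, 0 < eps & forall l : R, 0 <= l <= eps -> hh l <= - mu * l].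
Proof.
have [C C0 hC] := V_le1 ca.
pose X := Num.min 1 ((m / 2) `^ (p - 1)^-1).
have X0 : 0 < X by rewrite lt_min ltr01 powR_gt0// divr_gt0.
(* One factor [C] bounds sqrt(a) in the denominator, the other comes from V(u) <= C u; [X] makes
   u^(p-1) <= m/2. *)
exists (m / (2 * C ^+ 2)), (V X); split; first by rewrite divr_gt0// mulr_gt0// exprn_gt0.
  exact: V_gt0.
move=> l /andP[]; rewrite le_eqVlt => /predU1P[<- _|l0 lX]; first by rewrite hh0// mulr0.
have u0 := Up l0; have e := chUK ca c00 a_ge l; rewrite hhE//.
have uX : U l <= X.
  by rewrite leNgt; apply/negP => /(V_lt ca c00 a_ge); rewrite e ltNge lX.
have u1 : U l <= 1 by apply: (le_trans uX); rewrite ge_min lexx.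
have um2 : U l `^ (p - 1) <= m / 2.
  apply: (@le_trans _ _ (((m / 2) `^ (p - 1)^-1) `^ (p - 1))).
    apply: ge0_ler_powR; rewrite ?nnegrE ?powR_ge0//; [exact: ltW|exact: ltW|].
    by apply: (le_trans uX); rewrite ge_min lexx orbT.
  by rewrite -powRrM mulVf ?gt_eqF// powRr1//; apply: divr_ge0 => //; exact: ltW.
have [s1 s2] := hC (U l) ltac:(by rewrite (ltW u0) u1).
move: s1 s2; rewrite e (sqa_pos a (ltW u0)) /ff => s1 s2.
have sa : 0 < Num.sqrt (a (U l)) by rewrite sqrtr_gt0 a_gt0// ltW.
rewrite ler_pdivrMr//.
apply: (@le_trans _ _ (- (m / 2) * U l)).
  by rewrite mulrC; apply: ler_wpM2r; [exact: ltW|lra].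
rewrite !mulNr lerN2 -mulrA.
have -> : m / 2 * U l = m / (2 * C ^+ 2) * (C * U l * C) by field; rewrite gt_eqF.
apply: ler_wpM2l; first by apply: divr_ge0; [exact: ltW|apply: mulr_ge0 => //; exact: sqr_ge0].
by apply: ler_pM => //; exact: ltW.
Qed.

(** The derivative of [a] may be unbounded near 0, as for a power with k < 1. It enters only through
    [elas], which is bounded because s a'(s) is. *)
Lemma dhh_bound (A : R) : 0 < A -> exists2 L, 0 < L & forall v : R, 0 < v <= A -> `|hh v| <= L * v /\ `|dhh v| <= L.
Proof.
move=> A0; pose B := U A; have B0 : 0 < B by exact: Up.
have [C C0 hC] := da_bound B.
pose D := p * B `^ (p - 1) + m.
have Bp : 0 < B `^ (p - 1) by exact: powR_gt0.
have p0 : 0 < p by have := p1; lra.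
have D0 : 0 < D by apply: addr_gt0 => //; exact: mulr_gt0.
exists (D * (1 + C / (2 * c0)) / c0).
  apply: divr_gt0 => //; apply: mulr_gt0 => //; apply: ltr_pwDl => //; apply: divr_ge0 => //.
  by apply: mulr_ge0 => //; exact: ltW.
move=> v /andP[v0 vA]; have u0 := Up v0.
have uB : U v <= B.
  by move: vA; rewrite le_eqVlt => /predU1P[->//|/(U_lt ca c00 a_ge)/ltW].
have au := a_ge (ltW u0); have au0 := a_gt0 (ltW u0).
have upow : 0 <= U v `^ (p - 1) <= B `^ (p - 1).
  rewrite powR_ge0/=; apply: ge0_ler_powR; rewrite ?nnegrE//; exact: ltW.
have d1 : `|U v `^ (p - 1) - m| <= D.
  rewrite ler_norml /D; have : B `^ (p - 1) <= p * B `^ (p - 1) by rewrite ler_peMl//; [exact: ltW|exact: ltW p1].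
  by move: upow m0; move: (B `^ (p - 1)) (U v `^ (p - 1)) => y z; lra.
have d2 : `|p * U v `^ (p - 1) - m| <= D.
  rewrite ler_norml /D; have : p * U v `^ (p - 1) <= p * B `^ (p - 1).
    by apply: ler_wpM2l; [exact: ltW|case/andP: upow].
  have : 0 <= p * U v `^ (p - 1) by apply: mulr_ge0; [exact: ltW|exact: powR_ge0].
  have : 0 <= p * B `^ (p - 1) by apply: mulr_ge0; exact: ltW.
  by have := m0; move: (B `^ (p - 1)) (U v `^ (p - 1)) => y z; lra.
have d3 : `|elas (U v)| <= C / (2 * c0).
  rewrite /elas normrM; apply: ler_pM => //; first by apply: hC; rewrite u0 uB.
  rewrite ger0_norm; last by rewrite invr_ge0 mulr_ge0// ltW.
  by rewrite lef_pV2 ?posrE ?mulr_gt0//; lra.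
have sc0 : 0 < Num.sqrt c0 by rewrite sqrtr_gt0.
have sa : Num.sqrt c0 <= Num.sqrt (a (U v)) by apply: ler_wsqrtr.
have sa0 : 0 < Num.sqrt (a (U v)) by exact: lt_le_trans sa.
have Cc : 0 <= C / (2 * c0) by apply: divr_ge0 => //; rewrite mulr_ge0// ltW.
have sq : Num.sqrt c0 * Num.sqrt c0 = c0 by rewrite -expr2 sqr_sqrtr// ltW.
split.
  rewrite hhE// /ff !normrM (gtr0_norm u0) normrV ?unitfE ?gt_eqF// (gtr0_norm sa0).
  rewrite ler_pdivrMr//.
  have uv : U v <= v / Num.sqrt c0.
    rewrite ler_pdivlMr// mulrC; have := V_growth ca a_ge (ltW u0).
    by rewrite (V0 a) (chUK ca c00 a_ge) !subr0.
  apply: (@le_trans _ _ (v / Num.sqrt c0 * D)); first by apply: ler_pM => //; exact: ltW.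
  have -> : v / Num.sqrt c0 * D = D / c0 * v * Num.sqrt c0.
    by move: (Num.sqrt c0) sc0 sq => s s0 <-; field; rewrite gt_eqF.
  apply: ler_pM => //; first by apply: mulr_ge0; [apply: divr_ge0|]; exact: ltW.
  apply: ler_wpM2r; first exact: ltW.
  apply: ler_wpM2r; first by rewrite invr_ge0 ltW.
  by rewrite ler_peMr ?(ltW D0)// lerDl.
rewrite /dhh /dff -mulrA -invfM -expr2 sqr_sqrtr ?(ltW au0)// normrM.
apply: ler_pM => //; last first.
  by rewrite ger0_norm ?invr_ge0 ?(ltW au0)// lef_pV2 ?posrE.
apply: (le_trans (ler_normB _ _)); rewrite [leRHS]mulrDr mulr1; apply: lerD => //.
by rewrite normrM mulrC; apply: ler_pM.
Qed.

Lemma hh_lip (A : R) : exists2 L : R, 0 < L & forall x y : R, x <= A -> y <= A -> `|hh x - hh y| <= L * `|x - y|.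
Proof.
have A1 : 0 < `|A| + 1 by rewrite ltr_wpDl.
have [L L0 hL] := dhh_bound A1; exists L => //.
suff main x y : x <= y -> y <= A -> `|hh y - hh x| <= L * `|y - x|.
  move=> x y xA yA; have [xy|yx] := leP x y; last exact: main (ltW yx) xA.
  by rewrite distrC [in leRHS]distrC; exact: main.
rewrite le_eqVlt => /predU1P[->|xy] yA; first by rewrite !subrr normr0 mulr0.
have yA1 : y <= `|A| + 1 by have := ler_norm A; lra.
rewrite [`|y - x|]gtr0_norm ?subr_gt0//.
have [y0|y0] := leP y 0.
  rewrite (hh0 y0) (hh0 (le_trans (ltW xy) y0)) subrr normr0.
  by apply: mulr_ge0; [exact: ltW|rewrite subr_ge0 ltW].
have [x0|x0] := leP x 0.
  rewrite (hh0 x0) subr0; have [h1 _] := hL y ltac:(by rewrite y0 yA1).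
  by apply: (le_trans h1); apply: ler_wpM2l; [exact: ltW|lra].
have [t ht|t ht|c hc ->] := mvt xy (f := hh) (df := dhh).
- by apply: drv_cont (drv_hh _); lra.
- by apply: drv_hh; lra.
rewrite normrM (gtr0_norm (_ : 0 < y - x)) ?subr_gt0//; apply: ler_wpM2r; first by rewrite subr_ge0 ltW.
by have [|_] := hL c; first lra.
Qed.

(** The elasticity of u^p - m u, which decreases to p above the zero [um]. *)
Definition pq (u : R) : R := p + (p - 1) * m / (u `^ (p - 1) - m).

(** Elasticities multiply under composition: [ww] belongs to the inverse of V, and pq - elas to
    [ff]. *)
Lemma growthE v : hb < v -> v * dhh v / hh v = ww (U v) * (pq (U v) - elas (U v)).
Proof.
move=> bv; have v0 : 0 < v by apply: lt_trans bv; exact: hb_gt0.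
have u0 := Up v0; have uu : um < U v by rewrite um_lt_U.
have up : 0 < U v `^ (p - 1) - m by rewrite subr_gt0 um_gt.
rewrite hhE// /dhh -{1}(chUK ca c00 a_ge v) /ff /dff /ww /pq.
have sa : 0 < Num.sqrt (a (U v)) by rewrite sqrtr_gt0 a_gt0// ltW.
move: (Num.sqrt (a (U v))) (V (U v)) (elas (U v)) (U v `^ (p - 1)) (U v) sa u0 up => s V1 e y u s0 u0 up'.
by field; rewrite !gt_eqF.
Qed.

Lemma pq_gt u : um < u -> p < pq u.
Proof.
move=> uu; have u0 : 0 < u by apply: lt_trans uu; exact: um_gt0.
by rewrite /pq ltrDl divr_gt0 ?mulr_gt0// subr_gt0 um_gt.
Qed.

Lemma pq_mono x y : um < x -> x <= y -> pq y <= pq x.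
Proof.
move=> ux xy; have u0 : 0 < x by apply: lt_trans ux; exact: um_gt0.
rewrite /pq lerD2l; apply: ler_wpM2l; first by rewrite mulr_ge0// ltW.
have xp : x `^ (p - 1) <= y `^ (p - 1).
  by apply: ge0_ler_powR; rewrite ?nnegrE//; [exact: ltW|exact: ltW|exact: le_trans (ltW u0) xy].
have x1 : m < x `^ (p - 1) by rewrite um_gt.
by rewrite lef_pV2 ?posrE; lra.
Qed.

Lemma pq_lim e : 0 < e -> exists U2, forall u, U2 <= u -> um < u -> pq u <= p + e.
Proof.
move=> e0; exists ((m + (p - 1) * m / e) `^ (p - 1)^-1) => u Uu uu.
have u0 : 0 < u by apply: lt_trans uu; exact: um_gt0.
have x1 : m < u `^ (p - 1) by rewrite um_gt.
rewrite /pq lerD2l ler_pdivrMr ?subr_gt0// -ler_pdivrMl// [leLHS]mulrC.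
have y0 : 0 <= m + (p - 1) * m / e by rewrite addr_ge0 ?divr_ge0 ?mulr_ge0// ltW.
rewrite lerBrDl.
have -> : m + (p - 1) * m / e = (m + (p - 1) * m / e) `^ (p - 1)^-1 `^ (p - 1).
  by rewrite -powRrM mulVf ?gt_eqF// powRr1.
by apply: ge0_ler_powR; rewrite ?nnegrE ?powR_ge0// ltW.
Qed.

(** [U2 <= um] places all levels above [hb] where [ww] and pq - elas are both nonincreasing. They
    are positive, the second since p > 1 >= k/2, so their product is nonincreasing. *)
Lemma growth_mono U2 : 1 <= U2 -> (forall u, U2 <= u -> 0 <= delas u /\ 1 <= ww u * (1 + elas u)) ->
  U2 <= um -> forall x y : R, hb < x -> x <= y -> y * dhh y / hh y <= x * dhh x / hh x.
Proof.
move=> U21 hU Um x y bx xy; rewrite !growthE//; last exact: lt_le_trans xy.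
have ux : um < U x by rewrite um_lt_U.
have uxy : U x <= U y.
  by move: xy; rewrite le_eqVlt => /predU1P[->//|/(U_lt ca c00 a_ge)/ltW].
have g0 : 0 < um := um_gt0.
have U20 t : U x <= t -> 0 < t /\ U2 <= t by move=> k1; split; lra.
have w1 : ww (U y) <= ww (U x).
  apply: (@drv_le0_ge _ ww (fun u => (1 - ww u * (1 + elas u)) / u)) => // t ht.
  - by apply: drv_cont (drv_ww _); have [|] := U20 t; first by case/andP: ht.
  - by apply: drv_ww; have [|] := U20 t; first by case/andP: ht => /ltW.
  - have [t0 Ut] := U20 t ltac:(case/andP: ht => /ltW//); have [_ k1] := hU t Ut.
    by apply: mulr_le0_ge0; [lra|rewrite invr_ge0 ltW].
have e1 : elas (U x) <= elas (U y).
  apply: (@drv_ge0_le _ elas delas) => // t ht.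
  - by apply: drv_cont (drv_elas _); have [|] := U20 t; first by case/andP: ht.
  - by apply: drv_elas; have [|] := U20 t; first by case/andP: ht => /ltW.
  - by have [_ Ut] := U20 t ltac:(case/andP: ht => /ltW//); have [k1 _] := hU t Ut.
have q1 := pq_mono ux uxy.
have uy : um < U y by exact: lt_le_trans uxy.
have q2 := pq_gt uy; have ey := @elas_le (U y) ltac:(lra).
apply: ler_pM => //; [by apply/ltW/ww_gt0; lra| |lra].
by have := p1; have := k02; lra.
Qed.

Lemma growth_asym (n : R) U2 : 1 <= U2 -> (forall u, U2 <= u -> 0 <= delas u /\ 1 <= ww u * (1 + elas u)) ->
  U2 <= um -> 3 <= n -> p < ((k + 1) * n + 2) / (n - 2) ->
  exists q Q M0, [/\ 0 < q < 1, hb < M0, Q * (n - 2) - 2 < q * n &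
    forall l : R, M0 <= l -> q <= l * dhh l / hh l <= Q].
Proof.
move=> U21 hU Um n3 hp.
have [e [q [e0 q01 qq qn]]] := growth_exponents k02 p1 n3 hp.
have [e' [d1 [e'0 d10 window]]] := growth_window k02 p1 e0.
have [U3 U31 h3] := ww_le e'0; have [U4 U41 h4] := elas_lim d10.
have [U5 h5] := pq_lim d10.
pose X := Num.max (Num.max U3 U4) (Num.max U5 (um + 1)).
have X3 : U3 <= X by rewrite !le_max lexx.
have X4 : U4 <= X by rewrite !le_max lexx !orbT.
have X5 : U5 <= X by rewrite !le_max lexx !orbT.
have X6 : um < X by rewrite !lt_max (ltrDl um) ltr01 !orbT.
exists q, ((1 + k / 2)^-1 * (p - k / 2) + e), (V X); split => //.
  exact: (V_lt ca c00 a_ge).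
move=> l Xl; have bl : hb < l by apply: lt_le_trans Xl; exact: (V_lt ca c00 a_ge).
have uX : X <= U l.
  by rewrite leNgt; apply/negP => /(V_lt ca c00 a_ge); rewrite (chUK ca c00 a_ge) ltNge Xl.
have uu : um < U l by exact: lt_le_trans uX.
have u0 : 0 < U l by apply: lt_trans uu; exact: um_gt0.
have [_ b6] := hU (U l) (le_trans Um (ltW uu)).
have /andP[w1 w2] := window _ _ _ (ww_gt0 u0) b6 (h3 _ (le_trans X3 uX)) (h4 _ (le_trans X4 uX))
  (elas_le u0) (pq_gt uu) (h5 _ (le_trans X5 uX) uu).
by rewrite growthE//; apply/andP; split => //; exact: le_trans w1.
Qed.

End Nonlinearity.

(** * The coefficient a *)

(** [A] is the leading part a1 u^k of [au]. The hypothesis A <= a1 u^2, which holds for k <= 2 and u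
    >= 1, turns a bound of order 1/sqrt(A) into one of order 1/u. *)
Lemma asym_bound {R : rcfType} (a1 kl A u au x y : R) : 0 < a1 -> 0 < u -> 0 < kl -> 0 < A ->
  A <= a1 * u ^+ 2 -> A <= au -> au <= 2 * A -> kl * A / 4 <= (x + y) * au - x ^+ 2 ->
  kl / (32 * Num.sqrt a1) / u <= Num.sqrt au * (((x + y) * au - x ^+ 2) / (2 * au ^+ 2)).
Proof.
move=> a10 u0 kl0 A0 Au aA' aA; move: (_ - _) => W main.
have au0 : 0 < au by exact: lt_le_trans aA'.
have sa1 : 0 < Num.sqrt a1 by rewrite sqrtr_gt0.
have sA : 0 < Num.sqrt A by rewrite sqrtr_gt0.
have sA2 : Num.sqrt A <= Num.sqrt a1 * u.
  have -> : Num.sqrt a1 * u = Num.sqrt (a1 * u ^+ 2) by rewrite sqrtrM ?sqrtr_sqr ?gtr0_norm// ltW.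
  by apply: ler_wsqrtr.
apply: (@le_trans _ _ (Num.sqrt A * (kl * A / 4 / (2 * (2 * A) ^+ 2)))).
  have -> : Num.sqrt A * (kl * A / 4 / (2 * (2 * A) ^+ 2)) = kl / (32 * Num.sqrt A).
    by rewrite -{2 3}(sqr_sqrtr (ltW A0)); field; rewrite gt_eqF.
  have -> : kl / (32 * Num.sqrt a1) / u = kl / (32 * (Num.sqrt a1 * u)) by field; rewrite !gt_eqF.
  apply: ler_wpM2l; first exact: ltW.
  by rewrite lef_pV2 ?posrE ?mulr_gt0// ler_pM2l.
apply: ler_pM => //.
- by apply: divr_ge0; [apply: divr_ge0 => //; apply: mulr_ge0; exact: ltW|apply: mulr_ge0 => //; exact: sqr_ge0].
- exact: ler_wsqrtr.
apply: ler_pM => //.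
- by apply: divr_ge0 => //; apply: mulr_ge0; exact: ltW.
- by rewrite invr_ge0; apply: mulr_ge0 => //; exact: sqr_ge0.
rewrite lef_pV2 ?posrE ?mulr_gt0 ?exprn_gt0 ?mulr_gt0//.
apply: ler_wpM2l => //; apply: lerXn2r; rewrite ?nnegrE//; first exact: ltW.
by apply: mulr_ge0 => //; exact: ltW.
Qed.

Section Coefficient.
Context {R : realType}.
Variables (a1 k c0 l : R) (psi dpsi ddpsi a : R -> R).
Hypothesis a10 : 0 < a1.
Hypothesis k02 : 0 < k <= 2.
Hypothesis c00 : 0 < c0.
Hypothesis hpsi : forall s : R, drv psi s (dpsi s).
Hypothesis hdpsi : forall s : R, drv dpsi s (ddpsi s).
Hypothesis psi_ge : forall s : R, 0 <= s -> c0 <= psi s.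
Hypothesis dpsi_le : forall s : R, 0 <= s -> s * dpsi s <= k * psi s.
Hypothesis l0 : 0 < l.
Hypothesis lim0 : forall e : R, 0 < e -> exists U : R, forall u : R, U <= u -> `|psi u - l| < e.
Hypothesis lim1 : forall e : R, 0 < e -> exists U : R, forall u : R, U <= u -> `|u * dpsi u| < e.
Hypothesis lim2 : forall e : R, 0 < e -> exists U : R, forall u : R, U <= u -> `|u ^+ 2 * ddpsi u| < e.
Hypothesis ha : forall s : R, a s = a1 * `|s| `^ k + psi s.

Definition coef' (s : R) : R := a1 * k * s `^ (k - 1) + dpsi s.
Definition coef'' (s : R) : R := a1 * k * (k - 1) * s `^ (k - 2) + ddpsi s.
Local Notation da := coef'.
Local Notation dda := coef''.

Let k0 : 0 < k. Proof. by case/andP: k02. Qed.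

Lemma drv_powR' (s r : R) : 0 < s -> drv (fun s => s `^ r) s (r * s `^ (r - 1)).
Proof.
by move=> s0; apply: drv_eq; [apply: drv_powR; [exact: drvI|exact: s0]|rewrite /= ?mulr1 ?mul1r].
Qed.

Lemma coef_cont : continuous a.
Proof.
move=> s; rewrite (_ : a = fun s : R => a1 * `|s| `^ k + psi s); last exact/funext.
apply: (contD (f := fun s : R => a1 * `|s| `^ k) (g := psi)); last exact: drv_cont (hpsi s).
apply: contM; first exact: contC.
have [->|s0] := eqVneq s 0.
  apply/continuousP => e e0; exists (e `^ k^-1); first exact: powR_gt0.
  move=> t; rewrite subr0 normr0 powR0 ?gt_eqF// subr0 => ht.
  rewrite ger0_norm ?powR_ge0//.
  have -> : e = (e `^ k^-1) `^ k by rewrite -powRrM mulVf ?gt_eqF// powRr1// ltW.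
  by rewrite lt_powR ?powR_ge0.
apply: (cont_comp (f := fun s : R => `|s|) (g := fun t => t `^ k)); first exact: norm_continuous.
by apply: drv_cont (drv_powR' k _); rewrite normr_gt0.
Qed.

Lemma coef_ge s : 0 <= s -> c0 <= a s.
Proof.
move=> s0; rewrite ha; apply: le_trans (psi_ge s0) _; rewrite lerDr.
by apply: mulr_ge0; [exact: ltW|exact: powR_ge0].
Qed.

Lemma drv_coef s : 0 < s -> drv a s (da s).
Proof.
move=> s0; apply: (drv_near (f := fun s => a1 * s `^ k + psi s)).
  near=> y; rewrite ha ger0_norm// ltW//; near: y; exact: lt_nbhsr.
apply: drv_eq; first by apply: drvD; [apply: drvM; [exact: drvC|exact: drv_powR']|exact: hpsi].
by rewrite /da /=; ring.
Unshelve. all: by end_near. Qed.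

Lemma drv_coef' s : 0 < s -> drv da s (dda s).
Proof.
move=> s0; rewrite /da.
apply: drv_eq; first by apply: drvD; [apply: drvM; [exact: drvC|exact: drv_powR']|exact: hdpsi].
by rewrite /dda /= (_ : k - 1 - 1 = k - 2); ring.
Qed.

Lemma powRS (s r : R) : 0 < s -> s * s `^ (r - 1) = s `^ r.
Proof.
move=> s0; rewrite -{1}(powRr1 (ltW s0)) -powRD; first by congr (_ `^ _); ring.
by apply/implyP => _; rewrite gt_eqF.
Qed.

Lemma mul_coef' s : 0 < s -> s * da s = k * (a1 * s `^ k) + s * dpsi s.
Proof. by move=> s0; rewrite /da -(powRS k s0); ring. Qed.

Lemma mul_coef'' s : 0 < s -> s ^+ 2 * dda s = k * (k - 1) * (a1 * s `^ k) + s ^+ 2 * ddpsi s.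
Proof.
move=> s0; rewrite /dda -(powRS k s0) -(powRS (k - 1) s0) (_ : k - 1 - 1 = k - 2); ring.
Qed.

Lemma coef'_bound (A : R) : exists2 C, 0 <= C & forall s : R, 0 < s <= A -> `|s * da s| <= C.
Proof.
have [A0|A0] := leP A 0; first by exists 0 => // s; lra.
have [t _|C C0 hC] := @bounded_seg _ dpsi 0 A (ltW A0); first exact: drv_cont (hdpsi t).
have k1 : 0 <= k * (a1 * A `^ k) by apply: mulr_ge0; [|apply: mulr_ge0; [|exact: powR_ge0]]; exact: ltW.
exists (k * (a1 * A `^ k) + A * C); first by rewrite addr_ge0// mulr_ge0// ltW.
move=> s /andP[s0 sA]; rewrite mul_coef'//; apply: le_trans (ler_normD _ _) _; apply: lerD.
  rewrite ger0_norm; last by apply: mulr_ge0; [|apply: mulr_ge0; [|exact: powR_ge0]]; exact: ltW.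
  apply: ler_wpM2l; first exact: ltW.
  apply: ler_wpM2l; first exact: ltW.
  by apply: ge0_ler_powR; rewrite ?nnegrE//; apply: ltW.
rewrite normrM (gtr0_norm s0); apply: ler_pM => //; first exact: ltW.
by apply: hC; rewrite (ltW s0).
Qed.

Lemma coef'_le s : 0 < s -> s * da s <= k * a s.
Proof.
move=> s0; rewrite mul_coef'// ha (ger0_norm (ltW s0)) mulrDr lerD2l.
exact: dpsi_le (ltW s0).
Qed.

Lemma power_large (K : R) : exists2 U, 1 <= U & forall u, U <= u -> K <= a1 * u `^ k.
Proof.
exists (1 + (`|K| / a1) `^ k^-1); first by rewrite lerDl powR_ge0.
move=> u Uu; have x0 : 0 <= (`|K| / a1) `^ k^-1 by exact: powR_ge0.
have y0 : 0 <= `|K| / a1 by rewrite divr_ge0// ltW.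
apply: (le_trans (ler_norm K)); rewrite mulrC -ler_pdivrMr//.
have -> : `|K| / a1 = (`|K| / a1) `^ k^-1 `^ k by rewrite -powRrM mulVf ?gt_eqF// powRr1.
by apply: ge0_ler_powR; rewrite ?nnegrE//; [exact: ltW|lra|lra].
Qed.

(** With A = a1 u^k, P = psi, x = u psi' and y = u^2 psi'', the terms in A^2 cancel and k^2 A P is
    left, with P close to l. The errors linear in [A] are at most 6 e A; the factor 48 makes them an
    eighth of k^2 l A, and the bounded errors take another eighth. *)
Lemma asym_algebra (A P x y e : R) : 0 < e -> e <= 1 -> 48 * e <= k ^+ 2 * l -> `|x| < e -> `|y| < e ->
  l / 2 <= P -> P <= 2 * l -> 2 * l <= A -> 1 <= A * (k ^+ 2 * l / 8) - 4 * l -> 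
  k ^+ 2 * l * A / 4 <= (k * A + x + (k * (k - 1) * A + y)) * (A + P) - (k * A + x) ^+ 2.
Proof.
move=> e0 e1 ek; rewrite !ltr_norml => hx hy P1 P2 PA h1.
have K := k02; have L := l0; have A0 : 0 < A by lra.
have -> : (k * A + x + (k * (k - 1) * A + y)) * (A + P) - (k * A + x) ^+ 2 =
   k ^+ 2 * (A * P) + (x + y) * A + (x + y) * P - (2 * k * x) * A - x ^+ 2 by ring.
have q1 : k ^+ 2 * (A * (l / 2)) <= k ^+ 2 * (A * P).
  by apply: ler_wpM2l; [exact: sqr_ge0|apply: ler_wpM2l => //; exact: ltW].
have q2 : - (2 * e) * A <= (x + y) * A by apply: ler_wpM2r; [exact: ltW|lra].
have q3 : - (4 * l) <= (x + y) * P.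
  have : - (2 * e) * P <= (x + y) * P by apply: ler_wpM2r; lra.
  have : e * P <= 1 * (2 * l) by apply: ler_pM => //; lra.
  lra.
have q4 : (2 * k * x) * A <= (4 * e) * A.
  apply: ler_wpM2r; first exact: ltW.
  apply: (@le_trans _ _ (2 * k * e)); first by apply: ler_wpM2l; lra.
  by apply: ler_wpM2r; lra.
have q5 : x ^+ 2 <= 1.
  by rewrite -(real_normK (num_real x)) expr_le1// ler_norml; lra.
have q6 : 48 * e * A <= k ^+ 2 * l * A by apply: ler_wpM2r => //; exact: ltW.
move: q1 q2 q3 q4 q5 q6 h1.
have -> : k ^+ 2 * (A * (l / 2)) = k ^+ 2 * l * A / 2 by field.
have -> : A * (k ^+ 2 * l / 8) = k ^+ 2 * l * A / 8 by field.
rewrite mulNr -!(mulrA _ e A).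
move: (e * A) (k ^+ 2 * l * A) (k ^+ 2 * (A * P)) ((x + y) * A) ((x + y) * P) (2 * k * x * A) (x ^+ 2).
by move=> z1 z2 z3 z4 z5 z6 z7; lra.
Qed.

Lemma coef_regime (e K : R) : 0 < e -> exists2 U, 1 <= U & forall u, U <= u ->
  [/\ `|u * dpsi u| < e, `|u ^+ 2 * ddpsi u| < e, l / 2 <= psi u <= 2 * l & K <= a1 * u `^ k].
Proof.
move=> e0; have [U1 h1] := lim1 e0; have [U2 h2] := lim2 e0.
have [|U3 h3] := lim0 (e := l / 2); first by rewrite divr_gt0.
have [U4 U41 h4] := power_large K.
exists (Num.max (Num.max U1 U2) (Num.max U3 U4)) => [|u]; first by rewrite !le_max U41 !orbT.
rewrite !ge_max => /andP[/andP[u1 u2] /andP[u3 u4]]; split; [exact: h1|exact: h2| |exact: h4].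
by have := h3 u u3; have := l0; rewrite ltr_norml; move: (psi u) => y; lra.
Qed.

Lemma coef_asym : exists2 c, 0 < c & exists2 U1, 1 <= U1 & forall u : R, U1 <= u ->
  0 <= da u /\ c / u <= u * Num.sqrt (a u) * delas a da dda u.
Proof.
have kl : 0 < k ^+ 2 * l by rewrite mulr_gt0// exprn_gt0.
have [e [e0 e1 e2]] : exists e, [/\ 0 < e, e <= 1 & 48 * e <= k ^+ 2 * l].
  exists (Num.min 1 (k ^+ 2 * l / 48)); split; first by rewrite lt_min ltr01 divr_gt0.
    by rewrite ge_min lexx.
  by rewrite mulrC -ler_pdivlMr// ge_min lexx orbT.
have sa1 : 0 < Num.sqrt a1 by rewrite sqrtr_gt0.
(* Three lower bounds on A = a1 u^k: 2 l gives a(u) <= 2 A, the second absorbs the bounded errors of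
   [asym_algebra], and 1/k gives k A >= 1, hence a'(u) >= 0. *)
have [U U1 hU] := coef_regime (Num.max (2 * l) (Num.max ((1 + 4 * l) / (k ^+ 2 * l / 8)) k^-1)) e0.
exists (k ^+ 2 * l / (32 * Num.sqrt a1)); first by rewrite divr_gt0// mulr_gt0.
exists U => // u Uu; have u1 : 1 <= u by exact: le_trans Uu.
have u0 : 0 < u by exact: lt_le_trans u1.
have [k1 k2 /andP[P1 P2]] := hU u Uu; rewrite !ge_max => /and3P[Al Ae Ak].
rewrite ler_pdivrMr ?divr_gt0// -lerBrDr in Ae.
have A0 : 0 < a1 * u `^ k by rewrite mulr_gt0// powR_gt0.
have main := asym_algebra e0 e1 e2 k1 k2 P1 P2 Al Ae.
have m1 := mul_coef' u0; have m2 := mul_coef'' u0.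
have aE : a u = a1 * u `^ k + psi u by rewrite ha ger0_norm// ltW.
split.
  rewrite -(pmulr_rge0 _ u0) m1 -(subrK (- (u * dpsi u)) (k * _)) subrK -[u * dpsi u]opprK subr_ge0.
  apply: (@le_trans _ _ 1); first by apply: (le_trans (ler_norm _)); rewrite normrN; exact: ltW (lt_le_trans k1 e1).
  by rewrite mulrC -ler_pdivrMr// div1r.
rewrite -m1 -m2 -aE in main.
have -> : u * Num.sqrt (a u) * delas a da dda u =
    Num.sqrt (a u) * (((u * da u + u ^+ 2 * dda u) * a u - (u * da u) ^+ 2) / (2 * a u ^+ 2)).
  by rewrite /delas; field; rewrite aE gt_eqF// ltr_pwDl// (le_trans _ P1)// divr_ge0// ltW.
apply: (asym_bound a10 u0 kl A0 _ _ _ main); rewrite ?aE.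
- apply: ler_wpM2l; first exact: ltW.
  by rewrite -powR_mulrn ?(ltW u0)//; apply: ler_powR => //; case/andP: k02.
- by rewrite lerDl (le_trans _ P1)// divr_ge0// ltW.
- by rewrite mulr_natl mulr2n lerD2l (le_trans P2).
Qed.

Lemma coef_elas_lim (e : R) : 0 < e -> exists2 U1, 1 <= U1 & forall u : R, U1 <= u ->
  k / 2 - e <= elas a da u.
Proof.
move=> e0; have [U U1 hU] := coef_regime ((1 + 4 * l) / e) (@ltr01 R).
exists U => // u Uu; have u0 : 0 < u by exact: lt_le_trans (le_trans U1 Uu).
have [k1 _ k3 k4] := hU u Uu.
have au : 0 < a u by apply: lt_le_trans (coef_ge (ltW u0)); exact: c00.
rewrite /elas mul_coef'// ler_pdivlMr; last by rewrite mulr_gt0.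
have -> : a u = a1 * u `^ k + psi u by rewrite ha ger0_norm// ltW.
rewrite ler_pdivrMr// in k4.
have c1 := c00; have L := l0; have K := k02.
move: k1 k3 k4; rewrite ltr_norml; move: (a1 * u `^ k) (u * dpsi u) (psi u) (psi_ge (ltW u0)) => A x P Pc k1 k3 k4.
have kP : k * P <= 2 * (2 * l) by apply: ler_pM; lra.
have eP : 0 <= e * P by apply: mulr_ge0; lra.
have -> : (k / 2 - e) * (2 * (A + P)) = k * A + k * P - 2 * (A * e) - 2 * (e * P) by field.
lra.
Qed.

End Coefficient.

(** * Integration on tuples *)

Section TupleMeasure.
Context {R : realType}.
Local Notation Rb := (measurableTypeR R).
Local Notation leb := (@lebesgue_measure R).

(** A product of one-dimensional densities is integrable on tuples by Tonelli's theorem alone.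
    Domination by it replaces polar coordinates for rapidly decaying radial functions. *)
Definition weight n (t : n.-tuple Rb) : R := \prod_(i < n) (1 + (tnth t i : R) ^+ 2)^-1.

Lemma weight_gt0 n (t : n.-tuple Rb) : 0 < weight t.
Proof. by apply: prodr_gt0 => i _; rewrite invr_gt0 ltr_pwDl// sqr_ge0. Qed.

Lemma tnth_tconsS n (x : Rb) (t : n.-tuple Rb) i : tnth (tcons (x, t)) (lift ord0 i) = tnth t i.
Proof. by rewrite /tcons !(tnth_nth 0). Qed.

Lemma weight_tcons n (x : Rb) (t : n.-tuple Rb) :
  weight (tcons (x, t)) = (1 + (x : R) ^+ 2)^-1 * weight t.
Proof.
rewrite /weight big_ord_recl; congr (_ * _).
by apply: eq_bigr => i _; rewrite tnth_tconsS.
Qed.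

Lemma measurable_oneDsqrV : measurable_fun [set: R] (fun x : R => (1 + x ^+ 2)^-1).
Proof. by apply: continuous_measurable_fun; exact: (@continuous_oneDsqrV R). Qed.

Lemma measurable_weight n : measurable_fun [set: n.-tuple Rb] (@weight n).
Proof.
apply: measurable_prod => i _.
by apply: (measurableT_comp measurable_oneDsqrV); exact: measurable_tnth.
Qed.

Lemma measurable_tcons_r n (x : Rb) : measurable_fun [set: n.-tuple Rb] (fun t => tcons (x, t)).
Proof. by apply: (measurableT_comp (@measurable_tcons R n)); exact: pair1_measurable. Qed.

Lemma oneDsqr_integral_lty : (\int[leb]_x ((1 + (x : R) ^+ 2)^-1)%:E < +oo)%E.
Proof.
rewrite (@ge0_symfun_integralT R (fun x => (1 + x ^+ 2)^-1)).
- by have := @integral0y_oneDsqr R; rewrite set_itvE /= => ->; rewrite ltry.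
- by move=> x; rewrite invr_ge0 addr_ge0// sqr_ge0.
- exact: (@continuous_oneDsqrV R).
- by move=> x /=; rewrite sqrrN.
Qed.

Lemma step_integral_ge0 n (f : n.+1.-tuple Rb -> R) :
  measurable_fun [set: n.+1.-tuple Rb] f -> (forall t, 0 <= f t) ->
  (\int[lebesgue_tuple n.+1]_t (f t)%:E = \int[leb]_x \int[lebesgue_tuple n]_t (f (tcons (x, t)))%:E)%E.
Proof.
move=> mf f0; pose fE (t : n.+1.-tuple Rb) : \bar R := (f t)%:E.
have mfE : measurable_fun [set: n.+1.-tuple Rb] fE by exact/measurable_EFinP.
rewrite [LHS](@ge0_integral_pushforward _ _ _ _ R (@tcons R n) (@measurable_tcons R n)
  (leb \x lebesgue_tuple n)%E setT fE)//; last by move=> t _; rewrite /= lee_fin.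
rewrite preimage_setT (fubini_tonelli1 (fE \o @tcons R n))//.
  by apply: measurableT_comp => //; exact: measurable_tcons.
by move=> z; rewrite /= lee_fin.
Qed.

Lemma weight_integral_lty n : (\int[lebesgue_tuple n]_t (weight t)%:E < +oo)%E.
Proof.
elim: n => [|n IH].
  rewrite /= integral_dirac ?diracT ?mul1e ?ltry//.
  by apply/measurable_EFinP; exact: measurable_weight.
rewrite step_integral_ge0; [|exact: measurable_weight|by move=> t; exact/ltW/weight_gt0].
set I := (\int[lebesgue_tuple n]_t (weight t)%:E)%E in IH.
have I0 : (0 <= I)%E by apply: integral_ge0 => t _; rewrite lee_fin ltW// weight_gt0.
have o0 (x : R) : 0 <= (1 + x ^+ 2)^-1 by rewrite invr_ge0 addr_ge0// sqr_ge0.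
under eq_integral => x _.
  under eq_integral => t _ do rewrite weight_tcons EFinM.
  rewrite ge0_integralZl//; [|by apply/measurable_EFinP; exact: measurable_weight|by move=> t _; rewrite lee_fin ltW// weight_gt0|by rewrite lee_fin; exact: o0].
  rewrite -/I muleC; over.
rewrite ge0_integralZl//; [|by apply/measurable_EFinP; exact: measurable_oneDsqrV|by move=> x _; rewrite lee_fin].
by apply: lte_mul_pinfty => //; [rewrite ge0_fin_numE|exact: oneDsqr_integral_lty].
Qed.

Lemma weight_integrable n : (lebesgue_tuple n).-integrable setT (EFin \o @weight n).
Proof.
apply/integrableP; split; first by apply/measurable_EFinP; exact: measurable_weight.
apply: le_lt_trans (weight_integral_lty n); under eq_integral => t _ do
  rewrite /= gtr0_norm ?weight_gt0//.
by [].
Qed.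

Definition dominated n (f : n.-tuple Rb -> R) :=
  measurable_fun [set: n.-tuple Rb] f /\ exists C : R, forall t, `|f t| <= C * weight t.

Lemma dominated_integrable n (f : n.-tuple Rb -> R) :
  dominated f -> (lebesgue_tuple n).-integrable setT (EFin \o f).
Proof.
move=> [mf [C hC]]; have mfE : measurable_fun [set: n.-tuple Rb] (EFin \o f) by exact/measurable_EFinP.
have iw : (lebesgue_tuple n).-integrable setT (fun t => C%:E * (weight t)%:E)%E.
  by apply: integrableZl => //; exact: weight_integrable.
apply: (le_integrable _ mfE _ iw) => //= t _.
by rewrite lee_fin (le_trans (hC t))// ler_norm.
Qed.

Lemma dominated_tcons_r n (f : n.+1.-tuple Rb -> R) (x : Rb) :
  dominated f -> dominated (fun t : n.-tuple Rb => f (tcons (x, t))).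
Proof.
move=> [mf [C hC]]; split; first by apply: (measurableT_comp mf); exact: measurable_tcons_r.
by exists (C * (1 + (x : R) ^+ 2)^-1) => t; rewrite -mulrA -weight_tcons.
Qed.

Lemma step_integral n (f : n.+1.-tuple Rb -> R) : dominated f ->
  (leb \x lebesgue_tuple n)%E.-integrable setT (fun z => (f (tcons z))%:E) /\
  (\int[lebesgue_tuple n.+1]_t (f t)%:E = \int[leb \x lebesgue_tuple n]_z (f (tcons z))%:E)%E.
Proof.
move=> df; pose fE (t : n.+1.-tuple Rb) : \bar R := (f t)%:E.
have mf : measurable_fun [set: n.+1.-tuple Rb] fE by apply/measurable_EFinP; case: df.
have i1 : (leb \x lebesgue_tuple n)%E.-integrable setT (fE \o @tcons R n).
  apply/integrableP; split; first by apply: measurableT_comp => //; exact: measurable_tcons.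
  have /integrableP[_] := dominated_integrable df; apply: le_lt_trans.
  rewrite [leRHS](@ge0_integral_pushforward _ _ _ _ R (@tcons R n) (@measurable_tcons R n)
    (leb \x lebesgue_tuple n)%E setT (fun t => `|fE t|%E))//.
  by apply: measurableT_comp.
split => //.
by rewrite [LHS](@integral_pushforward _ _ _ _ R (@tcons R n) (@measurable_tcons R n)
  (leb \x lebesgue_tuple n)%E setT fE).
Qed.

Lemma derivative_integral0 (w g : R -> R) (K : R) : (forall s, drv w s (g s)) -> continuous g ->
  (forall s, K < `|s| -> w s = 0 /\ g s = 0) -> (\int[leb]_x (g x)%:E = 0)%E.
Proof.
move=> dw cg hK; pose b := `|K| + 1; have Kb : K < b by rewrite /b; have := ler_norm K; lra.
have b0 : 0 < b by rewrite /b; have := normr_ge0 K; lra.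
have lt : - b < b by lra.
pose I := `[- b, b]%R; transitivity (\int[leb]_(x in [set` I]) (g x)%:E)%E.
  rewrite [RHS]integral_mkcond; apply: eq_integral => x _; rewrite patchE.
  case: ifPn => //; rewrite notin_setE /= in_itv /= => hx.
  suff : K < `|x| by move=> /hK[_ ->].
  by apply: lt_le_trans Kb _; rewrite leNgt; apply/negP; rewrite ltr_norml => /andP[x1 x2]; move: hx; rewrite (ltW x1) (ltW x2).
rewrite (@continuous_FTC2 _ g w)//.
- have [-> _] := hK b ltac:(by rewrite gtr0_norm).
  by have [-> _] := hK (- b) ltac:(by rewrite normrN gtr0_norm); rewrite -EFinB subrr.
- by apply: continuous_in_subspaceT => x _; exact: cg.
- split => [x _||]; first by have := dw x; case.
  + by apply: cvg_at_right_filter; exact: drv_cont (dw _).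
  + by apply: cvg_at_left_filter; exact: drv_cont (dw _).
- by move=> x _; have [_ <-] := dw x; rewrite derive1E.
Qed.

Definition tset n (t : n.-tuple Rb) (i : 'I_n) (s : Rb) : n.-tuple Rb :=
  [tuple (if j == i then s else tnth t j) | j < n].

Lemma tset0 n (x s : Rb) (t : n.-tuple Rb) : tset (tcons (x, t)) ord0 s = tcons (s, t).
Proof.
apply: eq_from_tnth => j; rewrite tnth_mktuple; case: (unliftP ord0 j) => [k ->|-> //].
by rewrite !tnth_tconsS.
Qed.

Lemma tsetS n (x s : Rb) (t : n.-tuple Rb) (i : 'I_n) :
  tset (tcons (x, t)) (lift ord0 i) s = tcons (x, tset t i s).
Proof.
apply: eq_from_tnth => j; rewrite tnth_mktuple; case: (unliftP ord0 j) => [k ->|-> //].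
by rewrite (inj_eq lift_inj) !tnth_tconsS tnth_mktuple.
Qed.

(** Fubini's theorem reduces this to one variable. If the differentiated coordinate is the first, it
    is integrated first; otherwise the first coordinate is frozen and the induction hypothesis
    applies to the others. *)
Lemma partial_integral0 n (i : 'I_n) (w g : n.-tuple Rb -> R) (K : R) : dominated g ->
  (forall t s, drv (fun s : R => w (tset t i s)) s (g (tset t i s))) ->
  (forall t, continuous (fun s : R => g (tset t i s))) ->
  (forall t (s : R), K < `|s| -> w (tset t i s) = 0 /\ g (tset t i s) = 0) ->
  (\int[lebesgue_tuple n]_t (g t)%:E = 0)%E.
Proof.
elim: n i w g => [[]//|n IH] i w g dg dw cg hK.
have [i1 ->] := step_integral dg.
case: (unliftP ord0 i) => [k ki|i0].
  rewrite -integral12_prod_meas1// /fubini_F.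
  rewrite (eq_integral (fun=> 0%E)) ?integral0// => x _ /=.
  apply: (IH k (fun t => w (tcons (x, t)))).
  - exact: dominated_tcons_r.
  - move=> t s; have := dw (tcons (x, t)) s; rewrite ki => h.
    by rewrite -tsetS; apply: drv_ext h => y; rewrite tsetS.
  - move=> t; have := cg (tcons (x, t)); rewrite ki.
    by under eq_fun do rewrite tsetS.
  - by move=> t s sK; rewrite -tsetS -ki; apply: hK.
rewrite -integral21_prod_meas1// /fubini_G.
rewrite (eq_integral (fun=> 0%E)) ?integral0// => t _ /=.
(* An arbitrary first entry, overwritten by [tset]. *)
pose z : Rb := 0.
have e s : tset (tcons (z, t)) i s = tcons (s, t) by rewrite i0 tset0.
apply: (@derivative_integral0 (fun s => w (tcons (s, t))) _ K).
- by move=> s; have := dw (tcons (z, t)) s; rewrite e; apply: drv_ext => y; rewrite e.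
- by have := cg (tcons (z, t)); under eq_fun do rewrite e.
- by move=> s sK; rewrite -e; exact: hK.
Qed.

Lemma lebesgue_tupleT_gt0 n : (0 < lebesgue_tuple n [set: n.-tuple Rb])%E.
Proof.
elim: n => [|n IH]; first by rewrite /= diracT.
rewrite /= /lebesgue_step /pushforward preimage_setT -setXTT product_measure1E//.
apply: mule_gt0 => //.
have h : (0 < leb [set: R])%E by rewrite -set_itvNyy lebesgue_measure_itv /= addye// ltry.
exact: h.
Qed.

Lemma halfspace_infinite n (c : R) :
  lebesgue_tuple n.+1 (@thead n Rb @^-1` `[c, +oo[%classic) = +oo%E.
Proof.
rewrite /= /lebesgue_step /pushforward.
have -> : @tcons R n @^-1` (@thead n Rb @^-1` `[c, +oo[%classic) = (`[c, +oo[%classic : set Rb) `*` [set: n.-tuple Rb].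
  by apply/seteqP; split => [[x t]|[x t] []].
have h : leb `[c, +oo[%classic = +oo%E by rewrite lebesgue_measure_itv /= ltry.
rewrite product_measure1E//; first by rewrite [X in (X * _)%E]h gt0_mulye//; exact: lebesgue_tupleT_gt0.
Qed.

Definition rbox n (f : {ffun 'I_n -> rat * rat}) : set 'rV[R]_n :=
  [set x | forall i, ratr (f i).1 < x 0 i < ratr (f i).2].

Lemma measurable_rbox n (f : {ffun 'I_n -> rat * rat}) :
  measurable ((@vec_of_tuple R n) @^-1` (rbox f)).
Proof.
rewrite (_ : _ @^-1` _ = \bigcap_(i in [set: 'I_n])
   ((fun t : n.-tuple Rb => tnth t i) @^-1` `]ratr (f i).1, ratr (f i).2[)).
  apply: fin_bigcap_measurable => // i _; rewrite -[X in measurable X]setTI.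
  exact: measurable_tnth.
apply/seteqP; split => t /= h.
  by move=> i _; have := h i; rewrite /= mxE in_itv.
by move=> i; have := h i I; rewrite /= in_itv mxE.
Qed.

Lemma open_rboxE n (O : set 'rV[R]_n) : open O -> O = \bigcup_(f in [set f | rbox f `<=` O]) rbox f.
Proof.
move=> oO; apply/seteqP; split => [x Ox|x [f fO]]; last exact: fO.
have [P hP PO] : nbhs x O by exact: open_nbhs_nbhs.
have ex (i : 'I_n) : exists pq : rat * rat, ratr pq.1 < x 0 i < ratr pq.2 /\
    forall y : R, ratr pq.1 < y < ratr pq.2 -> P 0 i y.
  have /nbhs_ballP[e /= e0 he] := hP 0 i.
  have [|p1] := @rat_in_itvoo R (x 0 i - e) (x 0 i); first by rewrite ltrBlDr ltrDl.
  rewrite in_itv /= => /andP[p1l p1r].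
  have [|p2] := @rat_in_itvoo R (x 0 i) (x 0 i + e); first by rewrite ltrDl.
  rewrite in_itv /= => /andP[p2l p2r].
  exists (p1, p2); split => /= [|y /andP[y1 y2]]; first by rewrite p1r p2l.
  by apply: he; rewrite /ball /= ltr_norml; lra.
have [f hf] := choice ex.
exists [ffun i => f i]; last by move=> i; rewrite ffunE; case: (hf i).
move=> y hy; apply: PO => i j; rewrite ord1.
by apply: (hf j).2; have := hy j; rewrite ffunE.
Qed.

(** Measurability refers to the product sigma-algebra on tuples, continuity to the topology of row
    vectors. An open set is a countable union of boxes with rational corners, whose preimages are
    measurable. *)
Lemma measurable_continuous n (f : 'rV[R]_n -> R) : continuous f ->
  measurable_fun [set: n.-tuple Rb] (f \o @vec_of_tuple R n).
Proof.
move=> /topology_structure.continuousP cf; apply: (measurability _ (RGenOpens.measurableE R)).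
move=> _ [_ [a [b ->] <-]]; rewrite setTI comp_preimage.
have oO : open (f @^-1` `]a, b[) by apply: cf; exact: interval_open.
rewrite (open_rboxE oO) preimage_bigcup bigcup_mkcond.
apply: countable_bigcupT_measurable => // g; case: ifPn => _ //.
exact: measurable_rbox.
Qed.

Lemma weight_le1 n (t : n.-tuple Rb) : weight t <= 1.
Proof.
apply: prodr_ile1 => i _; have k : 1 <= 1 + (tnth t i : R) ^+ 2 by rewrite lerDl sqr_ge0.
by rewrite invr_ge0 (le_trans ler01 k) invf_le1// (lt_le_trans ltr01 k).
Qed.

Lemma Lp1_dominated n (f : 'rV[R]_n -> R) : dominated (f \o @vec_of_tuple R n) -> Lp 1%:E f.
Proof. by move=> /dominated_integrable h; apply/Lfun1_integrable. Qed.

Lemma Lp2_dominated n (f : 'rV[R]_n -> R) : dominated (f \o @vec_of_tuple R n) -> Lp 2%:E f.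
Proof.
move=> [mf [C hC]]; have C0 : 0 <= C.
  have /le_trans := normr_ge0 ((f \o @vec_of_tuple R n) [tuple of nseq n (0 : R)]).
  by move=> /(_ _ (hC _)); rewrite pmulr_lge0// weight_gt0.
have d2 : dominated (fun t : n.-tuple Rb => (f (vec_of_tuple t)) ^+ 2).
  split; first exact: measurable_funX.
  exists (C ^+ 2) => t; rewrite normrX.
  apply: (@le_trans _ _ ((C * weight t) ^+ 2)).
    by apply: lerXn2r; rewrite ?nnegrE ?mulr_ge0 ?(ltW (weight_gt0 t))//; exact: hC.
  rewrite exprMn; apply: ler_wpM2l; first exact: sqr_ge0.
  by rewrite expr2 ler_piMl ?weight_le1// ltW// weight_gt0.
have /integrableP[_ h] := dominated_integrable d2.
rewrite /Lp inE; apply/andP; split; rewrite inE //=.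
rewrite /finite_norm unlock; apply: poweR_lty; apply: le_lt_trans h.
rewrite le_eqVlt; apply/orP; left; apply/eqP; apply: eq_integral => t _ /=.
by rewrite normrX powR_mulrn.
Qed.

(** A half-space has infinite measure by the product structure alone, which makes it more convenient
    than the exterior of a ball. *)
Lemma Lp2_halfspace n (f : 'rV[R]_n.+1 -> R) (e c : R) : Lp 2%:E f -> 0 < e ->
  (forall x : 'rV[R]_n.+1, c <= x 0 0 -> e <= f x) -> False.
Proof.
move=> Lf e0 hf; have /integrableP[mf] := Lfun2_integrable_sqr Lf.
apply/negP; rewrite -leNgt.
pose H := @thead n Rb @^-1` `[c, +oo[%classic.
have mH : measurable H.
  rewrite -[X in measurable X]setTI; apply: (@measurable_tnth _ Rb n.+1 ord0) => //.
have <- : (\int[lebesgue_tuple n.+1]_(t in H) (e ^+ 2)%:E = +oo)%E.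
  by rewrite integral_cst// /H [X in (_ * X)%E](halfspace_infinite n c) mulry gtr0_sg ?mul1e// exprn_gt0.
apply: (@le_trans _ _ (\int[lebesgue_tuple n.+1]_(t in H) `|((f \o @vec_of_tuple R n.+1) t ^+ 2)%:E|)%E).
  apply: ge0_le_integral => //.
  - by move=> t _; rewrite lee_fin sqr_ge0.
  - by apply: measurable_funTS; apply: measurableT_comp.
  - move=> t Ht; rewrite lee_fin ger0_norm ?sqr_ge0//; apply: lerXn2r; rewrite ?nnegrE ?(ltW e0)//.
      by apply: (le_trans (ltW e0)); apply: hf; rewrite mxE; move: Ht; rewrite /H /= in_itv /= andbT.
    by apply: hf; rewrite mxE; move: Ht; rewrite /H /= in_itv /= andbT.
apply: ge0_subset_integral => //; exact: measurableT_comp.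
Qed.

End TupleMeasure.

(** * Radial functions *)

Section SmallIncrement.
Context {R : realType}.
Implicit Types f : R -> R.

Lemma drv_is_small f : drv f 0 0 -> forall e, 0 < e -> exists2 dl, 0 < dl & forall t : R, `|t| < dl ->
  `|f t - f 0| <= e * `|t|.
Proof.
move=> h e e0.
have d1 s : drv (fun t : R => f t - s * e * t) 0 (- s * e).
  apply: drv_eq; first by apply: drvD; [exact: h|apply: drvN; apply: drvM; [exact: drvC|exact: drvI]].
  by rewrite /=; ring.
have [|x x0 [hx1 hx2]] := drv_sign_neg (d1 1); first by rewrite mulNr mul1r oppr_lt0.
have [|y y0 [hy1 hy2]] := drv_sign_pos (d1 (-1)); first by rewrite opprK mul1r.
exists (Num.min x y); first by rewrite lt_min x0.
move=> t; rewrite lt_min => /andP[tx ty]; have [t0|t0|->] := ltgtP t 0; last by rewrite subrr !normr0 mulr0.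
  have := hx2 t; have := hy2 t; move: tx ty; rewrite (ltr0_norm t0) => tx ty.
  by move=> /(_ ltac:(lra)) k1 /(_ ltac:(lra)) k2; rewrite ler_norml; lra.
have := hx1 t; have := hy1 t; move: tx ty; rewrite (gtr0_norm t0) => tx ty.
by move=> /(_ ltac:(lra)) k1 /(_ ltac:(lra)) k2; rewrite ler_norml; lra.
Qed.

Lemma small_is_drv f : (forall e, 0 < e -> exists2 dl, 0 < dl & forall t : R, `|t| < dl ->
  `|f t - f 0| <= e * `|t|) -> drv f 0 0.
Proof.
move=> h; suff H : (fun k : R => k^-1 *: ((f \o shift 0) (k *: (1 : R)) - f 0)) @ 0^' --> (0 : R).
  by split; [apply/cvg_ex; exists 0|exact/cvg_lim].
apply/cvgrPdist_lt => e e0; have e2 : 0 < e / 2 by rewrite divr_gt0.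
have [dl dl0 hdl] := h _ e2.
apply/nbhs_ballP; exists dl => // t; rewrite /ball /= sub0r normrN => td t0.
have {}hdl := hdl t td.
rewrite sub0r normrN addr0 [t *: 1]mulr1 normrM normfV mulrC ltr_pdivrMr ?normr_gt0//.
by apply: (le_lt_trans hdl); rewrite ltr_pM2r ?normr_gt0//; lra.
Qed.

(** This is the shape, along its own axis through the origin, of a first partial derivative of a
    radial function, where f'(r)/r is only known to have a limit. *)
Lemma drv_mul_cont (g : R -> R) (l : R) :
  (forall e, 0 < e -> exists2 dl, 0 < dl & forall r : R, 0 <= r < dl -> `|g r - l| < e) ->
  drv (fun t : R => t * g `|t|) 0 l.
Proof.
move=> h; have k : drv (fun t : R => t * (g `|t| - l)) 0 0.
  apply: small_is_drv => e e0; have [dl dl0 hdl] := h e e0; exists dl => // t td.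
  rewrite mul0r subr0 normrM mulrC; apply: ler_wpM2r => //.
  by apply/ltW/hdl; rewrite normr_ge0.
apply: (drv_ext (f := fun t : R => t * (g `|t| - l) + t * l)); first by move=> t; ring.
by apply: drv_eq; [apply: drvD; [exact: k|apply: drvM; [exact: drvI|exact: drvC]]|rewrite /=; ring].
Qed.

End SmallIncrement.

Section Lines.
Context {R : realType} {N : nat}.
Local Notation RN := 'rV[R]_N.
Local Notation e_ := (delta_mx (0 : 'I_1)).
Implicit Types (u : RN -> R) (x : RN) (i j : 'I_N).

(** Partial derivatives are read on coordinate lines, so that the calculus of one variable applies
    to them. *)
Definition pdrv i u x (d : R) := drv (fun t : R => u (t *: e_ i + x)) 0 d.

Lemma pdrv_is_derive i u x d : pdrv i u x d <-> is_derive x (e_ i) u d.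
Proof.
have E : (fun h : R => h^-1 *: (((fun t : R => u (t *: e_ i + x)) \o shift 0) (h *: (1 : R)) - u (0 *: e_ i + x))) =
    (fun h : R => h^-1 *: ((u \o shift x) (h *: e_ i) - u x)).
  by apply/funext => h /=; rewrite scale0r add0r addr0 [h *: 1]mulr1.
split => -[d1 d2]; split.
- by move: d1; rewrite /derivable E.
- by move: d2; rewrite /derive E.
- by rewrite /derivable E.
- by rewrite /derive E.
Qed.

Lemma pdrv_partial i u x d : pdrv i u x d -> derivable u x (e_ i) /\ partial i u x = d.
Proof. by move=> /pdrv_is_derive[]. Qed.

Lemma derivable_pdrv i u x : derivable u x (e_ i) -> pdrv i u x (partial i u x).
Proof. by move=> h; apply/pdrv_is_derive; split. Qed.

Lemma pdrv_line i u x (s d : R) : pdrv i u (s *: e_ i + x) d -> drv (fun t : R => u (t *: e_ i + x)) s d.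
Proof.
move=> h; have h1 : drv (fun t : R => t - s) s 1.
  by apply: drv_eq; [apply: drvD; [exact: drvI|exact: drvC]|rewrite addr0].
have := drv_comp (f := fun t : R => t - s) (g := fun t : R => u (t *: e_ i + (s *: e_ i + x))) h1 (b := d).
rewrite subrr mulr1 => /(_ h); apply: drv_ext => t.
by rewrite addrA -scalerDl subrK.
Qed.

Lemma enorm_ge0 x : 0 <= enorm x.
Proof. exact: sqrtr_ge0. Qed.

Lemma enorm_sqr x : enorm x ^+ 2 = \sum_(i < N) x 0 i ^+ 2.
Proof. by rewrite sqr_sqrtr// sumr_ge0// => i _; exact: sqr_ge0. Qed.

Lemma enorm0 : enorm (0 : RN) = 0.
Proof. by rewrite /enorm big1 ?sqrtr0// => i _; rewrite mxE expr0n. Qed.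

Lemma coord_le_enorm i x : `|x 0 i| <= enorm x.
Proof.
rewrite -sqrtr_sqr; apply: ler_wsqrtr; rewrite (bigD1 i)//= lerDl.
by apply: sumr_ge0 => j _; exact: sqr_ge0.
Qed.

Lemma enorm_eq0 x : enorm x = 0 -> x = 0.
Proof.
move=> h; apply/rowP => i; rewrite mxE; apply/eqP.
by rewrite -normr_eq0 eq_le normr_ge0 andbT -h coord_le_enorm.
Qed.

Lemma enorm_gt0 x : x != 0 -> 0 < enorm x.
Proof.
by move=> x0; rewrite lt_neqAle enorm_ge0 andbT eq_sym; apply: contra x0 => /eqP/enorm_eq0/eqP.
Qed.

Lemma enorm_line i x (t : R) : enorm (t *: e_ i + x) ^+ 2 = enorm x ^+ 2 + 2 * t * x 0 i + t ^+ 2.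
Proof.
rewrite !enorm_sqr (bigD1 i)//= [in RHS](bigD1 i)//= !mxE !eqxx /= mulr1.
rewrite (eq_bigr (fun j : 'I_N => x 0 j ^+ 2)); last first.
  by move=> j ji; rewrite !mxE (negPf ji) andbF mulr0 add0r.
by ring.
Qed.

Lemma enorm_axis i (t : R) : enorm (t *: e_ i) = `|t|.
Proof.
have := enorm_line i 0 t; rewrite addr0 enorm0 mxE mulr0 expr0n !add0r => h.
by rewrite -[LHS]ger0_norm ?enorm_ge0// -sqrtr_sqr h sqrtr_sqr.
Qed.

Lemma continuous_coord i : continuous (fun x : RN => x 0 i).
Proof. by move=> x; exact: (@coord_continuous R 1 N 0 i x). Qed.

Lemma vcontM (f g : RN -> R) x : {for x, continuous f} -> {for x, continuous g} ->
  {for x, continuous (fun y => f y * g y)}.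
Proof. by move=> cf cg; exact: continuousM. Qed.

Lemma vcontD (f g : RN -> R) x : {for x, continuous f} -> {for x, continuous g} ->
  {for x, continuous (fun y => f y + g y)}.
Proof. by move=> cf cg; exact: continuousD. Qed.

Lemma vcont_comp (f : RN -> R) (g : R -> R) x : {for x, continuous f} -> {for f x, continuous g} ->
  {for x, continuous (fun y => g (f y))}.
Proof. by move=> cf cg; exact: continuous_comp. Qed.

Lemma continuous_enorm : continuous (@enorm R N).
Proof.
move=> x; apply: (@continuous_comp _ _ _ (fun x : RN => \sum_(i < N) x 0 i ^+ 2) Num.sqrt); last exact: sqrt_continuous.
elim: (index_enum _) => [|i s IH].
  rewrite (_ : (fun _ => _) = fun=> 0); last by apply/funext => y; rewrite big_nil.
  exact: cst_continuous.
rewrite (_ : (fun _ => _) = fun y : RN => y 0 i ^+ 2 + \sum_(i <- s) y 0 i ^+ 2); last first.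
  by apply/funext => y; rewrite big_cons.
apply: continuousD => //; apply: (@continuous_comp _ _ _ (fun x : RN => x 0 i) (fun t : R => t ^+ 2)).
  exact: continuous_coord.
exact: exprn_continuous.
Qed.

Lemma drv_enorm i x (t : R) : t *: e_ i + x != 0 ->
  drv (fun t : R => enorm (t *: e_ i + x)) t ((t *: e_ i + x) 0 i / enorm (t *: e_ i + x)).
Proof.
move=> h; set y := t *: e_ i + x; have y0 : 0 < enorm y by exact: enorm_gt0.
have E (s : R) : enorm (s *: e_ i + x) = Num.sqrt (enorm x ^+ 2 + 2 * s * x 0 i + s ^+ 2).
  by rewrite -enorm_line sqrtr_sqr ger0_norm// enorm_ge0.
have k : drv (fun s : R => enorm x ^+ 2 + 2 * s * x 0 i + s ^+ 2) t (2 * (x 0 i + t)).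
  apply: drv_eq; first by apply: drvD; [apply: drvD; [exact: drvC|apply: drvM; [apply: drvM; [exact: drvC|exact: drvI]|exact: drvC]]|apply: drvX; exact: drvI].
  by rewrite /=; ring.
apply: (drv_ext (f := fun s : R => Num.sqrt (enorm x ^+ 2 + 2 * s * x 0 i + s ^+ 2))); first by move=> s; rewrite E.
apply: drv_eq; first by apply: drv_sqrt; [exact: k|rewrite -enorm_line exprn_gt0].
have yi : y 0 i = t + x 0 i by rewrite /y !mxE !eqxx mulr1.
rewrite /= -E -/y yi.
by field; rewrite gt_eqF.
Qed.

Lemma drv_even_norm (f : R -> R) : drv f 0 0 -> drv (fun t : R => f `|t|) 0 0.
Proof.
move=> /drv_is_small h; apply: small_is_drv => e e0; have [dl dl0 hdl] := h e e0.
exists dl => // t td; rewrite normr0 -[in leRHS]normr_id; apply: hdl; by rewrite normr_id.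
Qed.

End Lines.

Section Divergence.
Context {R : realType} {N : nat}.
Local Notation RN := 'rV[R]_N.

Lemma divergence_flux (a da : R -> R) (u : RN -> R) (p q : 'I_N -> RN -> R) x :
  (forall y, drv a (u y) (da (u y))) ->
  (forall i y, pdrv i u y (p i y)) -> (forall i y, pdrv i (p i) y (q i y)) ->
  divergence (fun y => a (u y) *: grad u y) x =
    \sum_(i < N) (da (u x) * p i x ^+ 2 + a (u x) * q i x).
Proof.
move=> ha hp hq; apply: eq_bigr => i _.
have E : (fun y => (a (u y) *: grad u y) 0 i) = fun y => a (u y) * p i y.
  by apply/funext => y; rewrite !mxE (pdrv_partial (hp i y)).2.
rewrite E; apply: (pdrv_partial _).2.
have h1 := hp i x; have h2 := hq i x.
have h3 : drv (fun t : R => a (u (t *: delta_mx 0 i + x))) 0 (da (u x) * p i x).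
  by apply: (drv_comp h1); rewrite scale0r add0r.
apply: drv_eq; first exact: drvM h3 h2.
by rewrite /= !scale0r !add0r; ring.
Qed.

Lemma enorm_grad (u : RN -> R) (p : 'I_N -> RN -> R) x : (forall i, pdrv i u x (p i x)) ->
  enorm (grad u x) ^+ 2 = \sum_(i < N) p i x ^+ 2.
Proof.
by move=> hp; rewrite enorm_sqr; apply: eq_bigr => i _; rewrite mxE (pdrv_partial (hp i)).2.
Qed.

End Divergence.

Section Radial.
Context {R : realType} {N : nat}.
Local Notation RN := 'rV[R]_N.
Variables (f f1 f2 : R -> R) (L : R).
Hypothesis hf0 : drv f 0 0.
Hypothesis hf : forall r : R, 0 < r -> drv f r (f1 r).
Hypothesis hf1 : forall r : R, 0 < r -> drv f1 r (f2 r).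
Hypothesis cf2 : forall r : R, 0 < r -> {for r, continuous f2}.
Hypothesis lim0 : forall e : R, 0 < e -> exists2 dl, 0 < dl & forall r : R, 0 < r < dl ->
  `|f1 r / r - L| < e /\ `|f2 r - L| < e.

(** f'(r)/r completed by its limit; the gradient of the radial function is then x times a function
    continuous also at the origin. *)
Definition quot (r : R) : R := if r == 0 then L else f1 r / r.

Lemma quotE r : 0 < r -> quot r = f1 r / r.
Proof. by move=> r0; rewrite /quot gt_eqF. Qed.

Lemma drv_quot r : 0 < r -> drv quot r ((f2 r - quot r) / r).
Proof.
move=> r0; apply: (drv_near (f := fun r => f1 r / r)).
  by near=> y; rewrite quotE//; near: y; exact: lt_nbhsr.
apply: drv_eq; first by apply: drvM; [exact: hf1|apply: drvV; [exact: drvI|rewrite gt_eqF]].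
by rewrite quotE//=; field; rewrite gt_eqF.
Unshelve. all: by end_near. Qed.

Lemma quot_lim e : 0 < e -> exists2 dl, 0 < dl & forall r : R, 0 <= r < dl -> `|quot r - L| < e.
Proof.
move=> e0; have [dl dl0 hdl] := lim0 e0; exists dl => // r /andP[].
rewrite le_eqVlt => /predU1P[<- _|r0 rd]; first by rewrite /quot eqxx subrr normr0.
by rewrite quotE//; apply: (hdl r _).1; rewrite r0.
Qed.

Definition rad (x : RN) : R := f (enorm x).
Definition rad1 (i : 'I_N) (x : RN) : R := x 0 i * quot (enorm x).
(** The Hessian. At the origin the second summand vanishes through the factor x_i x_j, whatever the
    value of the quotient. *)
Definition rad2 (i j : 'I_N) (x : RN) : R :=
  (i == j)%:R * quot (enorm x) + x 0 i * x 0 j * ((f2 (enorm x) - quot (enorm x)) / enorm x ^+ 2).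

Lemma rad_pdrv i x : pdrv i rad x (rad1 i x).
Proof.
rewrite /pdrv /rad1; have [->|x0] := eqVneq x 0.
  rewrite mxE mul0r; apply: (drv_ext (f := fun t : R => f `|t|)); last exact: drv_even_norm.
  by move=> t; rewrite /rad addr0 enorm_axis.
have r0 := enorm_gt0 x0.
have h0 : 0 *: delta_mx 0 i + x != 0 by rewrite scale0r add0r.
have h := drv_enorm h0; rewrite scale0r add0r in h.
apply: drv_eq.
  by apply: (drv_comp (f := fun t : R => enorm (t *: delta_mx 0 i + x)) h); rewrite scale0r add0r; exact: hf.
by rewrite quotE//; field; rewrite gt_eqF.
Qed.

Lemma rad1_pdrv i j x : pdrv j (rad1 i) x (rad2 i j x).
Proof.
have hc : drv (fun t : R => (t *: delta_mx 0 j + x) 0 i) 0 (i == j)%:R.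
  apply: (drv_ext (f := fun t : R => t * (i == j)%:R + x 0 i)); first by move=> t; rewrite !mxE eqxx.
  apply: drv_eq; first by apply: drvD; [apply: drvM; [exact: drvI|exact: drvC]|exact: drvC].
  by rewrite /=; ring.
rewrite /pdrv /rad2; have [->|x0] := eqVneq x 0.
  rewrite !mxE mul0r mul0r addr0 enorm0.
  apply: (drv_ext (f := fun t : R => (i == j)%:R * (t * quot `|t|))).
    by move=> t; rewrite /rad1 addr0 enorm_axis !mxE eqxx /=; ring.
  apply: drv_eq; first by apply: drvM; [exact: drvC|apply: (drv_mul_cont quot_lim)].
  by rewrite /= /quot eqxx; ring.
have r0 := enorm_gt0 x0.
have h0 : 0 *: delta_mx 0 j + x != 0 by rewrite scale0r add0r.
have h := drv_enorm h0; rewrite scale0r add0r in h.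
have h2 : drv (fun t : R => quot (enorm (t *: delta_mx 0 j + x))) 0
    ((f2 (enorm x) - quot (enorm x)) / enorm x * (x 0 j / enorm x)).
  by apply: (drv_comp (f := fun t : R => enorm (t *: delta_mx 0 j + x)) h); rewrite scale0r add0r; exact: drv_quot.
apply: drv_eq; first exact: drvM hc h2.
by rewrite /= !scale0r !add0r; field; rewrite gt_eqF.
Qed.

Lemma continuous_rad : continuous rad.
Proof.
move=> x; apply: (@continuous_comp _ _ _ (@enorm R N) f); first exact: continuous_enorm.
have := enorm_ge0 x; rewrite le_eqVlt => /predU1P[<-|r0]; first exact: drv_cont hf0.
exact: drv_cont (hf r0).
Qed.

Lemma continuous_at0 (g : RN -> R) (l : R) (o : RN) : o = 0 -> g o = l ->
  (forall e : R, 0 < e -> exists2 dl, 0 < dl & forall x : RN, enorm x < dl -> `|g x - l| < e) ->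
  {for o, continuous g}.
Proof.
move=> o0 g0 h P /nbhs_ballP[e /= e0 he]; have [dl dl0 hdl] := h e e0.
have hn : nbhs o [set x | ball (enorm o) dl (enorm x)] :=
  @continuous_enorm R N o _ (nbhsx_ballx (enorm o) dl dl0).
suff : nbhs o [set x | P (g x)] by [].
apply: filterS hn => x /=; rewrite /ball /= o0 enorm0 sub0r normrN ger0_norm ?enorm_ge0// => /hdl k.
by apply: he; rewrite /ball /= g0 distrC.
Qed.

Lemma continuous_quot (x : RN) : {for x, continuous (fun x : RN => quot (enorm x))}.
Proof.
have [->|x0] := eqVneq x 0.
  apply: (continuous_at0 (l := L) erefl); first by rewrite enorm0 /quot eqxx.
  move=> e e0; have [dl dl0 hdl] := quot_lim e0; exists dl => // y yd.
  by apply: hdl; rewrite enorm_ge0.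
apply: (@continuous_comp _ _ _ (@enorm R N) quot); first exact: continuous_enorm.
exact: drv_cont (drv_quot (enorm_gt0 x0)).
Qed.

Lemma continuous_rad1 i : continuous (rad1 i).
Proof. by move=> x; apply: (vcontM (@continuous_coord R N i x) (@continuous_quot x)). Qed.

Lemma continuous_rad2 i j : continuous (rad2 i j).
Proof.
move=> x; pose K (x : RN) := (f2 (enorm x) - quot (enorm x)) / enorm x ^+ 2.
suff cK : {for x, continuous (fun y : RN => y 0 i * y 0 j * K y)}.
  apply: (vcontD (f := fun y => (i == j)%:R * quot (enorm y)) _ cK).
  by apply: (vcontM (f := fun=> (i == j)%:R) _ (@continuous_quot x)); exact: cst_continuous.
(* At the origin |x_i x_j| <= |x|^2, and f'' and f'/r have the same limit, so the second summand
   tends to 0. *)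
have [->|x0] := eqVneq x 0.
  apply: (continuous_at0 (l := 0) erefl); first by rewrite mxE !mul0r.
  move=> e e0; have e2 : 0 < e / 2 by rewrite divr_gt0.
  have [dl dl0 hdl] := lim0 e2; exists dl => // y yd; rewrite subr0.
  have [->|y0] := eqVneq y 0; first by rewrite mxE !mul0r normr0.
  have r0 := enorm_gt0 y0; have [k1 k2] := hdl (enorm y) ltac:(by rewrite r0 yd).
  have r2 : 0 < enorm y ^+ 2 by rewrite exprn_gt0.
  have k3 : `|f2 (enorm y) - quot (enorm y)| < e.
    rewrite quotE//; move: k1 k2; rewrite !ltr_norml; lra.
  rewrite mulrCA normrM (le_lt_trans _ k3)// ler_piMr//.
  rewrite normrM normfV (gtr0_norm r2) ler_pdivrMr// mul1r normrM expr2.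
  by apply: ler_pM; rewrite ?coord_le_enorm.
apply: (vcontM (f := fun y => y 0 i * y 0 j) (g := K)).
  exact: (vcontM (@continuous_coord R N i x) (@continuous_coord R N j x)).
have r0 := enorm_gt0 x0.
apply: (vcont_comp (g := fun r => (f2 r - quot r) / r ^+ 2) (@continuous_enorm R N x)).
apply: contM; first by apply: contD; [exact: cf2|apply: contN; exact: drv_cont (drv_quot r0)].
by apply: contV; [rewrite expf_neq0// gt_eqF|apply: contX; exact: contI].
Qed.

Lemma rad_Ck2 : Ck 2 rad.
Proof.
have e1 i : partial i rad = rad1 i by apply/funext => x; exact: (pdrv_partial (rad_pdrv i x)).2.
have e2 i j : partial j (rad1 i) = rad2 i j by apply/funext => x; exact: (pdrv_partial (rad1_pdrv i j x)).2.
split; first exact: continuous_rad.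
move=> i; split; first by move=> x; exact: (pdrv_partial (rad_pdrv i x)).1.
rewrite e1; split; first exact: continuous_rad1.
move=> j; split; first by move=> x; exact: (pdrv_partial (rad1_pdrv i j x)).1.
by rewrite e2; split => //; exact: continuous_rad2.
Qed.

Lemma rad_grad_sqr x : \sum_(i < N) rad1 i x ^+ 2 = (enorm x * quot (enorm x)) ^+ 2.
Proof.
rewrite exprMn enorm_sqr mulr_suml; apply: eq_bigr => i _; exact: exprMn.
Qed.

Lemma rad_laplacian x : x != 0 ->
  \sum_(i < N) rad2 i i x = f2 (enorm x) + (N%:R - 1) / enorm x * f1 (enorm x).
Proof.
move=> x0; have r0 := enorm_gt0 x0.
rewrite big_split /= (eq_bigr (fun=> quot (enorm x))); last by move=> i _; rewrite eqxx mul1r.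
rewrite sumr_const card_ord (eq_bigr (fun i => x 0 i ^+ 2 * ((f2 (enorm x) - quot (enorm x)) / enorm x ^+ 2))); last first.
  by move=> i _; rewrite expr2.
by rewrite -mulr_suml -enorm_sqr quotE// -mulr_natr; field; rewrite gt_eqF.
Qed.

Lemma rad_laplacian0 : \sum_(i < N) rad2 i i 0 = N%:R * L.
Proof.
rewrite (eq_bigr (fun=> L)); first by rewrite sumr_const card_ord mulr_natl.
by move=> i _; rewrite /rad2 eqxx mxE !mul0r addr0 enorm0 /quot eqxx mul1r.
Qed.

End Radial.

(** * A symmetric function restricted to an axis through its centre *)

Section Axis.
Context {R : realType} {d : nat}.
Local Notation RN := 'rV[R]_d.+3.
Local Notation e_ := (delta_mx (0 : 'I_1)).
Variables (u : RN -> R) (c : RN).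
Hypothesis uC2 : Ck 2 u.
Hypothesis usym : forall x y, enorm (x - c) = enorm (y - c) -> u x = u y.

Let p i := partial i u.
Let q i j := partial j (partial i u).

Lemma C2_pdrv i x : pdrv i u x (p i x).
Proof. by apply: derivable_pdrv; case: uC2 => _ /(_ i)[h _]; exact: h. Qed.

Lemma C2_pdrv2 i j x : pdrv j (p i) x (q i j x).
Proof. by apply: derivable_pdrv; case: uC2 => _ /(_ i)[_ [_ /(_ j)[h _]]]; exact: h. Qed.

Definition axis (r : R) : R := u (r *: e_ 0 + c).
Definition axis1 (r : R) : R := p 0 (r *: e_ 0 + c).
Definition axis2 (r : R) : R := q 0 0 (r *: e_ 0 + c).

Lemma drv_axis r : drv axis r (axis1 r).
Proof. by apply: pdrv_line; exact: C2_pdrv. Qed.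

Lemma drv_axis1 r : drv axis1 r (axis2 r).
Proof. by apply: pdrv_line; exact: C2_pdrv2. Qed.

Lemma axis_enorm x : u x = axis (enorm (x - c)).
Proof. by apply: usym; rewrite addrK enorm_axis ger0_norm// enorm_ge0. Qed.

Lemma axis_even r : axis (- r) = axis r.
Proof. by apply: usym; rewrite !addrK !enorm_axis normrN. Qed.

Lemma axis1_0 : axis1 0 = 0.
Proof.
have h : drv axis 0 (- axis1 0).
  have k : drv (fun r : R => - r) 0 (-1) by apply: drv_eq; [apply: drvN; exact: drvI|].
  apply: (drv_ext (f := fun r => axis (- r))); first exact: axis_even.
  by apply: drv_eq; [apply: (drv_comp k); rewrite oppr0; exact: drv_axis|rewrite mulrN1].
by have := drv_val (drv_axis 0) h => e; lra.
Qed.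

Section Off.
Variables (r : R) (j : 'I_d.+3).
Hypothesis r0 : 0 < r.
Hypothesis j0 : j != 0.
Let x : RN := r *: e_ 0.

Let x_j : x 0 j = 0. Proof. by rewrite !mxE (negPf j0) andbF mulr0. Qed.

Let x_ne s : s *: e_ j + x != 0.
Proof.
apply/eqP => /matrixP /(_ 0 0); rewrite !mxE !eqxx /= eq_sym (negPf j0) mulr0 add0r mulr1.
by move=> e; move: r0; rewrite e ltxx.
Qed.

(** On the line through r e_0 in the direction e_j, relative to the centre, [u] is [axis] of the
    norm, and the norm does not vanish there. *)
Lemma axis_off s : drv (fun t : R => u (t *: e_ j + (x + c))) s
  (axis1 (enorm (s *: e_ j + x)) * (s / enorm (s *: e_ j + x))).
Proof.
have h := drv_enorm (x_ne s).
apply: (drv_ext (f := fun t => axis (enorm (t *: e_ j + x)))).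
  by move=> t; rewrite [RHS]axis_enorm addrA addrK.
apply: drv_eq; first exact: (drv_comp h (drv_axis _)).
by congr (_ * (_ / _)); rewrite mxE x_j addr0 !mxE !eqxx mulr1.
Qed.

Lemma axis_off1 s : p j (s *: e_ j + (x + c)) =
  axis1 (enorm (s *: e_ j + x)) * (s / enorm (s *: e_ j + x)).
Proof. exact: drv_val (pdrv_line (C2_pdrv j _)) (axis_off s). Qed.

Let x_norm : enorm x = r. Proof. by rewrite enorm_axis gtr0_norm. Qed.

Lemma axis_off1_0 : p j (x + c) = 0.
Proof. by have := axis_off1 0; rewrite scale0r add0r mul0r mulr0. Qed.

(** The transverse second derivatives supply the friction term of the radial equation. Each is the
    derivative, at the axis, of the first-order formula of [axis_off1]. *)
Lemma axis_off2 : q j j (x + c) = axis1 r / r.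
Proof.
have h : drv (fun s : R => p j (s *: e_ j + (x + c))) 0 (q j j (x + c)) by exact: C2_pdrv2.
have k := drv_enorm (x_ne 0); rewrite scale0r add0r x_j mul0r in k.
have h1 : drv (fun s : R => axis1 (enorm (s *: e_ j + x)) * (s / enorm (s *: e_ j + x))) 0 (axis1 r / r).
  apply: drv_eq.
    apply: drvM; first exact: (drv_comp k (drv_axis1 _)).
    by apply: drvM; [exact: drvI|apply: drvV; [exact: k|rewrite scale0r add0r x_norm gt_eqF]].
  by rewrite /= !scale0r !add0r x_norm; field; rewrite gt_eqF.
by apply: (drv_val h); apply: drv_ext h1 => s; rewrite axis_off1.
Qed.

End Off.

Lemma axis_pde (a da : R -> R) (r : R) : 0 < r -> (forall y, drv a (u y) (da (u y))) ->
  divergence (fun y => a (u y) *: grad u y) (r *: e_ 0 + c) =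
    da (axis r) * axis1 r ^+ 2 + a (axis r) * (axis2 r + (d.+3%:R - 1) / r * axis1 r) /\
  enorm (grad u (r *: e_ 0 + c)) ^+ 2 = axis1 r ^+ 2.
Proof.
move=> r0 ha; split.
  rewrite (divergence_flux _ ha C2_pdrv (fun i => C2_pdrv2 i i)) big_ord_recl /=.
  rewrite (eq_bigr (fun=> a (axis r) * (axis1 r / r))); last first.
    by move=> j _; rewrite (axis_off1_0 r0)// (axis_off2 r0)// expr0n mulr0 add0r.
  rewrite sumr_const card_ord -[_ *+ d.+2]mulr_natl (_ : ord0 = 0 :> 'I_d.+3); last exact/val_inj.
  have -> : d.+3%:R - 1 = d.+2%:R :> R by rewrite -[in LHS]natr1 addrK.
  by rewrite -/(axis r) -/(axis1 r) -/(axis2 r); ring.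
rewrite (enorm_grad (fun i => C2_pdrv i _)) big_ord_recl big1 ?addr0// => j _.
by rewrite (axis_off1_0 r0)// expr0n.
Qed.

End Axis.

(** * Integration by parts against test functions *)

Section IntegrationByParts.
Context {R : realType} {N : nat}.
Local Notation RN := 'rV[R]_N.
Local Notation e_ := (delta_mx (0 : 'I_1)).

Lemma bounded_support (g : RN -> R) (K : R) : continuous g -> (forall x, K < enorm x -> g x = 0) ->
  exists2 M, 0 <= M & forall x, `|g x| <= M.
Proof.
move=> cg hK; pose A : set RN := [set x : RN | forall i, `[- `|K|, `|K|]%classic (x 0 i)].
have cA : compact A by apply: (@rV_compact _ _ (fun=> `[- `|K|, `|K|]%classic)) => i; exact: segment_compact.
have cgA : {within A, continuous (fun x => `|g x|)}.
  apply: continuous_subspaceT => x.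
  by apply: (@continuous_comp _ _ _ g Num.norm); [exact: cg|exact: norm_continuous].
have A0 : A !=set0 by exists 0 => i; rewrite /= mxE in_itv /= oppr_le0 normr_ge0.
have [y _ hy] := EVT_max_rV A0 cA cgA.
exists `|g y| => // x; have [xA|xA] := pselect (A x); first by apply: hy; rewrite inE.
rewrite hK ?normr0// ltNge; apply/negP => k; apply: xA => i.
rewrite /= in_itv /= -ler_norml; apply: le_trans (coord_le_enorm i x) _.
by apply: (le_trans k); exact: ler_norm.
Qed.

Lemma support_dominated (g : RN -> R) (K : R) : continuous g -> (forall x, K < enorm x -> g x = 0) ->
  dominated (g \o @vec_of_tuple R N).
Proof.
move=> cg hK; split; first exact: measurable_continuous.
have [M M0 hM] := bounded_support cg hK.
(* Where the norm is at most [K], each factor of [weight] is at least (1 + K^2)^-1, so [B] times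
   [weight] is at least 1. *)
pose B := (1 + K ^+ 2) ^+ N; have B0 : 0 <= B by apply: exprn_ge0; rewrite addr_ge0// sqr_ge0.
exists (M * B) => t /=; have [k|k] := ltP K (enorm (vec_of_tuple t)).
  by rewrite (hK _ k) normr0 mulr_ge0 ?mulr_ge0// ltW// weight_gt0.
rewrite -mulrA; apply: (@le_trans _ _ (M * 1)); first by rewrite mulr1.
have -> : B = \prod_(i < N) (1 + K ^+ 2) by rewrite prodr_const card_ord.
apply: ler_wpM2l => //; rewrite /weight -big_split /= [leLHS](_ : 1 = \prod_(i < N) 1); last by rewrite big1.
apply: ler_prod => i _; rewrite ler01 /= ler_pdivlMr ?mul1r.
  have : `|tnth t i : R| <= K.
    by apply: le_trans k; have := coord_le_enorm i (vec_of_tuple t); rewrite mxE.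
  move=> h; rewrite lerD2l -(real_normK (num_real (tnth t i : R))).
  by apply: lerXn2r; rewrite ?nnegrE// (le_trans _ h).
by rewrite ltr_pwDl// sqr_ge0.
Qed.

Lemma vec_tset (t : N.-tuple (measurableTypeR R)) i (s h : R) :
  vec_of_tuple (tset t i (h + s)) = h *: e_ i + vec_of_tuple (tset t i s).
Proof.
apply/rowP => j; rewrite !mxE !tnth_mktuple eqxx /=.
by case: eqP => _; rewrite ?mulr1 ?mulr0 ?add0r.
Qed.

Lemma integral_partial0 i (w g : RN -> R) (K : R) : continuous g -> (forall x, pdrv i w x (g x)) ->
  (forall x, K < enorm x -> w x = 0) ->
  (lebesgue_tuple N).-integrable setT (EFin \o (g \o @vec_of_tuple R N)) /\ integral_RN g = 0.
Proof.
move=> cg dw hw.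
have line t (s : R) : drv (fun s : R => w (vec_of_tuple (tset t i s))) s (g (vec_of_tuple (tset t i s))).
  have h := pdrv_line (s := s) (x := vec_of_tuple (tset t i 0)) (dw _).
  rewrite -vec_tset addr0 in h.
  by apply: drv_ext h => y; rewrite -vec_tset addr0.
(* The exterior of the ball is open, so [w] vanishes on the coordinate line near [x] and its
   derivative is 0. *)
have hg x : K < enorm x -> g x = 0.
  move=> Kx; have c1 : {for 0, continuous (fun t : R => enorm (t *: e_ i + x) - K)}.
    apply: (@continuous_comp _ _ _ (fun t : R => t *: e_ i + x) (fun y => enorm y - K)).
      by apply: cvgD; [apply: cvgZr_tmp; exact: cvg_id|exact: cvg_cst].
    by apply: (vcontD (g := fun=> - K) (@continuous_enorm R N _)); exact: cst_continuous.
  have [|e e0 he] := continuous_gt0 c1; first by rewrite scale0r add0r subr_gt0.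
  have z : drv (fun t : R => w (t *: e_ i + x)) 0 0.
    apply: (drv_near (f := fun=> 0)); last exact: drvC.
    apply/nbhs_ballP; exists e => // t; rewrite /ball /= sub0r normrN => te.
    by rewrite hw// -subr_gt0; apply: he; rewrite subr0.
  exact: drv_val (dw x) z.
have dom := support_dominated cg hg.
split; first exact: dominated_integrable.
rewrite /integral_RN /Rintegral.
have -> : (\int[lebesgue_tuple N]_t (g (vec_of_tuple t))%:E = 0)%E; last by [].
have far t (s : R) : K < `|s| -> K < enorm (vec_of_tuple (tset t i s)).
  move=> Ks; apply: (lt_le_trans Ks); have := coord_le_enorm i (vec_of_tuple (tset t i s)).
  by rewrite mxE tnth_mktuple eqxx.
apply: (partial_integral0 (i := i) (w := w \o @vec_of_tuple R N) (K := K) dom).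
- exact: line.
- move=> t s; apply: (@continuous_comp _ _ _ (fun s : R => vec_of_tuple (tset t i s)) g); last exact: cg.
  rewrite (_ : (fun s : R => _) = fun s : R => s *: e_ i + vec_of_tuple (tset t i 0)).
    by apply: cvgD; [apply: cvgZr_tmp; exact: cvg_id|exact: cvg_cst].
  by apply/funext => y; rewrite -vec_tset addr0.
- by move=> t s /far k; split; [exact: hw|exact: hg].
Qed.

Lemma weak_partial i (u phi : RN -> R) (p : RN -> R) : continuous u -> continuous p ->
  (forall x, pdrv i u x (p x)) -> test_function phi ->
  integral_RN (fun x => u x * partial i phi x) = - integral_RN (fun x => p x * phi x).
Proof.
move=> cu cp hp [ck [K hK]].
have [cphi /(_ i)[dphi [cdphi _]]] := ck 1.
have h2 x : pdrv i phi x (partial i phi x) by exact: derivable_pdrv.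
have dprod x : pdrv i (fun x => u x * phi x) x (p x * phi x + u x * partial i phi x).
  have h1 := hp x; apply: drv_eq; first exact: drvM h1 (h2 x).
  by rewrite /= !scale0r !add0r.
have c1 : continuous (fun x => p x * phi x) by move=> x; exact: vcontM (cp x) (cphi x).
have c2 : continuous (fun x => u x * partial i phi x) by move=> x; exact: vcontM (cu x) (cdphi x).
have c3 : continuous (fun x => p x * phi x + u x * partial i phi x) by move=> x; exact: vcontD (c1 x) (c2 x).
have z1 x : K < enorm x -> p x * phi x = 0 by move=> k; rewrite hK// mulr0.
have z3 x : K < enorm x -> u x * phi x = 0 by move=> k; rewrite hK// mulr0.
have [_ e] := integral_partial0 c3 dprod z3.
have i1 := dominated_integrable (support_dominated c1 z1).
have [i3 _] := integral_partial0 c3 dprod z3.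
have i2 : (lebesgue_tuple N).-integrable setT (EFin \o ((fun x => u x * partial i phi x) \o @vec_of_tuple R N)).
  have := integrableB measurableT i3 i1; apply: eq_integrable => // t _ /=.
  by rewrite -EFinB addrAC subrr add0r.
have := RintegralD measurableT i1 i2; rewrite -[X in X = _]/(integral_RN (fun x => p x * phi x + u x * partial i phi x)).
by rewrite e => k; apply/eqP; rewrite -addr_eq0 addrC; apply/eqP; rewrite /integral_RN -k.
Qed.

End IntegrationByParts.

(** * From the ODE to the equation and back *)

Section Correspondence.
Context {R : realType}.
Variables (d : nat) (a da dda : R -> R) (c0 p m : R).
Hypothesis ca : continuous a.
Hypothesis c00 : 0 < c0.
Hypothesis a_ge : forall s : R, 0 <= s -> c0 <= a s.
Hypothesis hda : forall s : R, 0 < s -> drv a s (da s).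
Hypothesis hdda : forall s : R, 0 < s -> drv da s (dda s).
Hypothesis da_bound : forall A : R, exists2 C, 0 <= C & forall s : R, 0 < s <= A -> `|s * da s| <= C.
Hypothesis p1 : 1 < p.
Hypothesis m0 : 0 < m.
Local Notation RN := 'rV[R]_d.+3.
Local Notation V := (chV a).
Local Notation U := (chU a).
Local Notation h := (hh a p m).
Local Notation el := (elas a da).
Local Notation n := (d.+3%:R : R).

Let hlip := hh_lip ca c00 a_ge hda da_bound p1 m0.
Let hneg := fun l => @hh_neg R a c0 p ca c00 a_ge p1 m m0 l.
Let hpos := fun l => @hh_pos R a c0 p ca c00 a_ge p1 m m0 l.

Lemma derive1_coef s : 0 < s -> (a^`())%classic s = da s.
Proof. by move=> /hda[_ <-]; rewrite derive1E. Qed.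

Lemma ff_powR s : 0 < s -> Num.sqrt (a s) * ff a p m s = s `^ p - m * s.
Proof.
move=> s0; have sa : 0 < Num.sqrt (a s) by rewrite sqrtr_gt0 (a_gt0 c00 a_ge)// ltW.
rewrite /ff mulrCA mulfV ?gt_eqF// mulr1 mulrBr [s * m]mulrC.
by rewrite -(powRS p s0).
Qed.

Section FromGround.
Variables (v dv : R -> R).
Hypothesis gv : ground d h v dv.

Let sol : radsol d.+3 h v dv. Proof. by case: gv. Qed.
Let vpos r : 0 <= r -> 0 < v r. Proof. by case: gv => _ k _; exact: k. Qed.
Let Epos r : 0 <= r -> 0 <= energy h v dv r. Proof. by case: gv => _ _ k; exact: k. Qed.
Let hv r : drv v r (dv r). Proof. by case: sol. Qed.
Let dv0 : dv 0 = 0. Proof. by case: sol. Qed.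
Let cdv r : {for r, continuous dv}. Proof. by case: sol => _ _ c _; exact: c. Qed.
Let ddv (r : R) := - (n - 1) / r * dv r - h (v r).
Let hdv r : 0 < r -> drv dv r (ddv r). Proof. by case: sol => _ _ _; apply. Qed.
Let cv r : {for r, continuous v}. Proof. exact: drv_cont (hv r). Qed.

Definition pf (r : R) := U (v r).
Definition sf (r : R) := sqa a (pf r).
Definition pf1 (r : R) := dv r / sf r.
(** Since el(u)/u is a'/(2a), this is u'' solved from v'' = sqrt(a) (u'' + a'/(2a) u'^2). *)
Definition pf2 (r : R) := ddv r / sf r - el (pf r) / pf r * pf1 r ^+ 2.

Lemma pf_gt0 r : 0 <= r -> 0 < pf r.
Proof. by move=> r0; apply: (U_gt0 ca c00 a_ge); exact: vpos. Qed.

Let sf_gt0 r : 0 < sf r. Proof. exact: sqa_gt0 c00 a_ge _. Qed.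

Let sfE r : 0 <= r -> sf r = Num.sqrt (a (pf r)).
Proof. by move=> r0; rewrite /sf sqa_pos// ltW// pf_gt0. Qed.

Lemma drv_pf r : drv pf r (pf1 r).
Proof. by apply: drv_eq; [exact: (drv_comp (hv r) (drv_U ca c00 a_ge (v r)))|rewrite mulrC]. Qed.

Lemma pf_drv0 : drv pf 0 0.
Proof. by apply: drv_eq; [exact: drv_pf|rewrite /pf1 dv0 mul0r]. Qed.

Lemma drv_sf r : 0 < r -> drv sf r (sf r * el (pf r) / pf r * pf1 r).
Proof.
move=> r0; have k := drv_comp (drv_pf r) (drv_sqrta c00 a_ge hda (pf_gt0 (ltW r0))).
rewrite {1}[sf r](sfE (ltW r0)); apply: (drv_near (f := fun y => Num.sqrt (a (pf y)))); last exact: k.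
by near=> y; rewrite sfE// ltW//; near: y; exact: lt_nbhsr.
Unshelve. all: by end_near. Qed.

Lemma drv_pf1 r : 0 < r -> drv pf1 r (pf2 r).
Proof.
move=> r0; rewrite /pf1; apply: drv_eq.
  by apply: drvM; [exact: hdv|apply: drvV; [exact: drv_sf|rewrite gt_eqF]].
rewrite /= /pf2 /pf1; have pf0 := pf_gt0 (ltW r0).
by move: (sf_gt0 r) pf0; move: (sf r) (pf r) (el _) (ddv r) => s f e z s0 f0; field; rewrite !gt_eqF.
Qed.

Let cpf r : {for r, continuous pf}. Proof. exact: drv_cont (drv_pf r). Qed.

Let csf r : {for r, continuous sf}.
Proof. by apply: (cont_comp (cpf (r := r))); exact: sqa_cont. Qed.

Let ch r : {for r, continuous (fun r => h (v r))}.
Proof. by apply: (cont_comp (cv (r := r))); exact: (h_cont hlip). Qed.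

Let cpf1 r : {for r, continuous pf1}.
Proof. by apply: contM => //; apply: contV; [rewrite gt_eqF|]. Qed.

Let celpf r : 0 <= r -> {for r, continuous (fun r => el (pf r) / pf r)}.
Proof.
move=> r0; have pf0 := pf_gt0 r0; apply: contM.
  by apply: (cont_comp (cpf (r := r))); exact: drv_cont (drv_elas c00 a_ge hda hdda pf0).
by apply: contV => //; rewrite gt_eqF.
Qed.

Lemma pf2_cont r : 0 < r -> {for r, continuous pf2}.
Proof.
move=> r0; have cddv : {for r, continuous ddv}.
  apply: contD; last exact: contN.
  apply: contM => //; apply: contM; first exact: contC.
  by apply: contV; [rewrite gt_eqF|exact: contI].
apply: contD; first by apply: contM => //; apply: contV; [rewrite gt_eqF|].
by apply: contN; apply: contM; [apply: celpf; exact: ltW|exact: contX].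
Qed.

(** At the centre the equation degenerates to n v''(0) = -h(v(0)); this is the resulting common
    limit of u'(r)/r and u''(r), which makes [usol] twice continuously differentiable at the
    origin. *)
Definition pfL : R := - h (v 0) / (n * sf 0).

Let n0 : 0 < n. Proof. by rewrite ltr0n. Qed.

Lemma pf_lim : forall e : R, 0 < e -> exists2 dl, 0 < dl & forall r : R, 0 < r < dl ->
  `|pf1 r / r - pfL| < e /\ `|pf2 r - pfL| < e.
Proof.
have right (g : R -> R) : {for 0, continuous g} -> g r @[r --> 0^'+] --> g 0.
  by move=> cg; apply: cvg_at_right_filter; exact: cg.
have q1 : dv r / r @[r --> 0^'+] --> - h (v 0) / n.
  apply/cvgrPdist_lt => e e0; have [dl dl0 hdl] := slope_at_0 hlip sol e0.
  near=> r; rewrite distrC mulNr opprK; apply: hdl; apply/andP; split; near: r.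
    exact: nbhs_right_gt.
  exact: nbhs_right_lt.
have q2 : (sf r)^-1 @[r --> 0^'+] --> (sf 0)^-1.
  by apply: (right (fun r => (sf r)^-1)); apply: contV; [rewrite gt_eqF|].
have q3 : dv r / r * (sf r)^-1 @[r --> 0^'+] --> pfL.
  have -> : pfL = - h (v 0) / n * (sf 0)^-1 by rewrite /pfL invfM mulrA.
  exact: cvgM.
have q4 : (- (n - 1) * (dv r / r) - h (v r)) * (sf r)^-1 - el (pf r) / pf r * pf1 r ^+ 2 @[r --> 0^'+] --> pfL.
  have -> : pfL = (- (n - 1) * (- h (v 0) / n) - h (v 0)) * (sf 0)^-1 - el (pf 0) / pf 0 * pf1 0 ^+ 2.
    by rewrite /pf1 dv0 mul0r expr0n mulr0 subr0 /pfL; field; rewrite !gt_eqF.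
  apply: cvgB; last first.
    apply: (right (fun r => el (pf r) / pf r * pf1 r ^+ 2)).
    by apply: contM; [exact: celpf|exact: contX].
  apply: cvgM => //; apply: cvgB; last exact: (right (fun r => h (v r))).
  by apply: cvgM => //; exact: cvg_cst.
move=> e e0.
have /cvgrPdist_lt/(_ e e0) := q3; have /cvgrPdist_lt/(_ e e0) := q4.
move=> k4 k3.
have : \forall r \near 0^'+, `|pf1 r / r - pfL| < e /\ `|pf2 r - pfL| < e.
  near=> r; split.
    have -> : pf1 r / r = dv r / r * (sf r)^-1 by rewrite /pf1 mulrAC.
    by rewrite distrC; near: r.
  have -> : pf2 r = (- (n - 1) * (dv r / r) - h (v r)) * (sf r)^-1 - el (pf r) / pf r * pf1 r ^+ 2.
    by rewrite /pf2 /ddv mulrAC -mulrA.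
  by rewrite distrC; near: r.
move=> [dl /= dl0 hdl].
exists dl => // r /andP[r0 rd]; apply: hdl => //.
by rewrite /ball /= sub0r normrN gtr0_norm.
Unshelve. all: by end_near. Qed.

Definition usol : RN -> R := rad pf.

Let hpf r : 0 < r -> drv pf r (pf1 r). Proof. by move=> _; exact: drv_pf. Qed.

Lemma usol_C2 : Ck 2 usol.
Proof. exact: (rad_Ck2 pf_drv0 hpf drv_pf1 pf2_cont pf_lim). Qed.

Lemma usol_pdrv i x : pdrv i usol x (rad1 pf1 pfL i x).
Proof. exact: (rad_pdrv pfL pf_drv0 hpf). Qed.

Lemma usol_pdrv2 (i : 'I_d.+3) (x : RN) : pdrv i (rad1 pf1 pfL i) x (rad2 pf1 pf2 pfL i i x).
Proof. exact: (rad1_pdrv drv_pf1 pf_lim). Qed.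

Lemma usol_gt0 x : 0 < usol x.
Proof. exact: pf_gt0 (enorm_ge0 x). Qed.

Lemma quot_pf1 (x : RN) : enorm x * quot pf1 pfL (enorm x) = pf1 (enorm x).
Proof.
have [->|x0] := eqVneq x 0; first by rewrite enorm0 mul0r /pf1 dv0 mul0r.
by rewrite quotE ?enorm_gt0// mulrC divfK// gt_eqF// enorm_gt0.
Qed.

Lemma usol_solves : solves a m p usol.
Proof.
split; [move=> x|exact: usol_gt0|exists 0 => x y; rewrite !subr0 => e; by rewrite /usol /rad e].
have hau y : drv a (usol y) (da (usol y)) by apply: hda; exact: usol_gt0.
rewrite (divergence_flux x hau usol_pdrv usol_pdrv2) big_split /= -!mulr_sumr rad_grad_sqr quot_pf1.
rewrite (enorm_grad (fun i => usol_pdrv i x)) rad_grad_sqr quot_pf1 derive1_coef ?usol_gt0//.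
have u0 := usol_gt0 x; have r0 := enorm_ge0 x.
have au0 : 0 < a (usol x) by exact: a_gt0 c00 a_ge _ (ltW u0).
have s2 : a (usol x) = sf (enorm x) ^+ 2 by rewrite sfE// sqr_sqrtr// ltW.
have hE : h (v (enorm x)) = ff a p m (usol x) by rewrite hhE//; exact: vpos.
(* In both cases this is a(u) Lap u + a'(u)/2 |Du|^2 = -sqrt(a(u)) h(v): away from 0 the radial
   equation for [v], at 0 the value of [pfL]. *)
have main : a (usol x) * (\sum_(i < d.+3) rad2 pf1 pf2 pfL i i x) + 2^-1 * da (usol x) * pf1 (enorm x) ^+ 2 =
    - (sf (enorm x) * h (v (enorm x))).
  have [->|x0] := eqVneq x 0.
    rewrite rad_laplacian0 enorm0 /pf1 dv0 mul0r expr0n mulr0 addr0.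
    have -> : a (usol 0) = sf 0 ^+ 2.
      by rewrite sfE// sqr_sqrtr; [rewrite /usol /rad enorm0|apply/ltW/(a_gt0 c00 a_ge)/ltW/pf_gt0].
    by rewrite /pfL; field; rewrite !gt_eqF.
  rewrite (rad_laplacian _ _ _ x0); have r1 := enorm_gt0 x0.
  have -> : da (usol x) = el (usol x) / usol x * (2 * a (usol x)).
    by rewrite /elas; field; rewrite !gt_eqF.
  rewrite s2 /pf2 /ddv /usol /rad.
  move: (sf_gt0 (enorm x)) (u0); rewrite /usol /rad /pf1; move: (enorm x) r1 => r r1.
  move: (sf r) (pf r) (el (pf r)) (h (v r)) (dv r) => s f e hr dr sr0 fr0.
  by field; rewrite !gt_eqF.
have := ff_powR u0; rewrite -hE -(sqa_pos a (ltW u0)) => ffE.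
rewrite -/(sf (enorm x)) in ffE.
have -> : usol x `^ p = sf (enorm x) * h (v (enorm x)) + m * usol x by rewrite ffE subrK.
move: main; rewrite -!mulrA; move: (da (usol x) * pf1 (enorm x) ^+ 2) (a (usol x) * _) (sf (enorm x) * h (v (enorm x))) (m * usol x).
by move=> y1 y2 y3 y4; lra.
Qed.

(** With N = d + 3, (1 + |x|^2)^-N is at most [weight] because each coordinate is at most |x|. The
    inequality (1 + y)^N <= 2^N (1 + y^N) at y = |x|^2 then leaves only the powers 0 and 2N of the
    radius to be controlled. *)
Lemma decay_weight (g : R -> R) : (forall r, 0 <= r -> 0 <= g r) ->
  (forall j, exists2 C, 0 < C & forall r, 0 <= r -> r ^+ j * g r <= C) ->
  exists2 C, 0 <= C & forall t : d.+3.-tuple (measurableTypeR R), g (enorm (vec_of_tuple t)) <= C * weight t.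
Proof.
move=> g0 hg; have [C1 C10 h1] := hg 0%N; have [C2 C20 h2] := hg (2 * d.+3)%N.
pose C := 2 ^+ d.+3 * (C1 + C2); have Cp : 0 <= C.
  by apply: mulr_ge0; [exact: exprn_ge0|apply: addr_ge0; exact: ltW].
exists C => // t; set x := vec_of_tuple t; have r0 := enorm_ge0 x.
have gr := g0 _ r0.
have wt : (1 + enorm x ^+ 2) ^- d.+3 <= weight t.
  have -> : (1 + enorm x ^+ 2) ^- d.+3 = \prod_(i < d.+3) (1 + enorm x ^+ 2)^-1.
    by rewrite prodr_const card_ord exprVn.
  apply: ler_prod => i _.
  have k : 0 < 1 + (tnth t i : R) ^+ 2 by rewrite ltr_pwDl// sqr_ge0.
  rewrite invr_ge0 addr_ge0 ?sqr_ge0//= lef_pV2 ?posrE// ?(lt_le_trans ltr01) ?lerDl ?sqr_ge0//.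
  rewrite lerD2l -(real_normK (num_real (tnth t i : R))); apply: lerXn2r; rewrite ?nnegrE//.
  by have := coord_le_enorm i x; rewrite mxE.
apply: (@le_trans _ _ (C * (1 + enorm x ^+ 2) ^- d.+3)); last exact: ler_wpM2l.
rewrite ler_pdivlMr; last by apply: exprn_gt0; rewrite ltr_pwDl// sqr_ge0.
apply: (@le_trans _ _ (g (enorm x) * (2 ^+ d.+3 * (1 + enorm x ^+ (2 * d.+3))))).
  apply: ler_wpM2l => //; rewrite exprM; set y := enorm x ^+ 2; have y0 : 0 <= y by exact: sqr_ge0.
  have [y1|y1] := leP y 1.
    apply: (@le_trans _ _ (2 ^+ d.+3)); last by rewrite ler_peMr ?exprn_ge0// lerDl exprn_ge0.
    by apply: lerXn2r; rewrite ?nnegrE ?addr_ge0//; lra.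
  apply: (@le_trans _ _ ((2 * y) ^+ d.+3)).
    by apply: lerXn2r; rewrite ?nnegrE ?addr_ge0 ?mulr_ge0//; lra.
  by rewrite exprMn; apply: ler_wpM2l; [exact: exprn_ge0|rewrite lerDr].
have k1 := h1 _ r0; have k2 := h2 _ r0; rewrite expr0 mul1r in k1.
rewrite mulrCA; apply: ler_wpM2l; first exact: exprn_ge0.
by rewrite mulrDr mulr1; apply: lerD => //; rewrite mulrC.
Qed.

Let slope r : 0 <= r -> 0 <= - dv r.
Proof.
rewrite le_eqVlt => /predU1P[<-|r0]; first by rewrite dv0 oppr0.
by rewrite oppr_ge0 ltW// (ground_slope hlip hneg hpos sol vpos Epos).
Qed.

(** a(u)|Du|^2 is exactly v'^2, so the condition special to X reduces to the decay of v'; u and Du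
    are controlled by v and v' because a >= c0. *)
Lemma usol_X : spaceX a usol.
Proof.
have [mu [eps [mu0 eps0 hmu]]] := hh_near0 ca c00 a_ge p1 m0.
have rd := rapid_decay (hb_gt0 p ca c00 a_ge m0) hlip hneg hpos mu0 eps0 hmu sol vpos Epos.
have sc : 0 < Num.sqrt c0 by rewrite sqrtr_gt0.
have [C1 C10 w1] : exists2 C, 0 <= C & forall t : d.+3.-tuple (measurableTypeR R),
    v (enorm (vec_of_tuple t)) <= C * weight t.
  apply: decay_weight => [r /vpos/ltW//|j]; have [C C0 hC] := rd j; exists C => // r /hC[].
  by [].
have [C2 C20 w2] : exists2 C, 0 <= C & forall t : d.+3.-tuple (measurableTypeR R),
    - dv (enorm (vec_of_tuple t)) <= C * weight t.
  by apply: (decay_weight (g := fun r => - dv r)) => [r /slope//|j]; have [C C0 hC] := rd j; exists C => // r /hC[].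
have cu : continuous usol by exact: continuous_rad pf_drv0 hpf.
have cp i : continuous (rad1 pf1 pfL i : RN -> R) by exact: continuous_rad1 drv_pf1 pf_lim i.
have pE i : partial i usol = rad1 pf1 pfL i.
  by apply/funext => x; exact: (pdrv_partial (usol_pdrv i x)).2.
have f1b (x : RN) : `|pf1 (enorm x)| <= - dv (enorm x) / Num.sqrt c0.
  rewrite /pf1 normrM normfV (gtr0_norm (sf_gt0 _)) -normrN ger0_norm ?slope ?enorm_ge0//.
  apply: ler_wpM2l; first by apply: slope; exact: enorm_ge0.
  by rewrite lef_pV2 ?posrE//; exact: sqa_ge a_ge _.
have du : dominated (usol \o @vec_of_tuple R d.+3).
  split; first exact: measurable_continuous.
  exists (C1 / Num.sqrt c0) => t /=; rewrite gtr0_norm ?usol_gt0// mulrAC ler_pdivlMr//.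
  apply: le_trans (w1 t).
  have := V_growth ca a_ge (ltW (usol_gt0 (vec_of_tuple t))).
  by rewrite /usol /rad {2}/pf (chUK ca c00 a_ge) (V0 a) !subr0 mulrC.
have dp i : dominated (partial i usol \o @vec_of_tuple R d.+3).
  rewrite pE; split; first exact: measurable_continuous.
  exists (C2 / Num.sqrt c0) => t /=; set x := vec_of_tuple t.
  apply: (@le_trans _ _ `|pf1 (enorm x)|).
    rewrite -quot_pf1 /rad1 !normrM; apply: ler_wpM2r => //.
    by rewrite [leRHS]ger0_norm ?enorm_ge0//; exact: coord_le_enorm.
  apply: le_trans (f1b x) _; rewrite [leRHS]mulrAC; apply: ler_wpM2r; first by rewrite invr_ge0 ltW.
  exact: w2.
have dE (x : RN) : a (usol x) * enorm (grad usol x) ^+ 2 = dv (enorm x) ^+ 2.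
  rewrite (enorm_grad (fun i => usol_pdrv i x)) rad_grad_sqr quot_pf1 /pf1.
  have -> : a (usol x) = sf (enorm x) ^+ 2.
    by rewrite sfE ?enorm_ge0// sqr_sqrtr// ltW// (a_gt0 c00 a_ge)// ltW// pf_gt0// enorm_ge0.
  by field; rewrite gt_eqF.
exists (grad usol).
  split => [||phi tphi i].
  - exact: Lp2_dominated.
  - move=> i; have -> : (fun x => grad usol x 0 i) = partial i usol by apply/funext => x; rewrite mxE.
    exact: Lp2_dominated.
  - have -> : (fun x => grad usol x 0 i * phi x) = fun x => rad1 pf1 pfL i x * phi x.
      by apply/funext => x; rewrite mxE pE.
    exact: (weak_partial cu (cp i) (usol_pdrv i) tphi).
have -> : (fun x => a (usol x) * enorm (grad usol x) ^+ 2) = fun x : RN => dv (enorm x) ^+ 2.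
  exact/funext.
apply: Lp1_dominated; split.
  apply: measurable_continuous => x.
  by apply: (vcont_comp (g := fun r => dv r ^+ 2) (@continuous_enorm R d.+3 x)); exact: contX.
have [C C0 hC] := rd 0%N.
exists (C * C2) => t /=; set x := vec_of_tuple t; have r0 := enorm_ge0 x.
rewrite ger0_norm ?sqr_ge0// -sqrrN expr2 -mulrA; apply: ler_pM; [exact: slope|exact: slope| |exact: w2].
by have [_] := hC _ r0; rewrite expr0 mul1r.
Qed.

End FromGround.

Section ToGround.
Variables (u : RN -> R) (c : RN).
Hypothesis uC2 : Ck 2 u.
Hypothesis usym : forall x y, enorm (x - c) = enorm (y - c) -> u x = u y.
Hypothesis upos : forall x, 0 < u x.
Hypothesis uL2 : Lp 2%:E u.
Hypothesis upde : forall x, - divergence (fun y => a (u y) *: grad u y) x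
  + 2^-1 * (a^`())%classic (u x) * enorm (grad u x) ^+ 2 + m * u x = u x `^ p.

Local Notation phi := (axis u c).
Local Notation phi1 := (axis1 u c).
Local Notation phi2 := (axis2 u c).

Let phi_gt0 r : 0 < phi r. Proof. exact: upos. Qed.
Let s_gt0 r : 0 < Num.sqrt (a (phi r)).
Proof. by rewrite sqrtr_gt0 (a_gt0 c00 a_ge)// ltW. Qed.

Definition lift_axis (r : R) := V (phi r).
Definition lift_axis1 (r : R) := Num.sqrt (a (phi r)) * phi1 r.

Lemma axis_ode r : 0 < r ->
  Num.sqrt (a (phi r)) * el (phi r) / phi r * phi1 r ^+ 2 + Num.sqrt (a (phi r)) * phi2 r =
  - (n - 1) / r * lift_axis1 r - h (lift_axis r).
Proof.
move=> r0; have hau y : drv a (u y) (da (u y)) by exact: hda.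
have [e1 e2] := axis_pde uC2 usym r0 hau.
have := upde (r *: delta_mx 0 0 + c); rewrite e1 e2 -/(phi r) derive1_coef//.
have ap : 0 < a (phi r) by rewrite (a_gt0 c00 a_ge)// ltW.
have hE : h (lift_axis r) = ff a p m (phi r).
  by rewrite /lift_axis hhE ?(chVK ca c00 a_ge)//; exact: V_gt0 ca c00 a_ge _ _.
have fE := ff_powR (phi_gt0 r); have s2 : Num.sqrt (a (phi r)) ^+ 2 = a (phi r) by rewrite sqr_sqrtr// ltW.
rewrite hE /lift_axis1.
have -> : da (phi r) = el (phi r) / phi r * (2 * a (phi r)).
  by rewrite /elas; field; rewrite !gt_eqF.
have -> : phi r `^ p = Num.sqrt (a (phi r)) * ff a p m (phi r) + m * phi r by rewrite fE subrK.
move: s2 (s_gt0 r) (phi_gt0 r); move: (Num.sqrt (a (phi r))) (ff a p m (phi r)) (el (phi r)).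
move: (a (phi r)) (phi r) (phi1 r) (phi2 r).
move=> A f g k s F e <- sr0 f0 E; apply: (mulfI (lt0r_neq0 sr0)).
have -> : s * (- (n - 1) / r * (s * g) - F) = (- (n - 1) / r * g) * s ^+ 2 - s * F by ring.
have -> : s * F = - (e / f * (2 * s ^+ 2) * g ^+ 2 + s ^+ 2 * (k + (n - 1) / r * g)) +
     2^-1 * (e / f * (2 * s ^+ 2)) * g ^+ 2.
  by apply: (addIr (m * f)); rewrite -E.
by field; rewrite !gt_eqF.
Qed.

Lemma axis_radsol : radsol d.+3 h lift_axis lift_axis1.
Proof.
have ds r := drv_comp (drv_axis c uC2 r) (drv_sqrta c00 a_ge hda (phi_gt0 r)).
have dl r : drv lift_axis1 r
    (Num.sqrt (a (phi r)) * el (phi r) / phi r * phi1 r ^+ 2 + Num.sqrt (a (phi r)) * phi2 r).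
  apply: drv_eq; first by apply: drvM; [exact: ds|exact: drv_axis1].
  by rewrite /=; ring.
split.
- move=> r; apply: drv_eq; first exact: (drv_comp (drv_axis c uC2 r) (drv_Vp ca (phi_gt0 r))).
  by [].
- by rewrite /lift_axis1 (axis1_0 uC2 usym) mulr0.
- by move=> r; exact: drv_cont (dl r).
- by move=> r r0; rewrite -axis_ode.
Qed.

Lemma axis_ground : ground d h lift_axis lift_axis1.
Proof.
have sol := axis_radsol.
split => // r r0; first exact: V_gt0 ca c00 a_ge _ _.
rewrite leNgt; apply/negP => E0; set eta := energy h lift_axis lift_axis1 r in E0.
(* H(0) = 0 exceeds the negative energy [eta], so a small value of [lift_axis] beyond [r] would have
   energy above [eta]. Hence [u] is bounded below by a positive constant outside a ball. *)
have cH : {for 0, continuous (fun x => potential h x - eta)}.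
  by apply: contD; [exact: drv_cont (drv_H hlip 0)|exact: contC].
have [|dl dl0 hdl] := continuous_gt0 cH; first by rewrite /potential prim0 sub0r oppr_gt0.
have low s : r <= s -> U dl <= phi s.
  move=> rs; rewrite leNgt; apply/negP => /(V_lt ca c00 a_ge); rewrite (chUK ca c00 a_ge) => k.
  have vp : 0 < lift_axis s by exact: V_gt0 ca c00 a_ge _ _.
  have := hdl (lift_axis s); rewrite subr0 gtr0_norm// => /(_ k).
  have := energy_noninc hlip sol r0 rs; rewrite -/eta /energy.
  have := sqr_ge0 (lift_axis1 s); move: (lift_axis1 s ^+ 2) (potential h (lift_axis s)) => y z.
  by lra.
have Ud : 0 < U dl by exact: U_gt0 ca c00 a_ge _ _.
apply: (Lp2_halfspace (n := d.+2) uL2 Ud (c := c 0 0 + r)) => x hx.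
rewrite (axis_enorm usym); apply: low; apply: le_trans (coord_le_enorm 0 _).
by rewrite !mxE (le_trans _ (ler_norm _))//; lra.
Qed.

End ToGround.

End Correspondence.

Lemma cvg_pinfty_eps {R : realType} (f : R -> R) (l : R) : f s @[s --> +oo] --> l ->
  forall e : R, 0 < e -> exists U : R, forall u : R, U <= u -> `|f u - l| < e.
Proof.
move=> /cvgrPdist_lt fl e e0; have [U [_ hU]] := fl e e0.
by exists (U + 1) => u Uu; rewrite distrC; apply: hU; lra.
Qed.

Lemma le_um {R : realType} (p m U : R) : 1 < p -> 0 <= U -> U `^ (p - 1) <= m -> U <= um p m.
Proof.
move=> p1 U0 Um; have p10 : 0 < p - 1 by lra.
rewrite -{1}(powRr1 U0) -(mulfV (lt0r_neq0 p10)) powRrM /um.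
by apply: ge0_ler_powR => //; rewrite ?nnegrE ?invr_ge0 ?powR_ge0 ?(ltW p10)// (le_trans _ Um)// powR_ge0.
Qed.

Unset Implicit Arguments.
Theorem theorem1p2 (R : realType) (N : nat) (a1 k p : R) (psi a : R -> R)
  (hN : (3 <= N)%N) (ha1 : 0 < a1) (hpsi : C2 psi)
  (hk : 0 < k <= 2)
  (hp : 1 < p < ((k + 1) * N%:R + 2) / (N%:R - 2))
  (ha : forall s, a s = a1 * `|s| `^ k + psi s)
  (hinf1 : (0 < ereal_inf [set (psi s)%:E | s in [set s : R | (0 <= s)%R]])%E)
  (hinf2 : (0 <= ereal_inf [set (k * psi s - s * (psi^`())%classic s)%:E
                           | s in [set s : R | (0 <= s)%R]])%E)
  (hlim0 : exists2 l : R, 0 < l & psi s @[s --> +oo] --> l)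
  (hlim1 : s * (psi^`())%classic s @[s --> +oo] --> (0 : R))
  (hlim2 : s ^+ 2 * (psi^`(2))%classic s @[s --> +oo] --> (0 : R)) :
  exists2 m0 : R, 0 < m0 & forall m : R, m0 <= m ->
    exists u : 'rV[R]_N -> R,
      [/\ spaceX a u, Ck 2 u, solves a m p u &
          forall v : 'rV[R]_N -> R,
            spaceX a v -> Ck 2 v -> solves a m p v ->
            exists y : 'rV[R]_N, forall x, v x = u (x - y)].
Proof.
case: N hN hp => [|[|[|d]]]// _ /andP[p1 hp].
pose dpsi := (psi^`())%classic : R -> R; pose ddpsi := (psi^`(2))%classic : R -> R.
have [dp1 dp2 _] := hpsi.
have hdpsi s : drv psi s (dpsi s).
  by rewrite /drv /dpsi derive1E; apply/derivableP; exact: dp1.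
have hddpsi s : drv dpsi s (ddpsi s).
  by rewrite /drv /ddpsi derive1nS derive1E derive1n1; apply/derivableP; exact: dp2.
(* The infimum is an extended real; it is finite because it is at most psi(0). *)
have [c0 c00 psi_ge] : exists2 c0 : R, 0 < c0 & forall s : R, 0 <= s -> c0 <= psi s.
  have lb s : 0 <= s -> (ereal_inf [set (psi s)%:E | s in [set s : R | (0 <= s)%R]] <= (psi s)%:E)%E.
    by move=> s0; apply: ereal_inf_lbound; exists s.
  move: hinf1 lb; case: (ereal_inf _) => [c c0 lb|_ lb|//].
  - by exists c => // s s0; have := lb s s0; rewrite lee_fin.
  - by have := lb 0 (lexx 0); rewrite leye_eq.
have dpsi_le s : 0 <= s -> s * dpsi s <= k * psi s.
  move=> s0; rewrite -subr_ge0 -lee_fin; apply: le_trans hinf2 _.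
  by apply: ereal_inf_lbound; exists s.
have [l l0 /cvg_pinfty_eps lim0] := hlim0.
have lim1 (e : R) : 0 < e -> exists U : R, forall u : R, U <= u -> `|u * dpsi u| < e.
  by move=> /(cvg_pinfty_eps hlim1)[U hU]; exists U => u /hU; rewrite subr0.
have lim2 (e : R) : 0 < e -> exists U : R, forall u : R, U <= u -> `|u ^+ 2 * ddpsi u| < e.
  by move=> /(cvg_pinfty_eps hlim2)[U hU]; exists U => u /hU; rewrite subr0.
have ca : continuous a := coef_cont hk hdpsi ha.
have a_ge := coef_ge ha1 psi_ge ha.
pose da := coef' a1 k dpsi; pose dda := coef'' a1 k ddpsi.
have hda : forall s : R, 0 < s -> drv a s (da s) := drv_coef hdpsi ha.
have hdda : forall s : R, 0 < s -> drv da s (dda s) := drv_coef' a1 k hddpsi.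
have da_bound := coef'_bound ha1 hk hddpsi.
have da_le := coef'_le dpsi_le ha.
have asym := coef_asym ha1 hk l0 lim0 lim1 lim2 ha.
have elas_lim := coef_elas_lim ha1 hk c00 psi_ge l0 lim0 lim1 lim2 ha.
have [U2 U21 hU] := ww_ge ca c00 a_ge hda hdda da_le hk asym.
(* For m >= U2^(p-1) the zero [um] of u^p - m u is at least [U2], so the elasticity is monotone on
   all levels above [hb]. *)
exists (1 + U2 `^ (p - 1)) => [|m hm]; first by rewrite ltr_pwDl// powR_ge0.
have m0 : 0 < m by apply: lt_le_trans hm; rewrite ltr_pwDl// powR_ge0.
have Um : U2 <= um p m.
  by apply: le_um => //; [lra|apply: le_trans hm; rewrite lerDr].
have b0 := hb_gt0 p ca c00 a_ge m0.
have h0 := hh0 a p m.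
have hlip := hh_lip ca c00 a_ge hda da_bound p1 m0.
have hneg v := @hh_neg R a c0 p ca c00 a_ge p1 m m0 v.
have hpos v := @hh_pos R a c0 p ca c00 a_ge p1 m m0 v.
have hdh v : hb a p m < v -> drv (hh a p m) v (dhh a da p m v).
  by move=> bv; apply: (drv_hh p ca c00 a_ge hda m); exact: lt_trans bv.
have gmono := growth_mono ca c00 a_ge hda hdda da_le hk p1 m0 U21 hU Um.
have n3 : 3 <= d.+3%:R :> R by rewrite ler_nat.
have [q [Q [M0 [q01 bM0 subcritical hg]]]] :=
  growth_asym ca c00 a_ge hda da_le hk p1 elas_lim m0 U21 hU Um n3 hp.
have [v [dv gv]] := ground_ex b0 h0 hlip hneg hpos
  (crossing_ex b0 h0 hlip hneg hpos hdh bM0 q01 hg subcritical).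
have [mu [eps [mu0 eps0 hmu]]] := hh_near0 ca c00 a_ge p1 m0.
exists (usol a v); split.
- exact: (usol_X ca c00 a_ge hda hdda da_bound p1 m0 gv).
- exact: (usol_C2 ca c00 a_ge hda hdda da_bound p1 m0 gv).
- exact: (usol_solves ca c00 a_ge hda hdda da_bound p1 m0 gv).
(* The constructed solution is centred at 0, so the translation is given by the centre [c] of [w].
   On the axis through [c], [w] becomes a ground state of the same equation. *)
move=> w [G [wL2 _ _] _] wC2 [wpde wpos [c wsym]]; exists c => x.
have gw := axis_ground ca c00 a_ge hda da_bound p1 m0 wC2 wsym wpos wL2 wpde.
have := ground_unique b0 hlip hneg hpos mu0 eps0 hmu hdh gmono gw gv (enorm_ge0 (x - c)).
rewrite (axis_enorm wsym) /usol /rad /pf => <-.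
by rewrite /lift_axis (chVK ca c00 a_ge).
Qed.
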